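(* Let $\Lambda$ be a right $4$-Nakayama artin algebra and $M$ be an indecomposable right $\Lambda$-module. Then $M$ is non-projective if and only if one of the following situations holds. (A) $M$ is a factor module of an indecomposable projective right $\Lambda$-module $P$ which is uniserial, and $M\cong P/\mathrm{rad}^{t}(P)$ for some $1\leq t<l(P)$. (B) $M$ is a factor module of an indecomposable projective right $\Lambda$-module $P$ which is $2$-factor serial with $\mathrm{rad}(P)=\mathrm{soc}(P)=S_1\oplus S_2$, and $M$ is isomorphic to either $P/\mathrm{rad}(P)$ or $P/S_i$ for some $1\leq i\leq 2$. (C) $M$ is a factor module of an indecomposable projective right $\Lambda$-module $P$ which is $3$-factor serial and colocal, such that the submodules of $P$ are $\mathrm{rad}(P)$, which is $3$-factor serial of length $3$ and non-local, two uniserial submodules $N_1$ and $N_2$ of length $2$, and $\mathrm{soc}(P)=S$, which is simple. $M$ is isomorphic to either $P/\mathrm{rad}(P)$, or $P/N_i$ for some $1\leq i\leq 2$, or $P/S$. (D) $M$ is a factor module of an indecomposable projective right $\Lambda$-module $P$ which is $3$-factor serial and non-colocal, such that the submodules of $P$ are $\mathrm{rad}(P)=N\oplus S_1$, where $N$ is uniserial of length $2$ and $S_1$ is simple, and $\mathrm{soc}(P)=S_1\oplus S_2$, where $\mathrm{soc}(N)=S_2$. $M$ is isomorphic to either $P/\mathrm{rad}(P)$, or $P/N$, or $P/\mathrm{soc}(P)$, or $P/S_i$ for some $1\leq i\leq 2$. (E) $M$ is a factor module of an indecomposable projective right $\Lambda$-module $P$ which is colocal and $4$-factor serial, such that the submodules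 of $P$ are $\mathrm{rad}(P)$, which is $4$-factor serial of length $4$ and non-local, two submodules $M_1$ and $M_2$ of length $3$, where $M_1$ is uniserial and $M_2$ is non-local $3$-factor serial, two uniserial submodules $N_1$ and $N_2$ of length $2$, where $N_1$ is a submodule of $M_1$ and $M_2$ and $N_2$ is a submodule of $M_2$, and $\mathrm{soc}(P)=S$, which is simple. $M$ is isomorphic to either $P/\mathrm{rad}(P)$, or $P/M_i$ for some $1\leq i\leq 2$, or $P/N_i$ for some $1\leq i\leq 2$, or $P/S$. (F) $M$ is a factor module of an indecomposable projective right $\Lambda$-module $P$ which is non-colocal and $4$-factor serial, such that the submodules of $P$ are $\mathrm{rad}(P)=N\oplus S_1$, where $N$ is uniserial of length $3$ and $S_1$ is a simple right $\Lambda$-module, an indecomposable uniserial submodule $N_1$ of length $2$, and $\mathrm{soc}(P)=S_1\oplus S_2$, where $\mathrm{soc}(N)=S_2$. $M$ is isomorphic to either $P/\mathrm{rad}(P)$, or $P/N$, or $P/N_1$, or $P/(N_1\oplus S_1)$, or $P/\mathrm{soc}(P)$, or $P/S_i$ for some $1\leq i\leq 2$. (G) $M$ is a factor module of an indecomposable projective right $\Lambda$-module $P$ which is non-colocal and $4$-factor serial, such that the submodules of $P$ are $\mathrm{rad}(P)=N_1\oplus N_2$, where $N_i$ is uniserial of length $2$ for each $1\leq i\leq 2$, and $\mathrm{soc}(P)=S_1\oplus S_2$, where $\mathrm{soc}(N_i)=S_i$ for each $1\leq i\leq 2$. $M$ is isomorphic to either $P/\mathrm{rad}(P)$, or $P/N_i$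 for some $1\leq i\leq 2$, or $P/(N_1\oplus S_2)$, or $P/(N_2\oplus S_1)$, or $P/\mathrm{soc}(P)$, or $P/S_i$ for some $1\leq i\leq 2$. (H) $M$ is a non-local $3$-factor serial right $\Lambda$-module whose submodules are two uniserial modules $M_1$ and $M_2$ and $\mathrm{soc}(M)=S$, which is simple. The indecomposable quotients of $M$ are $M/M_i$ for $1\leq i\leq 2$. (I) $M$ is a non-local $4$-factor serial right $\Lambda$-module with simple socle whose submodules are two maximal submodules $M_1$ and $M_2$ of length $3$, where $M_1$ is uniserial and $M_2$ is non-local $3$-factor serial, two uniserial submodules $N_1$ and $N_2$ of length $2$, where $N_1$ is a uniserial submodule of $M_1$ and $M_2$ and $N_2$ is a submodule of $M_2$, and $\mathrm{soc}(M)=S$, which is simple. The indecomposable quotients of $M$ are $M/M_i$ for $1\leq i\leq 2$ and $M/N_2$. (J) $M$ is a non-local $4$-factor serial right $\Lambda$-module such that $\mathrm{soc}(M)$ is not simple. The submodules of $M$ are an indecomposable module $N_1$ of length $3$ which is $2$-factor serial, a uniserial module $N_2$ of length $2$, and $\mathrm{soc}(M)=S_1\oplus S_2$, where $\mathrm{soc}(N_2)=S_2$. The indecomposable quotients of $M$ are $M/N_i$ for $1\leq i\leq 2$, $M/(N_2\oplus S_1)$ and $M/S_1$.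
   Context: An artin algebra is an algebra $\Lambda$ over a commutative artinian ring $R$ that is finitely generated as an $R$-module. All modules are finitely generated right $\Lambda$-modules. $\mathrm{soc}(M)$, $\mathrm{rad}(M)$, $l(M)$ denote the socle, radical and length of $M$; $\mathrm{rad}^0(M)=M$, $\mathrm{rad}^{i+1}(M)=\mathrm{rad}(\mathrm{rad}^i(M))$. A module is local if it has a unique maximal submodule, and colocal if its socle is simple. A module is uniserial (also called $1$-factor serial) if it has a unique composition series. For an integer $n>1$, a non-uniserial module $M$ of length $l\geq n$ is called $n$-factor serial if $M/\mathrm{rad}^{l-n}(M)$ is uniserial and $M/\mathrm{rad}^{l-n+1}(M)$ is not uniserial. $\Lambda$ is called right $n$-Nakayama if every indecomposable right $\Lambda$-module is $i$-factor serial for some $1\leq i\leq n$ and there exists at least one indecomposable $n$-factor serial right $\Lambda$-module.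
   Formalization: ''The submodules of P (or M) are ...'' is read as: every nonzero proper submodule is isomorphic to a listed one, with the direct sums named among the quotients in (F), (G), (J) added to the list; read literally, the list fails, e.g. in (I). Indecomposable quotients are likewise listed up to isomorphism. *)

(* Defs.v *)
From HB Require Import structures.
From mathcomp Require Import all_boot all_order all_algebra.
From mathcomp Require Import boolp.

Set Implicit Arguments.
Unset Strict Implicit.
Unset Printing Implicit Defensive.

Import GRing.Theory.
Local Open Scope ring_scope.
Local Open Scope quotient_scope.

(* The general module theory below is for left modules over a ring R; right
   modules over an algebra A are obtained as left modules over the converse
   ring A^c. *)

Section Submodules.
Variables (R : pzRingType) (M : lmodType R).
Implicit Types (K L N : submodClosed M).

Definition mk_submod (S : M -> bool) (hS : GRing.subsemimod_closed S) :
    submodClosed M :=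
  HB.pack_for (submodClosed M) S (GRing.isSubmodClosed.Build R M S hS).

(* Leibniz equality of bundled submodules is equality of the underlying sets. *)
Lemma submod_eqP K L : K = L <-> (K : {pred M}) =i L.
Proof.
split=> [->//|eqKL].
have {eqKL} : GRing.SubmodClosed.sort K = GRing.SubmodClosed.sort L.
  by apply: funext => x; exact: eqKL.
case: K => S [[a] [b]]; case: L => T [[c] [d]] /= eqST.
move: a b c d; rewrite eqST => a b c d.
by rewrite (Prop_irrelevance a c) (Prop_irrelevance b d).
Qed.

Lemma sub0_subproof : GRing.subsemimod_closed (fun x : M => x == 0).
Proof.
split; first split.
- exact: eqxx.
- by move=> x y /eqP-> /eqP->; rewrite unfold_in addr0.
- by move=> a x /eqP->; rewrite unfold_in scaler0.
Qed.
Definition sub0 := mk_submod sub0_subproof.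

Lemma subT_subproof : GRing.subsemimod_closed (fun _ : M => true).
Proof. by []. Qed.
Definition subT := mk_submod subT_subproof.

Lemma subadd_subproof K L : GRing.subsemimod_closed
  (fun x => `[< exists y z, [/\ y \in K, z \in L & x = y + z] >]).
Proof.
split; first split.
- by apply/asboolP; exists 0, 0; rewrite !rpred0 addr0.
- move=> _ _ /asboolP[y [z [yK zL ->]]] /asboolP[y' [z' [yK' zL' ->]]].
  by apply/asboolP; exists (y + y'), (z + z'); rewrite !rpredD // addrACA.
- move=> a _ /asboolP[y [z [yK zL ->]]].
  by apply/asboolP; exists (a *: y), (a *: z); rewrite !rpredZ // scalerDr.
Qed.
Definition subadd K L := mk_submod (subadd_subproof K L).

Definition is_dsum N K L :=
  N = subadd K L /\ forall x, x \in K -> x \in L -> x = 0.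

Definition covers K L :=
  [/\ {subset K <= L}, K <> L &
      forall N, {subset K <= N} -> {subset N <= L} -> N = K \/ N = L].

Definition maximal_submod K := covers K subT.

End Submodules.

Arguments sub0 {R M}.
Arguments subT {R M}.

HB.instance Definition _ (R : pzRingType) (M : lmodType R) :=
  gen_eqMixin (submodClosed M).

(* A submodule as a module, and the image in M of a submodule of it. *)
Definition subm_type (R : pzRingType) (M : lmodType R) (N : submodClosed M) :=
  {x : M | x \in N}.

HB.instance Definition _ (R : pzRingType) (M : lmodType R)
  (N : submodClosed M) := SubChoice.on (subm_type N).
HB.instance Definition _ (R : pzRingType) (M : lmodType R)
  (N : submodClosed M) := [SubChoice_isSubLmodule of subm_type N by <:].

Definition subm (R : pzRingType) (M : lmodType R) (N : submodClosed M) :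
  lmodType R := subm_type N.

Lemma subpush_subproof (R : pzRingType) (M : lmodType R) (N : submodClosed M)
  (K : submodClosed (subm N)) : GRing.subsemimod_closed
  (fun x => `[< exists2 y : subm_type N, y \in K & val y = x >]).
Proof.
split; first split.
- by apply/asboolP; exists 0; rewrite ?rpred0 // raddf0.
- move=> _ _ /asboolP[y yK <-] /asboolP[z zK <-].
  by apply/asboolP; exists (y + z); rewrite ?rpredD // raddfD.
- move=> a _ /asboolP[y yK <-].
  by apply/asboolP; exists (a *: y); rewrite ?rpredZ // linearZ.
Qed.
Definition subpush (R : pzRingType) (M : lmodType R) (N : submodClosed M)
  (K : submodClosed (subm N)) : submodClosed M :=
  mk_submod (subpush_subproof K).

(* The quotient module M / N, on top of the library's quotient of abelian
   groups. *)
Section Quotient.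
Variables (R : pzRingType) (M : lmodType R) (N : submodClosed M).

Definition submod_zmodClosed : zmodClosed M :=
  HB.pack_for (zmodClosed M) (GRing.SubmodClosed.sort N)
    (GRing.isZmodClosed.Build M (GRing.SubmodClosed.sort N)
      (GRing.submod_closedB (submodClosedP N))).

Definition quom_type := Quotient.quot submod_zmodClosed.
HB.instance Definition _ := GRing.Zmodule.on quom_type.
HB.instance Definition _ := EqQuotient.on quom_type.

Definition quom_scale (a : R) (x : quom_type) : quom_type :=
  \pi_quom_type (a *: repr x).

Lemma quom_piD : {morph \pi_quom_type : x y / x + y >-> x + y}.
Proof. exact: Quotient.pi_add. Qed.

Lemma quom_piZ a x : quom_scale a (\pi_quom_type x) = \pi_quom_type (a *: x).
Proof.
have eqE y z : (\pi_quom_type y == \pi_quom_type z) = (y - z \in N).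
  by rewrite (Quotient.idealrBE submod_zmodClosed).
apply/eqP; rewrite /quom_scale eqE -scalerBr rpredZ // -eqE.
by apply/eqP; exact: reprK.
Qed.

Lemma quom_piP (x : quom_type) : exists y, x = \pi_quom_type y.
Proof. by exists (repr x); rewrite reprK. Qed.

Lemma quom_scalerA a b x :
  quom_scale a (quom_scale b x) = quom_scale (a * b) x.
Proof. by have [y ->] := quom_piP x; rewrite !quom_piZ scalerA. Qed.

Lemma quom_scale1r : left_id 1 quom_scale.
Proof. by move=> x; have [y ->] := quom_piP x; rewrite quom_piZ scale1r. Qed.

Lemma quom_scalerDr : right_distributive quom_scale +%R.
Proof.
move=> a x y; have [{}x ->] := quom_piP x; have [{}y ->] := quom_piP y.
by rewrite -quom_piD !quom_piZ -quom_piD scalerDr.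
Qed.

Lemma quom_scalerDl x : {morph quom_scale^~ x : a b / a + b}.
Proof.
move=> a b; have [{}x ->] := quom_piP x.
by rewrite !quom_piZ -quom_piD scalerDl.
Qed.

HB.instance Definition _ := GRing.Zmodule_isLmodule.Build R quom_type
  quom_scalerA quom_scale1r quom_scalerDr quom_scalerDl.

Definition quom : lmodType R := quom_type.

End Quotient.

Section ModuleNotions.
Variable R : pzRingType.
Implicit Types M P : lmodType R.

Definition mod_iso M P := exists f : {linear M -> P}, bijective f.

Definition fin_gen M := exists (n : nat) (g : 'I_n -> M),
  forall x : M, exists c : 'I_n -> R, x = \sum_(i < n) c i *: g i.

Definition artinian_module M := forall N : nat -> submodClosed M,
  (forall i, {subset N i.+1 <= N i}) ->
  exists n, forall m, (n <= m)%N -> N m = N n.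

Definition simple_module M :=
  @sub0 R M <> subT /\ forall K : submodClosed M, K = sub0 \/ K = subT.

Definition indecomposable M :=
  @sub0 R M <> subT /\
  forall K L : submodClosed M, is_dsum subT K L -> K = sub0 \/ L = sub0.

Definition projective P :=
  forall (A B : lmodType R) (g : {linear A -> B}) (f : {linear P -> B}),
    (forall b, exists a, g a = b) ->
    exists h : {linear P -> A}, forall x, g (h x) = f x.

(* The series 0 < N_1 < ... < N_l = M is encoded by s = [:: N_1; ...; N_l], so
   that size s is its length; the zero module has the empty series. *)
Definition composition_series M (s : seq (submodClosed M)) :=
  path (fun K L => `[< covers K L >]) sub0 s /\ last sub0 s = subT.

Definition has_length M (l : nat) :=
  exists2 s, composition_series (M := M) s & size s = l.

Definition uniserial M := exists! s, composition_series (M := M) s.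

Lemma modrad_subproof M : GRing.subsemimod_closed
  (fun x : M => `[< forall K, maximal_submod K -> x \in K >]).
Proof.
split; first split.
- by apply/asboolP => K _; exact: rpred0.
- move=> x y /asboolP xP /asboolP yP; apply/asboolP => K mK.
  by rewrite rpredD ?xP ?yP.
- by move=> a x /asboolP xP; apply/asboolP => K mK; rewrite rpredZ ?xP.
Qed.
Definition modrad M : submodClosed M := mk_submod (@modrad_subproof M).

Lemma modsoc_subproof M : GRing.subsemimod_closed (fun x : M =>
  `[< exists2 s : seq M, x = \sum_(y <- s) y &
      forall y, y \in s ->
        exists2 K : submodClosed M, simple_module (subm K) & y \in K >]).
Proof.
split; first split.
- by apply/asboolP; exists [::]; rewrite ?big_nil.
- move=> _ _ /asboolP[s -> sP] /asboolP[t -> tP].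
  apply/asboolP; exists (s ++ t); rewrite ?big_cat // => y.
  by rewrite mem_cat => /orP[/sP|/tP].
- move=> a _ /asboolP[s -> sP]; apply/asboolP.
  exists [seq a *: y | y <- s]; first by rewrite big_map scaler_sumr.
  by move=> _ /mapP[y /sP[K sK yK] ->]; exists K; rewrite ?rpredZ.
Qed.
Definition modsoc M : submodClosed M := mk_submod (@modsoc_subproof M).

Fixpoint modradn M (n : nat) : submodClosed M :=
  if n is n'.+1 then subpush (modrad (subm (modradn M n'))) else subT.

Definition local_module M := exists! K : submodClosed M, maximal_submod K.

Definition colocal M := simple_module (subm (modsoc M)).

Definition factor_serial (n : nat) M :=
  (n = 1%N /\ uniserial M) \/
  ((1 < n)%N /\ ~ uniserial M /\
   exists l, [/\ has_length M l, (n <= l)%N,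
     uniserial (quom (modradn M (l - n))) &
     ~ uniserial (quom (modradn M (l - n + 1)))]).

(* s lists the nonzero proper submodules of M, without repetition and up to
   isomorphism. Completeness on the nose would be too strong: for the quiver
   with an arrow a : 1 -> 2 and a loop x at 2 with x^2 = 0, whose indecomposable
   modules are at most 4-factor serial, the indecomposable representation of
   dimension vector (2, 2) has one maximal subrepresentation for each point of
   the projective line over the ground field. *)
Definition submodules_are M (s : seq (submodClosed M)) :=
  [/\ uniq s,
      forall K, K \in s -> K <> sub0 /\ K <> subT &
      forall K : submodClosed M, K <> sub0 -> K <> subT ->
        exists2 L, L \in s & mod_iso (subm K) (subm L)].

(* The proper quotients of M that are indecomposable are, up to isomorphism,
   the M / K for K in s. *)
Definition indec_quotients_are M (s : seq (submodClosed M)) :=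
  (forall K, K \in s -> indecomposable (quom K)) /\
  (forall K : submodClosed M, K <> sub0 -> indecomposable (quom K) ->
     exists2 L, L \in s & mod_iso (quom K) (quom L)).

End ModuleNotions.

Arguments modrad {R} M.
Arguments modsoc {R} M.
Arguments modradn {R} M n.

Definition artin_algebra (R : comPzRingType) (A : algType R) :=
  artinian_module R^o /\ fin_gen (A : lmodType R).

Definition right_Nakayama (R : comPzRingType) (A : algType R) (n : nat) :=
  (forall M : lmodType A^c, fin_gen M -> indecomposable M ->
     exists2 i, (1 <= i <= n)%N & factor_serial i M) /\
  (exists M : lmodType A^c,
     [/\ fin_gen M, indecomposable M & factor_serial n M]).

(* Main.v *)
(* An indecomposable module that is not local has length at most 4, and a local one
   with nonlocal radical has length at most 5. Hence the pushout of two local modules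
   along a common simple submodule decomposes as soon as their lengths add up to 6,
   so the identification of the two simple submodules extends to a map in one of the
   two directions; dually for two modules with simple socle. Together with the fact
   that an injective additive self-correspondence of a module of finite length over R
   is onto, these maps show that rad P / rad^2 P has length at most 2 for P
   indecomposable projective, and that all maximal submodules of a nonlocal
   indecomposable module of length 4 share a submodule D of length 2. The latter
   determines the submodules of nonlocal indecomposable modules (cases H, I, J). A
   local module is a quotient P / K of an indecomposable projective P, and the
   submodules of P are found from rad P, which is a chain (A), semisimple (B),
   indecomposable (C, E) or a direct sum of two chains (D, F, G). Conversely an
   indecomposable projective module is local, and it is not isomorphic to an
   indecomposable proper quotient of an indecomposable projective module. *)
Require Import Defs.
From HB Require Import structures.
From mathcomp Require Import all_boot all_order all_algebra.
From mathcomp Require Import boolp.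
From mathcomp Require Import zify.

Set Implicit Arguments.
Unset Strict Implicit.
Unset Printing Implicit Defensive.

Import GRing.Theory.
Local Open Scope ring_scope.
Local Open Scope quotient_scope.

(** * Lattices of submodules and length *)

(** The bounds 4 and 5 come from the definition: if [M] is not local, [M / rad M] is not uniserial
    and [i]-factor seriality forces [l - i = 0]; if [M] is local with nonlocal radical,
    [M / rad^2 M] is not uniserial and [l - i] is at most 1. A pushout along a simple module has
    length [len U + len V - 1], whence the threshold 6. The obstacle is that the endomorphism ring
    of a simple module is only known to be a division ring, and that the direction of a gluing map
    cannot be chosen. A map in the wrong direction has to be inverted, so most arguments prove
    injectivity by locating what a noninjective map must kill. What remains is an injective
    correspondence on a simple module; its surjectivity needs finite length over [R], since a
    division ring may have injective endomorphisms that are not onto. The lists of submodules are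
    complete only up to isomorphism, and isomorphic submodules may have nonisomorphic quotients.
    Hence the list for [P] is built around the given kernel [K], or an automorphism of [P] moves [K]
    to an entry. *)

Notation "K '<=s' L" := {subset (K : submodClosed _) <= (L : submodClosed _)}
  (at level 70, no associativity).

Definition mk_lin (R : pzRingType) (U V : lmodType R) (f : U -> V)
    (lin_f : linear f) : {linear U -> V} :=
  HB.pack f (GRing.isLinear.Build R U V *:%R f lin_f).

Section Lattice.
Variables (R : pzRingType) (M : lmodType R).
Implicit Types (K L N X Y Z : submodClosed M) (x y : M).

Lemma in_sub0 x : (x \in (sub0 : submodClosed M)) = (x == 0).
Proof. by []. Qed.

Lemma in_subT x : x \in (subT : submodClosed M).
Proof. by []. Qed.

Lemma memN K x : x \in K -> - x \in K.
Proof. by move=> xK; rewrite -scaleN1r rpredZ. Qed.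

Lemma memB K x y : x \in K -> y \in K -> x - y \in K.
Proof. by move=> xK yK; rewrite rpredD // memN. Qed.

Lemma memBr K x y : x - y \in K -> y \in K -> x \in K.
Proof. by move=> xyK yK; rewrite -(subrK y x) rpredD. Qed.

Lemma memBl K x y : x - y \in K -> x \in K -> y \in K.
Proof. by move=> xyK xK; rewrite -(subKr x y) memB. Qed.

Lemma subaddP K L x :
  reflect (exists2 y, y \in K & x - y \in L) (x \in subadd K L).
Proof.
apply: (iffP (asboolP _)) => [[y [z [yK zL ->]]]|[y yK xyL]].
  by exists y; rewrite // addrC addKr.
by exists y, (x - y); split=> //; rewrite addrC subrK.
Qed.

Lemma subsub_anti K L : K <=s L -> L <=s K -> K = L.
Proof. by move=> KL LK; apply/submod_eqP => x; apply/idP/idP; [apply: KL|apply: LK]. Qed.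

Lemma subs_refl K : K <=s K. Proof. by []. Qed.

Lemma subs_trans L K N : K <=s L -> L <=s N -> K <=s N.
Proof. by move=> KL LN x /KL /LN. Qed.

Lemma sub0s K : sub0 <=s K.
Proof. by move=> x; rewrite in_sub0 => /eqP->; apply: rpred0. Qed.

Lemma subsT K : K <=s subT. Proof. by []. Qed.

Lemma subs0 K : K <=s sub0 -> K = sub0.
Proof. by move=> K0; apply: subsub_anti (@sub0s K). Qed.

Lemma subTs K : subT <=s K -> K = subT.
Proof. by move=> K0; apply: subsub_anti K0. Qed.

Lemma subaddl K L : K <=s subadd K L.
Proof. by move=> x xK; apply/subaddP; exists x; rewrite // subrr rpred0. Qed.

Lemma subaddr K L : L <=s subadd K L.
Proof. by move=> x xL; apply/subaddP; exists 0; rewrite ?rpred0 // subr0. Qed.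

Lemma subadd_lub K L N : K <=s N -> L <=s N -> subadd K L <=s N.
Proof.
by move=> KN LN x /subaddP[y /KN yN /LN]; rewrite -{2}(subrK y x) => xyN; rewrite rpredD.
Qed.

Lemma subaddC K L : subadd K L = subadd L K.
Proof.
by apply: subsub_anti; apply: subadd_lub; try exact: subaddl; exact: subaddr.
Qed.

Lemma subadd_absl K L : K <=s L -> subadd K L = L.
Proof. by move=> KL; apply: subsub_anti (@subaddr _ _); apply: subadd_lub. Qed.

Lemma subadd_absr K L : K <=s L -> subadd L K = L.
Proof. by move=> KL; rewrite subaddC subadd_absl. Qed.

Lemma subaddS K L K' L' : K <=s K' -> L <=s L' -> subadd K L <=s subadd K' L'.
Proof.
move=> KK LL; apply: subadd_lub.
  exact: subs_trans KK (@subaddl _ _).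
exact: subs_trans LL (@subaddr _ _).
Qed.

Lemma subI_subproof K L : GRing.subsemimod_closed (fun x => (x \in K) && (x \in L)).
Proof.
split; first split; first by rewrite unfold_in !rpred0.
  by move=> x y /andP[xK xL] /andP[yK yL]; rewrite unfold_in !rpredD.
by move=> a x /andP[xK xL]; rewrite unfold_in !rpredZ.
Qed.
Definition subI K L := mk_submod (subI_subproof K L).

Lemma in_subI K L x : (x \in subI K L) = (x \in K) && (x \in L).
Proof. by []. Qed.

Lemma capl K L : subI K L <=s K. Proof. by move=> x; rewrite in_subI => /andP[]. Qed.
Lemma capr K L : subI K L <=s L. Proof. by move=> x; rewrite in_subI => /andP[]. Qed.

Lemma subI_glb K L N : N <=s K -> N <=s L -> N <=s subI K L.
Proof. by move=> NK NL x xN; rewrite in_subI NK ?NL. Qed.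

Lemma subIC K L : subI K L = subI L K.
Proof. by apply/submod_eqP => x; rewrite !in_subI andbC. Qed.

Lemma subI_absl K L : K <=s L -> subI K L = K.
Proof. by move=> KL; apply: subsub_anti (@capl _ _) _; apply: subI_glb. Qed.

Lemma subI_absr K L : K <=s L -> subI L K = K.
Proof. by move=> KL; rewrite subIC subI_absl. Qed.

Lemma modular X K L : X <=s L -> subI (subadd X K) L = subadd X (subI K L).
Proof.
move=> XL; apply: subsub_anti.
  move=> x; rewrite in_subI => /andP[/subaddP[y yX xyK] xL].
  by apply/subaddP; exists y; rewrite // in_subI xyK memB // XL.
apply: subI_glb; first by apply: subaddS => //; apply: capl.
by apply: subadd_lub => //; apply: capr.
Qed.

Lemma is_dsumE N K L : is_dsum N K L <-> N = subadd K L /\ subI K L = sub0.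
Proof.
split=> -[-> KL0]; split=> //.
  by apply: subs0 => x; rewrite in_subI => /andP[xK xL]; rewrite in_sub0 (KL0 x).
move=> x xK xL; apply/eqP; rewrite -in_sub0 -KL0 in_subI xK.
exact: xL.
Qed.

Lemma coversP K L : covers K L -> [/\ K <=s L, ~ L <=s K & forall X, K <=s X -> X <=s L -> X = K \/ X = L].
Proof. by case=> KL nKL KLP; split=> // LK; apply/nKL/subsub_anti. Qed.

(** Second isomorphism theorem for simple factors: the modular law recovers [X] from [X + K]. The
    converse half is [covers_subadd]. *)
Lemma covers_subI K L Z : covers K Z -> L <=s Z -> ~ L <=s K -> covers (subI K L) L.
Proof.
move=> /coversP[KZ nZK KZP] LZ nLK; split; first exact: capr.
  by move=> eKL; apply: nLK; rewrite -eKL; apply: capl.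
move=> X KLX XL.
have [] := KZP (subadd X K); first exact: subaddr.
- by apply: subadd_lub => //; apply: subs_trans LZ.
- move=> XK; left; apply: subsub_anti KLX; apply: subI_glb => //.
  by rewrite -XK; apply: subaddl.
- move=> XKZ; right; apply: subsub_anti => //.
  have <- : subI (subadd X K) L = X.
    by rewrite modular // subadd_absr.
  by rewrite XKZ; apply: subI_glb.
Qed.

Lemma covers_subadd K L : covers (subI K L) L -> covers K (subadd K L).
Proof.
move=> /coversP[KL nLK KLP]; split; first exact: subaddl.
  move=> eKL; apply: nLK; apply: subI_glb => //.
  by rewrite eKL; apply: subaddr.
move=> X KX XKL.
have [] := KLP (subI X L).
- by apply: subI_glb; [apply: subs_trans KX; apply: capl|apply: capr].
- exact: capr.
- move=> XL; left; apply: subsub_anti => //.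
  have -> : X = subI (subadd K L) X by rewrite subI_absr.
  rewrite modular // subIC XL.
  by apply: subadd_lub => //; apply: capl.
- move=> XL; right; apply: subsub_anti => //; apply: subadd_lub => //.
  by rewrite -XL; apply: capl.
Qed.

(** Chains grow at the top, so that inversion exposes a maximal submodule of the last term;
    [has_lengthE] links them to the encoding by lists. *)
Inductive clen K : submodClosed M -> nat -> Prop :=
| clen0 : clen K K 0
| clenS L L' n : clen K L n -> covers L L' -> clen K L' n.+1.

Lemma clen_sub K L n : clen K L n -> K <=s L.
Proof. by elim=> // X Y m _ KX /coversP[XY _ _]; apply: subs_trans XY. Qed.

Lemma clen0E K L : clen K L 0 -> K = L.
Proof. by move: {-2}0%N (erefl 0%N) => n n0 c; case: c n0. Qed.

Lemma clenSE K L n : clen K L n.+1 -> exists2 Z, clen K Z n & covers Z L.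
Proof.
move: {-2}n.+1 (erefl n.+1) => m mn c; case: c mn => // X Y k c cov [<-].
by exists X.
Qed.

Lemma clen_trans L K N m n : clen K L m -> clen L N n -> clen K N (m + n).
Proof.
move=> KL; elim=> [|X Y k _ IH cov]; first by rewrite addn0.
by rewrite addnS; apply: clenS cov.
Qed.

Lemma clen1 K L : covers K L -> clen K L 1.
Proof. by move=> cov; apply: clenS cov; apply: clen0. Qed.

(** Adding [L] collapses no step, because the part of [L] inside [Y] already lies in [X]. *)
Lemma clen_add L X Y n : clen X Y n -> subI L Y <=s X ->
  clen (subadd X L) (subadd Y L) n.
Proof.
elim=> [|Z W k cXZ IH cov] LWX; first exact: clen0.
have [ZW _ _] := coversP cov.
have XZ := clen_sub cXZ.
apply: clenS (IH _) _.
  apply: subs_trans LWX; apply: subI_glb; first exact: capl.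
  by apply: subs_trans ZW; apply: capr.
have -> : subadd W L = subadd (subadd Z L) W.
  apply: subsub_anti; apply: subadd_lub.
  - exact: subaddr.
  - by apply: subs_trans (@subaddl _ _); apply: subaddr.
  - by apply: subaddS.
  - exact: subaddl.
apply: covers_subadd; rewrite modular // subadd_absr //.
exact: subs_trans XZ.
Qed.

(** Let [Z] be the last proper term of the chain. If [L] is not inside [Z], then [L] covers
    [subI Z L], and the chain from [subI Z L] to [Z] given by induction becomes, after adding [L], a
    chain from [L] to [K]. *)
Lemma clen_split n K : clen sub0 K n -> forall L, L <=s K ->
  exists m, [/\ (m <= n)%N, clen sub0 L m & clen L K (n - m)].
Proof.
elim: n K => [|n IH] K.
  move=> /clen0E <- L /subs0 ->; exists 0%N; split=> //; exact: clen0.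
move=> /clenSE[Z cZ cov] L LK; have [ZK nKZ _] := coversP cov.
have [LZ|nLZ] := pselect (L <=s Z).
  have [m [mn cL cLZ]] := IH _ cZ _ LZ; exists m; split=> //; first exact: ltnW.
  by rewrite subSn //; apply: clenS cov.
have [m [mn cL cLZ]] := IH _ cZ _ (@capl Z L).
have cov' := covers_subI cov LK nLZ.
exists m.+1; split=> //; first by apply: clenS cov'.
have := clen_add cLZ (_ : subI L Z <=s subI Z L); rewrite subIC => /(_ (@subs_refl _)).
rewrite subSS subadd_absl; last exact: capr.
suff -> : subadd Z L = K by [].
have [_ _ /(_ (subadd Z L) (@subaddl _ _) (subadd_lub ZK LK))[e|//]] := coversP cov.
by case: nLZ; rewrite -e; apply: subaddr.
Qed.

Lemma covers_neq_sub K L Z : covers K Z -> covers L Z -> K <> L -> ~ K <=s L.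
Proof.
move=> /coversP[KZ nZK KZP] /coversP[LZ nZL _] KL KL'.
by have [] := KZP L KL' LZ => e; [apply: KL|apply: nZL; rewrite e].
Qed.

(** Jordan-Hoelder for lengths: two different maximal submodules [Z] and [W] of [K] both cover their
    intersection, through which the two series are compared. *)
Lemma clen_inj n K : clen sub0 K n -> forall n', clen sub0 K n' -> n = n'.
Proof.
elim: n K => [|n IH] K.
  move=> /clen0E <- [//|n'] /clenSE[Z _ /coversP[_ nZ _]].
  by case: nZ; apply: sub0s.
move=> cK n'; have /clenSE[Z cZ cov] := cK; have [_ nZ _] := coversP cov.
case: n' => [/clen0E K0|n' /clenSE[W cW cov']]; first by case: nZ; rewrite -K0; apply: sub0s.
congr _.+1; have [ZW|nZW] := pselect (Z = W); first by apply: IH cZ _ _; rewrite ZW.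
have [m [mn cI cIZ]] := clen_split cZ (@capl Z W).
have [ZK _ _] := coversP cov; have [WK _ _] := coversP cov'.
have cIW := covers_subI cov WK (covers_neq_sub cov' cov (nesym nZW)).
have cIZ' := covers_subI cov' ZK (covers_neq_sub cov cov' nZW).
rewrite subIC in cIZ'.
have nm : n = m.+1 by apply: IH cZ _ _; apply: clenS cIZ'.
by apply: IH (cW); rewrite nm; apply: clenS cIW.
Qed.

Definition flen := exists n, clen sub0 subT n.

(** The default 0 stands for infinite length; the rank lemmas therefore assume [flen M]. *)
Definition rk K : nat :=
  if pselect (exists n, clen sub0 K n) is left h then projT1 (cid h) else 0%N.

Section Rank.
Hypothesis flM : flen.

Lemma clen_rk K : clen sub0 K (rk K).
Proof.
rewrite /rk; case: pselect => [h|[]]; first by case: (cid h).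
have [n /clen_split /(_ K (@subsT _)) [m [_ c _]]] := flM; by exists m.
Qed.

Lemma rkE K n : clen sub0 K n -> rk K = n.
Proof. by move=> c; apply: clen_inj c; apply: clen_rk. Qed.

Lemma rk_clen K L n : clen K L n -> rk L = (rk K + n)%N.
Proof. by move=> c; apply: rkE; apply: clen_trans c; apply: clen_rk. Qed.

Lemma clen_rkB K L : K <=s L -> clen K L (rk L - rk K).
Proof.
move=> /(clen_split (clen_rk L))[m [mn cK cKL]].
by rewrite (rkE cK).
Qed.

Lemma rk0 : rk sub0 = 0%N. Proof. by apply: rkE; apply: clen0. Qed.

Lemma rk_covers K L : covers K L -> rk L = (rk K).+1.
Proof. by move=> /clen1/rk_clen; rewrite addn1. Qed.

Lemma rkS K L : K <=s L -> (rk K <= rk L)%N.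
Proof. by move=> /clen_rkB /rk_clen; lia. Qed.

Lemma rk_eq K L : K <=s L -> (rk L <= rk K)%N -> K = L.
Proof.
move=> /clen_rkB; have [->|] := posnP (rk L - rk K)%N; last by lia.
by move=> /clen0E.
Qed.

Lemma rk_lt K L : K <=s L -> K <> L -> (rk K < rk L)%N.
Proof. by move=> KL nKL; rewrite ltnNge; apply/negP => /(rk_eq KL). Qed.

Lemma rk_eq0 K : rk K = 0%N -> K = sub0.
Proof. by move=> K0; apply/esym/rk_eq; rewrite ?K0 //; apply: sub0s. Qed.

Lemma rk_gt0 K : K <> sub0 -> (0 < rk K)%N.
Proof. by move=> K0; rewrite lt0n; apply/eqP => /rk_eq0. Qed.

Lemma rk_subT K : K <> subT -> (rk K < rk (subT : submodClosed M))%N.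
Proof. by move=> K0; apply: rk_lt. Qed.

Lemma rkP_covers K L : K <=s L -> rk L = (rk K).+1 -> covers K L.
Proof.
move=> KL rKL; have := clen_rkB KL; rewrite rKL subSn // subnn.
by move=> /clenSE[Z /clen0E <-].
Qed.

(** The chain from the intersection to [L] is carried by [clen_add] to a chain from [K] to the sum,
    with as many steps. *)
Lemma rkD K L : (rk (subadd K L) + rk (subI K L) = rk K + rk L)%N.
Proof.
have c := clen_rkB (@capr K L).
have := clen_add c (@subs_refl (subI K L)).
rewrite subadd_absl; last exact: capl.
move/rk_clen; rewrite subaddC.
have := rkS (@capr K L); lia.
Qed.

Lemma ex_coversr K L : K <=s L -> K <> L -> exists2 Z, K <=s Z & covers Z L.
Proof.
move=> KL nKL; have := clen_rkB KL; have := rk_lt KL nKL.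
case: (_ - _)%N (subn_gt0 (rk K) (rk L)) => [|n] <- // _.
by move=> /clenSE[Z c cov]; exists Z => //; apply: clen_sub c.
Qed.

Lemma clen_ex_coversl K L n : clen K L n.+1 -> exists2 Z, Z <=s L & covers K Z.
Proof.
elim: n L => [|n IH] L /clenSE[X c cov].
  by exists L => //; rewrite (clen0E c).
have [Z ZX cov'] := IH _ c; exists Z => //.
by apply: subs_trans ZX _; case: cov.
Qed.

Lemma ex_coversl K L : K <=s L -> K <> L -> exists2 Z, Z <=s L & covers K Z.
Proof.
move=> KL nKL; have := clen_rkB KL; have := rk_lt KL nKL.
case: (_ - _)%N (subn_gt0 (rk K) (rk L)) => [|n] <- // _.
exact: clen_ex_coversl.
Qed.

Lemma ex_maximal K : K <> subT -> exists2 Z, K <=s Z & maximal_submod Z.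
Proof. by move=> nK; apply: ex_coversr. Qed.

Lemma ex_atom K : K <> sub0 -> exists2 Z, Z <=s K & covers sub0 Z.
Proof. by move=> nK; apply: ex_coversl; [apply: sub0s|apply: nesym]. Qed.

Lemma atom_rk Z : rk Z = 1%N -> covers sub0 Z.
Proof. by move=> rZ; apply: rkP_covers; rewrite ?rk0 //; apply: sub0s. Qed.

Lemma rk_atom Z : covers sub0 Z -> rk Z = 1%N.
Proof. by move/rk_covers; rewrite rk0. Qed.

End Rank.

Lemma has_lengthE l : has_length M l <-> clen sub0 subT l.
Proof.
suff E K L n : (exists s, [/\ path (fun K L => `[< covers K L >]) K s, last K s = L
    & size s = n]) <-> clen K L n.
  rewrite -E; split=> [[s [p l'] sz]|[s [p l' sz]]]; last by exists s.
  by exists s.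
elim: n L => [|n IH] L.
  split=> [[[|x s] [_ <- // _]]|/clen0E <-]; first exact: clen0.
  by exists [::].
split=> [[s]|/clenSE[Z /IH[s [p l' sz]] cov]].
  case/lastP: s => [|s x]; first by case.
  rewrite rcons_path last_rcons size_rcons => -[/andP[p /asboolP cov] <- [sz]].
  by apply: clenS cov; apply/IH; exists s.
exists (rcons s L); rewrite rcons_path last_rcons size_rcons p l' sz; split=> //.
exact/asboolP.
Qed.

Lemma has_length_flen l : has_length M l -> flen.
Proof. by move=> /has_lengthE c; exists l. Qed.

Lemma has_lengthP l : flen -> has_length M l <-> rk subT = l.
Proof. by move=> flM; rewrite has_lengthE; split=> [/(rkE flM)//|<-]; apply: clen_rk. Qed.

End Lattice.

#[global] Hint Resolve subs_refl subsT sub0s capl capr subaddl subaddr : core.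

(** * Linear maps, submodules and quotients *)

Definition linj (R : pzRingType) (U V : lmodType R) (f : U -> V) :=
  forall x, f x = 0 -> x = 0.
Definition lsurj (U V : Type) (f : U -> V) := forall y, exists x, f x = y.

Section Maps.
Variables (R : pzRingType) (U V : lmodType R) (f : {linear U -> V}).
Implicit Types (K L X Y : submodClosed U) (Z W : submodClosed V).

Lemma linj_inj : linj f -> injective f.
Proof.
by move=> fi x y fxy; apply/eqP; rewrite -subr_eq0; apply/eqP/fi; rewrite linearB fxy subrr.
Qed.

Lemma linj_bij : linj f -> lsurj f -> bijective f.
Proof.
move=> fi fs; have [g gP] := choice fs.
exists g => // x; apply: linj_inj => //.
Qed.

Lemma limg_subproof K : GRing.subsemimod_closed
  (fun y => `[< exists2 x, x \in K & f x = y >]).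
Proof.
split; first split.
- by apply/asboolP; exists 0; rewrite ?rpred0 // linear0.
- move=> _ _ /asboolP[y yK <-] /asboolP[z zK <-].
  by apply/asboolP; exists (y + z); rewrite ?rpredD // linearD.
- move=> a _ /asboolP[y yK <-].
  by apply/asboolP; exists (a *: y); rewrite ?rpredZ // linearZ.
Qed.
Definition limg K := mk_submod (limg_subproof K).

Lemma limgP K y : reflect (exists2 x, x \in K & f x = y) (y \in limg K).
Proof. exact: asboolP. Qed.

Lemma mem_limg K x : x \in K -> f x \in limg K.
Proof. by move=> xK; apply/limgP; exists x. Qed.

Lemma lpre_subproof Z : GRing.subsemimod_closed (fun x => f x \in Z).
Proof.
split; first split; first by change (f 0 \in Z); rewrite linear0 rpred0.
- by move=> x y fx fy; change (f (x + y) \in Z); rewrite linearD; apply: rpredD.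
- by move=> a x fx; change (f (a *: x) \in Z); rewrite linearZ; apply: rpredZ.
Qed.
Definition lpre Z := mk_submod (lpre_subproof Z).
Definition lker := lpre sub0.

Lemma in_lpre Z x : (x \in lpre Z) = (f x \in Z). Proof. by []. Qed.
Lemma in_lker x : (x \in lker) = (f x == 0). Proof. by []. Qed.

Lemma lkerP x : x \in lker -> f x = 0.
Proof. by rewrite in_lker => /eqP. Qed.

Lemma limgS K L : K <=s L -> limg K <=s limg L.
Proof. by move=> KL _ /limgP[x /KL xL <-]; apply: mem_limg. Qed.

Lemma lpreS Z W : Z <=s W -> lpre Z <=s lpre W.
Proof. by move=> ZW x; rewrite !in_lpre => /ZW. Qed.

Lemma limg_subP K Z : limg K <=s Z <-> forall x, x \in K -> f x \in Z.
Proof.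
split=> [h x xK|h _ /limgP[x /h fx <-] //]; exact/h/mem_limg.
Qed.

Lemma limg0 : limg sub0 = sub0.
Proof. by apply: subs0; apply/limg_subP => x /eqP->; rewrite linear0 in_sub0. Qed.

Lemma lker0 : linj f -> lker = sub0.
Proof. by move=> fi; apply: subs0 => x /lkerP/fi->; rewrite in_sub0. Qed.

Lemma lker_inj : lker = sub0 -> linj f.
Proof. by move=> k0 x fx0; apply/eqP; rewrite -in_sub0 -k0 in_lker fx0. Qed.

Lemma limgT : lsurj f -> limg subT = subT.
Proof. by move=> fs; apply: subTs => y _; have [x <-] := fs y; apply: mem_limg. Qed.

Lemma limgT_surj : limg subT = subT -> lsurj f.
Proof. by move=> e y; have := in_subT y; rewrite -e => /limgP[x _ <-]; exists x. Qed.

Lemma limg_lpre Z : Z <=s limg subT -> limg (lpre Z) = Z.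
Proof.
move=> Zi; apply: subsub_anti; first by apply/limg_subP.
by move=> z zZ; have /limgP[x _ e] := Zi z zZ; rewrite -e; apply: mem_limg; rewrite in_lpre e.
Qed.

Lemma limg_lpre_surj Z : lsurj f -> limg (lpre Z) = Z.
Proof. by move=> fs; apply: limg_lpre; rewrite limgT. Qed.

Lemma lpre_limg K : lker <=s K -> lpre (limg K) = K.
Proof.
move=> kK; apply: subsub_anti => x; rewrite in_lpre; last exact: mem_limg.
move=> /limgP[y yK e]; apply: (memBl (x := y)) => //; apply: kK.
by rewrite in_lker linearB e subrr.
Qed.

Lemma lpre_limg_inj K : linj f -> lpre (limg K) = K.
Proof. by move=> fi; apply: lpre_limg; rewrite lker0. Qed.

Lemma lker_lpre Z : lker <=s lpre Z.
Proof. exact/lpreS/sub0s. Qed.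

(** The kernel enters [Y] only inside [X], so [f] does not shrink [Y / X]. *)
Lemma covers_img X Y : covers X Y -> subI lker Y <=s X ->
  covers (limg X) (limg Y).
Proof.
move=> /coversP[XY nYX XYP] kX; split; first exact: limgS.
  move=> e; apply: nYX => y yY; have := mem_limg yY; rewrite -e => /limgP[x xX fxy].
  apply: (memBl (x := x)) => //; apply: kX; rewrite in_subI in_lker linearB fxy subrr eqxx.
  by rewrite memB // XY.
move=> Z XZ ZY; have [] := XYP (subI (lpre Z) Y) => //.
- by apply: subI_glb => // x xX; rewrite in_lpre; apply/XZ/mem_limg.
- move=> e; left; apply: subsub_anti => // z zZ; have /limgP[y yY e'] := ZY _ zZ.
  by rewrite -e'; apply: mem_limg; rewrite -e in_subI in_lpre e' zZ.
- move=> e; right; apply: subsub_anti => //; apply/limg_subP => y; rewrite -e.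
  by rewrite in_subI => /andP[].
Qed.

Lemma clen_img X Y n : clen X Y n -> subI lker Y <=s X ->
  clen (limg X) (limg Y) n.
Proof.
elim=> [|L W k c IH cov] kX; first exact: clen0.
have [LW _ _] := coversP cov; have XL := clen_sub c.
apply: clenS (IH _) (covers_img cov _); last exact: subs_trans XL.
by apply: subs_trans kX; apply: subI_glb => //; apply: subs_trans LW.
Qed.

Lemma covers_lpre Z W : covers Z W -> W <=s limg subT -> covers (lpre Z) (lpre W).
Proof.
move=> /coversP[ZW nWZ ZWP] Wi; have Zi := subs_trans ZW Wi.
split; first exact: lpreS.
  by move=> e; apply: nWZ; rewrite -(limg_lpre Zi) e limg_lpre.
move=> X ZX XW; have kX : lker <=s X by apply: subs_trans ZX; apply: lker_lpre.
have [||e|e] := ZWP (limg X).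
- by rewrite -(limg_lpre Zi); apply: limgS.
- by apply/limg_subP => x /XW.
- by left; rewrite -e lpre_limg.
- by right; rewrite -e lpre_limg.
Qed.

Lemma clen_lpre Z W n : clen Z W n -> W <=s limg subT -> clen (lpre Z) (lpre W) n.
Proof.
elim=> [|L W' k c IH cov] Wi; first exact: clen0.
have [LW _ _] := coversP cov.
apply: clenS (IH _) (covers_lpre cov Wi); exact: subs_trans Wi.
Qed.

Lemma flen_surj : lsurj f -> flen U -> flen V.
Proof.
move=> fs flU; exists (rk (subT : submodClosed U) - rk lker)%N.
have <- : limg lker = sub0.
  by apply: subs0; apply/limg_subP => x; rewrite in_lker in_sub0.
by rewrite -(limgT fs); apply: clen_img => //; apply: clen_rkB.
Qed.

Lemma flen_inj : linj f -> flen V -> flen U.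
Proof.
move=> fi flV; exists (rk (limg subT)).
have := clen_lpre (clen_rk flV (limg subT)) (@subs_refl _ _ _).
by rewrite lpre_limg_inj // -/lker lker0.
Qed.

Hypotheses (flU : flen U) (flV : flen V).

Lemma rk_img K : (rk (limg K) + rk (subI lker K) = rk K)%N.
Proof.
have c := clen_img (clen_rkB flU (@capr _ _ lker K)) (@subs_refl _ _ _).
have e : limg (subI lker K) = sub0.
  apply: subs0; apply/limg_subP => x; rewrite in_subI in_lker in_sub0.
  by case/andP.
rewrite e in c; rewrite (rkE flV c).
have := rkS flU (@capr _ _ lker K); lia.
Qed.

Lemma rk_limg_inj K : linj f -> rk (limg K) = rk K.
Proof.
move=> fi; have := rk_img K.
by rewrite lker0 // subI_absl // rk0 // addn0.
Qed.

Lemma rk_limg_ker K : lker <=s K -> (rk (limg K) + rk lker = rk K)%N.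
Proof. by move=> kK; rewrite -(rk_img K) subI_absl. Qed.

End Maps.

Definition len (R : pzRingType) (M : lmodType R) := rk (subT : submodClosed M).

Section Bij.
Variables (R : pzRingType) (U V : lmodType R) (f : {linear U -> V}).
Hypotheses (flU : flen U) (flV : flen V).

Lemma rank_nullity : (rk (limg f subT) + rk (lker f) = len U)%N.
Proof. by rewrite rk_limg_ker. Qed.

Lemma linj_surj : linj f -> (len V <= len U)%N -> lsurj f.
Proof.
move=> fi le; apply: limgT_surj; apply: rk_eq => //.
by rewrite rk_limg_inj.
Qed.

Lemma lsurj_inj : lsurj f -> (len U <= len V)%N -> linj f.
Proof.
move=> fs le; apply: lker_inj; apply: rk_eq0 => //.
by have := rank_nullity; rewrite limgT // /len in le *; lia.
Qed.

End Bij.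

Section SubQuot.
Variables (R : pzRingType) (M : lmodType R).
Implicit Types (K L X Y : submodClosed M).

Definition incl K : {linear subm K -> M} := \val.

Lemma incl_inj K : linj (incl K).
Proof. by move=> x x0; apply: val_inj. Qed.

Lemma inclP K (x : subm K) : incl K x \in K.
Proof. exact: valP. Qed.

Lemma ex_incl K x : x \in K -> exists y : subm K, incl K y = x.
Proof. by move=> xK; exists (Sub x xK : subm_type K). Qed.

Lemma limg_incl K : limg (incl K) subT = K.
Proof.
apply: subsub_anti; first by apply/limg_subP => x _; apply: inclP.
by move=> x /ex_incl[y <-]; apply: mem_limg.
Qed.

Lemma subpushE K (X : submodClosed (subm K)) : subpush X = limg (incl K) X.
Proof. by apply: subsub_anti. Qed.

Lemma limg_incl_sub K (X : submodClosed (subm K)) : limg (incl K) X <=s K.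
Proof. by apply/limg_subP => x _; apply: inclP. Qed.

Lemma limg_incl_lpre K X : X <=s K -> limg (incl K) (lpre (incl K) X) = X.
Proof. by move=> XK; apply: limg_lpre; rewrite limg_incl. Qed.

Lemma linear_pi K : linear (fun x : M => \pi_(quom_type K) x : quom K).
Proof. by move=> a x y; rewrite quom_piD -quom_piZ. Qed.
Definition proj K : {linear M -> quom K} := mk_lin (@linear_pi K).

Lemma proj_surj K : lsurj (proj K).
Proof. by move=> y; have [x ->] := quom_piP y; exists x. Qed.

Lemma proj_eq0 K x : (proj K x == 0) = (x \in K).
Proof.
have -> : (0 : quom K) = \pi_(quom_type K) 0 by rewrite -[LHS](linear0 (proj K)).
by rewrite -[in RHS](subr0 x); rewrite (Quotient.idealrBE (submod_zmodClosed K)).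
Qed.

Lemma projP K x : reflect (proj K x = 0) (x \in K).
Proof. by rewrite -proj_eq0; apply: eqP. Qed.

Lemma lker_proj K : lker (proj K) = K.
Proof. by apply/submod_eqP => x; rewrite in_lker proj_eq0. Qed.

Lemma flen_subm K : flen M -> flen (subm K).
Proof. exact: (flen_inj (@incl_inj K)). Qed.

Lemma flen_quom K : flen M -> flen (quom K).
Proof. exact: (flen_surj (@proj_surj K)). Qed.

Lemma len_subm K : flen M -> len (subm K) = rk K.
Proof.
move=> flM; rewrite /len -(rk_limg_inj (flen_subm _ flM) flM _ (@incl_inj K)).
by rewrite limg_incl.
Qed.

Lemma len_quom K : flen M -> (len (quom K) + rk K = len M)%N.
Proof.
move=> flM; rewrite -(rank_nullity (proj K) flM (flen_quom _ flM)).
by rewrite (limgT (@proj_surj K)) lker_proj.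
Qed.

Lemma rk_pull K X : flen M -> X <=s K -> rk (lpre (incl K) X) = rk X.
Proof.
move=> flM XK.
by rewrite -(rk_limg_inj (flen_subm _ flM) flM _ (@incl_inj K)) limg_incl_lpre.
Qed.

Lemma rk_push K (X : submodClosed (subm K)) : flen M -> rk (limg (incl K) X) = rk X.
Proof. by move=> flM; apply: (rk_limg_inj (flen_subm _ flM) flM _ (@incl_inj K)). Qed.

End SubQuot.

Section Factor.
Variables (R : pzRingType).
Implicit Types (M N Q : lmodType R).

Lemma factor_surj M N Q (p : {linear M -> Q}) (f : {linear M -> N}) :
  lsurj p -> lker p <=s lker f -> exists g : {linear Q -> N}, forall x, g (p x) = f x.
Proof.
move=> ps kk; have [s sP] := choice ps.
have sE x y : p x = y -> f x = f (s y).
  move=> pxy; apply/eqP; rewrite -subr_eq0 -linearB -in_lker; apply: kk.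
  by rewrite in_lker linearB pxy sP subrr.
have lin : linear (f \o s).
  move=> a x y /=; rewrite -linearP; symmetry; apply: sE.
  by rewrite linearP !sP.
by exists (mk_lin lin) => x /=; symmetry; apply: sE.
Qed.

Lemma factor_inj M N Q (i : {linear Q -> N}) (f : {linear M -> N}) :
  linj i -> limg f subT <=s limg i subT -> exists g : {linear M -> Q}, forall x, i (g x) = f x.
Proof.
move=> ii ff; have ex x : exists y, i y = f x.
  by have /limgP[y _ <-] := ff _ (mem_limg f (in_subT x)); exists y.
have [g gP] := choice ex.
have lin : linear g.
  by move=> a x y; apply: (linj_inj ii); rewrite linearP !gP linearP.
by exists (mk_lin lin).
Qed.

Lemma lin_inverse M N (f : {linear M -> N}) : linj f -> lsurj f ->
  exists g : {linear N -> M}, (forall x, g (f x) = x) /\ (forall y, f (g y) = y).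
Proof.
move=> fi fs; have [g gP] := factor_surj (f := idfun : {linear M -> M}) fs (eq_ind_r (fun X => X <=s _) (@sub0s _ _ _) (lker0 fi)).
exists g; split=> // y; have [x <-] := fs y; by rewrite gP.
Qed.

Lemma iso_lin M N : mod_iso M N -> exists f : {linear M -> N}, linj f /\ lsurj f.
Proof.
move=> [f [g fK gK]]; exists f; split=> [x fx0|y]; last by exists (g y).
by rewrite -(fK x) fx0 -(linear0 f) fK.
Qed.

Lemma lin_iso M N (f : {linear M -> N}) : linj f -> lsurj f -> mod_iso M N.
Proof. by move=> fi fs; exists f; apply: linj_bij. Qed.

Lemma mod_iso_refl M : mod_iso M M.
Proof. by apply: (lin_iso (f := idfun : {linear M -> M})) => // y; exists y. Qed.

Lemma mod_iso_sym M N : mod_iso M N -> mod_iso N M.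
Proof.
move=> /iso_lin[f [fi fs]]; have [g [gK Kg]] := lin_inverse fi fs.
apply: (lin_iso (f := g)) => [x gx0|y]; last by exists (f y).
by rewrite -(Kg x) gx0 linear0.
Qed.

Lemma mod_iso_trans M N Q : mod_iso M N -> mod_iso N Q -> mod_iso M Q.
Proof.
move=> /iso_lin[f [fi fs]] /iso_lin[g [gi gs]].
apply: (lin_iso (f := g \o f : {linear M -> Q})) => [x /gi/fi //|z].
by have [y <-] := gs z; have [x <-] := fs y; exists x.
Qed.

Lemma quom_iso M N (p : {linear M -> N}) : lsurj p -> mod_iso (quom (lker p)) N.
Proof.
move=> ps; have [|g gP] := factor_surj (p := proj (lker p)) (f := p) (@proj_surj _ _ _).
  by rewrite lker_proj.
apply: (lin_iso (f := g)) => [y|z]; last by have [x <-] := ps z; exists (proj _ x).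
have [x <-] := proj_surj y; rewrite gP => px0; apply/projP.
by rewrite in_lker px0.
Qed.

Lemma subm_iso M N (f : {linear M -> N}) K : linj f -> mod_iso (subm K) (subm (limg f K)).
Proof.
move=> fi; have [|g gP] := factor_inj (i := incl (limg f K)) (f := f \o incl K) (@incl_inj _ _ _).
  by rewrite limg_incl; apply/limg_subP => x _; apply/mem_limg/inclP.
apply: (lin_iso (f := g)) => [x gx0|y].
  by apply/incl_inj/fi; rewrite -[LHS]gP gx0 linear0.
have /limgP[x xK e] := inclP y; have [x' e'] := ex_incl xK.
exists x'; apply: (linj_inj (@incl_inj _ _ (limg f K))).
by rewrite gP; apply: etrans (congr1 f e') e.
Qed.

Lemma quom_iso_eq M N Q (p : {linear M -> Q}) (q : {linear N -> Q}) :
  lsurj p -> lsurj q -> mod_iso (quom (lker p)) (quom (lker q)).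
Proof.
by move=> ps qs; apply: mod_iso_trans (quom_iso ps) (mod_iso_sym (quom_iso qs)).
Qed.

Lemma quom_iso_img M N (f : {linear M -> N}) (K : submodClosed M) : linj f -> lsurj f ->
  mod_iso (quom K) (quom (limg f K)).
Proof.
move=> fi fs; set p := proj (limg f K) \o f : {linear M -> quom (limg f K)}.
have e : lker p = K.
  apply/submod_eqP => x; rewrite in_lker /= proj_eq0; apply/idP/idP; last exact: mem_limg.
  by move=> /limgP[y yK /(linj_inj fi) <-].
have ps : lsurj p.
  by move=> z; have [y <-] := proj_surj z; have [x <-] := fs y; exists x.
by have := quom_iso_eq ps (@proj_surj _ _ (limg f K)); rewrite e lker_proj.
Qed.

Lemma subm_subT_iso M : mod_iso (subm (subT : submodClosed M)) M.
Proof.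
apply: (lin_iso (f := incl subT)); first exact: incl_inj.
by move=> y; have [x <-] := ex_incl (in_subT y); exists x.
Qed.

Lemma flen_iso M N : mod_iso M N -> flen M -> flen N.
Proof. by move=> /iso_lin[f [_ fs]]; apply: (flen_surj fs). Qed.

Lemma flen_ext M N (f : {linear M -> N}) : flen (subm (lker f)) -> flen N -> lsurj f -> flen M.
Proof.
move=> [m cm] [n cn] fs; exists (m + n)%N.
have cm' := clen_img (f := incl (lker f)) cm.
rewrite limg0 limg_incl (lker0 (@incl_inj _ _ _)) in cm'.
apply: clen_trans (cm' _) _; first exact: capl.
have -> : (subT : submodClosed M) = lpre f subT by apply: subsub_anti.
by apply: clen_lpre cn _; rewrite limgT.
Qed.

Lemma flen_prod M N : flen M -> flen N -> flen (M * N)%type.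
Proof.
move=> flM flN; refine (@flen_ext (M * N)%type M fst _ flM _); last first.
  by move=> x; exists (x, 0).
pose g : {linear subm (lker (fst : {linear (M * N)%type -> M})) -> N} := snd \o incl _.
apply: (flen_inj (f := g)) => // -[[a b] h].
rewrite /g /= => b0; apply: val_inj => /=.
by move: h; rewrite b0 in_lker => /eqP/= ->.
Qed.

Lemma len_prod M N : flen M -> flen N -> len (M * N)%type = (len M + len N)%N.
Proof.
move=> flM flN; have flMN := flen_prod flM flN.
rewrite -(rank_nullity (fst : {linear (M * N)%type -> M})) // limgT; last by move=> x; exists (x, 0).
congr addn; have lin : linear (fun y : N => (0, y) : (M * N)%type).
  by move=> a x y; apply: injective_projections => /=; rewrite ?scaler0 ?addr0.
have ii : linj (mk_lin lin) by move=> x [].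
rewrite /len -(rk_limg_inj flN flMN _ ii); congr rk.
apply/submod_eqP => -[x y]; rewrite in_lker; apply/eqP/limgP; first by move=> /= ->; exists y.
by move=> [z _ [<- _]].
Qed.

End Factor.

(** * Local, uniserial and factor serial modules *)

(** Besides uniqueness, every proper submodule of [K] is required to lie in [J]; in finite length
    this is locality ([unique_maxP]). Being relative to [K], it spares the passage to [subm K]. *)
Definition unique_max (R : pzRingType) (M : lmodType R) (K J : submodClosed M) :=
  covers J K /\ forall X : submodClosed M, X <=s K -> X <> K -> X <=s J.

Section Bridges.
Variable R : pzRingType.
Implicit Types M N : lmodType R.

Lemma covers_push M (K : submodClosed M) (X Y : submodClosed (subm K)) :
  covers X Y -> covers (limg (incl K) X) (limg (incl K) Y).
Proof.
move=> c; apply: covers_img c _; rewrite lker0; last exact: incl_inj.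
by apply: subs_trans (@sub0s _ _ _); apply: capl.
Qed.

Lemma covers_pull M (K X Y : submodClosed M) : Y <=s K ->
  covers X Y -> covers (lpre (incl K) X) (lpre (incl K) Y).
Proof. by move=> YK c; apply: covers_lpre c _; rewrite limg_incl. Qed.

Lemma push_pull M (K : submodClosed M) (X : submodClosed (subm K)) :
  lpre (incl K) (limg (incl K) X) = X.
Proof. exact/lpre_limg_inj/incl_inj. Qed.

Lemma pullT M (K : submodClosed M) : lpre (incl K) K = subT.
Proof. by apply: subTs => x _; apply: inclP. Qed.

Lemma pull_inj M (K X Y : submodClosed M) : X <=s K -> Y <=s K ->
  lpre (incl K) X = lpre (incl K) Y -> X = Y.
Proof. by move=> XK YK e; rewrite -(limg_incl_lpre XK) e limg_incl_lpre. Qed.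

Lemma pull_sub M (K X Y : submodClosed M) : X <=s K ->
  lpre (incl K) X <=s lpre (incl K) Y -> X <=s Y.
Proof. by move=> XK h x xX; have [x' e] := ex_incl (XK _ xX); have := h x'; rewrite !in_lpre e; apply. Qed.

Lemma subm_pull_iso M (K X : submodClosed M) : X <=s K ->
  mod_iso (subm (lpre (incl K) X)) (subm X).
Proof. by move=> XK; rewrite -{2}(limg_incl_lpre XK); apply/subm_iso/incl_inj. Qed.

Lemma maximal_pull M (K X : submodClosed M) : covers X K -> maximal_submod (lpre (incl K) X).
Proof. by move=> c; rewrite /maximal_submod -(pullT K); apply: covers_pull. Qed.

Lemma unique_maxP M : flen M -> local_module M <-> exists J : submodClosed M, unique_max subT J.
Proof.
move=> flM; split=> [[J [mJ uJ]]|[J [mJ uJ]]]; exists J; split=> // X.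
  by move=> _ /(ex_maximal flM)[Z XZ mZ]; rewrite (uJ Z mZ).
move=> [_ nX XP]; have XJ : X <=s J by apply: uJ.
have [//|e] := XP J XJ (@subsT _ _ _).
by case: mJ => _ /(_ e).
Qed.

Lemma unique_max_subm M (K : submodClosed M) : flen M ->
  local_module (subm K) <-> exists J : submodClosed M, unique_max K J.
Proof.
move=> flM; rewrite unique_maxP; last exact: flen_subm.
split=> [[J [/covers_push]]|[J [c uJ]]].
  rewrite limg_incl => c uJ; exists (limg (incl K) J); split=> // X XK nX.
  rewrite -(limg_incl_lpre XK); apply: limgS; apply: uJ => // e.
  by apply: nX; rewrite -(limg_incl_lpre XK) e limg_incl.
have [JK _ _] := coversP c.
exists (lpre (incl K) J); split=> [|X _ nX]; first exact: maximal_pull.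
rewrite -(push_pull X); apply: lpreS; apply: uJ; first exact: limg_incl_sub.
by move=> e; apply: nX; rewrite -(push_pull X) e pullT.
Qed.

Lemma two_max_nonlocal M (L1 L2 : submodClosed M) : maximal_submod L1 ->
  maximal_submod L2 -> L1 <> L2 -> ~ local_module M.
Proof. by move=> m1 m2 n12 [J [_ uJ]]; apply: n12; rewrite -(uJ _ m1) (uJ _ m2). Qed.

Lemma nonlocal_two_max M : flen M -> sub0 <> subT :> submodClosed M -> ~ local_module M ->
  exists L1 L2 : submodClosed M, [/\ maximal_submod L1, maximal_submod L2 & L1 <> L2].
Proof.
move=> flM n0 nl; have [L _ mL] := ex_maximal flM n0; exists L.
apply: contrapT => h; apply: nl; exists L; split=> // L' mL'.
by apply: contrapT => n; apply: h; exists L'.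
Qed.

Lemma two_covers_nonlocal M (K L1 L2 : submodClosed M) : covers L1 K -> covers L2 K ->
  L1 <> L2 -> ~ local_module (subm K).
Proof.
move=> c1 c2 n12; apply: two_max_nonlocal (maximal_pull c1) (maximal_pull c2) _.
by move=> /pull_inj e; apply/n12/e; [case/coversP: c1|case/coversP: c2].
Qed.

Lemma nonlocal_two_covers M (K : submodClosed M) : flen M -> K <> sub0 ->
  ~ local_module (subm K) ->
  exists L1 L2 : submodClosed M, [/\ covers L1 K, covers L2 K & L1 <> L2].
Proof.
move=> flM n0 nl.
have [|L1 [L2 [m1 m2 n12]]] := nonlocal_two_max (flen_subm K flM) _ nl.
  by move=> e; apply: n0; rewrite -(limg_incl K) -e limg0.
exists (limg (incl K) L1), (limg (incl K) L2).
have cP L : maximal_submod L -> covers (limg (incl K) L) K.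
  by move=> /covers_push; rewrite limg_incl.
split; [exact: cP|exact: cP|].
by move=> e; apply: n12; rewrite -(push_pull L1) e push_pull.
Qed.

Definition chain_below M (K : submodClosed M) := forall X Y : submodClosed M,
  X <=s K -> Y <=s K -> X <=s Y \/ Y <=s X.

(** Every submodule occurs in some composition series, so a unique series lists all submodules.
    Conversely, in a chain two covers of the same submodule coincide, and two series agree term by
    term. *)
Lemma uniserialP M : uniserial M <-> flen M /\ chain_below (subT : submodClosed M).
Proof.
split.
  move=> [s [cs us]]; have flM : flen M by apply: (has_length_flen (l := size s)); exists s.
  have sP (K : submodClosed M) : K \in sub0 :: s.
    have ex L L' n : clen L L' n -> exists2 t : seq (submodClosed M), path (fun K L => `[< covers K L >]) L t & last L t = L'.
      elim=> [|X Y k _ [t p e] c]; first by exists [::].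
      by exists (rcons t Y); rewrite ?last_rcons // rcons_path p e; apply/asboolP.
    have [t p e] := ex _ _ _ (clen_rk flM K).
    have [t' p' e'] := ex _ _ _ (clen_rkB flM (@subsT _ _ K)).
    rewrite (us (t ++ t')); last by split; rewrite ?cat_path ?p ?last_cat e.
    by rewrite -cat_cons mem_cat -{1}e mem_last.
  split=> // X Y _ _.
  set le := fun K L : submodClosed M => `[< K <=s L >].
  have le_tr : transitive le by move=> K L N /asboolP LK /asboolP KN; apply/asboolP; apply: subs_trans LK KN.
  have le_refl : reflexive le by move=> K; apply/asboolP.
  have srt : sorted le (sub0 :: s).
    case: cs => p _; rewrite /sorted; apply: sub_path p => K L /asboolP[KL _ _]; exact/asboolP.
  have := sorted_leq_index le_tr le_refl srt; move=> h.
  by have [/h|/ltnW/h] := leqP (index X (sub0 :: s)) (index Y (sub0 :: s));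
    move=> /(_ (sP _) (sP _)) /asboolP; [left|right].
move=> [flM ch]; have [s cs sz] := (has_lengthP (rk (subT : submodClosed M)) flM).2 erefl.
exists s; split=> // s'; case: cs => p e [p' e'].
elim: s (sub0 : submodClosed M) s' p e p' e' {sz} => [|Z s IH] K [|Z' s'] //=.
- move=> _ -> /andP[/asboolP/coversP[KZ nZK _] _]; by case: nZK.
- move=> /andP[/asboolP/coversP[KZ nZK _] _] _ _ e; by case: nZK; rewrite e.
move=> /andP[/asboolP c p] e /andP[/asboolP c' p'] e'.
suff eZ : Z = Z' by rewrite -eZ in p' e' *; rewrite (IH _ _ p e p' e').
have [KZ nZK ZP] := coversP c; have [KZ' nZK' ZP'] := coversP c'.
have [ZZ|ZZ] := ch Z Z' (@subsT _ _ _) (@subsT _ _ _).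
  by have [e0|//] := ZP' Z KZ ZZ; case: nZK; rewrite e0.
by have [e0|//] := ZP Z' KZ' ZZ; case: nZK'; rewrite e0.
Qed.

Lemma chain_pull M (K : submodClosed M) :
  chain_below (subT : submodClosed (subm K)) <-> chain_below K.
Proof.
split=> [ch X Y XK YK|ch X Y _ _].
  by have [/(pull_sub XK)|/(pull_sub YK)] := ch (lpre (incl K) X) (lpre (incl K) Y) (@subsT _ _ _) (@subsT _ _ _); [left|right].
have [h|h] := ch _ _ (limg_incl_sub (X := X)) (limg_incl_sub (X := Y)); [left|right].
  by rewrite -(push_pull X) -(push_pull Y); apply: lpreS.
by rewrite -(push_pull X) -(push_pull Y); apply: lpreS.
Qed.

Lemma uniserial_subm M (K : submodClosed M) : flen M ->
  uniserial (subm K) <-> chain_below K.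
Proof.
by move=> flM; rewrite uniserialP chain_pull; split=> [[]//|]; split=> //; apply: flen_subm.
Qed.

Lemma uniserial_quom M (K : submodClosed M) : flen M -> uniserial (quom K) <->
  forall X Y : submodClosed M, K <=s X -> K <=s Y -> X <=s Y \/ Y <=s X.
Proof.
move=> flM; rewrite uniserialP; split=> [[_ ch] X Y KX KY|ch].
  rewrite -(lpre_limg (f := proj K) (K := X)) ?lker_proj //.
  rewrite -(lpre_limg (f := proj K) (K := Y)) ?lker_proj //.
  by have [h|h] := ch (limg (proj K) X) (limg (proj K) Y) (@subsT _ _ _) (@subsT _ _ _);
    [left|right]; apply: lpreS.
split; first exact: flen_quom.
move=> X Y _ _; rewrite -(limg_lpre_surj X (@proj_surj _ _ K)) -(limg_lpre_surj Y (@proj_surj _ _ K)).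
have kk Z : K <=s lpre (proj K) Z by rewrite -{1}(lker_proj K); apply: lker_lpre.
by have [h|h] := ch _ _ (kk X) (kk Y); [left|right]; apply: limgS.
Qed.

Lemma has_length_subm M (K : submodClosed M) n : flen M -> has_length (subm K) n <-> rk K = n.
Proof. by move=> flM; have := has_lengthP n (flen_subm K flM); rewrite -/(len _) len_subm. Qed.

Lemma simpleP M : simple_module M <-> covers sub0 (subT : submodClosed M).
Proof.
split=> [[n0 h]|[_ n0 h]]; first by split=> // K _ _; apply: h.
by split=> // K; apply: h.
Qed.

Lemma simple_subm M (K : submodClosed M) : simple_module (subm K) <-> covers sub0 K.
Proof.
rewrite simpleP; split=> [/covers_push|/(covers_pull (@subs_refl _ _ _))].
  by rewrite limg0 limg_incl.
by rewrite pullT -/(lker _) lker0 //; apply: incl_inj.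
Qed.

Lemma simple_rk M (K : submodClosed M) : flen M -> simple_module (subm K) <-> rk K = 1%N.
Proof. by move=> flM; rewrite simple_subm; split; [apply: rk_atom|apply: atom_rk]. Qed.

Definition indec_sub M (K : submodClosed M) := K <> sub0 /\
  forall X Y : submodClosed M, subadd X Y = K -> subI X Y = sub0 -> X = sub0 \/ Y = sub0.

Lemma indecomposableP M : indecomposable M <-> indec_sub (subT : submodClosed M).
Proof.
split=> -[n0 h]; split; try exact: nesym.
  by move=> X Y e e0; apply: h; apply/is_dsumE; rewrite e.
by move=> X Y /is_dsumE[e e0]; apply: h.
Qed.

Lemma limg_add M N (f : {linear M -> N}) (X Y : submodClosed M) :
  limg f (subadd X Y) = subadd (limg f X) (limg f Y).
Proof.
apply: subsub_anti.
  apply/limg_subP => _ /asboolP[y [z [yX zY ->]]]; rewrite linearD rpredD //.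
    by apply: (@subaddl _ _ (limg f X)); apply: mem_limg.
  by apply: (@subaddr _ _ (limg f X)); apply: mem_limg.
by apply: subadd_lub; apply: limgS.
Qed.

Lemma limgI_inj M N (f : {linear M -> N}) (X Y : submodClosed M) : linj f ->
  limg f (subI X Y) = subI (limg f X) (limg f Y).
Proof.
move=> fi; apply: subsub_anti; first by apply: subI_glb; apply: limgS.
move=> _ /andP[/limgP[x xX <-] /limgP[y yY /(linj_inj fi) e]].
by apply: mem_limg; rewrite in_subI xX -e.
Qed.

Lemma limg_inj M N (f : {linear M -> N}) (X Y : submodClosed M) : linj f ->
  limg f X = limg f Y -> X = Y.
Proof. by move=> fi e; rewrite -(lpre_limg_inj X fi) e lpre_limg_inj. Qed.

Lemma indecomposable_subm M (K : submodClosed M) : indecomposable (subm K) <-> indec_sub K.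
Proof.
have ii := @incl_inj _ _ K.
rewrite indecomposableP; split=> -[n0 h]; split.
- by move=> e; apply: n0; apply: (limg_inj ii); rewrite limg_incl limg0.
- move=> X Y e e0; have XK : X <=s K by rewrite -e.
  have YK : Y <=s K by rewrite -e.
  have [| |e'|e'] := h (lpre (incl K) X) (lpre (incl K) Y).
  + by apply: (limg_inj ii); rewrite limg_add !limg_incl_lpre // limg_incl.
  + by apply: (limg_inj ii); rewrite limgI_inj // !limg_incl_lpre // e0 limg0.
  + by left; rewrite -(limg_incl_lpre XK) e' limg0.
  + by right; rewrite -(limg_incl_lpre YK) e' limg0.
- by move=> e; apply: n0; rewrite -(limg_incl K) e limg0.
- move=> X Y e e0; have [| |e'|e'] := h (limg (incl K) X) (limg (incl K) Y).
  + by rewrite -limg_add e limg_incl.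
  + by rewrite -limgI_inj // e0 limg0.
  + by left; apply: (limg_inj ii); rewrite e' limg0.
  + by right; apply: (limg_inj ii); rewrite e' limg0.
Qed.

Lemma indecomposable_quom M (K : submodClosed M) : indecomposable (quom K) <->
  K <> subT /\ forall X Y : submodClosed M, K <=s X -> K <=s Y ->
    subadd X Y = subT -> subI X Y = K -> X = K \/ Y = K.
Proof.
have ps := @proj_surj _ _ K.
have pk (X : submodClosed M) : K <=s X -> lpre (proj K) (limg (proj K) X) = X.
  by move=> KX; rewrite lpre_limg // lker_proj.
have kp (X : submodClosed (quom K)) : K <=s lpre (proj K) X.
  by rewrite -{1}(lker_proj K); apply: lker_lpre.
have p0 : limg (proj K) K = sub0.
  by apply: subs0; apply/limg_subP => x /projP ->; rewrite in_sub0.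
rewrite indecomposableP; split=> -[n0 h]; split.
- by move=> e; apply: n0; rewrite -p0 -[LHS](limgT ps); congr (limg _ _).
- move=> X Y KX KY e e0; have [| |e'|e'] := h (limg (proj K) X) (limg (proj K) Y).
  + by rewrite -limg_add e (limgT ps).
  + apply: subs0 => _ /andP[/limgP[x xX <-] xY]; rewrite in_sub0 proj_eq0 -e0 in_subI xX.
    by move: xY; rewrite -in_lpre pk.
  + by left; rewrite -(pk X) // e' -/(lker _) lker_proj.
  + by right; rewrite -(pk Y) // e' -/(lker _) lker_proj.
- by move=> e; apply: n0; rewrite -(lker_proj K) /lker -e; apply: subTs.
- move=> X Y e e0; have [| |e'|e'] := h (lpre (proj K) X) (lpre (proj K) Y) (kp _) (kp _).
  + rewrite -[LHS](pk (subadd _ _)); last exact: subs_trans (@subaddl _ _ _ _).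
    by rewrite limg_add !limg_lpre_surj // e; apply: subTs.
  + by rewrite -[RHS]lker_proj /lker -e0; apply/submod_eqP.
  + by left; rewrite -(limg_lpre_surj X ps) e'.
  + by right; rewrite -(limg_lpre_surj Y ps) e'.
Qed.

Lemma modrad_sub M (L : submodClosed M) : maximal_submod L -> modrad M <=s L.
Proof. by move=> mL x /asboolP h; apply: h. Qed.

Lemma sub_modrad M (K : submodClosed M) : (forall L, maximal_submod L -> K <=s L) -> K <=s modrad M.
Proof. by move=> h x xK; apply/asboolP => L /h; apply. Qed.

Lemma modrad_unique_max M (J : submodClosed M) : unique_max subT J -> modrad M = J.
Proof.
move=> [cJ uJ]; apply: subsub_anti; first exact: modrad_sub.
apply: sub_modrad => L mL; have [_ nL LP] := mL.
have LJ : L <=s J by apply: uJ.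
have [->//|eJ] := LP J LJ (@subsT _ _ _).
by case: cJ => _ /(_ eJ).
Qed.

(** [subpush (modrad (subm Y))] is the radical of [Y] seen inside [M]; this lemma and [sub_radpush]
    characterize it by the submodules that [Y] covers. *)
Lemma radpush_sub M (Y L : submodClosed M) : covers L Y -> subpush (modrad (subm Y)) <=s L.
Proof.
move=> c; have [LY _ _] := coversP c; rewrite subpushE -(limg_incl_lpre LY).
by apply: limgS; apply: modrad_sub; apply: maximal_pull.
Qed.

Lemma sub_radpush M (Y K : submodClosed M) : K <=s Y ->
  (forall L, covers L Y -> K <=s L) -> K <=s subpush (modrad (subm Y)).
Proof.
move=> KY h; rewrite subpushE -(limg_incl_lpre KY); apply: limgS.
apply: sub_modrad => L /covers_push; rewrite limg_incl => /h /lpreS KL.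
by rewrite -(push_pull L).
Qed.

Lemma radpush_subY M (Y : submodClosed M) : subpush (modrad (subm Y)) <=s Y.
Proof. by rewrite subpushE; apply: limg_incl_sub. Qed.

Lemma radpush_subT M : subpush (modrad (subm (subT : submodClosed M))) = modrad M.
Proof.
apply: subsub_anti; first by apply: sub_modrad => L; apply: radpush_sub.
by apply: sub_radpush => // L; apply: modrad_sub.
Qed.

Lemma modradnS M n : modradn M n.+1 <=s modradn M n.
Proof. exact: radpush_subY. Qed.

Lemma modradn_le M m n : (m <= n)%N -> modradn M n <=s modradn M m.
Proof.
move=> /subnK <-; elim: (n - m)%N => [|k IH] //.
by rewrite addSn; apply: subs_trans (@modradnS _ _) IH.
Qed.

Lemma modradn1 M : modradn M 1 = modrad M.
Proof. exact: radpush_subT. Qed.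

Lemma modradn2 M : modradn M 2 = subpush (modrad (subm (modrad M))).
Proof. by rewrite -modradn1. Qed.

Lemma atom_modsoc M (Z : submodClosed M) : covers sub0 Z -> Z <=s modsoc M.
Proof.
move=> c x xZ; apply/asboolP; exists [:: x]; first by rewrite big_seq1.
by move=> y; rewrite inE => /eqP->; exists Z => //; apply/simple_subm.
Qed.

Lemma modsoc_sub M (K : submodClosed M) : (forall Z, covers sub0 Z -> Z <=s K) -> modsoc M <=s K.
Proof.
move=> h x /asboolP[s -> sP].
rewrite big_seq; apply: rpred_sum => y /sP[Z /simple_subm /h ZK]; exact: ZK.
Qed.

Lemma modsocE M (S1 S2 : submodClosed M) : covers sub0 S1 -> covers sub0 S2 ->
  (forall Z, covers sub0 Z -> Z <=s subadd S1 S2) -> modsoc M = subadd S1 S2.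
Proof.
move=> c1 c2 h; apply: subsub_anti; first exact: modsoc_sub.
by apply: subadd_lub; apply: atom_modsoc.
Qed.

Lemma modsoc1E M (S : submodClosed M) : covers sub0 S ->
  (forall Z, covers sub0 Z -> Z <=s S) -> modsoc M = S.
Proof.
move=> c1 h; apply: subsub_anti; first exact: modsoc_sub.
exact: atom_modsoc.
Qed.

Lemma socpush1E M (N S : submodClosed M) : covers sub0 S -> S <=s N ->
  (forall Z, covers sub0 Z -> Z <=s N -> Z <=s S) -> subpush (modsoc (subm N)) = S.
Proof.
move=> c SN h; rewrite subpushE (@modsoc1E _ (lpre (incl N) S)) ?limg_incl_lpre //.
  by have := covers_pull SN c; rewrite -/(lker _) lker0 //; apply: incl_inj.
move=> Z /covers_push; rewrite limg0 => /h /(_ (@limg_incl_sub _ _ _ _)) ZS.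
by rewrite -(push_pull Z); apply: lpreS.
Qed.

(** Here [l = n]: the quotient by [rad^0] is zero, hence uniserial, while two different maximal
    submodules are incomparable and both contain the radical. *)
Lemma factor_serial_nonlocal M n : flen M -> len M = n -> (1 < n)%N ->
  ~ local_module M -> factor_serial n M.
Proof.
move=> flM lM n1 nl; right; split=> //.
have n0 : sub0 <> subT :> submodClosed M.
  by move=> e; move: lM; rewrite /len -e rk0 //; lia.
have [L1 [L2 [m1 m2 n12]]] := nonlocal_two_max flM n0 nl.
have nch : ~ (L1 <=s L2 \/ L2 <=s L1).
  by case; [apply: covers_neq_sub m1 m2 n12|apply: covers_neq_sub m2 m1 (nesym n12)].
split; first by move=> /uniserialP[_ ch]; apply/nch/ch.
exists n; rewrite subnn add0n; split=> //; first exact/has_lengthP.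
  by apply/uniserial_quom => // X Y XT _; right=> x _; apply: XT.
move=> /uniserial_quom h; apply: nch; apply: h => //.
  by rewrite modradn1; apply: modrad_sub.
by rewrite modradn1; apply: modrad_sub.
Qed.

(** Here [l - n = 1]: the quotient by the radical is simple, while two maximal submodules of [J] are
    incomparable and both contain [rad^2]. *)
Lemma factor_serial_local M (J : submodClosed M) n : flen M -> len M = n.+1 -> (1 < n)%N ->
  unique_max subT J -> ~ local_module (subm J) -> factor_serial n M.
Proof.
move=> flM lM n1 uJ nl; right; split=> //.
have rJ : modrad M = J by apply: modrad_unique_max.
have cJ := uJ.1.
have n0 : J <> sub0.
  by move=> e; move: lM (rk_covers flM cJ); rewrite /len e rk0 //; lia.
have [L1 [L2 [m1 m2 n12]]] := nonlocal_two_covers flM n0 nl.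
have nch : ~ (L1 <=s L2 \/ L2 <=s L1).
  by case; [apply: covers_neq_sub m1 m2 n12|apply: covers_neq_sub m2 m1 (nesym n12)].
split; first by move=> /uniserialP[_ ch]; apply/nch/ch.
exists n.+1; rewrite subSnn addn1; split=> //; first exact/has_lengthP.
  apply/uniserial_quom => //; rewrite modradn1 rJ => X Y JX JY.
  have [_ nJ JP] := cJ.
  have [->|->] := JP X JX (@subsT _ _ _); first by left.
  by right.
move=> /uniserial_quom h; apply: nch; apply: h => //;
  by rewrite modradn2 rJ; apply: radpush_sub.
Qed.

Lemma factor_serial_bound M i : flen M -> factor_serial i M -> sub0 <> subT :> submodClosed M ->
  ~ local_module M -> (len M <= i)%N.
Proof.
move=> flM fs n0 nl; have [L1 [L2 [m1 m2 n12]]] := nonlocal_two_max flM n0 nl.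
have nch : ~ (L1 <=s L2 \/ L2 <=s L1).
  by case; [apply: covers_neq_sub m1 m2 n12|apply: covers_neq_sub m2 m1 (nesym n12)].
case: fs => [[_ /uniserialP[_ ch]]|[i1 [_ [l [/(has_lengthP _ flM) lM il /uniserial_quom ch _]]]]].
  by case: nch; apply: ch.
rewrite leqNgt; apply/negP => il'; apply: nch.
have sub : modradn M (l - i) <=s modradn M 1 by apply: modradn_le; move: lM; rewrite /len in il'; lia.
by apply: ch => //; apply: subs_trans sub _; rewrite modradn1; apply: modrad_sub.
Qed.

Lemma factor_serial_bound_local M i (J : submodClosed M) : flen M -> factor_serial i M ->
  unique_max subT J -> J <> sub0 -> ~ local_module (subm J) -> (len M <= i.+1)%N.
Proof.
move=> flM fs uJ n0 nl; have [L1 [L2 [m1 m2 n12]]] := nonlocal_two_covers flM n0 nl.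
have rJ : modrad M = J by apply: modrad_unique_max.
have nch : ~ (L1 <=s L2 \/ L2 <=s L1).
  by case; [apply: covers_neq_sub m1 m2 n12|apply: covers_neq_sub m2 m1 (nesym n12)].
case: fs => [[_ /uniserialP[_ ch]]|[i1 [_ [l [/(has_lengthP _ flM) lM il /uniserial_quom ch _]]]]].
  by case: nch; apply: ch.
rewrite leqNgt; apply/negP => il'; apply: nch.
have sub : modradn M (l - i) <=s modradn M 2 by apply: modradn_le; move: lM; rewrite /len in il'; lia.
by apply: ch => //; apply: subs_trans sub _;
  rewrite modradn2 rJ; apply: radpush_sub.
Qed.

End Bridges.

(** * Amalgamation *)

(** In finite length such an [S] exists exactly when the socle is simple; as the least nonzero
    submodule it can be used without [modsoc]. *)
Definition colocal_at (R : pzRingType) (M : lmodType R) (S : submodClosed M) :=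
  covers sub0 S /\ forall K : submodClosed M, K <> sub0 -> S <=s K.

Section Amalgam.
Variable R : pzRingType.
Implicit Types U V M T Q Y : lmodType R.

Lemma decomposable_ex M : sub0 <> subT :> submodClosed M -> ~ indecomposable M ->
  exists X Y : submodClosed M, [/\ subadd X Y = subT, subI X Y = sub0, X <> sub0 & Y <> sub0].
Proof.
move=> n0 nM; apply: contrapT => h; apply: nM; split=> // X Y /is_dsumE[/esym e e0].
apply: contrapT => /not_orP[nX nY]; apply: h; by exists X, Y.
Qed.

Lemma dsum_proj M (X Y : submodClosed M) : subadd X Y = subT -> subI X Y = sub0 ->
  exists q : {linear M -> subm X}, [/\ lsurj q, lker q = Y & forall y, q (incl X y) = y].
Proof.
move=> e e0; have ex x : exists y : subm X, x - incl X y \in Y.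
  by have := in_subT x; rewrite -e => /subaddP[y /ex_incl[y' <-] ?]; exists y'.
have [q qP] := choice ex.
have uq x (y : subm X) : x - incl X y \in Y -> q x = y.
  move=> xy; apply/eqP; rewrite -subr_eq0; apply/eqP; apply: (@incl_inj _ _ X).
  apply/eqP; rewrite -in_sub0 -e0 in_subI inclP andTb linearB.
  by have := memB xy (qP x); rewrite opprB addrC addrA subrK.
have lin : linear q.
  move=> a x y; apply: uq.
  have -> : incl X (a *: q x + q y) = a *: incl X (q x) + incl X (q y) by apply: linearP.
  have -> : a *: x + y - (a *: incl X (q x) + incl X (q y)) = a *: (x - incl X (q x)) + (y - incl X (q y)).
    by rewrite scalerBr opprD addrACA.
  by rewrite rpredD ?rpredZ.
exists (mk_lin lin); split; last by move=> y; apply: uq; rewrite subrr rpred0.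
  by move=> y; exists (incl X y); apply: uq; rewrite subrr rpred0.
apply/submod_eqP => x; rewrite in_lker; apply/eqP/idP => [qx0|xY].
  have e1 : incl X (q x) = 0 by rewrite [q x]qx0; apply: linear0.
  by have := qP x; rewrite e1 subr0.
apply: uq; have -> : incl X 0 = 0 by apply: linear0.
by rewrite subr0.
Qed.

Hypothesis nak : forall M, flen M -> indecomposable M -> ~ local_module M -> (len M <= 4)%N.

Lemma simple_flen T : simple_module T -> flen T.
Proof. by move=> /simpleP c; exists 1%N; apply: clen1. Qed.

Lemma simple_len T : simple_module T -> len T = 1%N.
Proof. by move=> sT; rewrite /len; apply/rk_atom/simpleP => //; apply: simple_flen. Qed.

Lemma rk_add_le M (J A J' : submodClosed M) : flen M -> J' <=s J -> covers J' A ->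
  (rk (subadd J A) <= (rk J).+1)%N.
Proof.
move=> flM J'J c; have [J'A _ _] := coversP c.
have := rkD flM J A; have := rk_covers flM c.
by have := rkS flM (subI_glb J'J J'A); lia.
Qed.

(** [Z] meets the image of [U] in all of it or in a maximal submodule of it, and [J] is the only
    maximal submodule of [U]. *)
Lemma maximal_img_sub M U (i : {linear U -> M}) (Z : submodClosed M) (J : submodClosed U) :
  maximal_submod Z -> linj i -> unique_max subT J -> limg i J <=s Z.
Proof.
move=> mZ ii [cJ uJ]; apply/limg_subP => x xJ; rewrite -in_lpre.
have [->//|nZ] := pselect (lpre i Z = subT).
have nAZ : ~ limg i subT <=s Z.
  by move=> h; apply: nZ; apply: subTs => y _; rewrite in_lpre; apply/h/mem_limg.
have := covers_lpre (covers_subI mZ (@subsT _ _ _) nAZ) (@subs_refl _ _ _).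
rewrite lpre_limg_inj // => -[_ nT hT].
have sub : lpre i (subI Z (limg i subT)) <=s lpre i Z by apply: lpreS; apply: capl.
have nT' : lpre i (subI Z (limg i subT)) <> subT by [].
have [e|//] := hT J (uJ _ (@subsT _ _ _) nT') (@subsT _ _ _).
  by apply: sub; rewrite -e.
by move=> e; case: cJ => _ /(_ e).
Qed.

Lemma surj_add M U Q (q : {linear M -> Q}) (i : {linear U -> M}) : lsurj q ->
  subadd (limg i subT) (lker q) = subT -> lsurj (q \o i).
Proof.
move=> qs e z; have [x <-] := qs z; have := in_subT x; rewrite -e.
move=> /subaddP[_ /limgP[y _ <-]]; rewrite in_lker linearB subr_eq0 => /eqP qxy.
by exists y; rewrite /= qxy.
Qed.

(* The pushout X of u and v is not local and has length at least 5, so X = X1 + X2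
   decomposes. Up to an exchange, U and V map onto X1 and X2; their lengths add up
   to len X + 1, so one of these maps is bijective, and its inverse composed with
   the map from the other module is f up to sign. *)
Lemma amalgam U V T (u : {linear T -> U}) (v : {linear T -> V}) :
  flen U -> flen V -> simple_module T -> local_module U -> local_module V ->
  linj u -> linj v -> (6 <= len U + len V)%N ->
  (exists f : {linear U -> V}, forall t, f (u t) = v t) \/
  (exists f : {linear V -> U}, forall t, f (v t) = u t).
Proof.
move=> flU flV sT loU loV iu iv len6.
have flT := simple_flen sT; have lT := simple_len sT.
(* If [U] is simple, [u] is bijective and [v] composed with its inverse serves. Afterwards both
   lengths are at least 2, which makes [A] and [A'] proper. *)
have [lU1|lU1] := leqP (len U) 1.
  have [g [_ Kg]] := lin_inverse iu (linj_surj flT flU iu (leq_trans lU1 (eq_leq (esym lT)))).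
  by left; exists (v \o g) => t /=; congr (v _); apply: (linj_inj iu); rewrite Kg.
have [lV1|lV1] := leqP (len V) 1.
  have [g [_ Kg]] := lin_inverse iv (linj_surj flT flV iv (leq_trans lV1 (eq_leq (esym lT)))).
  by right; exists (u \o g) => t /=; congr (u _); apply: (linj_inj iv); rewrite Kg.
have flW := flen_prod flU flV.
have lind : linear (fun t => (u t, - v t) : (U * V)%type).
  by move=> a x y; apply: injective_projections; rewrite /= linearP // opprD scalerN.
(* [D] is the antidiagonal copy of [T], so [X] is the pushout. *)
pose d := mk_lin lind; pose D := limg d subT; pose X := quom D.
have linU : linear (fun x : U => proj D (x, 0)).
  by move=> a x y; rewrite -linearP; congr (proj D _); apply: injective_projections; rewrite /= ?scaler0 ?addr0.
have linV : linear (fun x : V => proj D (0, x)).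
  by move=> a x y; rewrite -linearP; congr (proj D _); apply: injective_projections; rewrite /= ?scaler0 ?addr0.
pose iU : {linear U -> X} := mk_lin linU; pose iV : {linear V -> X} := mk_lin linV.
have iUi : linj iU.
  move=> x /projP/limgP[t _ [<-]] /eqP; rewrite oppr_eq0 => /eqP /iv ->.
  exact: linear0.
have iVi : linj iV.
  by move=> x /projP/limgP[t _ [/iu ->]]; rewrite linear0 oppr0 => <-.
have iuv t : iU (u t) = iV (v t).
  apply/eqP; rewrite -subr_eq0.
  have -> : iU (u t) - iV (v t) = proj D ((u t, 0) - (0, v t)) by rewrite linearB.
  rewrite proj_eq0; apply/limgP; exists t => //.
  by apply: injective_projections; rewrite /= ?subr0 ?sub0r.
have iP z : exists x y, z = iU x + iV y.
  have [[x y] <-] := proj_surj z; exists x, y.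
  have -> : iU x + iV y = proj D ((x, 0) + (0, y)) by rewrite linearD.
  congr (proj D _).
  by apply: injective_projections; rewrite /= ?addr0 ?add0r.
have flX : flen X := flen_quom D flW.
have lX : (len X + 1 = len U + len V)%N.
  rewrite -(len_prod flU flV) -(len_quom D flW); congr addn.
  have di : linj d by move=> t [/iu].
  by rewrite /D rk_limg_inj.
have finish Y1 Y2 (r1 : {linear X -> Y1}) (r2 : {linear X -> Y2}) :
    flen Y1 -> flen Y2 -> (len Y1 + len Y2 = len X)%N ->
    lsurj (r1 \o iU) -> lsurj (r2 \o iV) ->
    (exists f : {linear U -> V}, forall t, f (u t) = v t) \/
    (exists f : {linear V -> U}, forall t, f (v t) = u t).
  move=> fl1 fl2 l12 s1 s2.
  have [le1|lt1] := leqP (len U) (len Y1).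
    have [g [gK _]] := lin_inverse (f := r1 \o iU : {linear _ -> _}) (lsurj_inj flU fl1 s1 le1) s1.
    by right; exists (g \o (r1 \o iV)) => t; apply: etrans (gK _); apply: (congr1 (g \o r1)); exact: esym (iuv t).
  have le2 : (len V <= len Y2)%N by lia.
  have [g [gK _]] := lin_inverse (f := r2 \o iV : {linear _ -> _}) (lsurj_inj flV fl2 s2 le2) s2.
  by left; exists (g \o (r2 \o iU)) => t; apply: etrans (gK _); apply: (congr1 (g \o r2)); exact: iuv t.
have [JU uJU] := (unique_maxP flU).1 loU; have [JV uJV] := (unique_maxP flV).1 loV.
pose A := limg iU subT; pose A' := limg iV subT.
have AA : subadd A A' = subT.
  apply: subTs => z _; have [x [y ->]] := iP z.
  by rewrite rpredD //; [apply: (@subaddl _ _ A)|apply: (@subaddr _ _ A)]; apply: mem_limg.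
have rA : rk A = len U by rewrite rk_limg_inj.
have rA' : rk A' = len V by rewrite rk_limg_inj.
have cU : covers (limg iU JU) A.
  apply: covers_img uJU.1 _; rewrite lker0 //; apply: subs_trans (@sub0s _ _ _); exact: capl.
have cV : covers (limg iV JV) A'.
  apply: covers_img uJV.1 _; rewrite lker0 //; apply: subs_trans (@sub0s _ _ _); exact: capl.
(* [J] lies in every maximal submodule of [X] and has colength at most 2. *)
pose J := subadd (limg iU JU) (limg iV JV).
have rJA : (rk (subadd J A) <= (rk J).+1)%N.
  apply: (@rk_add_le _ _ _ (limg iU JU)) => //; exact: subaddl.
have rJA' : (rk (subadd J A') <= (rk J).+1)%N.
  apply: (@rk_add_le _ _ _ (limg iV JV)) => //; exact: subaddr.
have rJ : (len X <= (rk J).+2)%N.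
  have : (rk (subadd (subadd J A) A') <= (rk (subadd J A)).+1)%N.
    apply: (@rk_add_le _ _ _ (limg iV JV)) => //.
    by apply: subs_trans (@subaddl _ _ _ _); apply: subaddr.
  have -> : subadd (subadd J A) A' = subT.
    by apply: subTs; rewrite -AA; apply: subaddS => //; apply: subaddr.
  by rewrite -/(len X); lia.
have JZ (Z : submodClosed X) : maximal_submod Z -> J <=s Z.
  move=> mZ; apply: subadd_lub; [exact: (maximal_img_sub mZ iUi uJU)|exact: (maximal_img_sub mZ iVi uJV)].
have Xn0 : sub0 <> subT :> submodClosed X.
  by move=> e; have : len X = 0%N by [rewrite /len -e rk0|]; lia.
have AT : A <> subT by move=> e; move: rA; rewrite e -/(len X); lia.
have A'T : A' <> subT by move=> e; move: rA'; rewrite e -/(len X); lia.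
have nlX : ~ local_module X.
  move=> /(unique_maxP flX)[Z [[_ ZT _] uZ]]; apply: ZT; apply: subTs; rewrite -AA.
  by apply: subadd_lub; apply: uZ.
have /(decomposable_ex Xn0)[X1 [X2 [e e0 n1 n2]]] : ~ indecomposable X.
  by move=> iX; have := nak flX iX nlX; lia.
have X2T : X2 <> subT by move=> e'; apply: n1; rewrite -e0 e' subI_absl.
have X1T : X1 <> subT by move=> e'; apply: n2; rewrite -e0 e' subI_absr.
have [M1 X2M1 m1] := ex_maximal flX X2T.
have [M2 X1M2 m2] := ex_maximal flX X1T.
have eM : subadd M1 M2 = subT.
  by apply: subTs; rewrite -e subaddC; apply: subaddS.
have rM : (rk (subI M1 M2) + 2 = len X)%N.
  have := rkD flX M1 M2; rewrite eM.
  by have := rk_covers flX m1; have := rk_covers flX m2; rewrite /len; lia.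
(* The right side has colength 2 because [M1] and [M2] generate [X], and it contains [J]. *)
have eJ : J = subI M1 M2.
  by apply: (rk_eq flX); [apply: subI_glb; apply: JZ|lia].
(* A maximal submodule above [X2] contains [X2 + J = M1]: the complement [X1] of [X2] is local. *)
have J1 (Z : submodClosed X) : maximal_submod Z -> X2 <=s Z -> Z = M1.
  move=> mZ X2Z; have M1Z : M1 <=s Z.
    have <- : subadd X2 (subI M2 M1) = M1.
      rewrite -modular // subI_absr // => x _.
      suff -> : subadd X2 M2 = subT by [].
      by apply: subTs; rewrite -e subaddC; apply: subaddS.
    by apply: subadd_lub => //; rewrite subIC -eJ; apply: JZ.
  by have [_ _ h] := m1; have [//|eZ] := h Z M1Z (@subsT _ _ _); have [_ /(_ eZ)] := mZ.
have J2 (Z : submodClosed X) : maximal_submod Z -> X1 <=s Z -> Z = M2.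
  move=> mZ X1Z; have M2Z : M2 <=s Z.
    have <- : subadd X1 (subI M1 M2) = M2.
      rewrite -modular // subI_absr // => x _.
      suff -> : subadd X1 M1 = subT by [].
      by apply: subTs; rewrite -e; apply: subaddS.
    by apply: subadd_lub => //; rewrite -eJ; apply: JZ.
  by have [_ _ h] := m2; have [//|eZ] := h Z M2Z (@subsT _ _ _); have [_ /(_ eZ)] := mZ.
have [q1 [q1s kq1 _]] := dsum_proj e e0.
have [q2 [q2s kq2 _]] := dsum_proj (etrans (subaddC _ _) e) (etrans (subIC _ _) e0).
(* The image of [i] and [X2] together lie in no maximal submodule, the only candidate being [M1]. *)
have surj1 Y (i : {linear Y -> X}) : ~ limg i subT <=s M1 -> lsurj (q1 \o i).
  move=> nM; apply: surj_add q1s _; rewrite kq1.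
  apply: contrapT => /(ex_maximal flX)[Z sZ mZ]; apply: nM.
  by rewrite -(J1 Z mZ) //; apply: subs_trans sZ; [apply: subaddl|apply: subaddr].
have surj2 Y (i : {linear Y -> X}) : ~ limg i subT <=s M2 -> lsurj (q2 \o i).
  move=> nM; apply: surj_add q2s _; rewrite kq2.
  apply: contrapT => /(ex_maximal flX)[Z sZ mZ]; apply: nM.
  by rewrite -(J2 Z mZ) //; apply: subs_trans sZ; [apply: subaddl|apply: subaddr].
have l12 : (len (subm X1) + len (subm X2) = len X)%N.
  by rewrite !len_subm // -(rkD flX) e e0 rk0 // addn0.
have fl1 := flen_subm X1 flX; have fl2 := flen_subm X2 flX.
have nT (Z : submodClosed X) : maximal_submod Z -> A <=s Z -> A' <=s Z -> False.
  move=> [_ nZ _] AZ AZ'; apply: nZ; apply: subTs; rewrite -AA; exact: subadd_lub.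
(* [A] and [A'] generate [X], so no maximal submodule contains both. Neither lies in
   [J = subI M1 M2], since adding the other to [J] raises the length by at most 1. So one of them
   misses [M1] and the other misses [M2]. *)
have [h1|n1'] := pselect (A <=s M1); last first.
  have [h2|n2'] := pselect (A' <=s M2); last by apply: (finish _ _ q1 q2) => //; [apply: surj1|apply: surj2].
  have [h3|n3'] := pselect (A' <=s M1); last first.
    have [h4|n4'] := pselect (A <=s M2); first by case: (nT _ m2).
    apply: (finish _ _ q2 q1) => //; [lia|exact: surj2|exact: surj1].
  suff : (len X <= (rk J).+1)%N by rewrite eJ; lia.
  have e' : subadd J A = subT.
    by apply: subTs; rewrite -AA subaddC; apply: subaddS => //; rewrite eJ; apply: subI_glb.
  by move: rJA; rewrite e'.
have [h3|n3'] := pselect (A' <=s M1); first by case: (nT _ m1).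
have [h4|n4'] := pselect (A <=s M2); last first.
  by apply: (finish _ _ q2 q1) => //; [lia|exact: surj2|exact: surj1].
suff : (len X <= (rk J).+1)%N by rewrite eJ; lia.
have e' : subadd J A' = subT.
  by apply: subTs; rewrite -AA; apply: subaddS => //; rewrite eJ; apply: subI_glb.
by move: rJA'; rewrite e'.
Qed.

Lemma subI_neq0 M (X Y : submodClosed M) : subI X Y <> sub0 ->
  exists x, [/\ x \in X, x \in Y & x <> 0].
Proof.
move=> n0; apply: contrapT => h; apply: n0; apply: subs0 => x.
rewrite in_subI in_sub0 => /andP[xX xY]; apply/eqP; apply: contrapT => x0.
by apply: h; exists x.
Qed.

(* Dual to amalgam: the pullback of a and b maps onto U, so it is not local. *)
Lemma pullback U V T (a : {linear U -> T}) (b : {linear V -> T})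
    (SU : submodClosed U) (SV : submodClosed V) :
  flen U -> flen V -> simple_module T -> colocal_at SU -> colocal_at SV ->
  ~ local_module U -> lsurj a -> lsurj b -> (6 <= len U + len V)%N ->
  (exists f : {linear U -> V}, forall x, b (f x) = a x) \/
  (exists f : {linear V -> U}, forall y, a (f y) = b y).
Proof.
move=> flU flV sT [cU coU] [cV coV] nlU sa sb len6.
have flT := simple_flen sT; have lT := simple_len sT.
have flW := flen_prod flU flV.
have linc : linear (fun w : (U * V)%type => a w.1 - b w.2).
  move=> k x y.
  have -> : a (k *: x + y).1 = k *: a x.1 + a y.1 by apply: linearP.
  have -> : b (k *: x + y).2 = k *: b x.2 + b y.2 by apply: linearP.
  by rewrite scalerBr opprD addrACA.
(* The pullback is the kernel of [a x - b y] on the product. *)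
pose c := mk_lin linc; pose X0 := lker c; pose X := subm X0.
have flX : flen X := flen_subm X0 flW.
have sc : lsurj c.
  by move=> t; have [x <-] := sa t; exists (x, 0) => /=; rewrite linear0 subr0.
have lX : (len X + 1 = len U + len V)%N.
  rewrite -(len_prod flU flV) -(rank_nullity c flW flT) limgT // len_subm //.
  by rewrite -/(len T) lT addnC.
pose pU : {linear X -> U} := fst \o incl X0.
pose pV : {linear X -> V} := snd \o incl X0.
have pab w : a (pU w) = b (pV w).
  by apply/eqP; rewrite -subr_eq0; have := inclP w; rewrite in_lker.
have mkX x y : a x = b y -> exists w : X, pU w = x /\ pV w = y.
  move=> axy; have [|w e] := @ex_incl _ _ X0 (x, y); first by rewrite in_lker /= axy subrr.
  by exists w; split; [apply: (congr1 fst e)|apply: (congr1 snd e)].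
have Xeq w : pU w = 0 -> pV w = 0 -> w = 0.
  move=> e1 e2; apply: (@incl_inj _ _ X0); exact: injective_projections.
have spU : lsurj pU.
  by move=> x; have [y e] := sb (a x); have [w [e1 _]] := mkX x y (esym e); exists w.
have Xn0 : sub0 <> subT :> submodClosed X.
  by move=> e; have : len X = 0%N by [rewrite /len -e rk0|]; lia.
have nlX : ~ local_module X.
  have Un0 : sub0 <> subT :> submodClosed U.
    by move=> e; have [_ n0 _] := coversP cU; apply: n0; rewrite e.
  have [L1 [L2 [m1 m2 n12]]] := nonlocal_two_max flU Un0 nlU.
  have mp L : maximal_submod L -> maximal_submod (lpre pU L).
    move=> mL; have := covers_lpre (f := pU) mL; rewrite limgT // => /(_ (@subs_refl _ _ _)).
    by have -> : lpre pU subT = subT by apply: subTs.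
  apply: (two_max_nonlocal (mp _ m1) (mp _ m2)) => e; apply: n12.
  by rewrite -(limg_lpre_surj L1 spU) e limg_lpre_surj.
have /(decomposable_ex Xn0)[X1 [X2 [e e0 n1 n2]]] : ~ indecomposable X.
  by move=> iX; have := nak flX iX nlX; lia.
(* [Y1] embeds in [U] and [Y2] in [V]. As the ranks add up to [len U + len V - 1], one embedding is
   onto, and that summand is the graph of the required map. *)
have finish (Y1 Y2 : submodClosed X) : (rk Y1 + rk Y2 = len X)%N ->
    subI Y1 (lker pU) = sub0 -> subI Y2 (lker pV) = sub0 ->
    (exists f : {linear U -> V}, forall x, b (f x) = a x) \/
    (exists f : {linear V -> U}, forall y, a (f y) = b y).
  move=> r12 e1 e2.
  have [fl1 fl2] := (flen_subm Y1 flX, flen_subm Y2 flX).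
  have i1 : linj (pU \o incl Y1).
    move=> y /= py; apply: incl_inj; apply/eqP; rewrite -in_sub0 -e1 in_subI inclP in_lker /=.
    by apply/eqP.
  have i2 : linj (pV \o incl Y2).
    move=> y /= py; apply: incl_inj; apply/eqP; rewrite -in_sub0 -e2 in_subI inclP in_lker /=.
    by apply/eqP.
  have [le1|lt1] := leqP (len U) (rk Y1).
    rewrite -(len_subm _ flX) in le1.
    have [g [_ Kg]] := lin_inverse (f := pU \o incl Y1 : {linear _ -> _}) i1 (linj_surj fl1 flU i1 le1).
    left; exists (pV \o (incl Y1 \o g)) => x; apply: etrans (esym (pab _)) _.
    exact: congr1 (Kg x).
  have le2 : (len V <= len (subm Y2))%N by rewrite len_subm //; lia.
  have [g [_ Kg]] := lin_inverse (f := pV \o incl Y2 : {linear _ -> _}) i2 (linj_surj fl2 flV i2 le2).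
  right; exists (pU \o (incl Y2 \o g)) => x; apply: etrans (pab _) _.
  exact: congr1 (Kg x).
(* The kernel of [pU] embeds in [V], so a [K] that meets it contains all of [0 x SV]. *)
have EV K : subI K (lker pU) <> sub0 -> forall w, pU w = 0 -> pV w \in SV -> w \in K.
  move=> nK w w1 w2; have nI : limg pV (subI K (lker pU)) <> sub0.
    have [z [zK zk z0]] := subI_neq0 nK => h; apply: z0; apply: Xeq; first exact: lkerP.
    by apply/eqP; rewrite -in_sub0 -h; apply: mem_limg; rewrite in_subI zK.
  have /limgP[z /andP[zK zk] ez] := coV _ nI _ w2.
  suff -> : w = z by [].
  by apply: (linj_inj (f := idfun : {linear X -> X})) => //; apply/eqP; rewrite -subr_eq0; apply/eqP/Xeq;
    rewrite linearB ?w1 ?(lkerP zk) ?ez subrr.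
have EU K : subI K (lker pV) <> sub0 -> forall w, pV w = 0 -> pU w \in SU -> w \in K.
  move=> nK w w1 w2; have nI : limg pU (subI K (lker pV)) <> sub0.
    have [z [zK zk z0]] := subI_neq0 nK => h; apply: z0; apply: Xeq; last exact: lkerP.
    by apply/eqP; rewrite -in_sub0 -h; apply: mem_limg; rewrite in_subI zK.
  have /limgP[z /andP[zK zk] ez] := coU _ nI _ w2.
  suff -> : w = z by [].
  by apply/eqP; rewrite -subr_eq0; apply/eqP/Xeq;
    rewrite linearB ?w1 ?(lkerP zk) ?ez subrr.
(* Otherwise [X1] and [X2] would share [0 x SV]. *)
have bothU : subI X1 (lker pU) <> sub0 -> subI X2 (lker pU) <> sub0 -> False.
  move=> h1 h2; have [z [zK zk z0]] := subI_neq0 h1.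
  have nI : limg pV (subI X1 (lker pU)) <> sub0.
    move=> h; apply: z0; apply: Xeq; first exact: lkerP.
    by apply/eqP; rewrite -in_sub0 -h; apply: mem_limg; rewrite in_subI zK.
  have [_ nS _] := coversP cV; apply: nS => s sS.
  have /limgP[w /andP[wK wk] ew] := coV _ nI _ sS.
  have : w \in subI X1 X2 by rewrite in_subI wK EV // ?ew //; apply: lkerP.
  by rewrite e0 in_sub0 -ew => /eqP->; rewrite linear0 in_sub0.
have bothV : subI X1 (lker pV) <> sub0 -> subI X2 (lker pV) <> sub0 -> False.
  move=> h1 h2; have [z [zK zk z0]] := subI_neq0 h1.
  have nI : limg pU (subI X1 (lker pV)) <> sub0.
    move=> h; apply: z0; apply: Xeq; last exact: lkerP.
    by apply/eqP; rewrite -in_sub0 -h; apply: mem_limg; rewrite in_subI zK.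
  have [_ nS _] := coversP cU; apply: nS => s sS.
  have /limgP[w /andP[wK wk] ew] := coU _ nI _ sS.
  have : w \in subI X1 X2 by rewrite in_subI wK EU // ?ew //; apply: lkerP.
  by rewrite e0 in_sub0 -ew => /eqP->; rewrite linear0 in_sub0.
(* [Y1] would contain [SU x 0] and [0 x SV]. Since [Y2] embeds in both [U] and [V], it has a nonzero
   element with both coordinates in the socles, and this element lies in [Y1] as well. *)
have mixed (Y1 Y2 : submodClosed X) : subI Y1 Y2 = sub0 -> Y2 <> sub0 ->
    subI Y2 (lker pU) = sub0 -> subI Y2 (lker pV) = sub0 ->
    subI Y1 (lker pU) <> sub0 -> subI Y1 (lker pV) <> sub0 -> False.
  move=> i12 n2' u0 v0 u1 v1.
  have SUa x : x \in SU -> a x = 0.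
    have nk : lker a <> sub0.
      move=> ka; have [z [zK zk z0]] := subI_neq0 v1; apply: z0; apply: Xeq; last exact: lkerP.
      by apply/eqP; rewrite -in_sub0 -ka in_lker pab (lkerP zk) linear0.
    by move=> /(coU _ nk)/lkerP.
  have SVb y : y \in SV -> b y = 0.
    have nk : lker b <> sub0.
      move=> kb; have [z [zK zk z0]] := subI_neq0 u1; apply: z0; apply: Xeq; first exact: lkerP.
      by apply/eqP; rewrite -in_sub0 -kb in_lker -pab (lkerP zk) linear0.
    by move=> /(coV _ nk)/lkerP.
  have nU : limg pU Y2 <> sub0.
    move=> h; apply: n2'; apply: subs0 => w wY; rewrite -u0 in_subI wY in_lker -in_sub0 -h.
    exact: mem_limg.
  pose Y := subI Y2 (lpre pU SU).
  have nY : limg pV Y <> sub0.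
    move=> h; have [_ nS _] := coversP cU; apply: nS => s sS.
    have /limgP[w wK ew] := coU _ nU _ sS.
    suff w0 : w = 0 by rewrite -ew w0 linear0 in_sub0.
    apply/eqP; rewrite -in_sub0 -v0 in_subI wK in_lker -in_sub0 -h; apply: mem_limg.
    by rewrite in_subI wK in_lpre ew.
  have [_ nS _] := coversP cV; apply: nS => s sS.
  have /limgP[w /andP[wK wU] ew] := coV _ nY _ sS.
  have [wa [ea1 ea2]] := mkX (pU w) 0 (etrans (SUa _ wU) (esym (linear0 b))).
  have [wb [eb1 eb2]] := mkX 0 (pV w) (etrans (linear0 a) (esym (SVb _ (eq_ind_r (fun z => z \in SV) sS ew)))).
  have ew' : w = wa + wb.
    by apply/eqP; rewrite -subr_eq0; apply/eqP/Xeq;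
      [rewrite (linearB pU) (linearD pU) ea1 eb1 addr0 subrr|rewrite (linearB pV) (linearD pV) ea2 eb2 add0r subrr].
  have : w \in subI Y1 Y2.
    rewrite in_subI wK andbT ew' rpredD //; first by apply: EU; rewrite ?ea1.
    by apply: EV; rewrite ?eb2 ?ew.
  by rewrite i12 in_sub0 -ew => /eqP->; rewrite linear0 in_sub0.
have r12 : (rk X1 + rk X2 = len X)%N by rewrite -(rkD flX) e e0 rk0 // addn0.
have [u1|u1] := pselect (subI X1 (lker pU) = sub0).
  have [v2|v2] := pselect (subI X2 (lker pV) = sub0); first exact: (finish X1 X2).
  have [u2|u2] := pselect (subI X2 (lker pU) = sub0).
    have [v1|v1] := pselect (subI X1 (lker pV) = sub0); last by case: bothV.
    by apply: (finish X2 X1) => //; lia.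
  have [v1|v1] := pselect (subI X1 (lker pV) = sub0); last by case: bothV.
  by case: (mixed X2 X1) => //; rewrite subIC.
have [u2|u2] := pselect (subI X2 (lker pU) = sub0); last by case: bothU.
have [v1|v1] := pselect (subI X1 (lker pV) = sub0).
  by apply: (finish X2 X1) => //; lia.
have [v2|v2] := pselect (subI X2 (lker pV) = sub0); last by case: bothV.
by case: (mixed X1 X2).
Qed.

End Amalgam.

(** * Chain conditions and projective modules *)

Section ChainConditions.
Variable S : pzRingType.
Implicit Types M N : lmodType S.

Lemma fin_gen_surj M N (f : {linear M -> N}) : lsurj f -> fin_gen M -> fin_gen N.
Proof.
move=> fs [n [g gP]]; exists n, (f \o g) => y; have [x <-] := fs y.
have [c ->] := gP x; exists c; rewrite linear_sum; apply: eq_bigr => i _.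
exact: linearZ.
Qed.

Lemma clen_fin_gen M (K : submodClosed M) n : clen sub0 K n ->
  exists m (g : 'I_m -> M), forall x, x \in K -> exists c : 'I_m -> S, x = \sum_(i < m) c i *: g i.
Proof.
elim=> [|L L' k _ [m [g gP]] cov].
  exists 0%N, (fun=> 0) => x; rewrite in_sub0 => /eqP->; exists (fun=> 0).
  by rewrite big_ord0.
have [LL nLL LP] := coversP cov.
have [y yL' yL] : exists2 y, y \in L' & y \notin L.
  apply: contrapT => h; apply: nLL => y yL'; apply: contrapT => yL; apply: h.
  by exists y => //; apply/negP.
have cyc : GRing.subsemimod_closed (fun x : M => `[< exists a, x = a *: y >]).
  split; first split; first by apply/asboolP; exists 0; rewrite scale0r.
    by move=> _ _ /asboolP[a ->] /asboolP[b ->]; apply/asboolP; exists (a + b); rewrite scalerDl.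
  by move=> a _ /asboolP[b ->]; apply/asboolP; exists (a * b); rewrite scalerA.
have cycP x : x \in mk_submod cyc -> exists a, x = a *: y by move=> /asboolP.
have [||e|e] := LP (subadd L (mk_submod cyc)); first exact: subaddl.
- by apply: subadd_lub => // x /cycP[a ->]; apply: rpredZ.
- case/negP: yL; rewrite -e; apply: subaddr; apply/asboolP; exists 1; by rewrite scale1r.
exists m.+1, (fun i => if unlift ord0 i is Some j then g j else y) => x.
rewrite -e => /asboolP[l [z [lL /cycP[a ->] ->]]].
have [c ->] := gP l lL.
exists (fun i => if unlift ord0 i is Some j then c j else a).
rewrite big_ord_recl unlift_none addrC; congr (_ + _).
by apply: eq_bigr => i _; rewrite liftK.
Qed.

Lemma flen_fin_gen M : flen M -> fin_gen M.
Proof.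
by move=> [n /clen_fin_gen[m [g gP]]]; exists m, g => x; apply: gP.
Qed.

(** The coefficients of the generator [g k] in those elements of [N i] that use only the generators
    up to [k] form a left ideal [I k (g k) i]; these ideals are stationary from a common index [m0]
    on. By induction on [k], an element of [N m0] is reduced by an element of [N m] with the same
    last coefficient, and the difference uses one generator less. *)
Lemma artinian_fin_gen M : artinian_module S^o -> fin_gen M -> artinian_module M.
Proof.
move=> artS [n [g gP]] N Ndec.
have NS i j : (i <= j)%N -> N j <=s N i.
  move=> /subnK <-; elim: (j - i)%N => [//|k IH]; rewrite addSn.
  by apply: subs_trans IH; apply: Ndec.
have idP (k : nat) (y : M) i : GRing.subsemimod_closed (fun r : S^o =>
    `[< exists c : 'I_n -> S, \sum_(j < n | (j < k)%N) c j *: g j + (r : S) *: y \in N i >]).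
  split; first split.
  - apply/asboolP; exists (fun=> 0); rewrite scale0r addr0 big1 ?rpred0 // => j _.
    by rewrite scale0r.
  - move=> r s /asboolP[c cP] /asboolP[d dP]; apply/asboolP; exists (fun j => c j + d j).
    rewrite scalerDl (eq_bigr _ (fun j _ => scalerDl _ _ _)) big_split /= addrACA.
    exact: rpredD.
  - move=> a r /asboolP[c cP]; apply/asboolP; exists (fun j => a * c j).
    rewrite -[(a *: r : S^o) : S]/(a * (r : S)) -scalerA (eq_bigr _ (fun j _ => esym (scalerA _ _ _))).
    by rewrite -scaler_sumr -scalerDr; apply: rpredZ.
pose I (k : nat) (y : M) i := mk_submod (idP k y i).
have Istab k y : exists m0, forall m, (m0 <= m)%N -> I k y m = I k y m0.
  apply: artS => i r /asboolP[c cP]; apply/asboolP; exists c; exact: Ndec.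
have [b bP] := choice (fun k : 'I_n => Istab k (g k)).
pose m0 := \max_(k < n) b k; exists m0 => m m0m.
apply: subsub_anti; first exact: NS.
have Ieq (k : 'I_n) : I k (g k) m = I k (g k) m0.
  have bk : (b k <= m0)%N by apply: (leq_bigmax k).
  by rewrite (bP k m0) // (bP k m) // (leq_trans bk).
suff main k : (k <= n)%N -> forall c : 'I_n -> S, \sum_(j < n | (j < k)%N) c j *: g j \in N m0 ->
    \sum_(j < n | (j < k)%N) c j *: g j \in N m.
  move=> x; have [c ->] := gP x; have := main n (leqnn n) c.
  by rewrite (eq_bigl predT) // => j; rewrite ltn_ord.
elim: k => [|k IH] kn c.
  by rewrite !big_pred0 ?rpred0 //.
pose kk := Ordinal kn.
have split_sum (d : 'I_n -> S) : \sum_(j < n | (j < k.+1)%N) d j *: g j =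
    \sum_(j < n | (j < k)%N) d j *: g j + d kk *: g kk.
  rewrite (bigD1 kk) //= addrC; congr (_ + _); apply: eq_bigl => j.
  by rewrite -val_eqE /=; lia.
rewrite split_sum => cN.
have : (c kk : S^o) \in I kk (g kk) m0 by apply/asboolP; exists c.
rewrite -Ieq => /asboolP[d dN].
rewrite -[X in X \in _](subrK (\sum_(j < n | (j < k)%N) d j *: g j + c kk *: g kk)).
rewrite rpredD // opprD addrACA subrr addr0 -sumrB.
rewrite (eq_bigr (fun j => (c j - d j) *: g j)); last by move=> j _; rewrite scalerBl.
apply: IH; first exact: ltnW.
rewrite (eq_bigr (fun j => c j *: g j - d j *: g j)); last by move=> j _; rewrite scalerBl.
rewrite sumrB -[X in X - _](addrK (c kk *: g kk)) -addrA -opprD [X in _ - X]addrC.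
by apply: memB => //; apply: (NS _ _ m0m).
Qed.

Lemma artinian_min M (P : submodClosed M -> Prop) : artinian_module M ->
  (exists K, P K) -> exists K, P K /\ forall L, L <=s K -> P L -> L = K.
Proof.
move=> artM [K0 PK0]; apply: contrapT => h.
have ex (K : {K | P K}) : exists L : {L | P L}, proj1_sig L <=s proj1_sig K /\ proj1_sig L <> proj1_sig K.
  apply: contrapT => h'; apply: h; exists (proj1_sig K); split; first exact: (proj2_sig K).
  by move=> L LK PL; apply: contrapT => n; apply: h'; exists (exist _ L PL).
have [f fP] := choice ex.
pose N i := proj1_sig (iter i f (exist _ K0 PK0)).
have [n /(_ n.+1 (leqnSn _)) e] : exists n, forall m, (n <= m)%N -> N m = N n.
  by apply: artM => i; apply: (fP _).1.
by have [_] := fP (iter n f (exist _ K0 PK0)).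
Qed.

Definition summand M (K : submodClosed M) := exists L : submodClosed M, subadd K L = subT /\ subI K L = sub0.

Lemma summandT M : summand (subT : submodClosed M).
Proof. by exists sub0; rewrite subadd_absr // subI_absr. Qed.

Lemma summand_add M (X Y : submodClosed M) : summand (subadd X Y) -> subI X Y = sub0 -> summand X.
Proof.
move=> [L [e e0]] i0; exists (subadd Y L); split.
  apply: subTs; rewrite -e; apply: subadd_lub; first by apply: subaddS.
  by apply: subs_trans (@subaddr _ _ _ _); apply: subaddr.
apply: subs0 => x /andP[xX /subaddP[y yY xyL]].
have xy0 : x - y = 0.
  apply/eqP; rewrite -in_sub0 -e0 in_subI xyL andbT memB //; first exact: subaddl.
  exact: subaddr.
by rewrite -i0 in_subI xX (_ : x = y) //; apply/eqP; rewrite -subr_eq0 xy0.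
Qed.

Lemma sum_map M (X Y : submodClosed M) : exists f : {linear (subm X * subm Y)%type -> M},
  (forall x y, f (x, y) = incl X x + incl Y y) /\ limg f subT = subadd X Y.
Proof.
have lin : linear (fun w : (subm X * subm Y)%type => incl X w.1 + incl Y w.2).
  move=> k x y.
  have -> : incl X (k *: x + y).1 = k *: incl X x.1 + incl X y.1 by apply: linearP.
  have -> : incl Y (k *: x + y).2 = k *: incl Y x.2 + incl Y y.2 by apply: linearP.
  by rewrite scalerDr addrACA.
exists (mk_lin lin); split=> //; apply: subsub_anti.
  apply/limg_subP => w _; apply: rpredD; first by apply: subaddl; apply: inclP.
  by apply: subaddr; apply: inclP.
move=> _ /asboolP[_ [_ [/ex_incl[x <-] /ex_incl[y <-] ->]]].
by apply/limgP; exists (x, y).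
Qed.

Lemma flen_add M (X Y : submodClosed M) : flen (subm X) -> flen (subm Y) -> flen (subm (subadd X Y)).
Proof.
move=> flX flY; have [f [_ fI]] := sum_map X Y.
have [|g gP] := factor_inj (f := f) (@incl_inj _ _ (subadd X Y)); first by rewrite fI limg_incl.
apply: (flen_surj (f := g)) (flen_prod flX flY) => z.
have /limgP[w _ e] : incl _ z \in limg f subT by rewrite fI; apply: inclP.
by exists w; apply: (linj_inj (@incl_inj _ _ _)); rewrite gP.
Qed.

Lemma summand_proj M (K : submodClosed M) : summand K ->
  exists q : {linear M -> subm K}, lsurj q /\ forall y, q (incl K y) = y.
Proof. by move=> [L [e e0]]; have [q [qs _ qK]] := dsum_proj e e0; exists q. Qed.

(** The Nakayama hypothesis gives a length only to indecomposable modules. A minimal direct summand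
    of infinite length would be decomposable, into two summands that have finite length by
    minimality. *)
Lemma artinian_flen M : (forall N, fin_gen N -> indecomposable N -> flen N) ->
  artinian_module M -> fin_gen M -> flen M.
Proof.
move=> fgfl artM fgM; apply: contrapT => nfl.
have [] := @artinian_min M (fun K => summand K /\ ~ flen (subm K)) artM.
  exists subT; split; first exact: summandT.
  by move=> /(flen_iso (subm_subT_iso M)).
move=> K [[sK nK] Kmin]; apply: nK.
have [q [qs _]] := summand_proj sK.
apply: contrapT => nK.
have K0 : K <> sub0.
  move=> e; apply: nK; exists 0%N; rewrite (_ : subT = sub0); first exact: clen0.
  apply: subs0 => x _; rewrite in_sub0; apply/eqP/incl_inj/eqP; rewrite -in_sub0 -e.
  exact: inclP.
have /indecomposable_subm nind : ~ indecomposable (subm K).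
  by move=> /(fgfl _ (fin_gen_surj qs fgM)).
apply: nind; split=> // X Y e i0; apply: contrapT => /not_orP[nX nY]; apply: nK.
rewrite -e in sK Kmin *.
have fl1 (Z : submodClosed M) : summand Z -> Z <=s subadd X Y -> Z <> subadd X Y -> flen (subm Z).
  by move=> sZ ZK nZ; apply: contrapT => nfZ; apply: nZ; apply: Kmin.
apply: flen_add.
  apply: fl1; [exact: summand_add sK i0|exact: subaddl|].
  by move=> e'; apply: nY; rewrite -i0 e' subI_absr //; apply: subaddr.
apply: fl1; [|exact: subaddr|].
  by apply: (summand_add (Y := X)); rewrite ?(subaddC Y) ?(subIC Y).
by move=> e'; apply: nX; rewrite -i0 subIC e' subI_absr //; apply: subaddl.
Qed.

End ChainConditions.

(** * Finiteness over an artin algebra, and the two length bounds *)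

Section ArtinAlgebra.
Variables (R : comPzRingType) (A : algType R).
Hypothesis artA : artin_algebra A.

Lemma artinian_algebra : artinian_module (A : lmodType R).
Proof. by case: artA => artR fgA; apply: artinian_fin_gen. Qed.

(* [x *: y] in the converse algebra is [y * x] in [A]. *)
Lemma artinian_regular : artinian_module ((A^c)^o : lmodType A^c).
Proof.
move=> N Ndec.
have sub i : GRing.subsemimod_closed (fun x : A => (x : (A^c)^o) \in N i).
  split; first split; first exact: (rpred0 (N i)).
    by move=> x y; apply: (@rpredD _ (N i)).
  move=> r x xN; have := @rpredZ _ _ (N i) (r%:A : A^c) _ xN.
  by rewrite /GRing.scale /= -[X in X \in N i -> _]/((x : A) * (r%:A : A)) -scalerAr mulr1.
have [n nP] := artinian_algebra (N := fun i => mk_submod (sub i)) Ndec.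
exists n => m /nP e; apply/submod_eqP => x.
by have /submod_eqP/(_ x) := e.
Qed.

Lemma fin_gen_artinian (M : lmodType A^c) : fin_gen M -> artinian_module M.
Proof. exact/artinian_fin_gen/artinian_regular. Qed.

(* An injective additive self-correspondence of a finite R-length bimodule is
   onto: its iterated images form a descending chain of R-submodules. *)
Lemma linear_rel_surj (V : lmodType A^c) (t0 : V) (rho : V -> V -> Prop) :
  (forall x, exists a, x = a *: t0) ->
  rho 0 0 ->
  (forall x y x' y', rho x y -> rho x' y' -> rho (x + x') (y + y')) ->
  (forall r x y, rho x y -> rho ((r%:A : A^c) *: x) ((r%:A : A^c) *: y)) ->
  (forall x y, rho x y -> exists z, rho y z) ->
  (forall x, rho x 0 -> x = 0) ->
  forall y, (exists z, rho y z) -> exists x, rho x y.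
Proof.
move=> gen rho0 rhoD rhoZ rhod rhoi.
(* [W 0] is the domain of [rho] and each further [W] is the image of the preceding one; they are
   pulled back to [R]-submodules of [A] along the action on [t0]. *)
pose W := fix W n x := if n is n'.+1 then exists2 y, W n' y & rho y x else exists z, rho x z.
have WD n x y : W n x -> W n y -> W n (x + y).
  elim: n x y => [|n IH] x y /=; first by move=> [z xz] [z' yz]; exists (z + z'); apply: rhoD.
  by move=> [z Wz xz] [z' Wz' yz]; exists (z + z'); [apply: IH|apply: rhoD].
have WZ n r x : W n x -> W n ((r%:A : A^c) *: x).
  elim: n x => [|n IH] x /=; first by move=> [z xz]; exists ((r%:A : A^c) *: z); apply: rhoZ.
  by move=> [z Wz xz]; exists ((r%:A : A^c) *: z); [apply: IH|apply: rhoZ].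
have W0 n : W n 0.
  by elim: n => [|n IH] /=; [exists 0|exists 0].
have Wdec n x : W n.+1 x -> W n x.
  elim: n x => [|n IH] x /=; first by move=> [y _ /rhod].
  by move=> [y /IH Wy yx]; exists y.
have WW0 n x : W n x -> exists z, rho x z.
  by elim: n x => [//|n IH] x /Wdec/IH.
have sub n : GRing.subsemimod_closed (fun a : A => `[< W n ((a : A^c) *: t0) >]).
  split; first split; first by apply/asboolP; rewrite (scale0r t0).
    move=> a b /asboolP aW /asboolP bW; apply/asboolP.
    by rewrite (scalerDl t0 (a : A^c) b); apply: WD.
  move=> r a /asboolP aW; apply/asboolP.
  have -> : (r *: a : A^c) = (r%:A : A^c) * (a : A^c).
    by rewrite -[RHS]/((a : A) * (r%:A : A)) -scalerAr mulr1.
  by rewrite -scalerA; apply: WZ.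
have [n nP] : exists n, forall m, (n <= m)%N -> mk_submod (sub m) = mk_submod (sub n).
  by apply: artinian_algebra => i a /asboolP aW; apply/asboolP/Wdec.
have Wn x : W n x -> W n.+1 x.
  have [a ->] := gen x => Wx; apply/asboolP.
  have /submod_eqP/(_ (a : A)) := nP n.+1 (leqnSn _).
  by rewrite -[_ \in mk_submod (sub n)]/(asbool _) -[_ \in mk_submod (sub n.+1)]/(asbool _) => ->; apply/asboolP.
(* Stationarity descends: for [x] in [W n] and [rho x y], the element [y] is also reached from some
   [x'] in [W n.+1], and injectivity gives [x = x']. *)
have W1 : forall x, W 0%N x -> W 1%N x.
  elim: n Wn {nP} => [//|n IH] Wn; apply: IH => x Wx.
  have [y xy] := WW0 _ _ Wx.
  have [x' Wx' x'y] : W n.+2 y by apply: Wn; exists x.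
  suff -> : x = x' by [].
  apply/eqP; rewrite -subr_eq0; apply/eqP/rhoi.
  have eN : ((- 1)%:A : A^c) = - 1 by rewrite -[LHS]/((- 1)%:A : A) scaleN1r.
  by have := rhoD _ _ _ _ xy (rhoZ (- 1) _ _ x'y); rewrite !eN !scaleN1r subrr.
by move=> y yz; have [x _ xy] := W1 y yz; exists x.
Qed.

Hypothesis nakA : right_Nakayama A 4.

Lemma fin_gen_flen (M : lmodType A^c) : fin_gen M -> flen M.
Proof.
move=> fgM; apply: artinian_flen (fin_gen_artinian fgM) fgM => N fgN indN.
have [i _ [[_ /uniserialP[]//]|[_ [_ [l [lN _ _ _]]]]]] := nakA.1 N fgN indN.
exact: has_length_flen lN.
Qed.

Lemma nonlocal_len (M : lmodType A^c) : flen M -> indecomposable M -> ~ local_module M -> (len M <= 4)%N.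
Proof.
move=> flM indM nl; have [i /andP[_ i4] fs] := nakA.1 M (flen_fin_gen flM) indM.
by apply: leq_trans i4; apply: factor_serial_bound => //; case: indM.
Qed.

Lemma local_len (M : lmodType A^c) (J : submodClosed M) : flen M -> indecomposable M ->
  unique_max subT J -> J <> sub0 -> ~ local_module (subm J) -> (len M <= 5)%N.
Proof.
move=> flM indM uJ J0 nl; have [i /andP[_ i4] fs] := nakA.1 M (flen_fin_gen flM) indM.
have := factor_serial_bound_local flM fs uJ J0 nl; lia.
Qed.

End ArtinAlgebra.

(** * Projective modules: covers of local modules, and locality of indecomposables *)

Section Projective.
Variable S : pzRingType.
Implicit Types M N P : lmodType S.

Lemma projective_regular : projective (S^o : lmodType S).
Proof.
move=> X Y g f gs; have [a0 a0P] := gs (f 1).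
have lin : linear (fun x : S^o => (x : S) *: a0).
  by move=> a x y; rewrite scalerDl -scalerA.
exists (mk_lin lin) => x; rewrite /= linearZ a0P -linearZ; congr (f _).
exact: mulr1.
Qed.

Lemma projective_summand M (K : submodClosed M) : projective M -> summand K -> projective (subm K).
Proof.
move=> pM sK X Y g f gs; have [q [_ qK]] := summand_proj sK.
have [h hP] := pM X Y g (f \o q) gs.
by exists (h \o incl K) => x; apply: etrans (hP _) _; apply: congr1 (qK x).
Qed.

Lemma projective_iso M P : mod_iso M P -> projective M -> projective P.
Proof.
move=> /iso_lin[k [ki ks]] pM X Y g f gs; have [k' [kK Kk]] := lin_inverse ki ks.
have [h hP] := pM X Y g (f \o k) gs.
by exists (h \o k') => x; apply: etrans (hP _) _; apply: congr1 (Kk x).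
Qed.

Lemma local_indecomposable M : flen M -> local_module M -> indecomposable M.
Proof.
move=> flM /(unique_maxP flM)[J [cJ uJ]]; have [_ nJ _] := coversP cJ.
split=> [e|X Y /is_dsumE[e e0]]; first by apply: nJ; rewrite -e.
have [eX|nX] := pselect (X = subT).
  by right; rewrite -e0 eX subI_absr.
have [eY|nY] := pselect (Y = subT).
  by left; rewrite -e0 eY subI_absl.
by case: nJ; rewrite e; apply: subadd_lub; apply: uJ.
Qed.

Lemma local_surj M N (f : {linear N -> M}) (J : submodClosed M) : unique_max subT J ->
  ~ limg f subT <=s J -> lsurj f.
Proof.
by move=> [_ uJ] nf; apply: limgT_surj; apply: contrapT => h; apply: nf; apply: uJ.
Qed.

(** An element outside [J] generates [M], so the regular module maps onto [M]. A minimal direct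
    summand that still maps onto [M] is indecomposable: if it splits, one of the parts maps onto the
    local module [M]. *)
Lemma ex_projective_cover M : artinian_module (S^o : lmodType S) -> flen M -> local_module M ->
  exists (P : lmodType S) (p : {linear P -> M}),
    [/\ fin_gen P, indecomposable P, projective P & lsurj p].
Proof.
move=> artS flM /(unique_maxP flM)[J uJ]; have [cJ _] := uJ; have [_ nJ _] := coversP cJ.
have [m mJ] : exists m : M, m \notin J.
  by apply: contrapT => h; apply: nJ => x _; apply: contrapT => /negP xJ; apply: h; exists x.
have lin : linear (fun x : S^o => (x : S) *: m).
  by move=> a x y; rewrite scalerDl -scalerA.
pose p : {linear S^o -> M} := mk_lin lin.
have ps : lsurj p.
  apply: (local_surj uJ) => h; case/negP: mJ; apply: h.
  by apply/limgP; exists 1 => //=; rewrite scale1r.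
have [] := @artinian_min S (S^o : lmodType S) (fun K => summand K /\ limg p K = subT) artS.
  by exists subT; split; [apply: summandT|apply: limgT].
move=> K [[sK pK] Kmin].
have [q [qs qK]] := summand_proj sK.
exists (subm K), (p \o incl K); split.
- by apply: (fin_gen_surj qs); exists 1%N, (fun=> 1) => x; exists (fun=> x);
    rewrite big_ord1 -[RHS]/((x : S) * 1) mulr1.
- apply/indecomposable_subm; split=> [e|X Y e i0].
    have [_ n0 _] := cJ; apply: nJ; rewrite -pK e limg0; exact: sub0s.
  have key X' Y' : subadd X' Y' = K -> subI X' Y' = sub0 -> limg p X' = subT -> Y' = sub0.
    move=> e' i0' pX; have eX : X' = K.
      by apply: Kmin; [rewrite -e'; apply: subaddl|split=> //; apply: summand_add i0'; rewrite e'].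
    by rewrite -i0' eX subI_absr // -e'; apply: subaddr.
  have [pX|pX] := pselect (limg p X = subT); first by right; apply: key e i0 pX.
  have [pY|pY] := pselect (limg p Y = subT).
    by left; apply: key pY; rewrite 1?subaddC 1?subIC.
  case: nJ; rewrite -pK -e limg_add; apply: subadd_lub; by apply: uJ.2.
- exact/projective_summand/sK/projective_regular.
- move=> x; have : x \in limg p K by rewrite pK.
  by move=> /limgP[y /ex_incl[z <-] e]; exists z.
Qed.

(** The exponent is chosen with minimal rank of the image, so that the iterate is injective on its
    own image, and image and kernel are complements. *)
Lemma fitting M (f : {linear M -> M}) : flen M -> indecomposable M ->
  linj f \/ exists n, forall x, iter n f x = 0.
Proof.
move=> flM indM.
have lin_it n : linear (iter n f).
  by elim: n => [//|n IH] a x y; rewrite /= IH linearP.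
pose fi n := mk_lin (lin_it n).
have fiD m n x : fi (m + n)%N x = fi m (fi n x) by rewrite /= iterD.
have ex : exists r, `[< exists n, rk (limg (fi n.+1) subT) = r >].
  by exists (rk (limg (fi 1%N) subT)); apply/asboolP; exists 0%N.
have [r /asboolP[n rn] rmin] := ex_minnP ex.
pose K := limg (fi n.+1) subT; pose L := lker (fi n.+1).
have KL : subI L K = sub0.
  apply: (rk_eq0 flM); have := rk_img (fi n.+1) flM flM K.
  have : (r <= rk (limg (fi n.+1) K))%N.
    apply: rmin; apply/asboolP; exists (n + n.+1)%N; congr rk; apply: subsub_anti.
      by apply/limg_subP => x _; rewrite -addSn fiD; do 2!apply: mem_limg.
    by move=> _ /limgP[_ /limgP[x _ <-] <-]; rewrite -fiD addSn; apply: mem_limg.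
  by rewrite -/L rn; lia.
have KLT : subadd K L = subT.
  apply: (rk_eq flM) => //; have := rkD flM K L; rewrite (subIC K) KL rk0 //.
  by have := rank_nullity (fi n.+1) flM flM; rewrite -/K -/L /len; lia.
have [_ h] := indM; have [|e|e] := h K L; first by apply/is_dsumE; rewrite KLT subIC.
  by right; exists n.+1 => x; apply/eqP; rewrite -in_sub0 -e; apply: (mem_limg (fi n.+1)).
left=> x fx0; apply/eqP; rewrite -in_sub0 -e in_lker; apply/eqP.
by apply: etrans (iterSr n f x) _; rewrite fx0; apply: (linear0 (fi n)).
Qed.

(** Splitting the surjection from [L1 x L2] writes the identity as [e1 + e2], with [ei] mapping into
    [Li]; so neither is injective. Then [e1] is nilpotent by Fitting, and [e2 x = 0] gives
    [e1 x = x], hence [x = 0]: this makes [e2] injective after all. *)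
Lemma projective_local P : flen P -> indecomposable P -> projective P -> local_module P.
Proof.
move=> flP indP pP; apply: contrapT => nl; have [n0 _] := indP.
have [L1 [L2 [m1 m2 n12]]] := nonlocal_two_max flP n0 nl.
have [f [fE fI]] := sum_map L1 L2.
have LT : subadd L1 L2 = subT.
  have [_ nL1 h] := m1; have [e|//] := h (subadd L1 L2) (@subaddl _ _ _ _) (@subsT _ _ _).
  by case: (covers_neq_sub m2 m1 (nesym n12)); rewrite -e; apply: subaddr.
have fs : lsurj f by apply: limgT_surj; rewrite fI.
have [h hP] := pP _ _ f (idfun : {linear P -> P}) fs.
pose e1 : {linear P -> P} := incl L1 \o (fst \o h).
pose e2 : {linear P -> P} := incl L2 \o (snd \o h).
have e12 x : e1 x + e2 x = x.
  by rewrite -[RHS]hP -fE -surjective_pairing.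
have nsurj (L : submodClosed P) (e : {linear P -> P}) : maximal_submod L ->
    (forall x, e x \in L) -> ~ linj e.
  move=> [_ nL _] eL ei; apply: nL; apply: subTs => y _.
  by have [x <-] := linj_surj flP flP ei (leqnn _) y.
have [e1i|[n e1n]] := fitting e1 flP indP.
  by apply: (nsurj _ _ m1 _ e1i) => x; apply: inclP.
apply: (nsurj _ e2 m2); first by move=> x; apply: inclP.
move=> x ex; have e1x : e1 x = x by rewrite -[RHS]e12 ex addr0.
by rewrite -(e1n x); elim: n {e1n} => [|n IH] //; apply: etrans (esym e1x) _; apply: congr1 IH.
Qed.

Lemma projective_quom P (K : submodClosed P) : indecomposable P -> indecomposable (quom K) ->
  projective (quom K) -> K = sub0.
Proof.
move=> indP indQ pQ.
have [s sP] := pQ _ _ (proj K) (idfun : {linear quom K -> quom K}) (@proj_surj _ _ K).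
have [_ h] := indP; have [|//|e] := h K (limg s subT).
  apply/is_dsumE; split.
    apply: esym; apply: subTs => x _; rewrite -(subrK (s (proj K x)) x); apply: rpredD.
      by apply: subaddl; apply/projP; rewrite linearB sP subrr.
    by apply: subaddr; apply: mem_limg.
  apply: subs0 => x /andP[/projP px /limgP[y _ e]].
  have y0 : y = 0 by rewrite -[LHS]/(idfun y) -sP e.
  by rewrite -e y0 linear0 in_sub0.
case: indQ => n0 _; case: n0; apply: esym; apply: subs0 => y _.
have sy : s y = 0 by apply/eqP; rewrite -in_sub0 -e; apply: mem_limg.
by rewrite in_sub0 -[y]sP sy linear0.
Qed.

End Projective.

(** * Local modules *)

Section LocalModules.
Variable S : pzRingType.
Implicit Types M N U V T : lmodType S.

Lemma unique_max_img U V (f : {linear U -> V}) (K J : submodClosed U) :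
  unique_max K J -> lker f <=s J -> unique_max (limg f K) (limg f J).
Proof.
move=> [c uJ] kJ; split.
  by apply: covers_img c _; apply: subs_trans kJ; apply: capl.
move=> X XK nX; have XI : X <=s limg f subT by apply: subs_trans XK _; apply: limgS.
have sub : subI (lpre f X) K <=s J.
  apply: uJ; first exact: capr.
  move=> e; apply: nX; apply: subsub_anti => // _ /limgP[y yK <-].
  by rewrite -in_lpre; apply: (@capl _ _ _ K); rewrite e.
move=> x xX; have /limgP[y yK e] := XK _ xX; rewrite -e; apply: mem_limg; apply: sub.
by rewrite in_subI in_lpre e xX.
Qed.

Lemma unique_max_surj U V (f : {linear U -> V}) (J : submodClosed U) : lsurj f ->
  unique_max subT J -> lker f <=s J -> unique_max subT (limg f J).
Proof. by move=> fs uJ kJ; rewrite -(limgT fs); apply: unique_max_img. Qed.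

Lemma local_iso M N : flen M -> mod_iso M N -> local_module M -> local_module N.
Proof.
move=> flM iMN /(unique_maxP flM)[J uJ]; have [f [fi fs]] := iso_lin iMN.
apply/unique_maxP; first exact: flen_iso iMN flM.
by exists (limg f J); apply: unique_max_surj => //; rewrite lker0.
Qed.

Lemma local_quom U (J K : submodClosed U) : flen U -> unique_max subT J -> K <=s J ->
  unique_max subT (limg (proj K) J).
Proof.
by move=> flU uJ KJ; apply: unique_max_surj; rewrite ?lker_proj //; apply: proj_surj.
Qed.

Hypothesis nak : forall M, flen M -> indecomposable M -> ~ local_module M -> (len M <= 4)%N.

(* Otherwise let K1 <> K2 be maximal in H. Modulo their intersection, amalgamating
   U with Q / K1 along K2 embeds Q / K1 into U with image H, so that H is local. *)
Lemma local_local_rad U (Q H : submodClosed U) : flen U -> unique_max subT Q ->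
  unique_max Q H -> H <> sub0 -> local_module (subm H).
Proof.
move=> flU uQ uH H0; apply: contrapT => nl.
have [K1 [K2 [c1 c2 n12]]] := nonlocal_two_covers flU H0 nl.
have [K1H _ _] := coversP c1; have [K2H _ _] := coversP c2.
have [HQ _ _] := coversP uH.1.
pose K := subI K1 K2; pose p := proj K; pose p1 := proj K1.
have nK21 : ~ K2 <=s K1 by apply: covers_neq_sub c2 c1 (nesym n12).
have cK2 : covers K K2 by apply: covers_subI c1 K2H nK21.
have cK1 : covers K K1.
  by rewrite /K subIC; apply: (covers_subI c2 K1H); apply: (covers_neq_sub c1 c2 n12).
have [KK1 _ _] := coversP cK1; have [KK2 _ _] := coversP cK2.
have ps := @proj_surj _ _ K.
have rH := rk_covers flU c1; have rQ := rk_covers flU uH.1; have rU := rk_covers flU uQ.1.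
have rK1 := rk_covers flU cK1; have rK2 := rk_covers flU cK2.
have flK := flen_quom K flU; have flK1 := flen_quom K1 flU.
have kp : lker p = K := lker_proj K.
(* [U > Q > H > K1 > K] is a chain of covers. Together with the length 2 of [V], which is [Q / K1],
   the total is exactly 6. *)
have lK : len (quom K) = 4%N by have := len_quom K flU; rewrite /len in rU *; lia.
have rp X : K <=s X -> rk (limg p X) = (rk X - rk K)%N.
  by move=> KX; have := rk_limg_ker (f := p) flU flK; rewrite kp => /(_ _ KX); lia.
have uQ' : unique_max subT (limg p Q).
  by apply: local_quom => //; apply: subs_trans HQ; apply: subs_trans K1H.
have uH' : unique_max (limg p Q) (limg p H).
  by apply: unique_max_img => //; rewrite kp; apply: subs_trans K1H.
have p0 : limg p K = sub0.
  by apply: subs0; apply/limg_subP => x /projP px; rewrite in_sub0 [p x]px.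
have cT : covers sub0 (limg p K2).
  by rewrite -p0; apply: covers_img cK2 _; rewrite kp; apply: capl.
have [|g gP] := factor_surj (p := p) (f := p1) ps (_ : lker p <=s lker p1).
  by rewrite kp lker_proj.
pose T := subm (limg p K2); pose V := subm (limg p1 Q).
have [|v vP] := factor_inj (i := incl (limg p1 Q)) (f := g \o incl (limg p K2)) (@incl_inj _ _ _)
   (_ : limg _ subT <=s _).
  rewrite limg_incl; apply/limg_subP => t _; have /limgP[k kK e] := inclP t.
  suff : p1 k \in limg p1 Q by rewrite -(gP k) e.
  by apply: mem_limg; apply: HQ; apply: K2H.
have vi : linj v.
  move=> t vt; have /limgP[k kK e] := inclP t; have e2 : incl (limg p1 Q) (v t) = g (incl _ t) := vP t.
  rewrite vt linear0 -e gP in e2; have /projP kK1 := esym e2.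
  by apply: incl_inj; rewrite -e; apply/projP; rewrite in_subI kK1.
have uV : unique_max (limg p1 Q) (limg p1 H).
  by apply: unique_max_img => //; rewrite lker_proj.
have flV : flen V := flen_subm _ flK1.
have loV : local_module V by apply/unique_max_subm => //; exists (limg p1 H).
have lV : len V = 2%N.
  rewrite len_subm //; have := rk_limg_ker (f := p1) flU flK1 (K := Q); rewrite lker_proj.
  move=> /(_ (subs_trans K1H HQ)); lia.
have loU : local_module (quom K) by apply/unique_maxP => //; exists (limg p Q).
have nzT : exists t : T, t <> 0.
  have [_ n0 _] := coversP cT; apply: contrapT => h; apply: n0 => x /ex_incl[t <-].
  by rewrite in_sub0; apply/eqP; apply: contrapT => t0; apply: h; exists t => e; apply: t0; rewrite e linear0.
have sT : simple_module T by apply/simple_subm.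
have [t0 t0n] := nzT.
have inH t : incl (limg p K2) t \in limg p H.
  by have := inclP t; apply: limgS.
case: (amalgam nak (u := incl (limg p K2)) (v := v) flK flV sT loU loV (@incl_inj _ _ _) vi _).
- by rewrite lK lV.
(* The kernel of [f] has colength at most 2, and proper submodules descend through [Q / K] and
   [H / K]. So [f] kills [H / K] and with it the image of [u], although [v] is injective. *)
- move=> [f fP]; have HK : limg p H <=s lker f.
    have [e|nT] := pselect (lker f = subT); first by rewrite e.
    have fQ : lker f <=s limg p Q by apply: uQ'.2.
    have [e|nQ] := pselect (lker f = limg p Q); first by rewrite e; apply: limgS.
    have fH : lker f <=s limg p H by apply: uH'.2.
    suff -> : lker f = limg p H by [].
    apply: rk_eq => //; rewrite rp; last exact: subs_trans K1H.
    have := rank_nullity f flK flV.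
    by have : (rk (limg f subT) <= len V)%N := rkS flV (@subsT _ _ _); lia.
  by apply: t0n; apply: vi; rewrite -fP; apply: lkerP; apply: HK.
move=> [f fP].
have [JV uJV] := (unique_maxP flV).1 loV.
have rJV : rk JV = 1%N by have := rk_covers flV uJV.1; rewrite -/(len V); lia.
(* The only nonzero proper submodule of [V] is [JV], which contains the image of [v]; a noninjective
   [f] would kill it, against the injectivity of [u]. *)
have fi : linj f.
  apply: lker_inj; apply: contrapT => nk; have k1 := rk_gt0 flV nk.
  have nT : lker f <> subT.
    move=> e; apply: t0n; apply: incl_inj; rewrite -fP; apply: lkerP; by rewrite e.
  have vJ : limg v subT <=s JV.
    apply: uJV.2 => // e; have : len V = len T.
      by rewrite /len -e rk_limg_inj //; apply: simple_flen.
    by rewrite (simple_len sT) lV.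
  have e : lker f = JV by apply: (rk_eq flV); [exact: uJV.2|rewrite rJV].
  apply: t0n; apply: incl_inj; rewrite -fP; apply: lkerP; rewrite e; apply: vJ.
  exact: mem_limg.
have rI : rk (limg f subT) = 2%N by rewrite rk_limg_inj.
have IQ : limg f subT <=s limg p Q.
  by apply: uQ'.2 => // e; move: rI; rewrite e -/(len _) lK.
have KQ : K <=s Q by apply: subs_trans HQ; apply: subs_trans K1H.
have KH : K <=s H by apply: subs_trans K1H.
have IH : limg f subT <=s limg p H.
  by apply: uH'.2 => // e; move: rI; rewrite e rp //; lia.
have eI : limg f subT = limg p H by apply: rk_eq; rewrite ?rp //; lia.
have uI : unique_max (limg p H) (limg f JV).
  by rewrite -eI; apply: unique_max_img => //; rewrite lker0.
have rJI : rk (limg f JV) = 1%N by rewrite rk_limg_inj.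
have sub X : covers K X -> X <=s H -> limg p X = limg f JV.
  move=> c XH; have [KX _ _] := coversP c; have rX := rk_covers flU c.
  apply: rk_eq => //; last by rewrite rp //; lia.
  apply: uI.2; first exact: limgS.
  by move=> e; have := congr1 (@rk _ _) e; rewrite !rp //; lia.
apply: n12; rewrite -(lpre_limg (f := p) (K := K1)) ?kp //.
by rewrite (sub K1) // -(sub K2) // lpre_limg // kp.
Qed.

(** By [local_local_rad], once the radical of a local module is local, so is the next one; the
    descent stops at a nonlocal radical only directly below the top. *)
Lemma local_cases U : flen U -> local_module U ->
  uniserial U \/ exists J : submodClosed U, [/\ unique_max subT J, J <> sub0 & ~ local_module (subm J)].
Proof.
move: {2}(len U) (leqnn (len U)) => n; elim: n U => [|n IH] U lU flU loU.
  have [J uJ] := (unique_maxP flU).1 loU.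
  by have := rk_covers flU uJ.1; rewrite -/(len U); lia.
have [J uJ] := (unique_maxP flU).1 loU.
have [nl|lJ] := pselect (J <> sub0 /\ ~ local_module (subm J)).
  by right; exists J; case: nl.
left; apply/uniserialP; split=> //.
have chT : chain_below J -> chain_below (subT : submodClosed U).
  move=> ch X Y _ _; have [->|nX] := pselect (X = subT); first by right.
  have [->|nY] := pselect (Y = subT); first by left.
  by apply: ch; apply: uJ.2.
apply: chT; have [->|nJ] := pselect (J = sub0).
  by move=> X Y /subs0-> /subs0->; left.
have loJ : local_module (subm J) by apply: contrapT => h; apply: lJ.
have flJ := flen_subm J flU.
have lenJ : (len (subm J) <= n)%N.
  by rewrite len_subm //; have := rk_covers flU uJ.1; rewrite -/(len U); lia.
case: (IH _ lenJ flJ loJ) => [/uniserial_subm h|[H [uH H0 nlH]]]; first exact: h.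
have iH := subm_iso H (@incl_inj _ _ J).
case: nlH; apply: (local_iso (flen_subm _ flU) (mod_iso_sym iH)).
apply: local_local_rad uJ _ _ => //.
  have := @unique_max_img _ _ (incl J) _ _ uH; rewrite limg_incl lker0; last exact: incl_inj.
  by apply; apply: sub0s.
move=> e; apply: H0; apply: (limg_inj (@incl_inj _ _ J)); by rewrite e limg0.
Qed.

End LocalModules.

(** * Simple modules and simple submodules *)

Section Atoms.
Variable S : pzRingType.
Implicit Types M N U V T W : lmodType S.

Lemma nonzero_elt M : sub0 <> subT :> submodClosed M -> exists x : M, x <> 0.
Proof.
move=> n0; apply: contrapT => h; apply: n0; apply: esym; apply: subs0 => x _.
by rewrite in_sub0; apply/eqP; apply: contrapT => x0; apply: h; exists x.
Qed.

Lemma simple_end T (f : {linear T -> T}) : simple_module T ->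
  (forall x, f x = 0) \/ linj f /\ lsurj f.
Proof.
move=> sT; have flT := simple_flen sT; have [_ h] := sT.
have [e|e] := h (lker f); last by left=> x; apply: lkerP; rewrite e.
by right; have fi := lker_inj e; split=> //; apply: (linj_surj flT flT).
Qed.

Lemma simple_gen T (t0 : T) : simple_module T -> t0 <> 0 -> forall x, exists a, x = a *: t0.
Proof.
move=> [_ h] t00 x.
have cyc : GRing.subsemimod_closed (fun x : T => `[< exists a, x = a *: t0 >]).
  split; first split; first by apply/asboolP; exists 0; rewrite scale0r.
    by move=> _ _ /asboolP[a ->] /asboolP[b ->]; apply/asboolP; exists (a + b); rewrite scalerDl.
  by move=> a _ /asboolP[b ->]; apply/asboolP; exists (a * b); rewrite scalerA.
have [e|e] := h (mk_submod cyc); last first.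
  by have := in_subT x; rewrite -e => /asboolP.
case: t00; apply/eqP; rewrite -in_sub0 -e; apply/asboolP; exists 1; by rewrite scale1r.
Qed.

Lemma atom_sub M (Z K : submodClosed M) x : covers sub0 Z -> x \in Z -> x \in K -> x <> 0 -> Z <=s K.
Proof.
move=> /coversP[_ _ ZP] xZ xK x0; have [e|e] := ZP (subI Z K) (@sub0s _ _ _) (@capl _ _ _ _).
  by case: x0; apply/eqP; rewrite -in_sub0 -e in_subI xZ.
by rewrite -e; apply: capr.
Qed.

Lemma subI_atom M (Z K : submodClosed M) : covers sub0 Z -> ~ Z <=s K -> subI Z K = sub0.
Proof.
move=> cZ nZ; apply: subs0 => x /andP[xZ xK]; rewrite in_sub0; apply/eqP.
by apply: contrapT => x0; apply: nZ; apply: atom_sub xK x0.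
Qed.

(** The hypothesis on [H] says that its radical is zero. Take [C] of least length with [C + Z = H]
    and an atom [B] of [C]. If [B] lay in [Z], a maximal submodule [L] of [H] not containing [B]
    would give the shorter supplement [subI L C]. *)
Lemma ex_atom_notin M (H Z : submodClosed M) : flen M ->
  (forall x, x \in H -> x <> 0 -> exists2 L : submodClosed M, covers L H & x \notin L) ->
  Z <=s H -> Z <> H -> exists C : submodClosed M, [/\ covers sub0 C, C <=s H & ~ C <=s Z].
Proof.
move=> flM rad0 ZH nZ.
have ex : exists r, `[< exists C : submodClosed M, [/\ C <=s H, subadd C Z = H & rk C = r] >].
  by exists (rk H); apply/asboolP; exists H; split=> //; apply: subadd_absr.
have [r /asboolP[C [CH eC rC]] rmin] := ex_minnP ex.
have C0 : C <> sub0 by move=> e; apply: nZ; rewrite -eC e subadd_absl //; apply: sub0s.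
have [B BC cB] := ex_atom flM C0; exists B; split=> //; first exact: subs_trans CH.
move=> BZ; have [BB _ _] := coversP cB.
have B0 : sub0 <> B by case: cB.
have [s [sB s0]] : exists s, s \in B /\ s <> 0.
  apply: contrapT => h; apply: B0; apply: esym; apply: subs0 => s sB; rewrite in_sub0; apply/eqP.
  by apply: contrapT => s0; apply: h; exists s.
have [L cL sL] := rad0 s (CH _ (BC _ sB)) s0; have [LH nL LP] := coversP cL.
have LB : subadd B L = H.
  have [||e|//] := LP (subadd B L); first exact: subaddr.
    by apply: subadd_lub => //; apply: subs_trans CH.
  by case/negP: sL; rewrite -e; apply: subaddl.
have eCC : subadd B (subI L C) = C by rewrite -modular // LB subI_absr.
have : (r <= rk (subI L C))%N.
  apply: rmin; apply/asboolP; exists (subI L C); split=> //.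
    by apply: subs_trans CH; apply: capr.
  apply: subsub_anti.
    by apply: subadd_lub => //; apply: subs_trans CH; apply: capr.
  have CZ : C <=s subadd (subI L C) Z.
    rewrite -{1}eCC; apply: subadd_lub; last exact: subaddl.
    by apply: subs_trans (@subaddr _ _ _ _).
  by rewrite -{1}eC; apply: subadd_lub => //; apply: subaddr.
rewrite -rC => /(rk_eq flM (@capr _ _ _ _)) e.
by case/negP: sL; have := BC _ sB; rewrite -e in_subI => /andP[].
Qed.

(** [X] modulo the preimage of [L] embeds in the simple module [Y / L] with nonzero image. It is the
    reason why homomorphisms respect radicals. *)
Lemma covers_lpre_sub U V (f : {linear U -> V}) (X : submodClosed U) (L Y : submodClosed V) :
  covers L Y -> limg f X <=s Y -> ~ limg f X <=s L -> covers (subI (lpre f L) X) X.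
Proof.
move=> /coversP[LY nL LP] fXY nfX; split; first exact: capr.
  by move=> e; apply: nfX; apply/limg_subP => x; rewrite -e => /andP[].
move=> N lN NX; have [||e|e] := LP (subadd L (limg f N)); first exact: subaddl.
- by apply: subadd_lub => //; apply: subs_trans fXY; apply: limgS.
- left; apply: subsub_anti => // x xN; rewrite in_subI in_lpre NX // andbT -e.
  by apply: subaddr; apply: mem_limg.
right; apply: subsub_anti => // x xX.
have : f x \in subadd (limg f N) L by rewrite subaddC e; apply/fXY/mem_limg.
move=> /subaddP[_ /limgP[n nN <-]]; rewrite -linearB => xnL.
by apply: (memBr (y := n)) => //; apply: lN; rewrite in_subI in_lpre xnL memB // NX.
Qed.

End Atoms.

(** * The top of the radical of an indecomposable projective module *)

Section QuasiProjective.
Variables (R : comPzRingType) (A : algType R).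
Hypotheses (artA : artin_algebra A) (nakA : right_Nakayama A 4).
Implicit Types M N U V T W P : lmodType A^c.

(** Scalars from [R] are central in [A], so [R] acts on homomorphisms; this makes the
    correspondences below [R]-linear. *)
Lemma central_linear r U V (f : {linear U -> V}) : linear (fun x => (r%:A : A^c) *: f x).
Proof.
move=> a x y; rewrite linearP scalerDr !scalerA; congr (_ *: _ + _).
by rewrite -[LHS]/((a : A) * (r%:A : A)) -[RHS]/((r%:A : A) * (a : A)) -scalerAr -scalerAl mulr1 mul1r.
Qed.
Definition cscale r U V (f : {linear U -> V}) : {linear U -> V} := mk_lin (@central_linear r U V f).

(** The part of projectivity that survives in the quotient of [P] by a submodule stable under all
    endomorphisms. *)
Definition quasi_projective W := forall N (k f : {linear W -> N}), lsurj k ->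
  exists g : {linear W -> W}, forall x, k (g x) = f x.

Section SemisimpleRadical.
Variables (W : lmodType A^c) (H : submodClosed W).
Hypotheses (flW : flen W) (uH : unique_max subT H) (qp : quasi_projective W).
Hypothesis rad0 : forall x, x \in H -> x <> 0 -> exists2 L : submodClosed W, covers L H & x \notin L.

(** A noninjective [g] maps [W] into [H]. The preimage of a maximal submodule of [H] is [W] or the
    only maximal submodule [H] of [W], so the image of [H] lies in every maximal submodule of [H];
    these intersect in zero by [rad0]. *)
Lemma noninj_kills (g : {linear W -> W}) : ~ linj g -> forall x, x \in H -> g x = 0.
Proof.
move=> ni x xH; apply: contrapT => gx0.
have ns : ~ lsurj g by move=> gs; apply: ni; apply: (lsurj_inj flW flW gs).
have gH : limg g subT <=s H.
  by apply: uH.2 => // e; apply: ns; apply: limgT_surj.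
have [L cL xL] := rad0 (gH _ (mem_limg g (in_subT x))) gx0.
have [|_ nL _] := covers_lpre_sub cL gH _.
  by move=> h; case/negP: xL; apply/h/mem_limg.
have sub : subI (lpre g L) subT <=s H.
  by apply: uH.2.
have : H <=s subI (lpre g L) subT.
  have [_ _ h] : covers (subI (lpre g L) subT) (subT : submodClosed W).
    by apply: (covers_lpre_sub cL gH) => h'; case/negP: xL; apply/h'/mem_limg.
  have [->//|e] := h H sub (@subsT _ _ _).
  by case: uH => [[_ /(_ e)]].
by move=> /(_ x xH) /andP[]; rewrite in_lpre (negbTE xL).
Qed.

Lemma kill_inj (g : {linear W -> W}) x : x \in H -> g x <> 0 -> linj g.
Proof. by move=> xH gx; apply: contrapT => /noninj_kills/(_ _ xH). Qed.

(** [W / Sa] and [W / Sb] are amalgamated along [T], and the map is lifted to [W] by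
    quasi-projectivity. With [3 <= rk H] both quotients have length at least 3; this is the origin
    of the bound 2 below. *)
Lemma glue_atoms T (Sa Sb : submodClosed W) (u v : {linear T -> W}) :
  simple_module T -> covers sub0 Sa -> covers sub0 Sb -> Sa <=s H -> Sb <=s H -> (3 <= rk H)%N ->
  (forall t, u t \in Sa -> t = 0) -> (forall t, v t \in Sb -> t = 0) ->
  exists g : {linear W -> W},
    (limg g Sa <=s Sb /\ forall t, g (u t) - v t \in Sb) \/
    (limg g Sb <=s Sa /\ forall t, g (v t) - u t \in Sa).
Proof.
move=> sT cSa cSb SaH SbH rH uSa vSb.
have rW := rk_covers flW uH.1.
have loq (K : submodClosed W) : K <=s H -> local_module (quom K).
  move=> KH; apply/unique_maxP; first exact: flen_quom.
  by exists (limg (proj K) H); apply: local_quom.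
have lq (K : submodClosed W) : covers sub0 K -> (3 <= len (quom K))%N.
  by move=> c; have := len_quom K flW; rewrite (rk_atom flW c) /len; lia.
have ui : linj (proj Sa \o u) by move=> t /projP /uSa.
have vi : linj (proj Sb \o v) by move=> t /projP /vSb.
have lift (K K' : submodClosed W) (f : {linear quom K -> quom K'}) : exists g : {linear W -> W},
    forall x, proj K' (g x) = f (proj K x).
  exact: (qp (f \o proj K) (@proj_surj _ _ K')).
have sub (K K' : submodClosed W) (f : {linear quom K -> quom K'}) (g : {linear W -> W}) :
    (forall x, proj K' (g x) = f (proj K x)) -> limg g K <=s K'.
  by move=> h; apply/limg_subP => x /projP xK; apply/projP; rewrite h xK linear0.
have [|[f fP]|[f fP]] := amalgam (nonlocal_len nakA) (flen_quom Sa flW) (flen_quom Sb flW) sT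
  (loq _ SaH) (loq _ SbH) ui vi.
- by have := lq _ cSa; have := lq _ cSb; lia.
- have [g gP] := lift _ _ f; exists g; left; split; first exact: sub gP.
  by move=> t; apply/projP; rewrite linearB gP; apply/eqP; rewrite subr_eq0; apply/eqP/fP.
have [g gP] := lift _ _ f; exists g; right; split; first exact: sub gP.
by move=> t; apply/projP; rewrite linearB gP; apply/eqP; rewrite subr_eq0; apply/eqP/fP.
Qed.

Lemma inj_limg_atom (g : {linear W -> W}) (Sa Sb : submodClosed W) : linj g ->
  covers sub0 Sa -> covers sub0 Sb -> limg g Sa <=s Sb -> limg g Sa = Sb.
Proof.
move=> gi ca cb gab; apply: (rk_eq flW) => //; rewrite rk_limg_inj //.
by rewrite (rk_atom flW ca) (rk_atom flW cb).
Qed.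

(* Let S1, S2, S3 be independent atoms of H; gluing shows that they are isomorphic.
   An endomorphism g of W that preserves S1 and acts as e on S2 modulo S1 induces
   some e' on S1; this correspondence between e and e' is onto by linear_rel_surj.
   Applied to a g that moves S2 to S3 modulo S1, it yields g2 agreeing with g on S1
   and preserving S1 + S2; then g - g2 kills S1, hence H, so S3 lies in S1 + S2. *)
Lemma semisimple_rad_le2 : (rk H <= 2)%N.
Proof.
rewrite leqNgt; apply/negP => rH.
have n0 : sub0 <> H by move=> e; move: rH; rewrite -e rk0.
have [S1 [c1 S1H _]] := ex_atom_notin flW rad0 (@sub0s _ _ _) n0.
have r1 := rk_atom flW c1.
have nS1 : S1 <> H by move=> e; move: rH; rewrite -e r1.
have [S2 [c2 S2H nS21]] := ex_atom_notin flW rad0 S1H nS1.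
have r2 := rk_atom flW c2.
have S12H : subadd S1 S2 <=s H by apply: subadd_lub.
have nS12 : subadd S1 S2 <> H.
  by move=> e; move: rH; rewrite -e; have := rkD flW S1 S2; lia.
have [S3 [c3 S3H nS3]] := ex_atom_notin flW rad0 S12H nS12.
pose T := subm S1.
have sT : simple_module T by apply/simple_subm.
have [t0 t00] := nonzero_elt sT.1.
(* A third atom [Sc], included in both quotients, serves as [T]. The resulting [g] does not vanish
   on [H], so it is injective and carries [Sa] to [Sb] or [Sb] to [Sa]; in the second case it is
   inverted. *)
have copy (Sa Sb Sc : submodClosed W) : covers sub0 Sa -> covers sub0 Sb -> covers sub0 Sc ->
    Sa <=s H -> Sb <=s H -> Sc <=s H -> subI Sc Sa = sub0 -> subI Sc Sb = sub0 ->
    exists i : {linear subm Sa -> W}, linj i /\ forall t, i t \in Sb.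
  move=> ca cb cc aH bH cH ia ib.
  have sc : simple_module (subm Sc) by apply/simple_subm.
  have in0 (X : submodClosed W) : subI Sc X = sub0 -> forall t : subm Sc, incl Sc t \in X -> t = 0.
    by move=> iX t tX; apply: incl_inj; apply/eqP; rewrite -in_sub0 -iX in_subI inclP tX.
  have [s s0] := nonzero_elt sc.1.
  have sH : incl Sc s \in H by apply/cH/inclP.
  have [g [[gab gP]|[gba gP]]] := glue_atoms sc ca cb aH bH rH (in0 _ ia) (in0 _ ib).
    have gi : linj g.
      apply: (kill_inj sH) => gs0; apply: s0; apply: (in0 _ ib).
      by have := gP s; rewrite gs0 sub0r => /memN; rewrite opprK.
    exists (g \o incl Sa); split; first by move=> t /gi/incl_inj.
    by move=> t; apply: gab; apply: mem_limg; apply: inclP.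
  have gi : linj g.
    apply: (kill_inj sH) => gs0; apply: s0; apply: (in0 _ ia).
    by have := gP s; rewrite gs0 sub0r => /memN; rewrite opprK.
  have eg := inj_limg_atom gi cb ca gba.
  have [g' [gK _]] := lin_inverse gi (linj_surj flW flW gi (leqnn _)).
  have pre t : exists2 y, y \in Sb & g y = incl Sa t.
    by apply/limgP; rewrite eg; apply: inclP.
  exists (g' \o incl Sa); split=> t; have [y yb e] := pre t.
    by move=> gt0; apply: incl_inj; rewrite -e -(gK y) e [g' _]gt0 linear0.
  by have := yb; rewrite -{1}(gK y) e.
have S31 : subI S3 S1 = sub0.
  by apply: subI_atom => // h; apply: nS3; apply: subs_trans h (@subaddl _ _ _ _).
have S32 : subI S3 S2 = sub0.
  by apply: subI_atom => // h; apply: nS3; apply: subs_trans h (@subaddr _ _ _ _).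
have S21 : subI S2 S1 = sub0 by apply: subI_atom.
have S23 : subI S2 S3 = sub0 by rewrite subIC.
have [i2 [i2i i2P]] := copy _ _ _ c1 c2 c3 S1H S2H S3H S31 S32.
have [i3 [i3i i3P]] := copy _ _ _ c1 c3 c2 S1H S3H S2H S21 S23.
have i2S1 t : i2 t \in S1 -> t = 0.
  by move=> h; apply: i2i; apply/eqP; rewrite -in_sub0 -S21 in_subI i2P h.
have i3S1 t : i3 t \in S1 -> t = 0.
  by move=> h; apply: i3i; apply/eqP; rewrite -in_sub0 -S31 in_subI i3P h.
(* If the gluing goes the wrong way, [g] does not vanish on [H], so it is an automorphism and its
   inverse serves. *)
have moveto (w : {linear T -> W}) : (forall t, w t \in H) -> (forall t, w t \in S1 -> t = 0) ->
    exists g : {linear W -> W}, limg g S1 <=s S1 /\ forall t, g (i2 t) - w t \in S1.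
  move=> wH w1; have [g [[g1 gP]|[g1 gP]]] := glue_atoms sT c1 c1 S1H S1H rH i2S1 w1.
    by exists g.
  have gi : linj g.
    apply: (kill_inj (wH t0)) => gs0; apply: t00; apply: i2S1.
    by have := gP t0; rewrite gs0 sub0r => /memN; rewrite opprK.
  have eg := inj_limg_atom gi c1 c1 g1.
  have [g' [gK Kg]] := lin_inverse gi (linj_surj flW flW gi (leqnn _)).
  have g'1 : limg g' S1 <=s S1.
    by apply/limg_subP => x; rewrite -{1}eg => /limgP[y yS <-]; rewrite gK.
  exists g'; split=> // t; have := g'1 _ (mem_limg g' (gP t)).
  by rewrite linearB gK => /memN; rewrite opprB.
have restr (g : {linear W -> W}) : limg g S1 <=s S1 ->
    exists e : {linear T -> T}, forall t, incl S1 (e t) = g (incl S1 t).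
  move=> g1; apply: (factor_inj (i := incl S1) (f := g \o incl S1)); first exact: incl_inj.
  by rewrite limg_incl; apply/limg_subP => t _; apply: g1; apply: mem_limg; apply: inclP.
(* Endomorphisms of [T] are recorded by their value at the generator [t0]; [y] is the value at [t0]
   of the action of [g] on [S1]. *)
pose rho (x y : T) := exists (e : {linear T -> T}) (g : {linear W -> W}),
  [/\ x = e t0, limg g S1 <=s S1, (forall t, g (i2 t) - i2 (e t) \in S1) & g (incl S1 t0) = incl S1 y].
have i20 : i2 0 = 0 by apply: linear0.
have rhoT (e : {linear T -> T}) : exists z, rho (e t0) z.
  have [e0|[ei es]] := simple_end e sT.
    exists 0, e, \0; split=> //; first by apply/limg_subP => x _; apply: rpred0.
    by move=> t /=; rewrite e0 i20 subrr rpred0.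
  have [|t|g [g1 gP]] := moveto (i2 \o e).
  - by move=> t; apply/S2H/i2P.
  - by move=> /= /i2S1/ei.
  have [z ez] := ex_incl (g1 _ (mem_limg g (inclP t0))).
  by exists z, e, g.
have onto y : (exists z, rho y z) -> exists x, rho x y.
  move: y; apply: (linear_rel_surj artA (simple_gen sT t00)).
  - by exists \0, \0; split=> //; [apply/limg_subP => x _; apply: rpred0|move=> t /=; rewrite i20 subrr rpred0].
  - move=> x y x' y' [e [g [-> g1 gP gy]]] [e' [g' [-> g1' gP' gy']]].
    exists (e \+ e'), (g \+ g'); split=> //.
    + by apply/limg_subP => s sS; apply: rpredD; [apply/g1/mem_limg|apply/g1'/mem_limg].
    + by move=> t /=; rewrite linearD opprD addrACA rpredD.
    + by rewrite /= gy gy' -linearD.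
  - move=> r x y [e [g [-> g1 gP gy]]]; exists (cscale r e), (cscale r g); split=> //.
    + by apply/limg_subP => s sS; apply: rpredZ; apply/g1/mem_limg.
    + by move=> t /=; rewrite linearZ -scalerBr rpredZ.
    + by rewrite /= gy -linearZ.
  - move=> x y [e [g [_ g1 gP gy]]]; have [e' eP] := restr g g1.
    have -> : y = e' t0 by apply: (linj_inj (@incl_inj _ _ S1)); rewrite eP gy.
    exact: rhoT.
  - move=> x [e [g [-> g1 gP gy]]]; apply: i2S1.
    have ng : ~ linj g by move=> gi; apply: t00; apply: incl_inj; apply: gi; rewrite gy linear0.
    have := gP t0; rewrite (noninj_kills ng); last by apply/S2H/i2P.
    by rewrite sub0r => /memN; rewrite opprK.
have [||g [g1 gP]] := moveto i3 => //; first by move=> t; apply/S3H/i3P.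
have [e' eP] := restr g g1.
have [x [e [g2 [_ g21 g2P g2y]]]] := onto _ (rhoT e').
have nd : ~ linj (g \- g2).
  move=> di; apply: t00; apply: incl_inj; apply: di.
  by rewrite /= g2y -eP subrr.
have d0 : g (i2 t0) = g2 (i2 t0).
  apply/eqP; rewrite -subr_eq0; apply/eqP.
  by apply: (noninj_kills nd); apply/S2H/i2P.
have : i3 t0 \in subI S3 (subadd S1 S2).
  rewrite in_subI i3P andTb.
  have -> : i3 t0 = - (g (i2 t0) - i3 t0) + (g2 (i2 t0) - i2 (e t0)) + i2 (e t0).
    by rewrite opprB d0 addrA !subrK.
  apply: rpredD; last by apply: subaddr; apply: i2P.
  by apply: rpredD; apply: subaddl; [apply/memN/gP|apply: g2P].
by rewrite subI_atom // in_sub0 => /eqP /i3i.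
Qed.

End SemisimpleRadical.
Lemma mem_radpush M (Y : submodClosed M) y : y \in Y ->
  (forall L : submodClosed M, covers L Y -> y \in L) -> y \in subpush (modrad (subm Y)).
Proof.
move=> /ex_incl[z <-] h; rewrite subpushE; apply: mem_limg; apply/asboolP => L mL.
rewrite -(push_pull L) in_lpre; apply: h.
by have := covers_push mL; rewrite limg_incl.
Qed.

Lemma local_endo_rad P (Y : submodClosed P) (h : {linear P -> P}) : flen P -> unique_max subT Y ->
  limg h Y <=s Y.
Proof.
move=> flP uY; have [hs|nhs] := pselect (limg h subT = subT); last first.
  by apply: subs_trans (uY.2 _ (@subsT _ _ _) nhs); apply: limgS.
have hi : linj h by apply: (lsurj_inj flP flP (limgT_surj hs) (leqnn _)).
apply: uY.2 => // e; have [_ _ _] := uY.1; have := rk_covers flP uY.1.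
by have := rk_limg_inj flP flP Y hi; rewrite e; lia.
Qed.

Lemma radpush_endo P (Y : submodClosed P) (h : {linear P -> P}) : flen P -> unique_max subT Y ->
  limg h (subpush (modrad (subm Y))) <=s subpush (modrad (subm Y)).
Proof.
move=> flP uY; have hY : limg h Y <=s Y by apply: local_endo_rad.
apply/limg_subP => x xJ; have xY := @radpush_subY _ _ _ _ xJ.
apply: mem_radpush => [|L cL]; first by apply/hY/mem_limg.
have [hL|nL] := pselect (limg h Y <=s L); first by apply/hL/mem_limg.
by have := radpush_sub (covers_lpre_sub cL hY nL) xJ; rewrite in_subI => /andP[].
Qed.

Lemma quasi_projective_quom P (J : submodClosed P) : projective P ->
  (forall h : {linear P -> P}, limg h J <=s J) -> quasi_projective (quom J).
Proof.
move=> pP hJ N k f ks.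
have [|h hP] := pP _ _ (k \o proj J) (f \o proj J).
  by move=> b; have [y <-] := ks b; have [x <-] := proj_surj y; exists x.
have [|g gP] := factor_surj (p := proj J) (f := proj J \o h) (@proj_surj _ _ J).
  by rewrite lker_proj => x xJ; apply/eqP/projP/(hJ h)/mem_limg.
exists g => y; have [x <-] := proj_surj y; rewrite gP; exact: hP.
Qed.

Lemma quom_rad0 M (Y : submodClosed M) x :
  x \in limg (proj (subpush (modrad (subm Y)))) Y -> x <> 0 ->
  exists2 L : submodClosed (quom (subpush (modrad (subm Y)))),
    covers L (limg (proj (subpush (modrad (subm Y)))) Y) & x \notin L.
Proof.
set J := subpush _; have kJ : lker (proj J) = J := lker_proj J.
move=> /limgP[y yY <-] y0; apply: contrapT => h; apply: y0; apply/projP.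
apply: mem_radpush => // L cL; have JL : J <=s L by apply: radpush_sub.
rewrite -(lpre_limg (f := proj J) (K := L)) ?kJ // in_lpre.
apply: contrapT => /negP yL; apply: h; exists (limg (proj J) L) => //.
by apply: covers_img cL _; rewrite kJ; apply: subs_trans JL; apply: capl.
Qed.

(** [semisimple_rad_le2] is applied to [P / rad^2 P], which is quasi-projective because [rad^2 P] is
    stable under all endomorphisms. *)
Lemma rad_top_le2 P (Y : submodClosed P) : flen P -> projective P -> unique_max subT Y ->
  (rk Y <= rk (subpush (modrad (subm Y))) + 2)%N.
Proof.
move=> flP pP uY; have := @quom_rad0 P Y; set J := subpush _ => rad0.
have JY : J <=s Y by apply: radpush_subY.
have flQ := flen_quom J flP.
have := semisimple_rad_le2 flQ (local_quom flP uY JY)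
  (quasi_projective_quom pP (fun h => radpush_endo (h := h) flP uY)) rad0.
have := rk_limg_ker (f := proj J) flP flQ (K := Y); rewrite lker_proj => /(_ JY); lia.
Qed.

End QuasiProjective.

(** * Nonlocal indecomposable modules *)

Section Nonlocal.
Variables (R : comPzRingType) (A : algType R).
Hypotheses (artA : artin_algebra A) (nakA : right_Nakayama A 4).
Implicit Types M N U V T W P : lmodType A^c.

Lemma max_add M (L L' : submodClosed M) : maximal_submod L -> ~ L' <=s L -> subadd L L' = subT.
Proof.
move=> [_ _ h] nL; have [e|//] := h (subadd L L') (@subaddl _ _ _ _) (@subsT _ _ _).
by case: nL; rewrite -e; apply: subaddr.
Qed.

Lemma max_add2 M (L L' : submodClosed M) : maximal_submod L -> maximal_submod L' -> L <> L' ->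
  subadd L L' = subT.
Proof. by move=> m m' n; apply: max_add => //; apply: covers_neq_sub m' m (nesym n). Qed.

Lemma atom_in_max M (Z L : submodClosed M) : flen M -> indecomposable M -> (2 <= len M)%N ->
  covers sub0 Z -> maximal_submod L -> Z <=s L.
Proof.
move=> flM [n0 ind] lM cZ mL; apply: contrapT => nZ.
have e : subadd L Z = subT by apply: max_add.
have i0 : subI L Z = sub0 by rewrite subIC; apply: subI_atom.
have [|L0|Z0] := ind L Z; first by apply/is_dsumE.
  have := rk_covers flM mL; rewrite L0 rk0 // -/(len M); lia.
by case: cZ => _ /(_ (esym Z0)).
Qed.

Lemma colocal_atom M (S Z : submodClosed M) : colocal_at S -> covers sub0 Z -> Z = S.
Proof.
move=> [cS coS] cZ; have [_ _ h] := cZ; have Z0 : Z <> sub0 by move=> e; case: cZ => _ /(_ (esym e)).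
have [e|->//] := h S (@sub0s _ _ _) (coS _ Z0).
by case: cS => _ /(_ (esym e)).
Qed.

Lemma atoms_colocal M (S : submodClosed M) : flen M -> covers sub0 S ->
  (forall Z, covers sub0 Z -> Z <=s S) -> colocal_at S.
Proof.
move=> flM cS h; split=> // K K0; have [Z ZK cZ] := ex_atom flM K0.
have [_ _ h'] := cS; have [e|<-//] := h' Z (@sub0s _ _ _) (h _ cZ).
by case: cZ => _ /(_ (esym e)).
Qed.

Lemma colocal_subm M (S K : submodClosed M) : colocal_at S -> S <=s K ->
  colocal_at (lpre (incl K) S).
Proof.
move=> [cS coS] SK; split.
  by have := covers_pull SK cS; rewrite -/(lker _) lker0 //; apply: incl_inj.
move=> X X0; rewrite -(push_pull X); apply: lpreS; apply: coS => e; apply: X0.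
by apply: (limg_inj (@incl_inj _ _ K)); rewrite e limg0.
Qed.

Lemma noninj_colocal U V (SU : submodClosed U) (f : {linear U -> V}) : colocal_at SU ->
  ~ linj f -> SU <=s lker f.
Proof. by move=> [_ coU] ni; apply: coU => e; apply: ni; apply: lker_inj. Qed.

(** A noninjective [f] kills [SU]. A maximal submodule of [U] has length 2 and contains [SU], so its
    image has length at most 1 and lies in [SV]; two maximal submodules generate [U]. *)
Lemma noninj_soc U V (SU : submodClosed U) (SV : submodClosed V) (f : {linear U -> V}) :
  flen U -> flen V -> colocal_at SU -> colocal_at SV -> len U = 3%N -> ~ local_module U ->
  ~ linj f -> forall x, f x \in SV.
Proof.
move=> flU flV cU [cV coV] lU nl ni x.
have kS := noninj_colocal cU ni.
have U0 : sub0 <> subT :> submodClosed U.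
  by move=> e; move: lU; rewrite /len -e rk0.
have [L1 [L2 [m1 m2 n12]]] := nonlocal_two_max flU U0 nl.
have sub L : maximal_submod L -> limg f L <=s SV.
  move=> mL; have rL := rk_covers flU mL; rewrite -/(len U) lU in rL.
  have [L0|L0] := pselect (L = sub0); first by move: rL; rewrite L0 rk0.
  have SL : SU <=s subI (lker f) L by apply: subI_glb => //; apply: cU.2.
  have := rk_img f flU flV L; have := rkS flU SL; rewrite (rk_atom flU cU.1) => h1 h2.
  have [e|nz] := pselect (limg f L = sub0); first by rewrite e; apply: sub0s.
  have SI := coV _ nz.
  suff <- : SV = limg f L by [].
  by apply: (rk_eq flV) => //; rewrite (rk_atom flV cV); lia.
have := mem_limg f (in_subT x); rewrite -(max_add2 m1 m2 n12) limg_add.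
by apply: subadd_lub; apply: sub.
Qed.

(** Perspectivity: both quotients are [C] modulo the common intersection. *)
Lemma persp M (L L' C : submodClosed M) : subadd L C = subT -> subadd L' C = subT ->
  subI L C = subI L' C -> exists b : {linear M -> quom L}, lsurj b /\ lker b = L'.
Proof.
move=> e e' eI.
pose q := proj L' \o incl C; pose p := proj L \o incl C.
have qs : lsurj q.
  move=> y; have [x <-] := proj_surj y; have := in_subT x; rewrite -e' => /subaddP[l lL /ex_incl[c ec]].
  exists c; apply/eqP; rewrite -subr_eq0; apply/eqP.
  have -> : q c - proj L' x = proj L' (incl C c - x) by rewrite linearB.
  by apply/projP; rewrite ec addrC addKr memN.
have ps : lsurj p.
  move=> y; have [x <-] := proj_surj y; have := in_subT x; rewrite -e => /subaddP[l lL /ex_incl[c ec]].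
  exists c; apply/eqP; rewrite -subr_eq0; apply/eqP.
  have -> : p c - proj L x = proj L (incl C c - x) by rewrite linearB.
  by apply/projP; rewrite ec addrC addKr memN.
have kk (c : subm C) : (q c == 0) = (p c == 0).
  rewrite /q /p /= !proj_eq0; have := inclP c => cC.
  have : (incl C c \in subI L C) = (incl C c \in subI L' C) by rewrite eI.
  by rewrite !in_subI cC !andbT => ->.
have [|g gP] := factor_surj (p := q) (f := p) qs.
  by move=> c; rewrite !in_lker kk.
exists (g \o proj L'); split.
  by move=> y; have [c <-] := ps y; exists (incl C c); apply: gP.
apply/submod_eqP => x; rewrite in_lker -proj_eq0.
have [c ec] := qs (proj L' x).
have eg : g (proj L' x) = p c by rewrite -ec gP.
by rewrite -[X in X == 0]/(g (proj L' x)) eg -kk ec.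
Qed.

Lemma quom_simple M (L : submodClosed M) : flen M -> maximal_submod L -> simple_module (quom L).
Proof.
move=> flM mL; apply/simpleP; apply: (atom_rk (flen_quom L flM)).
have := len_quom L flM; have := rk_covers flM mL; rewrite /len; lia.
Qed.

(** The two maps of [M] onto [M / L], with kernels [L] and [L'], are pulled back, the lengths 3 + 3
    just reaching 6. The map obtained is injective: otherwise its image would lie in [S], which both
    kernels contain. *)
Lemma conj3 M (S L L' C : submodClosed M) : flen M -> len M = 3%N -> ~ local_module M ->
  colocal_at S -> maximal_submod L -> maximal_submod L' ->
  subadd L C = subT -> subadd L' C = subT -> subI L C = subI L' C ->
  exists f : {linear M -> M}, [/\ linj f, lsurj f & limg f L' = L].
Proof.
move=> flM lM nl cS mL mL' e e' eI.
have [b [bs kb]] := persp e e' eI.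
have sT := quom_simple flM mL.
have rL := rk_covers flM mL; have rL' := rk_covers flM mL'.
have [t t0] := nonzero_elt sT.1.
have SX X : maximal_submod X -> S <=s X.
  move=> mX; apply: cS.2 => X0; have := rk_covers flM mX; rewrite X0 rk0 // -/(len M); lia.
have [|[f fP]|[f fP]] := pullback (nonlocal_len nakA) flM flM sT cS cS nl (@proj_surj _ _ L) bs.
- by rewrite lM.
- have fi : linj f.
    apply: contrapT => ni; have [x ex] := proj_surj t; apply: t0.
    by rewrite -ex -fP; apply: lkerP; rewrite kb; apply: SX => //; apply: (noninj_soc _ _ cS cS).
  have fs := linj_surj flM flM fi (leqnn _).
  have fL : limg f L = L'.
    apply: (rk_eq flM); last by rewrite rk_limg_inj //; lia.
    by apply/limg_subP => x xL; rewrite -kb in_lker fP proj_eq0.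
  have [g [gK Kg]] := lin_inverse fi fs; exists g; split.
  + by move=> y gy0; rewrite -(Kg y) gy0 linear0.
  + by move=> x; exists (f x).
  apply: subsub_anti; first by apply/limg_subP => x; rewrite -fL => /limgP[y yL <-]; rewrite gK.
  by move=> x xL; rewrite -(gK x); apply: mem_limg; rewrite -fL; apply: mem_limg.
have fi : linj f.
  apply: contrapT => ni; have [x ex] := bs t; apply: t0.
  by rewrite -ex -fP; apply/projP; apply: SX => //; apply: (noninj_soc _ _ cS cS).
exists f; split=> //; first exact: (linj_surj flM flM).
apply: (rk_eq flM); last by rewrite rk_limg_inj //; lia.
by apply/limg_subP => x; rewrite -kb => /lkerP bx; apply/projP; rewrite fP.
Qed.

(** * Three maximal submodules in length 4 with simple socle *)

Section ThreeMax.
Variables (M : lmodType A^c) (S : submodClosed M).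
Hypotheses (flM : flen M) (lM : len M = 4%N) (cS : colocal_at S).

Lemma rk_inter (L L' : submodClosed M) : maximal_submod L -> maximal_submod L' -> L <> L' ->
  rk (subI L L') = 2%N.
Proof.
move=> m m' n; have := rkD flM L L'; rewrite (max_add2 m m' n) -/(len M) lM.
by have := rk_covers flM m; have := rk_covers flM m'; rewrite -/(len M) lM; lia.
Qed.

Lemma sub_soc (Z : submodClosed M) : (rk Z <= 1)%N -> Z <=s S.
Proof.
move=> rZ; have [->|Z0] := pselect (Z = sub0); first exact: sub0s.
have SZ := cS.2 _ Z0; suff -> : S = Z by [].
by apply: (rk_eq flM) => //; rewrite (rk_atom flM cS.1).
Qed.

(** Being compatible with the projections to [M / L3], [f] carries [subI L1 L3] onto [subI L2 L3].
    Modulo [S] these are [M / L2] and [M / L1]. *)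
Lemma three_max_iso (L1 L2 L3 : submodClosed M) (f : {linear subm L1 -> subm L2}) :
  maximal_submod L1 -> maximal_submod L2 -> maximal_submod L3 ->
  L1 <> L2 -> L1 <> L3 -> L2 <> L3 -> subI (subI L1 L2) L3 = S ->
  linj f -> (forall x, proj L3 (incl L2 (f x)) = proj L3 (incl L1 x)) ->
  mod_iso (quom L1) (quom L2).
Proof.
move=> m1 m2 m3 n12 n13 n23 eS fi fP.
have inS x : x \in L1 -> x \in L2 -> x \in L3 -> x \in S by move=> h1 h2 h3; rewrite -eS !in_subI h1 h2 h3.
have SL1 : S <=s L1 by rewrite -eS => x /andP[/andP[]].
have SL2 : S <=s L2 by rewrite -eS => x /andP[/andP[]].
have SL3 : S <=s L3 by rewrite -eS => x /andP[/andP[]].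
pose F := incl L2 \o f.
have Fi : linj F by move=> x /incl_inj/fi.
pose D := lpre (incl L1) L3; pose j := incl L1 \o incl D.
have [fl1 flD] : flen (subm L1) /\ flen (subm D) by split; do ?apply: flen_subm.
have jT : limg j subT = subI L1 L3.
  apply: subsub_anti.
    by apply/limg_subP => d _; rewrite in_subI [_ \in L1]inclP; have := inclP d.
  move=> x /andP[/ex_incl[y e] x3]; have [d ed] : exists d : subm D, incl D d = y.
    by apply: ex_incl; rewrite in_lpre e.
  by apply/limgP; exists d => //; rewrite /j /= -e -ed.
pose G := F \o incl D.
have GD : limg G subT = subI L2 L3.
  apply: (rk_eq flM).
    apply/limg_subP => d _; rewrite in_subI [_ \in L2]inclP; apply/projP.
    by apply: etrans (fP _) _; apply/projP; have := inclP d.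
  have Gi : linj G by move=> d /Fi/incl_inj.
  have ji : linj j by move=> d /incl_inj/incl_inj.
  by rewrite (rk_inter m2 m3 n23) rk_limg_inj // -(rk_limg_inj flD flM subT ji) jT (rk_inter m1 m3 n13).
have FS : limg F (lpre (incl L1) S) = S.
  apply: (rk_eq flM); last by rewrite rk_limg_inj // rk_pull.
  by apply: sub_soc; rewrite rk_limg_inj // rk_pull // (rk_atom flM cS.1).
pose a := proj L2 \o j; pose b := proj L1 \o G.
have sur (L X Y : submodClosed M) (k : {linear subm D -> M}) : limg k subT = subI X Y ->
    subadd (subI X Y) L = subT -> lsurj (proj L \o k).
  by move=> ek e; apply: surj_add; [apply: proj_surj|rewrite lker_proj ek].
have rS : rk S = 1%N := rk_atom flM cS.1.
have as_ : lsurj a.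
  apply: (sur _ _ _ _ jT); rewrite subaddC; apply: max_add => // h.
  have : (rk (subI L1 L3) <= rk S)%N.
    by apply: rkS => // x xI; have [x1 x3] := andP xI; apply: inS => //; apply: h.
  by rewrite (rk_inter m1 m3 n13) rS.
have bs : lsurj b.
  apply: (sur _ _ _ _ GD); rewrite subaddC; apply: max_add => // h.
  have : (rk (subI L2 L3) <= rk S)%N.
    by apply: rkS => // x xI; have [x1 x3] := andP xI; apply: inS => //; apply: h.
  by rewrite (rk_inter m2 m3 n23) rS.
have inL1 d : j d \in L1 by apply: inclP.
have inL3 d : j d \in L3 by apply: (inclP d).
have inG d : G d \in subI L2 L3 by rewrite -GD; apply: mem_limg.
have ab : lker a = lker b.
  apply/submod_eqP => d; rewrite !in_lker [a d == 0]proj_eq0 [b d == 0]proj_eq0.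
  have [G2 G3] := andP (inG d).
  apply/idP/idP => h.
    apply: SL1; rewrite -FS; apply: mem_limg; rewrite in_lpre; exact: inS (inL1 d) h (inL3 d).
  have : G d \in S by apply: inS.
  by rewrite -FS => /limgP[y yS /(linj_inj Fi) e]; rewrite in_lpre e in yS; apply: SL2.
by apply: mod_iso_sym; have := quom_iso as_; rewrite ab => h; apply: mod_iso_trans (mod_iso_sym h) (quom_iso bs).
Qed.

(* If L1, L2, L3 intersected in S only, the quotients M / Li would be isomorphic to
   one T. Lifting endomorphisms e of T to maps f : L1 -> L2, and letting e' be the
   action of f on (L1 /\ L2) / S, gives a correspondence that is onto by
   linear_rel_surj. For e' = 1 the map f - 1 sends L1 into S, so L1 <= L2. *)
Lemma max_inter_sub (L1 L2 L3 : submodClosed M) :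
  maximal_submod L1 -> maximal_submod L2 -> maximal_submod L3 ->
  L1 <> L2 -> subI L1 L2 <=s L3.
Proof.
move=> m1 m2 m3 n12; apply: contrapT => nI.
have n13 : L1 <> L3 by move=> e; apply: nI; rewrite -e; apply: capl.
have n23 : L2 <> L3 by move=> e; apply: nI; rewrite -e; apply: capr.
have rS : rk S = 1%N := rk_atom flM cS.1.
(* [subI L1 L2] has length 2 and is not inside the maximal [L3], so the triple intersection has
   length 1. *)
have eS : subI (subI L1 L2) L3 = S.
  have r12 := rk_inter m1 m2 n12.
  have : (rk (subI (subI L1 L2) L3) < 2)%N.
    rewrite -r12; apply: (rk_lt flM); first exact: capl.
    by move=> e; apply: nI; rewrite -e; apply: capr.
  move=> r1; apply: (rk_eq flM); first by apply: sub_soc; lia.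
  have := rkD flM L3 (subI L1 L2); rewrite (max_add m3 nI) -/(len M) lM (subIC L3).
  by have := rk_covers flM m3; rewrite -/(len M) lM r12 rS; lia.
have inS x : x \in L1 -> x \in L2 -> x \in L3 -> x \in S by move=> h1 h2 h3; rewrite -eS !in_subI h1 h2 h3.
have SL1 : S <=s L1 by rewrite -eS => x /andP[/andP[]].
have SL2 : S <=s L2 by rewrite -eS => x /andP[/andP[]].
have SL3 : S <=s L3 by rewrite -eS => x /andP[/andP[]].
have eS' : subI (subI L2 L1) L3 = S by rewrite (subIC L2).
have nak := nonlocal_len nakA.
have [fl1 fl2] : flen (subm L1) /\ flen (subm L2) by split; apply: flen_subm.
have l3 (L : submodClosed M) : maximal_submod L -> len (subm L) = 3%N.
  by move=> mL; rewrite len_subm //; have := rk_covers flM mL; rewrite -/(len M) lM => -[].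
(* [L] covers its intersections with [L'] and with [L'']; these differ, since otherwise the triple
   intersection would have length 2. *)
have nl (L L' L'' : submodClosed M) : maximal_submod L -> maximal_submod L' -> maximal_submod L'' -> L <> L' -> L <> L'' ->
    L' <> L'' -> subI (subI L L') L'' = S -> ~ local_module (subm L).
  move=> m m' m'' n n' n'' e.
  have c : covers (subI L' L) L by apply: (covers_subI m' (@subsT _ _ _)); apply: (covers_neq_sub m m' n).
  have c' : covers (subI L'' L) L by apply: (covers_subI m'' (@subsT _ _ _)); apply: (covers_neq_sub m m'' n').
  apply: (two_covers_nonlocal c c') => e'.
  have := rk_inter m m' n; rewrite subIC.
  have -> : subI L' L = S.
    rewrite -e; apply: subsub_anti => x; last by move=> /andP[/andP[h1 h2] _]; rewrite in_subI h2.
    by move=> h; have [h1 h2] := andP h; rewrite !in_subI h1 h2 /=; move: h; rewrite e' => /andP[].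
  by rewrite rS.
have co (L : submodClosed M) : S <=s L -> colocal_at (lpre (incl L) S) by apply: colocal_subm.
have nl1 := nl _ _ _ m1 m2 m3 n12 n13 n23 eS.
have nl2 := nl _ _ _ m2 m1 m3 (nesym n12) n23 n13 eS'.
have ninj (L L' : submodClosed M) (f : {linear subm L -> subm L'}) : S <=s L -> S <=s L' ->
    maximal_submod L -> ~ local_module (subm L) -> ~ linj f -> forall x, incl L' (f x) \in S.
  move=> SL SL' mL nlL ni x; rewrite -in_lpre.
  by apply: (noninj_soc _ _ (co _ SL) (co _ SL')); rewrite ?l3 //; apply: flen_subm.
have surj3 (L X : submodClosed M) : maximal_submod L -> maximal_submod X -> X <> L ->
    lsurj (proj X \o incl L).
  move=> mL mX n; apply: surj_add; first exact: proj_surj.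
  by rewrite limg_incl lker_proj subaddC; apply: max_add2.
have sur13 := surj3 _ _ m1 m3 (nesym n13); have sur23 := surj3 _ _ m2 m3 (nesym n23).
have len6 (L L' : submodClosed M) : maximal_submod L -> maximal_submod L' -> (6 <= len (subm L) + len (subm L'))%N.
  by move=> m m'; rewrite !l3.
have nz (X : submodClosed M) : maximal_submod X -> exists t : quom X, t <> 0.
  by move=> mX; apply: nonzero_elt; case: (quom_simple flM mX).
have iso (X Y Z : submodClosed M) : maximal_submod X -> maximal_submod Y -> maximal_submod Z ->
    X <> Y -> X <> Z -> Y <> Z -> subI (subI X Y) Z = S -> mod_iso (quom X) (quom Y).
  move=> mX mY mZ nXY nXZ nYZ e.
  have e' : subI (subI Y X) Z = S by rewrite (subIC Y).
  have SX : S <=s X by rewrite -e => x /andP[/andP[]].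
  have SY : S <=s Y by rewrite -e => x /andP[/andP[]].
  have SZ : S <=s Z by rewrite -e => x /andP[].
  have [t t0] := nz _ mZ.
  have nlX := nl _ _ _ mX mY mZ nXY nXZ nYZ e.
  have nlY := nl _ _ _ mY mX mZ (nesym nXY) nYZ nXZ e'.
  have surX := surj3 _ _ mX mZ (nesym nXZ); have surY := surj3 _ _ mY mZ (nesym nYZ).
  have [[f fP]|[f fP]] := pullback nak (flen_subm X flM) (flen_subm Y flM) (quom_simple flM mZ)
    (co _ SX) (co _ SY) nlX surX surY (len6 _ _ mX mY).
    apply: (three_max_iso (f := f) mX mY mZ) => //.
    apply: contrapT => ni; have [x ex] := surX t; apply: t0.
    by rewrite -ex -fP; apply/projP/SZ/ninj.
  apply: mod_iso_sym; apply: (three_max_iso (f := f) mY mX mZ) => //; try exact: nesym.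
  apply: contrapT => ni; have [x ex] := surY t; apply: t0.
  by rewrite -ex -fP; apply/projP/SZ/ninj.
have eS23 : subI (subI L2 L3) L1 = S by rewrite (subIC _ L1) -eS; apply/submod_eqP => x; rewrite !in_subI andbA.
have eS13 : subI (subI L1 L3) L2 = S.
  by rewrite -eS; apply/submod_eqP => x; rewrite !in_subI -!andbA (andbC (x \in L3)).
have [h [hi hs]] := iso_lin (iso _ _ _ m2 m3 m1 n23 (nesym n12) (nesym n13) eS23).
have [h' [h'i h's]] := iso_lin (iso _ _ _ m1 m3 m2 n13 n12 (nesym n23) eS13).
pose T := quom L3; have sT : simple_module T := quom_simple flM m3.
pose a : {linear subm L1 -> T} := h \o (proj L2 \o incl L1).
pose b : {linear subm L2 -> T} := h' \o (proj L1 \o incl L2).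
have sa : lsurj a.
  by move=> t; have [y <-] := hs t; have [x <-] := surj3 _ _ m1 m2 (nesym n12) y; exists x.
have sb : lsurj b.
  by move=> t; have [y <-] := h's t; have [x <-] := surj3 _ _ m2 m1 n12 y; exists x.
have a0 x : a x = 0 <-> incl L1 x \in L2.
  by split=> [/hi/projP|/projP e] //; rewrite -[RHS](linear0 h); apply: congr1 e.
have b0 x : b x = 0 <-> incl L2 x \in L1.
  by split=> [/h'i/projP|/projP e] //; rewrite -[RHS](linear0 h'); apply: congr1 e.
(* A map in the direction from [L2] to [L1] is injective, for otherwise its image would lie in [S],
   where [a] vanishes, while [b] is onto. The lengths agree, so it can be inverted. *)
have lift (e : {linear T -> T}) : exists f : {linear subm L1 -> subm L2}, forall x, b (f x) = e (a x).
  have [e0|[ei es]] := simple_end e sT.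
    by exists \0 => x; rewrite e0; apply: linear0.
  have sea : lsurj (e \o a) by move=> t; have [y <-] := es t; have [x <-] := sa y; exists x.
  have [[f fP]|[f fP]] := pullback nak fl1 fl2 sT (co _ SL1) (co _ SL2) nl1 sea sb (len6 _ _ m1 m2).
    by exists f.
  have fi : linj f.
    apply: contrapT => ni; have [t t0] := nz _ m3; have [y ey] := sb t; apply: t0.
    have /a0 e0 : incl L1 (f y) \in L2 by apply/SL2/ninj.
    by apply: etrans (etrans (esym ey) (esym (fP y))) _; apply: etrans (congr1 e e0) (linear0 e).
  have [g [_ Kg]] := lin_inverse fi (linj_surj fl2 fl1 fi (eq_leq (etrans (l3 _ m1) (esym (l3 _ m2))))).
  by exists g => x; rewrite -fP Kg.
have [t0 t00] := nz _ m3.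
have rI : rk (subI L1 L2) = 2%N := rk_inter m1 m2 n12.
have [n0 [n01 n02 en0]] : exists n0 : M, [/\ n0 \in L1, n0 \in L2 & proj L3 n0 = t0].
  have e : subadd L3 (subI L1 L2) = subT by apply: max_add.
  have [x <-] := proj_surj t0; have := in_subT x; rewrite -e => /subaddP[y yL3 /andP[h1 h2]].
  by exists (x - y); split=> //; rewrite linearB; move/projP: yL3 => ->; rewrite subr0.
have [u0 eu0] := ex_incl n01.
have n0S : n0 \notin S.
  by apply/negP => /SL3/projP e; apply: t00; rewrite -en0.
have finN (f : {linear subm L1 -> subm L2}) (e : {linear T -> T}) : (forall x, b (f x) = e (a x)) ->
    forall x, incl L1 x \in L2 -> incl L2 (f x) \in L1.
  by move=> fP x x2; apply/b0; rewrite fP; have /a0 -> := x2; apply: linear0.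
have fS (f : {linear subm L1 -> subm L2}) : linj f -> limg (incl L2 \o f) (lpre (incl L1) S) = S.
  move=> fi; have Fi : linj (incl L2 \o f) by move=> x /incl_inj/fi.
  apply: (rk_eq flM); last by rewrite rk_limg_inj // rk_pull.
  by apply: sub_soc; rewrite rk_limg_inj // rk_pull // rS.
have fS' (f : {linear subm L1 -> subm L2}) x : incl L1 x \in S -> incl L2 (f x) \in S.
  have [fi|ni] := pselect (linj f); last by move=> _; apply: ninj.
  by move=> xS; rewrite -(fS f fi); apply: (mem_limg (incl L2 \o f)).
(* [q] identifies [(L1 cap L2) / S] with [T]; a lift [f] acts on this quotient because it preserves
   [L1 cap L2] and [S]. *)
pose N := lpre (incl L1) L2.
pose q : {linear subm N -> T} := proj L3 \o (incl L1 \o incl N).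
have qs : lsurj q.
  move=> t; have e : subadd L3 (subI L1 L2) = subT by apply: max_add.
  have [x <-] := proj_surj t; have := in_subT x; rewrite -e => /subaddP[y yL3 /andP[/ex_incl[z ez] h2]].
  have [w ew] : exists w : subm N, incl N w = z by apply: ex_incl; rewrite in_lpre ez.
  exists w; apply/eqP; rewrite -subr_eq0; apply/eqP.
  have -> : q w - proj L3 x = proj L3 (x - y - x) by rewrite linearB -ez -ew.
  by apply/projP; rewrite addrC addKr memN.
pose rho (x y : T) := exists (e : {linear T -> T}) (f : {linear subm L1 -> subm L2}),
  [/\ x = e t0, (forall x, b (f x) = e (a x)) & y = proj L3 (incl L2 (f u0))].
have rhoT (e : {linear T -> T}) : exists z, rho (e t0) z.
  by have [f fP] := lift e; exists (proj L3 (incl L2 (f u0))), e, f.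
have onto y : (exists z, rho y z) -> exists x, rho x y.
  move: y; apply: (linear_rel_surj artA (simple_gen sT t00)).
  - exists \0, \0; split=> //; first by move=> x; rewrite [LHS]linear0.
    by apply: esym; apply: etrans (congr1 (proj L3) (linear0 (incl L2))) (linear0 _).
  - move=> x y x' y' [e [f [-> fP ->]]] [e' [f' [-> fP' ->]]].
    exists (e \+ e'), (f \+ f'); split=> //; last by rewrite -!linearD.
    by move=> z; rewrite [LHS]linearD fP fP'.
  - move=> r x y [e [f [-> fP ->]]]; exists (cscale r e), (cscale r f); split=> //.
      by move=> z; apply: etrans (linearZZ b _ _) _; rewrite fP.
    by apply: esym; apply: etrans (congr1 (proj L3) (linearZZ (incl L2) _ _)) (linearZZ (proj L3) _ _).
  - move=> x y [e [f [_ fP ->]]].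
    pose k : {linear subm N -> T} := proj L3 \o (incl L2 \o (f \o incl N)).
    have [|e' eP] := factor_surj (p := q) (f := k) qs.
      move=> w /lkerP/projP w3; apply/eqP; apply/projP; apply: SL3; apply: fS'.
      by apply: inS => //; [apply: inclP|apply: (inclP w)].
    have [w ew] : exists w : subm N, incl N w = u0 by apply: ex_incl; rewrite in_lpre eu0.
    have -> : proj L3 (incl L2 (f u0)) = e' t0.
      have -> : t0 = q w by rewrite -en0 -eu0 -ew.
      by rewrite eP -ew.
    exact: rhoT.
  (* If [f] sends [n0] into [S], it is not injective, so its whole image lies in [S]; then [b]
     composed with [f] is zero, and so is [e]. *)
  - move=> x [e [f [-> fP /esym/projP h3]]].
    have f0S : incl L2 (f u0) \in S.
      by apply: inS => //; [apply: (finN f e fP); rewrite eu0|apply: inclP].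
    have ni : ~ linj f.
      move=> fi; case/negP: n0S.
      have : incl L2 (f u0) \in limg (incl L2 \o f) (lpre (incl L1) S) by rewrite fS.
      have Fi : linj (incl L2 \o f) by move=> z /incl_inj/fi.
      move=> /limgP[z zS e0]; have ez : z = u0 by apply: (linj_inj Fi).
      by rewrite -eu0 -ez.
    have [y ey] := sa t0; rewrite -ey -fP; apply/b0; apply/SL1; exact: (ninj _ _ f SL1 SL2 m1 nl1 ni y).
(* Surjectivity yields a lift that fixes the class of [n0]; its difference with the inclusion sends
   [n0] into [S] and cannot be injective. *)
have [x [e [f [_ fP et]]]] := onto t0 (rhoT idfun).
pose d : {linear subm L1 -> M} := (incl L2 \o f) \- incl L1.
have d0S : d u0 \in S.
  apply: inS.
  - by apply: memB; [apply: (finN f e fP); rewrite eu0|apply: inclP].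
  - by apply: memB; [apply: inclP|rewrite eu0].
  by apply/projP; rewrite linearB -et eu0 en0 subrr.
have ni : ~ linj d.
  move=> di; case/negP: n0S.
  have eS1 : limg d (lpre (incl L1) S) = S.
    apply: (rk_eq flM); last by rewrite rk_limg_inj // rk_pull.
    by apply: sub_soc; rewrite rk_limg_inj // rk_pull // rS.
  have : d u0 \in limg d (lpre (incl L1) S) by rewrite eS1.
  by move=> /limgP[z zS e0]; have ez : z = u0 by [apply: (linj_inj di)|]; rewrite -eu0 -ez.
have dS := noninj_soc fl1 flM (co _ SL1) cS (l3 _ m1) nl1 ni.
apply: (covers_neq_sub m1 m2 n12) => y /ex_incl[z <-].
have -> : incl L1 z = incl L2 (f z) - d z by rewrite /d /= opprB addrC subrK.
by apply: memB; [apply: inclP|apply/SL2/dS].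
Qed.

End ThreeMax.
End Nonlocal.

Section Complements.
Variable S : pzRingType.
Implicit Types M N : lmodType S.

Lemma subm_iso_on M N (f : {linear M -> N}) (K : submodClosed M) :
  (forall x, x \in K -> f x = 0 -> x = 0) -> mod_iso (subm K) (subm (limg f K)).
Proof.
move=> fi; have gi : linj (f \o incl K).
  by move=> x /(fi _ (inclP x))/incl_inj.
have := subm_iso subT gi.
have -> : limg (f \o incl K) subT = limg f K.
  apply: subsub_anti; first by apply/limg_subP => x _; apply/mem_limg/inclP.
  by move=> _ /limgP[x /ex_incl[y <-] <-]; apply/limgP; exists y.
by apply: mod_iso_trans; apply/mod_iso_sym/subm_subT_iso.
Qed.

(** Both map isomorphically onto the same submodule of the quotient by [Z]. *)
Lemma compl_iso M (X Y Z : submodClosed M) : subadd X Z = subadd Y Z ->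
  subI X Z = sub0 -> subI Y Z = sub0 -> mod_iso (subm X) (subm Y).
Proof.
move=> e iX iY.
have inj (W : submodClosed M) : subI W Z = sub0 -> forall x, x \in W -> proj Z x = 0 -> x = 0.
  by move=> iW x xW /projP xZ; apply/eqP; rewrite -in_sub0 -iW in_subI xW.
have e0 (W : submodClosed M) : limg (proj Z) W = limg (proj Z) (subadd W Z).
  apply: subsub_anti; first by apply: limgS; apply: subaddl.
  rewrite limg_add; apply: subadd_lub => //.
  by apply/limg_subP => x /projP->; apply: rpred0.
apply: mod_iso_trans (subm_iso_on (inj _ iX)) _.
by rewrite e0 e -e0; apply: mod_iso_sym; apply: subm_iso_on (inj _ iY).
Qed.

Lemma quom_max_indec M (L : submodClosed M) : maximal_submod L -> indecomposable (quom L).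
Proof.
move=> [_ nL h]; apply/indecomposable_quom; split=> // X Y LX LY e i.
have [->|eX] := h X LX (@subsT _ _ _); first by left.
by right; rewrite -i eX subI_absr.
Qed.

Lemma chain_rank2 M (K Z : submodClosed M) : flen M -> (rk K <= 2)%N ->
  (forall X, covers sub0 X -> X <=s K -> X = Z) -> chain_below K.
Proof.
move=> flM rK h X Y XK YK.
have cases W : W <=s K -> [\/ W = sub0, W = K | W = Z].
  move=> WK; have [->|W0] := pselect (W = sub0); first exact: Or31.
  have [->|WK'] := pselect (W = K); first exact: Or32.
  apply: Or33; apply: h => //; apply: (atom_rk flM).
  by have := rk_gt0 flM W0; have := rk_lt flM WK WK'; lia.
have [->|->|eX] := cases X XK; [left; exact: sub0s|by right|].
have [->|->|eY] := cases Y YK; [right; exact: sub0s|by left|].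
by left; rewrite eX eY.
Qed.

Lemma chain_unique_max M (K J : submodClosed M) : unique_max K J -> chain_below J -> chain_below K.
Proof.
move=> [_ uJ] ch X Y XK YK; have [->|nX] := pselect (X = K); first by right.
have [->|nY] := pselect (Y = K); first by left.
by apply: ch; apply: uJ.
Qed.

Lemma quom_persp_iso (R : comPzRingType) (A : algType R) (M : lmodType A^c) (L L' C : submodClosed M) :
  subadd L C = subT -> subadd L' C = subT -> subI L C = subI L' C -> mod_iso (quom L') (quom L).
Proof. by move=> e e' eI; have [b [bs <-]] := persp e e' eI; apply: quom_iso. Qed.

End Complements.

(** * Nonlocal modules of length 3 *)

Section LengthThree.
Variables (R : comPzRingType) (A : algType R).
Hypotheses (artA : artin_algebra A) (nakA : right_Nakayama A 4).
Variables (M : lmodType A^c).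
Hypotheses (flM : flen M) (lM : len M = 3%N) (nlM : ~ local_module M).

Lemma inter_max3 (L L' : submodClosed M) : maximal_submod L -> maximal_submod L' -> L <> L' ->
  rk (subI L L') = 1%N.
Proof.
move=> m m' n; have := rkD flM L L'; rewrite (max_add2 m m' n) -/(len M) lM.
by have := rk_covers flM m; have := rk_covers flM m'; rewrite -/(len M) lM; lia.
Qed.

(** Every atom lies in every maximal submodule, hence in the simple module [subI L1 L2]. *)
Lemma len3_colocal : indecomposable M -> exists S : submodClosed M, colocal_at S.
Proof.
move=> indM; have [L1 [L2 [m1 m2 n12]]] := nonlocal_two_max flM indM.1 nlM.
exists (subI L1 L2); apply: atoms_colocal => //.
  by apply: (atom_rk flM); apply: inter_max3.
by move=> Z cZ; apply: subI_glb; apply: atom_in_max => //; rewrite lM.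
Qed.

Section Colocal.
Variable S : submodClosed M.
Hypothesis cS : colocal_at S.

Lemma inter_max3E (L L' : submodClosed M) : maximal_submod L -> maximal_submod L' -> L <> L' ->
  subI L L' = S.
Proof.
move=> m m' n; apply: (colocal_atom cS); apply: (atom_rk flM); exact: inter_max3.
Qed.

(** [L] and [L1] have the common supplement [L2] with the same intersection [S], so an automorphism
    of [M] carries one to the other; only [L = L2] escapes. This is why two maximal submodules
    suffice in the lists. *)
Lemma max_conj3 (L L1 L2 : submodClosed M) : maximal_submod L -> maximal_submod L1 ->
  maximal_submod L2 -> L1 <> L2 -> L = L2 \/
  mod_iso (subm L) (subm L1) /\ mod_iso (quom L) (quom L1).
Proof.
move=> m m1 m2 n12; have [->|n1] := pselect (L = L1).
  by right; split; apply: mod_iso_refl.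
have [->|n2] := pselect (L = L2); [by left|right].
have [|||f [fi fs <-]] := conj3 (L := L1) (L' := L) (C := L2) nakA flM lM nlM cS m1 m.
- exact: max_add2.
- exact: max_add2.
- by rewrite !inter_max3E.
by split; [apply: subm_iso|apply: quom_iso_img].
Qed.

Lemma rk_proper (K : submodClosed M) : K <> sub0 -> K <> subT -> K = S \/ maximal_submod K.
Proof.
move=> K0 KT; have r0 := rk_gt0 flM K0; have rT := rk_subT flM KT; rewrite -/(len M) lM in rT.
have [r1|r1] := leqP (rk K) 1.
  by left; apply: (colocal_atom cS); apply: (atom_rk flM); lia.
by right; apply: (rkP_covers flM) => //; rewrite -/(len M) lM; lia.
Qed.

End Colocal.
End LengthThree.

(** * Nonlocal indecomposable modules of length 4: the core and the maximal submodules *)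

Section LengthFour.
Variables (R : comPzRingType) (A : algType R).
Hypotheses (artA : artin_algebra A) (nakA : right_Nakayama A 4).
Variables (M : lmodType A^c).
Hypotheses (flM : flen M) (indM : indecomposable M) (lM : len M = 4%N) (nlM : ~ local_module M).
Implicit Types K L X Y Z D : submodClosed M.

Lemma rk_max4 L : maximal_submod L -> rk L = 3%N.
Proof. by move=> m; have := rk_covers flM m; rewrite -/(len M) lM => -[]. Qed.

Lemma max4_rk L : rk L = 3%N -> maximal_submod L.
Proof. by move=> r; apply: (rkP_covers flM) => //; rewrite r -/(len M). Qed.

Lemma rk_proper4 K : K <> sub0 -> K <> subT -> [\/ covers sub0 K, rk K = 2%N | maximal_submod K].
Proof.
move=> K0 KT; have r0 := rk_gt0 flM K0; have rT := rk_subT flM KT; rewrite -/(len M) lM in rT.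
have [r1|n1] := eqVneq (rk K) 1%N; first by apply: Or31; apply: (atom_rk flM).
have [r2|n2] := eqVneq (rk K) 2%N; first exact: Or32.
by apply: Or33; apply: max4_rk; lia.
Qed.

Lemma atom_in_max4 Z L : covers sub0 Z -> maximal_submod L -> Z <=s L.
Proof. by move=> cZ m; apply: atom_in_max => //; rewrite lM. Qed.

(** Otherwise the triple intersection is simple and contains all atoms, so [M] has a simple socle
    and [max_inter_sub] applies. *)
Lemma max_inter4 L1 L2 L3 : maximal_submod L1 -> maximal_submod L2 -> maximal_submod L3 ->
  L1 <> L2 -> subI L1 L2 <=s L3.
Proof.
move=> m1 m2 m3 n12; have [h|nI] := pselect (subI L1 L2 <=s L3); first exact: h.
have r12 := rk_inter flM lM m1 m2 n12.
have r : rk (subI L3 (subI L1 L2)) = 1%N.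
  have := rkD flM L3 (subI L1 L2); rewrite (max_add m3 nI) -/(len M) lM r12 (rk_max4 m3); lia.
apply: (max_inter_sub artA nakA (S := subI L3 (subI L1 L2)) flM lM _ m1 m2 m3 n12).
apply: atoms_colocal => //; first exact: (atom_rk flM).
by move=> Z cZ; do ?[apply: subI_glb]; apply: atom_in_max4.
Qed.

(** Two local maximal submodules have lengths 3 + 3, so they can be amalgamated along an atom. *)
Lemma glue_max L1 L2 Z : maximal_submod L1 -> maximal_submod L2 ->
  local_module (subm L1) -> local_module (subm L2) -> covers sub0 Z ->
  (exists f : {linear subm L1 -> subm L2}, forall x, incl L1 x \in Z -> incl L2 (f x) = incl L1 x) \/
  (exists f : {linear subm L2 -> subm L1}, forall x, incl L2 x \in Z -> incl L1 (f x) = incl L2 x).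
Proof.
move=> m1 m2 lo1 lo2 cZ; pose T := subm Z.
have sub L : maximal_submod L -> limg (incl Z) subT <=s limg (incl L) subT.
  by move=> m; rewrite !limg_incl; apply: atom_in_max4.
have [u uP] := factor_inj (i := incl L1) (@incl_inj _ _ _) (sub _ m1).
have [v vP] := factor_inj (i := incl L2) (@incl_inj _ _ _) (sub _ m2).
have sT : simple_module T by apply/simple_subm.
have ui : linj u by move=> t ut; apply: incl_inj; rewrite -uP ut linear0.
have vi : linj v by move=> t vt; apply: incl_inj; rewrite -vP vt linear0.
have [|[f fP]|[f fP]] := amalgam (nonlocal_len nakA) (flen_subm L1 flM) (flen_subm L2 flM) sT lo1 lo2 ui vi.
- by rewrite !len_subm // !rk_max4.
- left; exists f => x xZ; have [t et] := ex_incl xZ.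
  have -> : x = u t by apply: (linj_inj (@incl_inj _ _ L1)); rewrite uP et.
  by rewrite fP vP uP.
right; exists f => x xZ; have [t et] := ex_incl xZ.
have -> : x = v t by apply: (linj_inj (@incl_inj _ _ L2)); rewrite vP et.
by rewrite fP vP uP.
Qed.

Section Core.
Variable D : submodClosed M.
Hypotheses (rD : rk D = 2%N) (Dmax : forall L, maximal_submod L -> D <=s L).

Lemma atom_core Z : covers sub0 Z -> Z <=s D.
Proof.
move=> cZ; have [L1 [L2 [m1 m2 n12]]] := nonlocal_two_max flM indM.1 nlM.
suff <- : subI L1 L2 = D by apply: subI_glb; apply: atom_in_max4.
apply: esym; apply: (rk_eq flM); first by apply: subI_glb; apply: Dmax.
by rewrite (rk_inter flM lM m1 m2 n12) rD.
Qed.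

Lemma inter_max4 L1 L2 : maximal_submod L1 -> maximal_submod L2 -> L1 <> L2 -> subI L1 L2 = D.
Proof.
move=> m1 m2 n12; apply: esym; apply: (rk_eq flM); first by apply: subI_glb; apply: Dmax.
by rewrite (rk_inter flM lM m1 m2 n12) rD.
Qed.

Lemma core_cover L : maximal_submod L -> covers D L.
Proof. by move=> m; apply: (rkP_covers flM (Dmax m)); rewrite rD rk_max4. Qed.

Lemma rank2_core X : rk X = 2%N -> X <> D -> rk (subI X D) = 1%N.
Proof.
move=> rX nX; have X0 : X <> sub0 by move=> e; move: rX; rewrite e rk0.
have [Z ZX cZ] := ex_atom flM X0.
have := rkS flM (subI_glb ZX (atom_core cZ)); rewrite (rk_atom flM cZ) => r1.
have : (rk (subI X D) < rk X)%N.
  apply: (rk_lt flM); first exact: capl.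
  move=> e; apply: nX; apply: (rk_eq flM); last by rewrite rX rD.
  by rewrite -e; apply: capr.
by rewrite rX; lia.
Qed.

(** [X] and [D] are two different maximal submodules of their sum. *)
Lemma rank2_add X : rk X = 2%N -> X <> D ->
  maximal_submod (subadd X D) /\ ~ local_module (subm (subadd X D)).
Proof.
move=> rX nX; have r : rk (subadd X D) = 3%N.
  by have := rkD flM X D; rewrite rank2_core // rX rD; lia.
split; first exact: max4_rk.
apply: (two_covers_nonlocal (L1 := X) (L2 := D)) => //; apply: (rkP_covers flM); rewrite ?r ?rX ?rD //.
Qed.

(* The image G of f - 1 is not contained in L2, and G + D is the required maximal
   submodule. *)
Lemma glue_nonlocal L1 L2 (f : {linear subm L1 -> subm L2}) Z : maximal_submod L1 ->
  maximal_submod L2 -> L1 <> L2 -> covers sub0 Z ->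
  (forall x, incl L1 x \in Z -> incl L2 (f x) = incl L1 x) ->
  exists L, maximal_submod L /\ ~ local_module (subm L).
Proof.
move=> m1 m2 n12 cZ fZ; pose d : {linear subm L1 -> M} := (incl L2 \o f) \- incl L1.
pose G := limg d subT.
have nG : ~ G <=s L2.
  move=> h; apply: (covers_neq_sub m1 m2 n12) => y /ex_incl[z <-].
  have -> : incl L1 z = incl L2 (f z) - d z by rewrite /d /= opprB addrC subrK.
  by apply: memB; [apply: inclP|apply/h/mem_limg].
have fl1 := flen_subm L1 flM.
have rG : (rk G <= 2)%N.
  have := rank_nullity d fl1 flM; rewrite -/G len_subm // (rk_max4 m1) => rn.
  have ZL := atom_in_max4 cZ m1.
  have : (rk (lpre (incl L1) Z) <= rk (lker d))%N.
    by apply: (rkS fl1) => x xZ; rewrite in_lker -[d x]/(incl L2 (f x) - incl L1 x) fZ // subrr.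
  by rewrite rk_pull // (rk_atom flM cZ); lia.
have nGD : G <> D by move=> e; apply: nG; rewrite e; apply: Dmax.
have rG2 : rk G = 2%N.
  have [r1|] := leqP (rk G) 1; last by lia.
  case: nG; have [->|G0] := pselect (G = sub0); first exact: sub0s.
  by apply: atom_in_max4 => //; apply: (atom_rk flM); have := rk_gt0 flM G0; lia.
by exists (subadd G D); apply: rank2_add.
Qed.

Lemma ex_nonlocal_max : exists L, maximal_submod L /\ ~ local_module (subm L).
Proof.
have [L1 [L2 [m1 m2 n12]]] := nonlocal_two_max flM indM.1 nlM.
have [lo1|nl1] := pselect (local_module (subm L1)); last by exists L1.
have [lo2|nl2] := pselect (local_module (subm L2)); last by exists L2.
have [Z _ cZ] := ex_atom flM (nesym indM.1).
have [[f fP]|[f fP]] := glue_max m1 m2 lo1 lo2 cZ.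
  exact: glue_nonlocal m1 m2 n12 cZ fP.
exact: glue_nonlocal m2 m1 (nesym n12) cZ fP.
Qed.

Lemma nonlocal_rank2 L : maximal_submod L -> ~ local_module (subm L) ->
  exists X, [/\ rk X = 2%N, X <> D & X <=s L].
Proof.
move=> m nl; have L0 : L <> sub0 by move=> e; have := rk_max4 m; rewrite e rk0.
have [X [Y [cX cY nXY]]] := nonlocal_two_covers flM L0 nl.
have rk2 W : covers W L -> rk W = 2%N by move=> c; have := rk_covers flM c; rewrite (rk_max4 m) => -[].
have [eX|nX] := pselect (X = D); last by exists X; split; rewrite ?rk2 //; case/coversP: cX.
by exists Y; split; [apply: rk2|rewrite -eX; apply: nesym|case/coversP: cY].
Qed.

(** [L] and [L'] contain [X] and [Y] of length 2 other than [D]. If [X] and [Y] were disjoint, [M]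
    would be their direct sum. So [X + Y] has length 3, contains [D], and equals both [X + D = L]
    and [Y + D = L']. *)
Lemma nonlocal_max_uniq L L' : maximal_submod L -> maximal_submod L' ->
  ~ local_module (subm L) -> ~ local_module (subm L') -> L = L'.
Proof.
move=> m m' nl nl'; apply: contrapT => n.
have [X [rX nX XL]] := nonlocal_rank2 m nl; have [Y [rY nY YL]] := nonlocal_rank2 m' nl'.
have DXY W : W <=s L -> W <=s L' -> W <=s D by move=> h h'; rewrite -(inter_max4 m m' n); apply: subI_glb.
have r0 : (0 < rk (subI X Y))%N.
  have [r0|//] := posnP (rk (subI X Y)); have i0 := rk_eq0 flM r0.
  have e : subadd X Y = subT.
    by apply: (rk_eq flM) => //; have := rkD flM X Y; rewrite r0 rX rY -/(len M) lM; lia.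
  have [|e0|e0] := indM.2 X Y; first by apply/is_dsumE.
    by move: rX; rewrite e0 rk0.
  by move: rY; rewrite e0 rk0.
have r1 : (rk (subI X Y) < 2)%N.
  have : (rk (subI X Y) <= rk (subI X D))%N.
    apply: (rkS flM); apply: subI_glb; first exact: capl.
    by apply: DXY; [apply: subs_trans XL; apply: capl|apply: subs_trans YL; apply: capr].
  by rewrite rank2_core //; lia.
have rXY : rk (subadd X Y) = 3%N by have := rkD flM X Y; rewrite rX rY; lia.
have mXY := max4_rk rXY.
have DX := Dmax mXY.
have [mX _] := rank2_add rX nX; have [mY _] := rank2_add rY nY.
have eq3 K1 K2 : K1 <=s K2 -> maximal_submod K1 -> maximal_submod K2 -> K1 = K2.
  by move=> h k1 k2; apply: (rk_eq flM h); rewrite !rk_max4.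
have e1 : subadd X D = subadd X Y by apply: eq3 => //; apply: subadd_lub => //; apply: subaddl.
have e2 : subadd Y D = subadd X Y by apply: eq3 => //; apply: subadd_lub => //; apply: subaddr.
have e3 : subadd X D = L by apply: eq3 => //; apply: subadd_lub => //; apply: Dmax.
have e4 : subadd Y D = L' by apply: eq3 => //; apply: subadd_lub => //; apply: Dmax.
by apply: n; rewrite -e3 -e4 e1 e2.
Qed.

End Core.

Lemma ex_core : exists D, rk D = 2%N /\ forall L, maximal_submod L -> D <=s L.
Proof.
have [L1 [L2 [m1 m2 n12]]] := nonlocal_two_max flM indM.1 nlM.
by exists (subI L1 L2); split; [apply: rk_inter|move=> L m; apply: max_inter4].
Qed.

End LengthFour.

(** * Nonlocal modules: case (H), and the quotients in length 4 *)

Section Cases.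
Variables (R : comPzRingType) (A : algType R).
Hypotheses (artA : artin_algebra A) (nakA : right_Nakayama A 4).
Implicit Types M P : lmodType A^c.

Lemma rk_neq M (K L : submodClosed M) : rk K <> rk L -> K <> L.
Proof. by move=> h e; apply: h; rewrite e. Qed.

Lemma decomp_quom M (K X Y : submodClosed M) : K <=s X -> K <=s Y -> subadd X Y = subT ->
  subI X Y = K -> X <> K -> Y <> K -> ~ indecomposable (quom K).
Proof. by move=> KX KY e i nX nY /indecomposable_quom[_ /(_ X Y KX KY e i)[]]. Qed.

(** [M / S] is the direct sum of [M1 / S] and [M2 / S], so only quotients by maximal submodules
    remain. *)
Lemma nonlocal_case3 M : flen M -> indecomposable M -> len M = 3%N -> ~ local_module M ->
  ~ local_module M /\ factor_serial 3 M /\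
  exists M1 M2 : submodClosed M,
     [/\ uniserial (subm M1), uniserial (subm M2),
         simple_module (subm (modsoc M)),
         submodules_are [:: M1; M2; modsoc M] &
         indec_quotients_are [:: M1; M2]].
Proof.
move=> flM indM lM nlM; split=> //; split; first exact: factor_serial_nonlocal.
have [S cS] := len3_colocal flM lM nlM indM.
have [M1 [M2 [m1 m2 n12]]] := nonlocal_two_max flM indM.1 nlM.
have eS : modsoc M = S.
  by apply: modsoc1E; [exact: cS.1|move=> Z /(colocal_atom cS)->].
have rmax (L : submodClosed M) : maximal_submod L -> rk L = 2%N.
  by move=> m; have := rk_covers flM m; rewrite -/(len M) lM => -[].
have rS := rk_atom flM cS.1.
have rT : rk (subT : submodClosed M) = 3%N := lM.
have uni (L : submodClosed M) : maximal_submod L -> uniserial (subm L).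
  move=> m; apply/uniserial_subm => //; apply: (chain_rank2 flM (Z := S)); rewrite ?rmax //.
  by move=> X /(colocal_atom cS).
exists M1, M2; split; [exact: uni|exact: uni| | |].
- by rewrite eS; apply/simple_subm; exact: cS.1.
- split.
  + rewrite eS /= !inE negb_or andbT; apply/andP; split; last by apply/eqP/rk_neq; rewrite rS rmax.
    by apply/andP; split; apply/eqP => //; apply: rk_neq; rewrite rS rmax.
  + move=> K; rewrite !inE eS => /or3P[] /eqP->; split; apply: rk_neq; rewrite ?rk0 ?rT ?rS ?rmax //.
  + move=> K K0 KT; have [->|mK] := rk_proper flM lM cS K0 KT.
      by exists S; rewrite ?eS ?inE ?eqxx ?orbT //; apply: mod_iso_refl.
    have [->|[i _]] := max_conj3 nakA flM lM nlM cS mK m1 m2 n12.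
      by exists M2; rewrite ?inE ?eqxx ?orbT //; apply: mod_iso_refl.
    by exists M1; rewrite ?inE ?eqxx.
split.
  by move=> K; rewrite !inE => /orP[] /eqP->; apply: quom_max_indec.
move=> K K0 iK; have KT : K <> subT by have /indecomposable_quom[] := iK.
have [eK|mK] := rk_proper flM lM cS K0 KT.
  have i12 := inter_max3E flM lM cS m1 m2 n12.
  case: (decomp_quom (K := S) (X := M1) (Y := M2)) => //.
  - by rewrite -i12; apply: capl.
  - by rewrite -i12; apply: capr.
  - exact: max_add2.
  - by apply: rk_neq; rewrite rmax ?rS.
  - by apply: rk_neq; rewrite rmax ?rS.
  - by rewrite -eK.
have [->|[_ i]] := max_conj3 nakA flM lM nlM cS mK m1 m2 n12.
  by exists M2; rewrite ?inE ?eqxx ?orbT //; apply: mod_iso_refl.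
by exists M1; rewrite ?inE ?eqxx.
Qed.

Section LengthFour.
Variable M : lmodType A^c.
Hypotheses (flM : flen M) (indM : indecomposable M) (lM : len M = 4%N) (nlM : ~ local_module M).
Variables D M2 : submodClosed M.
Hypotheses (rD : rk D = 2%N) (Dmax : forall L : submodClosed M, maximal_submod L -> D <=s L).
Hypotheses (m2 : maximal_submod M2) (nl2 : ~ local_module (subm M2)).
Implicit Types K L X Y Z : submodClosed M.

Let rM2 : rk M2 = 3%N := rk_max4 flM lM m2.

Lemma local_other L : maximal_submod L -> L <> M2 -> local_module (subm L).
Proof.
move=> m n; apply: contrapT => nl; apply: n.
exact: (nonlocal_max_uniq flM indM lM nlM rD Dmax).
Qed.

Lemma ex_other : exists2 L : submodClosed M, maximal_submod L & L <> M2.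
Proof.
have [L1 [L2 [m1' m2' n12]]] := nonlocal_two_max flM indM.1 nlM.
have [e|n] := pselect (L1 = M2); last by exists L1.
by exists L2 => // e2; apply: n12; rewrite e e2.
Qed.

Lemma rank2_sub X : rk X = 2%N -> X <=s M2.
Proof.
move=> rX; have [->|nX] := pselect (X = D); first exact: Dmax.
have [m nl] := rank2_add flM indM lM nlM rD Dmax rX nX.
by rewrite -(nonlocal_max_uniq flM indM lM nlM rD Dmax m m2 nl nl2); apply: subaddl.
Qed.

Lemma rank2_addE X : rk X = 2%N -> X <> D -> subadd X D = M2.
Proof.
move=> rX nX; have [m nl] := rank2_add flM indM lM nlM rD Dmax rX nX.
exact: (nonlocal_max_uniq flM indM lM nlM rD Dmax).
Qed.

Lemma ex_rank2 : exists X, rk X = 2%N /\ X <> D.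
Proof. by have [X [rX nX _]] := nonlocal_rank2 flM lM D m2 nl2; exists X. Qed.

(* The socle of every submodule of length 2 other than D is the radical of M2. *)
Lemma rank2_inter X Y : rk X = 2%N -> rk Y = 2%N -> X <> D -> Y <> D -> subI X D = subI Y D.
Proof.
move=> rX rY nX nY; have [->//|nXY] := pselect (X = Y).
have rXD := rank2_core flM indM lM nlM rD Dmax rX nX.
have rYD := rank2_core flM indM lM nlM rD Dmax rY nY.
have i1 : (0 < rk (subI X Y))%N.
  have := rkD flM X Y; rewrite rX rY.
  have := rkS flM (subadd_lub (rank2_sub rX) (rank2_sub rY)); rewrite rM2; lia.
have nz : subI X Y <> sub0 by move=> e; rewrite e rk0 in i1.
have [Z ZXY cZ] := ex_atom flM nz.
have ZD := atom_core flM indM lM nlM rD Dmax cZ.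
have rZ := rk_atom flM cZ.
have eX : Z = subI X D.
  by apply: (rk_eq flM); [apply: subI_glb => //; apply: subs_trans ZXY (@capl _ _ _ _)|rewrite rXD rZ].
have eY : Z = subI Y D.
  by apply: (rk_eq flM); [apply: subI_glb => //; apply: subs_trans ZXY (@capr _ _ _ _)|rewrite rYD rZ].
by rewrite -eX -eY.
Qed.

Lemma unique_max_other L : maximal_submod L -> L <> M2 -> unique_max L D.
Proof.
move=> m n; have c := core_cover flM lM rD Dmax m.
have /(unique_max_subm L flM)[J uJ] := local_other m n.
suff -> : D = J by [].
apply: (rk_eq flM); first by apply: uJ.2; [case/coversP: c|case: c].
by have := rk_covers flM uJ.1; rewrite (rk_max4 flM lM m) rD => -[->].
Qed.

Lemma rank2_other L X : maximal_submod L -> L <> M2 -> rk X = 2%N -> X <=s L -> X = D.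
Proof.
move=> m n rX XL; apply: (rk_eq flM); last by rewrite rX rD.
apply: (unique_max_other m n).2 => // e; have := rk_max4 flM lM m; by rewrite -e rX.
Qed.

Lemma other_add L X : maximal_submod L -> L <> M2 -> rk X = 2%N -> X <> D -> subadd X L = subT.
Proof.
move=> m n rX nX; rewrite subaddC; apply: max_add => // XL; apply: nX; exact: rank2_other m n rX XL.
Qed.

Lemma other_inter L X : maximal_submod L -> L <> M2 -> rk X = 2%N -> subI X L = subI X D.
Proof.
move=> m n rX; rewrite -(inter_max4 flM lM rD Dmax m m2 n); apply: subsub_anti.
  apply: subI_glb; first exact: capl.
  apply: subI_glb; first exact: capr.
  by apply: subs_trans (rank2_sub rX); apply: capl.
by apply: subI_glb; [apply: capl|apply: subs_trans (@capr _ _ _ _) (@capl _ _ _ _)].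
Qed.

(** A maximal submodule other than [M2] is a common supplement of [X] and [Y], with the same
    intersection. *)
Lemma quom_rank2_iso X Y : rk X = 2%N -> rk Y = 2%N -> X <> D -> Y <> D ->
  mod_iso (quom X) (quom Y).
Proof.
move=> rX rY nX nY; have [L m n] := ex_other.
apply: (quom_persp_iso (C := L)); try exact: other_add.
by rewrite !other_inter //; apply: rank2_inter.
Qed.

Lemma quom_max_iso L L' K : maximal_submod L -> maximal_submod L' -> maximal_submod K ->
  L <> L' -> K = L' \/ mod_iso (quom K) (quom L).
Proof.
move=> m m' k n; have [->|n'] := pselect (K = L'); [by left|right].
have [->|nL] := pselect (K = L); first exact: mod_iso_refl.
apply: (quom_persp_iso (C := L')); try exact: max_add2.
by rewrite !(inter_max4 flM lM rD Dmax).
Qed.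

(** A proper submodule properly above [X] has length 3, so it contains [D] and equals [X + D = M2].
    Two complementary summands would both be [M2]. *)
Lemma quom_rank2_indec X : rk X = 2%N -> X <> D -> indecomposable (quom X).
Proof.
move=> rX nX; apply/indecomposable_quom; split; first by apply: rk_neq; rewrite rX -/(len M) lM.
move=> Y Z XY XZ e i; apply: contrapT => /not_orP[nY nZ].
have big W W' : X <=s W -> W <> X -> W' <> X -> subI W W' = X -> W = M2.
  move=> XW nW nW' iW; have r3 : rk W = 3%N.
    have := rk_lt flM XW (nesym nW); rewrite rX => r2.
    have [//|r4] : rk W = 3%N \/ rk W = 4%N by have := rkS flM (@subsT _ _ W); rewrite -/(len M) lM; lia.
    by case: nW'; rewrite -iW (_ : W = subT) ?subI_absr //; apply: (rk_eq flM); rewrite // r4 -/(len M) lM.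
  have mW := max4_rk flM lM r3.
  apply: esym; apply: (rk_eq flM); last by rewrite r3 rM2.
  by rewrite -(rank2_addE rX nX); apply: subadd_lub => //; apply: Dmax.
have eY := big _ _ XY nY nZ i; have eZ := big Z Y XZ nZ nY; rewrite subIC in eZ.
by have := congr1 (@rk _ _) e; rewrite eY (eZ i) subadd_absl // rM2 -/(len M) lM.
Qed.

Lemma quom_core_decomp : ~ indecomposable (quom D).
Proof.
have [L m n] := ex_other; apply: (decomp_quom (X := L) (Y := M2)); try exact: Dmax.
- exact: max_add2.
- exact: (inter_max4 flM lM rD Dmax).
- by apply: rk_neq; rewrite (rk_max4 flM lM m) rD.
- by apply: rk_neq; rewrite rM2 rD.
Qed.

Lemma quom_soc_decomp X : rk X = 2%N -> X <> D -> ~ indecomposable (quom (subI X D)).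
Proof.
move=> rX nX; have [L m n] := ex_other.
have rXD := rank2_core flM indM lM nlM rD Dmax rX nX.
apply: (decomp_quom (X := X) (Y := L)).
- exact: capl.
- by apply: subs_trans (Dmax m); apply: capr.
- exact: other_add.
- exact: other_inter.
- by apply: rk_neq; rewrite rXD rX.
- by apply: rk_neq; rewrite rXD (rk_max4 flM lM m).
Qed.

(* If the map were not injective, its image would be the core D; being the
   image of a local module, D would then contain a single atom, but it contains
   both Z and an atom of the kernel. *)
Lemma glue_inj K K' (f : {linear subm K -> subm K'}) Z :
  maximal_submod K -> maximal_submod K' -> K <> M2 -> K' <> M2 -> covers sub0 Z ->
  (forall x, incl K x \in Z -> incl K' (f x) = incl K x) -> linj f.
Proof.
move=> k k' nk nk' cZ fZ; apply: contrapT => ni.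
have [flK flK'] : flen (subm K) /\ flen (subm K') by split; apply: flen_subm.
have rK : len (subm K) = 3%N by rewrite len_subm // (rk_max4 flM lM k).
have rZ := rk_atom flM cZ.
have kerZ : ~ Z <=s limg (incl K) (lker f).
  move=> h; case: cZ => _ n0 _; apply: n0; apply: esym; apply: subs0 => z zZ.
  have /limgP[x /lkerP fx e] := h z zZ.
  by rewrite in_sub0 -e -(fZ x) ?e // fx linear0.
have k0 : lker f <> sub0 by move=> e; apply: ni; apply: lker_inj.
have [Z' Z'k cZ'] : exists2 Z', Z' <=s limg (incl K) (lker f) & covers sub0 Z'.
  apply: ex_atom => // e; apply: k0; apply: (limg_inj (@incl_inj _ _ K)); by rewrite e limg0.
have nZ : Z <> Z' by move=> e; apply: kerZ; rewrite e.
have [J uJ] := (unique_maxP flK).1 (local_other k nk).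
have rJ : rk J = 2%N by have := rk_covers flK uJ.1; rewrite -/(len _) rK => -[].
have pJ : limg (incl K) J = D.
  by apply: (rank2_other k nk); rewrite ?rk_push //; apply: limg_incl_sub.
have kT : lker f <> subT.
  move=> e; apply: kerZ; rewrite e limg_incl; exact: atom_in_max4.
have kJ : lker f <=s J by apply: uJ.2.
have r1 : rk (lker f) = 1%N.
  have := rk_gt0 flK k0; have := rkS flK kJ; rewrite rJ.
  have [r2|n2] := eqVneq (rk (lker f)) 2%N; last by lia.
  case: kerZ; have -> : lker f = J by apply: (rk_eq flK) => //; rewrite r2 rJ.
  by rewrite pJ; apply: atom_core.
pose F := incl K' \o f; pose I := limg F subT.
have kF : lker F = lker f.
  apply: subsub_anti => x /lkerP e; rewrite in_lker; apply/eqP.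
    exact (@incl_inj _ _ K' (f x) e).
  exact (etrans (congr1 (incl K') e) (linear0 _)).
have rI : rk I = 2%N.
  by have := rank_nullity F flK flM; rewrite kF r1 rK -/I; lia.
have ID : I = D.
  apply: (rank2_other k' nk') => //; apply/limg_subP => x _; exact: inclP.
have uI : unique_max I (limg F J) by apply: unique_max_img => //; rewrite kF.
have rFJ : rk (limg F J) = 1%N by have := rk_covers flM uI.1; rewrite rI => -[].
have eqZ W : covers sub0 W -> W = limg F J.
  move=> cW; have rW := rk_atom flM cW; apply: (rk_eq flM); last by rewrite rFJ rW.
  apply: uI.2; first by rewrite ID; apply: atom_core.
  by apply: rk_neq; rewrite rW rI.
by apply: nZ; rewrite (eqZ Z) // -(eqZ Z').
Qed.

Lemma local_max_iso L L' : maximal_submod L -> maximal_submod L' -> L <> M2 -> L' <> M2 ->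
  mod_iso (subm L) (subm L').
Proof.
move=> m m' n n'.
have leq : len (subm L') = len (subm L) by rewrite !len_subm // !(rk_max4 flM lM).
have [Z _ cZ] := ex_atom flM (nesym indM.1).
have [[f fP]|[f fP]] := glue_max nakA flM indM lM m m' (local_other m n) (local_other m' n') cZ.
  have fi := glue_inj m m' n n' cZ fP.
  by apply: (lin_iso fi); apply: linj_surj; rewrite ?leq //; apply: flen_subm.
have fi := glue_inj m' m n' n cZ fP.
apply/mod_iso_sym; apply: (lin_iso fi); apply: linj_surj; rewrite ?leq //; exact: flen_subm.
Qed.

End LengthFour.
End Cases.

Lemma uniq_consI (T : eqType) (x : T) s : x \notin s -> uniq s -> uniq (x :: s).
Proof. by move=> h1 h2; rewrite cons_uniq h1. Qed.

Lemma notin_consI (T : eqType) (x y : T) s : x <> y -> x \notin s -> x \notin y :: s.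
Proof. by move=> /eqP h1 h2; rewrite in_cons negb_or h1. Qed.

(** Equality of submodules does not compute, so [uniq] is reduced to pairwise disequalities, settled
    mostly by ranks. *)
Ltac uniq_goals := repeat first
  [ exact isT
  | apply: uniq_consI
  | apply: notin_consI ].

(** * Length 4 with simple socle: case (I) *)

Section CasesFour.
Variables (R : comPzRingType) (A : algType R).
Hypotheses (artA : artin_algebra A) (nakA : right_Nakayama A 4).
Implicit Types M P : lmodType A^c.

Lemma proper_rk M (K : submodClosed M) : flen M -> (0 < rk K < len M)%N -> K <> sub0 /\ K <> subT.
Proof.
move=> flM /andP[r0 rT]; split=> e; first by move: r0; rewrite e rk0.
by move: rT; rewrite e ltnn.
Qed.

(* The lattice of submodules of a nonlocal submodule Y of length 4 with simple
   socle S: D is the radical of Y and M2 its only nonlocal maximal submodule. *)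
Definition colocal4 M (Y S D M2 : submodClosed M) :=
  [/\ covers sub0 S, S <=s Y & forall K : submodClosed M, K <=s Y -> K <> sub0 -> S <=s K] /\
  [/\ rk D = 2%N, rk M2 = 3%N, D <=s M2, M2 <=s Y & ~ local_module (subm M2)] /\
  [/\ exists M1 : submodClosed M, [/\ M1 <=s Y, rk M1 = 3%N & M1 <> M2],
      exists N2 : submodClosed M, [/\ N2 <=s Y, rk N2 = 2%N & N2 <> D],
      forall K : submodClosed M, K <=s Y -> rk K = 3%N -> K = M2 \/ D <=s K /\ chain_below K,
      forall K : submodClosed M, K <=s Y -> rk K = 2%N -> K <=s M2 &
      forall K K' : submodClosed M, K <=s Y -> K' <=s Y -> rk K = 3%N -> rk K' = 3%N ->
        K <> M2 -> K' <> M2 -> mod_iso (subm K) (subm K')] /\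
  (forall K X1 X2 : submodClosed M, K <=s Y -> X1 <=s Y -> X2 <=s Y ->
      rk K = 2%N -> rk X1 = 2%N -> rk X2 = 2%N -> X1 <> X2 ->
      K = X2 \/ mod_iso (subm K) (subm X1)).

Lemma colocal4P M (S : submodClosed M) : flen M -> indecomposable M -> len M = 4%N ->
  ~ local_module M -> colocal_at S -> exists D M2 : submodClosed M, colocal4 subT S D M2 /\
    (forall L : submodClosed M, maximal_submod L -> D <=s L).
Proof.
move=> flM indM lM nlM cS.
have [D [rD Dmax]] := ex_core artA nakA flM indM lM nlM.
have [M2 [m2 nl2]] := ex_nonlocal_max nakA flM indM lM nlM rD Dmax.
have rM2 := rk_max4 flM lM m2.
have mx (K : submodClosed M) : rk K = 3%N -> maximal_submod K := max4_rk flM lM (L := K).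
have uD := unique_max_other flM indM lM nlM rD Dmax m2 nl2.
have r2sub := rank2_sub flM indM lM nlM rD Dmax m2 nl2.
exists D, M2; split=> //; split; last split; last split; last first.
(* [M2] is itself nonlocal of length 3 with simple socle, so its maximal submodules are conjugate by
   [max_conj3]. *)
- move=> K X1 X2 _ _ _ rK r1 r2 n12.
  have c3 X : rk X = 2%N -> maximal_submod (lpre (incl M2) X).
    by move=> rX; apply: maximal_pull; apply: (rkP_covers flM (r2sub _ rX)); rewrite rX rM2.
  have l3 : len (subm M2) = 3%N by rewrite len_subm.
  have SM2 : S <=s M2 by apply: cS.2 => e; move: rM2; rewrite e rk0.
  have [|e|[i _]] := max_conj3 nakA (flen_subm M2 flM) l3 nl2 (colocal_subm cS SM2) (c3 _ rK) (c3 _ r1) (c3 _ r2).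
  + by move=> /pull_inj e; apply: n12; apply: e; apply: r2sub.
  + by left; apply: pull_inj e; apply: r2sub.
  + right; apply: mod_iso_trans (mod_iso_sym (subm_pull_iso (r2sub _ rK))) _.
    exact: mod_iso_trans i (subm_pull_iso (r2sub _ r1)).
- split.
  + have [L m n] := ex_other flM indM nlM M2; exists L; split=> //; exact: (rk_max4 flM lM).
  + by have [X [rX nX]] := ex_rank2 flM lM D m2 nl2; exists X.
  + move=> K _ rK; have [->|n] := pselect (K = M2); [by left|right].
    split; first exact/Dmax/mx.
    apply: (chain_unique_max (uD _ (mx _ rK) n)); apply: (chain_rank2 flM (Z := S)); rewrite ?rD //.
    by move=> X /(colocal_atom cS).
  + by move=> K _; apply: r2sub.
  + move=> K K' _ _ rK rK' n n'; apply: (local_max_iso nakA flM indM lM nlM rD Dmax m2 nl2) => //; exact: mx.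
- by split=> //; apply: Dmax.
- by split=> //; [exact: cS.1|move=> K _; apply: cS.2].
Qed.

(** Case (E) describes the radical of [P] by submodules of [P], so the lattice is moved from
    [subm Y] into [M]. *)
Lemma colocal4_push M (Y : submodClosed M) (S D M2 : submodClosed (subm Y)) : flen M ->
  colocal4 subT S D M2 ->
  colocal4 Y (limg (incl Y) S) (limg (incl Y) D) (limg (incl Y) M2).
Proof.
move=> flM [[c0 _ cS] [[rD rM2 DM2 _ nl2] [[[M1 [_ rM1 n1]] [N2 [_ rN2 n2]] h3 h2 i3] i2]]].
have ii := @incl_inj _ _ Y.
have pp := push_pull; have lp := limg_incl_lpre.
have rp K : K <=s Y -> rk (lpre (incl Y) K) = rk K by apply: rk_pull.
have T := fun K : submodClosed (subm Y) => @subsT _ _ K.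
split; last split; last split.
- split; first by have := covers_push c0; rewrite limg0.
    exact: limg_incl_sub.
  move=> K KY K0; rewrite -(lp _ _ _ _ KY); apply: limgS; apply: cS => // e; apply: K0.
  by rewrite -(lp _ _ _ _ KY) e limg0.
- split; rewrite ?rk_push //; [exact: limgS|exact: limg_incl_sub|].
  move=> lo; apply: nl2; apply: local_iso lo; first exact: flen_subm.
  exact/mod_iso_sym/subm_iso.
- split.
  + exists (limg (incl Y) M1); split; [exact: limg_incl_sub|by rewrite rk_push|by move/(limg_inj ii)].
  + exists (limg (incl Y) N2); split; [exact: limg_incl_sub|by rewrite rk_push|by move/(limg_inj ii)].
  + move=> K KY rK; have [||e|[DK ch]] := h3 (lpre (incl Y) K) => //; first by rewrite rp.
      by left; rewrite -e lp.
    right; split; first by rewrite -(lp _ _ _ _ KY); apply: limgS.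
    move=> X X' XK X'K; have XY := subs_trans XK KY; have X'Y := subs_trans X'K KY.
    have [h|h] := ch _ _ (lpreS (f := incl Y) XK) (lpreS (f := incl Y) X'K); [left|right].
      exact: pull_sub XY h.
    exact: pull_sub X'Y h.
  + move=> K KY rK; rewrite -(lp _ _ _ _ KY); apply: limgS; apply: h2 => //; by rewrite rp.
  + move=> K K' KY KY' rK rK' n n'.
    apply: mod_iso_trans (mod_iso_sym (subm_pull_iso KY)) _.
    apply: mod_iso_trans (subm_pull_iso KY'); apply: i3; rewrite ?rp //.
      by move=> e; apply: n; rewrite -e lp.
    by move=> e; apply: n'; rewrite -e lp.
move=> K X1 X2 KY Y1 Y2 rK r1 r2 n12.
have [||||e|i] := i2 (lpre (incl Y) K) (lpre (incl Y) X1) (lpre (incl Y) X2) (T _) (T _) (T _); rewrite ?rp //.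
- by move=> e; apply: n12; apply: pull_inj e.
- by left; apply: pull_inj e.
right; apply: mod_iso_trans (mod_iso_sym (subm_pull_iso KY)) _.
exact: mod_iso_trans i (subm_pull_iso Y1).
Qed.

(** [N1] is the core [D]. The quotients by [S] and by [D] decompose: [M1] and [N2] are complements
    over [S], two maximal submodules over [D]. *)
Lemma nonlocal_case4_colocal M (S : submodClosed M) : flen M -> indecomposable M -> len M = 4%N ->
  ~ local_module M -> colocal_at S ->
  ~ local_module M /\ factor_serial 4 M /\ simple_module (subm (modsoc M)) /\
  exists M1 M2 N1 N2 : submodClosed M,
     [/\ [/\ maximal_submod M1, has_length (subm M1) 3 & uniserial (subm M1)],
         [/\ maximal_submod M2, has_length (subm M2) 3,
             ~ local_module (subm M2) & factor_serial 3 (subm M2)],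
         uniserial (subm N1) /\ has_length (subm N1) 2 &
         uniserial (subm N2) /\ has_length (subm N2) 2] /\
     [/\ {subset N1 <= M1}, {subset N1 <= M2}, {subset N2 <= M2},
         submodules_are [:: M1; M2; N1; N2; modsoc M] &
         indec_quotients_are [:: M1; M2; N2]].
Proof.
move=> flM indM lM nlM cS; split=> //; split; first exact: factor_serial_nonlocal.
have eS : modsoc M = S.
  by apply: modsoc1E; [exact: cS.1|move=> Z /(colocal_atom cS)->].
rewrite eS; split; first by apply/simple_subm; exact: cS.1.
have [D [M2 [[_ [[rD rM2 DM2 _ nl2] [[[M1 [_ rM1 n1]] [N2 [_ rN2 n2]] h3 h2 i3] i2]]] Dmax]]] :=
  colocal4P flM indM lM nlM cS.
have rS := rk_atom flM cS.1.
have rT : rk (subT : submodClosed M) = 4%N := lM.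
have m2 := max4_rk flM lM rM2.
have T K := @subsT _ M K.
have uni2 (K : submodClosed M) : rk K = 2%N -> uniserial (subm K).
  move=> rK; apply/uniserial_subm => //; apply: (chain_rank2 flM (Z := S)); rewrite ?rK //.
  by move=> X /(colocal_atom cS).
have [//|[DM1 ch1]] := h3 M1 (T _) rM1.
exists M1, M2, D, N2; split; split.
- by split; [apply: (max4_rk flM lM)|apply/has_length_subm|apply/uniserial_subm].
- split=> //; first exact/has_length_subm.
  by apply: factor_serial_nonlocal; rewrite ?len_subm //; apply: flen_subm.
- by split; [apply: uni2|apply/has_length_subm].
- by split; [apply: uni2|apply/has_length_subm].
- exact: DM1.
- exact: DM2.
- exact: h2.
- split.
  + by uniq_goals => //; try (by apply: nesym); apply: rk_neq; rewrite ?rS ?rM1 ?rM2 ?rD ?rN2.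
  + move=> K; rewrite !inE => /or4P[/eqP->|/eqP->|/eqP->|/orP[]/eqP->]; apply: proper_rk => //;
      by rewrite ?rS ?rM1 ?rM2 ?rD ?rN2 lM.
  + move=> K K0 KT; have [cK|rK|mK] := rk_proper4 flM lM K0 KT.
    * by exists S; rewrite ?inE ?eqxx ?orbT // (colocal_atom cS cK); apply: mod_iso_refl.
    * have [->|i] := i2 K D N2 (T _) (T _) (T _) rK rD rN2 (nesym n2).
        by exists N2; rewrite ?inE ?eqxx ?orbT //; apply: mod_iso_refl.
      by exists D; rewrite ?inE ?eqxx ?orbT.
    * have rK := rk_max4 flM lM mK; have [->|n] := pselect (K = M2).
        by exists M2; rewrite ?inE ?eqxx ?orbT //; apply: mod_iso_refl.
      by exists M1; rewrite ?inE ?eqxx ?orbT //; apply: i3.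
have m1 := max4_rk flM lM rM1.
split.
  move=> K; rewrite !inE => /or3P[] /eqP->; try exact: quom_max_indec.
  exact: (quom_rank2_indec flM indM lM nlM rD Dmax m2 nl2).
move=> K K0 iK; have KT : K <> subT by have /indecomposable_quom[] := iK.
have [cK|rK|mK] := rk_proper4 flM lM K0 KT.
- have eK : K = subI N2 D.
    have := colocal_atom cS cK; move=> ->; apply: esym; apply: (colocal_atom cS).
    by apply: (atom_rk flM); apply: (rank2_core flM indM lM nlM rD Dmax).
  by case: (quom_soc_decomp flM indM lM nlM rD Dmax m2 nl2 rN2 n2); rewrite -eK.
- have [eK|nK] := pselect (K = D).
    by case: (quom_core_decomp flM indM lM nlM rD Dmax m2); rewrite -eK.
  exists N2; rewrite ?inE ?eqxx ?orbT //.
  exact: (quom_rank2_iso flM indM lM nlM rD Dmax m2 nl2).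
have [->|i] := quom_max_iso flM lM rD Dmax m1 m2 mK n1.
  by exists M2; rewrite ?inE ?eqxx ?orbT //; apply: mod_iso_refl.
by exists M1; rewrite ?inE ?eqxx.
Qed.

End CasesFour.

Lemma unique_max_pull (S : pzRingType) (M : lmodType S) (K J : submodClosed M) :
  unique_max K J -> unique_max subT (lpre (incl K) J).
Proof.
move=> [c uJ]; split=> [|X _ nX]; first exact: maximal_pull.
rewrite -(push_pull X); apply: lpreS; apply: uJ; first exact: limg_incl_sub.
by move=> e; apply: nX; rewrite -(push_pull X) e pullT.
Qed.

(** * Length 4 with nonsimple socle: case (J) *)

Section NonColocal.
Variables (R : comPzRingType) (A : algType R).
Hypotheses (artA : artin_algebra A) (nakA : right_Nakayama A 4).
Variable M : lmodType A^c.
Hypotheses (flM : flen M) (indM : indecomposable M) (lM : len M = 4%N) (nlM : ~ local_module M).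
Hypothesis ncol : ~ exists S : submodClosed M, colocal_at S.
Variables D M2 N2 : submodClosed M.
Hypotheses (rD : rk D = 2%N) (Dmax : forall L : submodClosed M, maximal_submod L -> D <=s L).
Hypotheses (m2 : maximal_submod M2) (nl2 : ~ local_module (subm M2)).
Hypotheses (rN2 : rk N2 = 2%N) (nN2 : N2 <> D).
Implicit Types K L X Y Z : submodClosed M.

Let S2 := subI N2 D.

Lemma soc2_atom : covers sub0 S2.
Proof. by apply: (atom_rk flM); apply: (rank2_core flM indM lM nlM rD Dmax). Qed.

Lemma ex_soc1 : exists S1, covers sub0 S1 /\ S1 <> S2.
Proof.
apply: contrapT => h; apply: ncol; exists S2; apply: atoms_colocal => //; first exact: soc2_atom.
by move=> Z cZ; apply: contrapT => nZ; apply: h; exists Z; split=> // e; apply: nZ; rewrite e.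
Qed.

Lemma atoms_disjoint Z Z' : covers sub0 Z -> covers sub0 Z' -> Z <> Z' -> subI Z Z' = sub0.
Proof.
move=> c c' n; apply: subI_atom => // ZZ'; apply: n; apply: (rk_eq flM) => //.
by rewrite (rk_atom flM c) (rk_atom flM c').
Qed.

Lemma atoms_add Z Z' : covers sub0 Z -> covers sub0 Z' -> Z <> Z' -> subadd Z Z' = D.
Proof.
move=> c c' n; apply: (rk_eq flM).
  by apply: subadd_lub; apply: (atom_core flM indM lM nlM rD Dmax).
have := rkD flM Z Z'; rewrite atoms_disjoint // rk0 // (rk_atom flM c) (rk_atom flM c').
by rewrite rD; lia.
Qed.

Variable S1 : submodClosed M.
Hypotheses (c1 : covers sub0 S1) (n12 : S1 <> S2).

Let r1 : rk S1 = 1%N := rk_atom flM c1.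
Let r2 : rk S2 = 1%N := rk_atom flM soc2_atom.
Let rM2 : rk M2 = 3%N := rk_max4 flM lM m2.

(** All submodules of length 2 other than [D] meet [D] in the same atom [S2], and [S1] is another
    atom of [D]. *)
Lemma core_soc1 X : rk X = 2%N -> X <> D -> subI X S1 = sub0.
Proof.
move=> rX nX; rewrite subIC; apply: subI_atom => // S1X; apply: n12.
have e : subI X D = S2 := rank2_inter flM indM lM nlM rD Dmax m2 nl2 rX rN2 nX nN2.
apply: (rk_eq flM); last by rewrite r1 r2.
by rewrite -e; apply: subI_glb => //; apply: (atom_core flM indM lM nlM rD Dmax).
Qed.

Lemma core_soc1_add X : rk X = 2%N -> X <> D -> subadd X S1 = M2.
Proof.
move=> rX nX; apply: (rk_eq flM).
  apply: subadd_lub; first exact: (rank2_sub flM indM lM nlM rD Dmax m2 nl2).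
  exact: (atom_in_max4 flM indM lM).
by have := rkD flM X S1; rewrite core_soc1 // rk0 // r1 rX rM2; lia.
Qed.

Lemma core_nonlocal : ~ local_module (subm D).
Proof.
have cS Z : covers sub0 Z -> covers Z D.
  move=> cZ; apply: (rkP_covers flM); first exact: (atom_core flM indM lM nlM rD Dmax).
  by rewrite rD (rk_atom flM cZ).
exact: two_covers_nonlocal (cS _ c1) (cS _ soc2_atom) n12.
Qed.

(** So [D / S1] is the least nonzero submodule of [M / S1], which is therefore indecomposable with
    simple socle. *)
Lemma soc1_core X : S1 <=s X -> X <> S1 -> D <=s X.
Proof.
move=> S1X nX; have X0 : X <> sub0 by move=> e; have := rkS flM S1X; rewrite e rk0 // r1.
have [->|XT] := pselect (X = subT); first exact: subsT.
have [cX|rX|mX] := rk_proper4 flM lM X0 XT; last exact: Dmax.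
  by case: nX; apply: esym; apply: (rk_eq flM) => //; rewrite r1 (rk_atom flM cX).
have [->//|nXD] := pselect (X = D).
by have := core_soc1 rX nXD; rewrite subI_absr // => e; have := r1; rewrite e rk0.
Qed.

Lemma quom_soc1_indec : indecomposable (quom S1).
Proof.
apply/indecomposable_quom; split; first by apply: rk_neq; rewrite r1 -/(len M) lM.
move=> X Y SX SY e i; apply: contrapT => /not_orP[nX nY].
have := rkS flM (subI_glb (soc1_core SX nX) (soc1_core SY nY)); rewrite i r1 rD; lia.
Qed.

Lemma quom_soc1_colocal : colocal_at (limg (proj S1) D).
Proof.
have flQ := flen_quom S1 flM.
have S1D : S1 <=s D by apply: (atom_core flM indM lM nlM rD Dmax).
have k1 : lker (proj S1) = S1 := lker_proj S1.
split.
  apply: (atom_rk flQ); have := rk_limg_ker (f := proj S1) flM flQ (K := D).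
  by rewrite k1 => /(_ S1D); rewrite rD r1; lia.
move=> K K0; rewrite -(limg_lpre_surj K (@proj_surj _ _ S1)); apply: limgS; apply: soc1_core.
  by rewrite -{1}k1; apply: lker_lpre.
move=> e; apply: K0; rewrite -(limg_lpre_surj K (@proj_surj _ _ S1)) e.
by apply: subs0; apply/limg_subP => x /projP ->; rewrite in_sub0.
Qed.

Lemma quom_soc1_len : len (quom S1) = 3%N.
Proof. by have := len_quom S1 flM; rewrite lM r1; lia. Qed.

Lemma quom_soc1_nonlocal : ~ local_module (quom S1).
Proof.
have [L m n] := ex_other flM indM nlM M2.
have k1 : lker (proj S1) = S1 := lker_proj S1.
have mx K : maximal_submod K -> maximal_submod (limg (proj S1) K) /\ lpre (proj S1) (limg (proj S1) K) = K.
  move=> mK; have SK : S1 <=s K by apply: (atom_in_max4 flM indM lM).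
  split; last by apply: lpre_limg; rewrite k1.
  rewrite /maximal_submod -(limgT (@proj_surj _ _ S1)); apply: covers_img mK _.
  by rewrite k1; apply: subs_trans SK; apply: capl.
have [[a ea] [b eb]] := (mx _ m, mx _ m2).
by apply: (two_max_nonlocal a b) => e; apply: n; rewrite -ea e eb.
Qed.

End NonColocal.

Section CaseJ.
Variables (R : comPzRingType) (A : algType R).
Hypotheses (artA : artin_algebra A) (nakA : right_Nakayama A 4).
Variable M : lmodType A^c.
Hypotheses (flM : flen M) (indM : indecomposable M) (lM : len M = 4%N) (nlM : ~ local_module M).
Hypothesis ncol : ~ exists S : submodClosed M, colocal_at S.

(** Both quotients are nonlocal of length 3 with simple socle, and they are pulled back over
    [M / M2]. A noninjective map would land in the socle [D / S1] or [D / S1'], which is zero in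
    [M / M2]. *)
Lemma quom_soc_iso (D M2 N2 S1 S1' : submodClosed M) :
  rk D = 2%N -> (forall L : submodClosed M, maximal_submod L -> D <=s L) ->
  maximal_submod M2 -> ~ local_module (subm M2) -> rk N2 = 2%N -> N2 <> D ->
  covers sub0 S1 -> S1 <> subI N2 D -> covers sub0 S1' -> S1' <> subI N2 D ->
  mod_iso (quom S1) (quom S1').
Proof.
move=> rD Dmax m2 nl2 rN2 nN2 c1 n1 c1' n1'.
have good (Z : submodClosed M) : covers sub0 Z -> Z <> subI N2 D ->
    [/\ colocal_at (limg (proj Z) D), len (quom Z) = 3%N & ~ local_module (quom Z)].
  move=> c n; split; first exact: (quom_soc1_colocal flM indM lM nlM rD Dmax m2 nl2 rN2 nN2).
    exact: (quom_soc1_len flM indM lM nlM rD Dmax m2 rN2 nN2).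
  exact: (quom_soc1_nonlocal flM indM lM nlM m2).
have sT : simple_module (quom M2) := quom_simple flM m2.
have ex (Z : submodClosed M) : covers sub0 Z -> exists a : {linear quom Z -> quom M2}, forall x, a (proj Z x) = proj M2 x.
  move=> c; apply: factor_surj; first exact: proj_surj.
  by rewrite !lker_proj; apply: (atom_in_max4 flM indM lM).
have surj (Z : submodClosed M) (a : {linear quom Z -> quom M2}) : (forall x, a (proj Z x) = proj M2 x) -> lsurj a.
  by move=> aP t; have [x <-] := proj_surj t; exists (proj Z x).
have core (Z Z' : submodClosed M) (a : {linear quom Z -> quom M2}) (b : {linear quom Z' -> quom M2})
    (f : {linear quom Z -> quom Z'}) : covers sub0 Z -> Z <> subI N2 D -> covers sub0 Z' -> Z' <> subI N2 D ->
    (forall x, a (proj Z x) = proj M2 x) -> (forall x, b (proj Z' x) = proj M2 x) ->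
    (forall x, b (f x) = a x) -> mod_iso (quom Z) (quom Z').
  move=> c n c' n' aP bP fP.
  have [[co l nl] [co' l' _]] := (good _ c n, good _ c' n').
  have [flZ flZ'] := (flen_quom Z flM, flen_quom Z' flM).
  have fi : linj f.
    apply: contrapT => ni; have [t t0] := nonzero_elt sT.1; have [x ex'] := surj _ _ aP t.
    apply: t0; rewrite -ex' -fP.
    have /limgP[d dD <-] := noninj_soc flZ flZ' co co' l nl ni x.
    by rewrite bP; apply/projP; apply: Dmax.
  by apply: (lin_iso fi); apply: linj_surj; rewrite ?l ?l'.
have [a aP] := ex _ c1; have [b bP] := ex _ c1'.
have [[co l nl] [co' l' _]] := (good _ c1 n1, good _ c1' n1').
have [|[f fP]|[f fP]] := pullback (nonlocal_len nakA) (flen_quom S1 flM) (flen_quom S1' flM) sT co co' nl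
  (surj _ _ aP) (surj _ _ bP).
- by rewrite l l'.
- exact: core aP bP fP.
by apply: mod_iso_sym; apply: core bP aP fP.
Qed.

(** The core [D] is the socle, [N1] is a local maximal submodule and [N2 + S1] the nonlocal one. The
    quotients by [D] and by [S2] decompose. *)
Lemma nonlocal_case4_noncolocal :
  ~ local_module M /\ factor_serial 4 M /\ ~ simple_module (subm (modsoc M)) /\
   exists N1 N2 S1 S2 : submodClosed M,
     [/\ [/\ indecomposable (subm N1), has_length (subm N1) 3 &
             factor_serial 2 (subm N1)],
         uniserial (subm N2) /\ has_length (subm N2) 2,
         simple_module (subm S1) /\ simple_module (subm S2),
         is_dsum (modsoc M) S1 S2 &
         subpush (modsoc (subm N2)) = S2] /\
     is_dsum (subadd N2 S1) N2 S1 /\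
     submodules_are [:: N1; N2; subadd N2 S1; modsoc M; S1; S2] /\
     indec_quotients_are [:: N1; N2; subadd N2 S1; S1].
Proof.
split=> //; split; first exact: factor_serial_nonlocal.
have [D [rD Dmax]] := ex_core artA nakA flM indM lM nlM.
have [M2 [m2 nl2]] := ex_nonlocal_max nakA flM indM lM nlM rD Dmax.
have rM2 := rk_max4 flM lM m2.
have [N1 m1 n1] := ex_other flM indM nlM M2; have rN1 := rk_max4 flM lM m1.
have [N2 [rN2 nN2]] := ex_rank2 flM lM D m2 nl2.
have [S1 [c1 n12]] := ex_soc1 flM indM lM nlM ncol rD Dmax rN2 nN2.
have c2 := soc2_atom flM indM lM nlM rD Dmax rN2 nN2.
set S2 := subI N2 D in n12 c2 *.
have [r1 r2] := (rk_atom flM c1, rk_atom flM c2).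
have rT : rk (subT : submodClosed M) = 4%N := lM.
have eD : subadd S1 S2 = D := atoms_add flM indM lM nlM rD Dmax rN2 c1 c2 n12.
have eS : modsoc M = D.
  by rewrite -eD; apply: modsocE => // Z cZ; rewrite eD; apply: (atom_core flM indM lM nlM rD Dmax).
have i12 : subI S1 S2 = sub0 := atoms_disjoint flM c1 c2 n12.
have e2 : subadd N2 S1 = M2 := core_soc1_add flM indM lM nlM rD Dmax m2 nl2 rN2 nN2 c1 n12 rN2 nN2.
have i2 : subI N2 S1 = sub0 := core_soc1 flM indM lM nlM rD Dmax m2 nl2 rN2 nN2 c1 n12 rN2 nN2.
have S2N2 : S2 <=s N2 by apply: capl.
have atomN2 Z : covers sub0 Z -> Z <=s N2 -> Z <=s S2.
  by move=> cZ ZN; apply: subI_glb => //; apply: (atom_core flM indM lM nlM rD Dmax).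
have eqS2 Z : covers sub0 Z -> Z <=s N2 -> Z = S2.
  by move=> cZ ZN; apply: (rk_eq flM (atomN2 _ cZ ZN)); rewrite r2 (rk_atom flM cZ).
have lo1 := local_other flM indM lM nlM rD Dmax m2 nl2 m1 n1.
have fl1 := flen_subm N1 flM.
rewrite eS; split; first by move=> /(simple_rk _ flM); rewrite rD.
exists N1, N2, S1, S2; rewrite e2; split; last split; last split.
- split.
  + split; [exact: local_indecomposable|exact/has_length_subm|].
    apply: (factor_serial_local (J := lpre (incl N1) D)); rewrite ?len_subm //.
      exact/unique_max_pull/(unique_max_other flM indM lM nlM rD Dmax m2 nl2).
    move=> lo; apply: (core_nonlocal flM indM lM nlM rD Dmax rN2 nN2 c1 n12).
    by apply: local_iso (subm_pull_iso (Dmax _ m1)) lo; apply: flen_subm.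
  + split; last exact/has_length_subm.
    by apply/uniserial_subm => //; apply: (chain_rank2 flM (Z := S2)); rewrite ?rN2.
  + by split; apply/simple_subm.
  + by apply/is_dsumE; rewrite eD.
  + exact: socpush1E.
- by apply/is_dsumE; rewrite e2.
- split.
  + by uniq_goals => //; apply: rk_neq; rewrite ?rN1 ?rN2 ?rM2 ?rD ?r1 ?r2.
  + move=> K; rewrite !inE => /or4P[/eqP->|/eqP->|/eqP->|/or3P[]/eqP->]; apply: proper_rk => //;
      by rewrite ?rN1 ?rN2 ?rM2 ?rD ?r1 ?r2 lM.
  + move=> K K0 KT; have [cK|rK|mK] := rk_proper4 flM lM K0 KT.
    * have [->|nK] := pselect (K = S2).
        by exists S2; rewrite ?inE ?eqxx ?orbT //; apply: mod_iso_refl.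
      exists S1; rewrite ?inE ?eqxx ?orbT //.
      apply: (compl_iso (Z := S2)); rewrite ?(atoms_disjoint flM) //.
      by rewrite eD; apply: (atoms_add flM indM lM nlM rD Dmax rN2).
    * have [->|nK] := pselect (K = D).
        by exists D; rewrite ?inE ?eqxx ?orbT //; apply: mod_iso_refl.
      exists N2; rewrite ?inE ?eqxx ?orbT //; apply: (compl_iso (Z := S1)) => //.
        by rewrite e2; apply: (core_soc1_add flM indM lM nlM rD Dmax m2 nl2 rN2 nN2 c1 n12).
      exact: (core_soc1 flM indM lM nlM rD Dmax m2 nl2 rN2 nN2 c1 n12).
    * have [->|nK] := pselect (K = M2).
        by exists M2; rewrite ?inE ?eqxx ?orbT //; apply: mod_iso_refl.
      exists N1; rewrite ?inE ?eqxx ?orbT //.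
      exact: (local_max_iso nakA flM indM lM nlM rD Dmax m2 nl2).
split.
  move=> K; rewrite !inE => /or4P[] /eqP->; try exact: quom_max_indec.
    exact: (quom_rank2_indec flM indM lM nlM rD Dmax m2 nl2).
  exact: (quom_soc1_indec flM indM lM nlM rD Dmax m2 nl2 rN2 nN2 c1 n12).
move=> K K0 iK; have KT : K <> subT by have /indecomposable_quom[] := iK.
have [cK|rK|mK] := rk_proper4 flM lM K0 KT.
- have [eK|nK] := pselect (K = S2).
    by case: (quom_soc_decomp flM indM lM nlM rD Dmax m2 nl2 rN2 nN2); rewrite -/S2 -eK.
  exists S1; rewrite ?inE ?eqxx ?orbT //.
  exact: (quom_soc_iso rD Dmax m2 nl2 rN2 nN2 cK nK c1 n12).
- have [eK|nK] := pselect (K = D).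
    by case: (quom_core_decomp flM indM lM nlM rD Dmax m2); rewrite -eK.
  exists N2; rewrite ?inE ?eqxx ?orbT //.
  exact: (quom_rank2_iso flM indM lM nlM rD Dmax m2 nl2).
have [->|i] := quom_max_iso flM lM rD Dmax m1 m2 mK n1.
  by exists M2; rewrite ?inE ?eqxx ?orbT //; apply: mod_iso_refl.
by exists N1; rewrite ?inE ?eqxx.
Qed.

End CaseJ.

(** * The radical of an indecomposable projective module *)

Section RadicalStructure.
Variables (R : comPzRingType) (A : algType R).
Hypotheses (artA : artin_algebra A) (nakA : right_Nakayama A 4).
Implicit Types M P U V : lmodType A^c.

Lemma local_max_img U V (f : {linear U -> V}) (Y : submodClosed U) : unique_max subT Y ->
  sub0 <> subT :> submodClosed V -> limg f Y <> subT.
Proof.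
move=> uY V0 e; have kY : lker f <=s Y.
  apply: uY.2 => // ek; apply: V0; rewrite -e; apply/esym/subs0.
  by move=> _ /limgP[x _ <-]; rewrite in_sub0; have : x \in lker f by rewrite ek.
have sf : lsurj f by apply: limgT_surj; apply: subTs; rewrite -e; apply: limgS.
by have [[_ n _] _] := unique_max_surj sf uY kY; apply: n.
Qed.

(* Otherwise rad P has atoms S1 <> S2 as in case (J). Amalgamate P along S1 with
   L / S2, where L is a local maximal submodule of rad P: a map P -> L / S2 kills D,
   which contains S1, and a map L / S2 -> P has a local image of length 2 containing
   S1, which does not exist. *)
Lemma rad_colocal P (Y : submodClosed P) : flen P -> unique_max subT Y ->
  indecomposable (subm Y) -> ~ local_module (subm Y) -> rk Y = 4%N ->
  exists S : submodClosed (subm Y), colocal_at S.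
Proof.
move=> flP uY iY nlY rY; apply: contrapT => ncol.
set M := subm Y in iY nlY ncol *.
have flM : flen M := flen_subm Y flP.
have lM : len M = 4%N by rewrite len_subm.
have lP : len P = 5%N by rewrite /len (rk_covers flP uY.1) rY.
have [D [rD Dmax]] := ex_core artA nakA flM iY lM nlY.
have [M2 [m2 nl2]] := ex_nonlocal_max nakA flM iY lM nlY rD Dmax.
have [N2 [rN2 nN2]] := ex_rank2 flM lM D m2 nl2.
have s2 := soc2_atom flM iY lM nlY rD Dmax rN2 nN2.
set S2 := subI N2 D in s2.
have [S1 [c1 n12]] := ex_soc1 flM iY lM nlY ncol rD Dmax rN2 nN2.
have [L mL nL] := ex_other flM iY nlY M2.
have uL := unique_max_other flM iY lM nlY rD Dmax m2 nl2 mL nL.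
have DL : D <=s L by have [[]] := uL.
have S1D := atom_core flM iY lM nlY rD Dmax c1.
have S2D := atom_core flM iY lM nlY rD Dmax s2.
have rS2 := rk_atom flM s2; have rL := rk_max4 flM lM mL.
pose Q := quom S2; pose W := limg (proj S2) L.
have flQ : flen Q := flen_quom S2 flM.
have rJ : rk (limg (proj S2) D) = 1%N.
  by have := rk_limg_ker (f := proj S2) flM flQ (K := D); rewrite lker_proj rD rS2 => /(_ S2D); lia.
have rW : rk W = 2%N.
  by have := rk_limg_ker (f := proj S2) flM flQ (K := L); rewrite lker_proj rL rS2 => /(_ (subs_trans S2D DL)); rewrite -/W; lia.
have uW : unique_max W (limg (proj S2) D) by apply: unique_max_img; rewrite ?lker_proj.
have flW : flen (subm W) := flen_subm W flQ.
have lW : len (subm W) = 2%N by rewrite len_subm.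
have [v vE] : exists v : {linear subm S1 -> subm W}, forall t, incl W (v t) = proj S2 (incl S1 t).
  apply: (@factor_inj _ _ _ _ (incl W) (proj S2 \o incl S1)); first exact: incl_inj.
  move=> _ /limgP[t _ <-]; rewrite limg_incl; apply: mem_limg; apply: DL; apply: S1D; exact: inclP.
have iv : linj v.
  move=> t et; have /projP h : proj S2 (incl S1 t) = 0 by rewrite -vE et linear0.
  apply: (@incl_inj _ _ S1); apply/eqP; rewrite -in_sub0.
  by rewrite -(atoms_disjoint flM c1 s2 n12) in_subI inclP.
have [t0 nt0] : exists t0 : subm S1, t0 <> 0.
  by apply: nonzero_elt => e; have /simple_subm/simpleP[_ n _] := c1; apply: n.
have iu : linj (incl Y \o incl S1).
  move=> t e; apply: (@incl_inj _ _ S1); apply: (@incl_inj _ _ Y); exact: e.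
have loP : local_module P by apply/unique_maxP => //; exists Y.
have loW : local_module (subm W) by apply/unique_max_subm => //; exists (limg (proj S2) D).
have T1 : simple_module (subm S1) by apply/simple_subm.
have le6 : (6 <= len P + len (subm W))%N by rewrite lP lW.
have [[f fE]|[f fE]] := amalgam (nonlocal_len nakA) flP flW T1 loP loW iu iv le6.
  pose g : {linear M -> subm W} := f \o incl Y.
  have W0 : sub0 <> subT :> submodClosed (subm W).
    by move=> e; have := lW; rewrite /len -e rk0.
  (* The radical of [P] has a proper image, of length at most 1; so the kernel of [g] is maximal in
     it and contains [D]. *)
  have gT : limg g subT <> subT.
    move=> e; apply: (local_max_img (f := f) uY W0); apply: subTs; rewrite -e.
    by move=> _ /limgP[x _ <-]; apply: mem_limg; exact: inclP.
  have := rk_subT flW gT; have := rank_nullity g flM flW; rewrite -/(len (subm W)) lW lM => rn lt.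
  have nk : lker g <> subT.
    move=> e; apply: nt0; apply: iv; rewrite -fE.
    by apply: (lkerP (f := g)); rewrite e.
  have := rk_subT flM nk; rewrite -/(len M) lM => lt'.
  have mk : maximal_submod (lker g) by apply: max4_rk => //; lia.
  apply: nt0; apply: iv; rewrite -fE; apply: (lkerP (f := g)); apply: (Dmax _ mk); apply: S1D; exact: inclP.
(* The only nonzero proper submodule of [W] is [D / S2], which contains the image of [S1]. *)
have kf : lker f = sub0.
  apply: contrapT => k0.
  have uV := unique_max_pull uW.
  have kT : lker f <> subT.
    by move=> e; apply: nt0; apply: iu; rewrite -fE; apply: lkerP; rewrite e.
  have kJ := uV.2 _ (@subsT _ _ _) kT.
  have ek : lker f = lpre (incl W) (limg (proj S2) D).
    by apply: (rk_eq flW) => //; rewrite rk_pull ?rJ ?rk_gt0 //; have [[]] := uW.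
  apply: nt0; apply: iu; rewrite -fE; apply: lkerP; rewrite ek in_lpre vE.
  by apply: mem_limg; apply: S1D; exact: inclP.
have {kf}fi := lker_inj kf.
pose X := limg f subT.
have rX : rk X = 2%N by rewrite rk_limg_inj.
have XY : X <=s Y.
  by apply: uY.2 => // e; have := lP; rewrite /len -e rX.
have S1X : S1 <=s lpre (incl Y) X.
  move=> x xS1; have [t <-] := ex_incl xS1; rewrite in_lpre.
  by rewrite -[incl Y _]/((incl Y \o incl S1) t) -fE; apply: mem_limg.
have loX : local_module (subm (lpre (incl Y) X)).
  apply: local_iso loW => //.
  apply: mod_iso_trans (mod_iso_sym (subm_pull_iso XY)).
  by apply: mod_iso_trans (subm_iso _ fi); apply/mod_iso_sym/subm_subT_iso.
have nD : lpre (incl Y) X <> D.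
  by move=> e; apply: (core_nonlocal flM iY lM nlY rD Dmax rN2 nN2 c1 n12); rewrite -e.
have := core_soc1 flM iY lM nlY rD Dmax m2 nl2 rN2 nN2 c1 n12 _ nD.
rewrite rk_pull // => /(_ rX); rewrite subIC subI_absl // => e.
by have [_ n _] := c1; apply: n; rewrite e.
Qed.

End RadicalStructure.

(** * Radicals that are direct sums *)

Section DirectSum.
Variables (S : pzRingType) (M : lmodType S).
Hypothesis flM : flen M.
Implicit Types K L N X Y Z : submodClosed M.

Definition dsum Y K L := subadd K L = Y /\ subI K L = sub0.

Lemma dsumC Y K L : dsum Y K L -> dsum Y L K.
Proof. by rewrite /dsum subaddC subIC. Qed.

Lemma dsum_subl Y K L : dsum Y K L -> K <=s Y.
Proof. by move=> [<- _]; apply: subaddl. Qed.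

Lemma dsum_subr Y K L : dsum Y K L -> L <=s Y.
Proof. by move=> [<- _]; apply: subaddr. Qed.

Lemma dsum_rk Y K L : dsum Y K L -> rk Y = (rk K + rk L)%N.
Proof. by move=> [<- e]; have := rkD flM K L; rewrite e (rk0 flM) addn0. Qed.

Lemma rk_dsum Y K L : K <=s Y -> L <=s Y -> subI K L = sub0 -> (rk Y <= rk K + rk L)%N -> dsum Y K L.
Proof.
move=> KY LY e le; split=> //; apply: (rk_eq flM); first exact: subadd_lub.
by have := rkD flM K L; rewrite e (rk0 flM); lia.
Qed.

Lemma subI0S K L K' L' : K' <=s K -> L' <=s L -> subI K L = sub0 -> subI K' L' = sub0.
Proof.
move=> KK LL e; apply: subs0 => x; rewrite in_subI => /andP[/KK xK /LL xL].
by rewrite -e in_subI xK.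
Qed.

Lemma dsum_sub Y K L X Z : dsum Y K L -> X <=s K -> Z <=s L -> dsum (subadd X Z) X Z.
Proof. by move=> [_ e] XK ZL; split=> //; apply: subI0S e. Qed.

Lemma dsum_cap Y K L X : dsum Y K L -> X <=s K -> subI (subadd X L) K = X.
Proof. by move=> [_ e] XK; rewrite modular // subIC e; apply: subadd_absr; apply: sub0s. Qed.

Lemma dsum_cover Y K L X : dsum Y K L -> covers X K -> covers (subadd X L) Y.
Proof.
move=> d c; have [XK _ _] := c; have d' := dsum_sub d XK (@subs_refl _ _ L).
apply: (rkP_covers flM); last by rewrite (dsum_rk d) (dsum_rk d') (rk_covers flM c).
by have [<- _] := d; apply: subaddS.
Qed.

Lemma dsum_in Y K L X : dsum Y K L -> L <=s X -> X <=s Y -> X = subadd L (subI K X).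
Proof. by move=> [e _] LX XY; rewrite -modular // subaddC e subI_absr. Qed.

Lemma dsum_compl Y K L X : dsum Y K L -> X <=s Y -> subI X L = sub0 ->
  mod_iso (subm X) (subm (subI (subadd X L) K)) /\ subadd (subI (subadd X L) K) L = subadd X L.
Proof.
move=> d XY e.
have h : subadd (subI (subadd X L) K) L = subadd X L.
  rewrite subaddC subIC; apply: esym; apply: (dsum_in d); first exact: subaddr.
  by apply: subadd_lub => //; apply: dsum_subr d.
split=> //; apply: (compl_iso (Z := L)) => //.
by apply: subI0S (@subs_refl _ _ L) d.2; apply: capr.
Qed.

(** Projection along [L] embeds [X] in [K]. *)
Lemma dsum_trace Y K L X : dsum Y K L -> X <=s Y -> subI X L = sub0 ->
  exists X', [/\ X' <=s K, rk X' = rk X, mod_iso (subm X) (subm X') & subadd X' L = subadd X L].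
Proof.
move=> d XY e; have [i h] := dsum_compl d XY e; exists (subI (subadd X L) K).
have le : subI (subadd X L) K <=s K by exact: capr.
have dX : dsum (subadd X L) X L by [].
have := dsum_rk (dsum_sub d le (@subs_refl _ _ L)); rewrite h (dsum_rk dX) => r.
by split=> //; lia.
Qed.

Lemma dsum_capl_rk Y K L X : dsum Y K L -> X <=s Y -> (rk (subI (subadd X L) K) <= rk X)%N.
Proof.
move=> d XY; have := rkD flM (subadd X L) K; have := rkD flM X L.
have -> : subadd (subadd X L) K = Y.
  apply: subsub_anti; first by apply: subadd_lub; [apply: subadd_lub => //; apply: dsum_subr d|apply: dsum_subl d].
  have [<- _] := d; apply: subadd_lub; first exact: subaddr.
  exact: subs_trans (@subaddr _ _ X L) (@subaddl _ _ _ _).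
by rewrite (dsum_rk d); lia.
Qed.


Definition only_atom K Z := [/\ covers sub0 Z, Z <=s K &
  forall Z', covers sub0 Z' -> Z' <=s K -> Z' = Z].

Lemma only_atom_self Z : covers sub0 Z -> only_atom Z Z.
Proof.
move=> c; split=> // Z' c' h; apply: (rk_eq flM) => //.
by rewrite (rk_atom flM c) (rk_atom flM c').
Qed.

Lemma only_atom_small K Z X : only_atom K Z -> X <=s K -> (rk X <= 1)%N -> X <=s Z.
Proof.
move=> [cZ ZK uZ] XK r; have [->|X0] := pselect (X = sub0); first exact: sub0s.
have cX : covers sub0 X by apply: (atom_rk flM); have := rk_gt0 flM X0; lia.
by rewrite (uZ X).
Qed.

(** The projections of [Z] to the summands have length at most 1, so they lie in [A] and [B]. *)
Lemma dsum_atoms Y K L A B Z : dsum Y K L -> only_atom K A -> only_atom L B ->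
  covers sub0 Z -> Z <=s Y -> Z <=s subadd A B.
Proof.
have half K' L' A' : dsum Y K' L' -> only_atom K' A' -> covers sub0 Z -> Z <=s Y -> Z <=s subadd L' A'.
  move=> d oA c ZY; apply: (@subs_trans _ _ (subadd Z L')); first exact: subaddl.
  rewrite (dsum_in d (X := subadd Z L')); [|exact: subaddr|by apply: subadd_lub => //; apply: dsum_subr d].
  apply: subaddS => //; rewrite subIC; apply: (only_atom_small oA); first exact: capr.
  by apply: leq_trans (dsum_capl_rk d ZY) _; rewrite (rk_atom flM c).
move=> d oA oB c ZY.
have h1 := half _ _ _ d oA c ZY; have h2 := half _ _ _ (dsumC d) oB c ZY.
have [_ AK _] := oA; have [_ BL _] := oB.
have <- : subI (subadd A L) (subadd K B) = subadd A B.
  rewrite modular; last by apply: subs_trans AK (@subaddl _ _ _ _).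
  by rewrite subIC (subaddC K) (dsum_cap (dsumC d) BL).
by apply: subI_glb => //; rewrite subaddC.
Qed.

Section CoversCore.
Variables Y J : submodClosed M.
Hypothesis hJ : forall L, covers L Y -> J <=s L.

(** Two atoms [A] and [B] of [K] are maximal in it, so [A + L] and [B + L] are maximal in [Y], and
    [J] lies in their intersection [L]. It also lies in a maximal submodule of [L], so it is shorter
    than [L]. *)
Lemma dsum_only_atom K L : dsum Y K L -> rk K = 2%N -> L <> sub0 -> (rk L <= rk J)%N ->
  exists A, only_atom K A.
Proof.
move=> d rK L0 rJ.
have K0 : K <> sub0 by move=> e; move: rK; rewrite e rk0.
have [A AK cA] := ex_atom flM K0; exists A; split=> // B cB BK; apply: contrapT => nBA.
have cov Z : covers sub0 Z -> Z <=s K -> covers Z K.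
  by move=> c ZK; apply: (rkP_covers flM) => //; rewrite rK (rk_atom flM c).
have JA := hJ (dsum_cover d (cov _ cA AK)); have JB := hJ (dsum_cover d (cov _ cB BK)).
have AB0 : subI B A = sub0.
  apply: subI_atom => // h; apply: nBA; apply: (rk_eq flM) => //.
  by rewrite (rk_atom flM cA) (rk_atom flM cB).
have JL : J <=s L.
  have e : subI (subadd L B) (subadd A L) = L.
    rewrite modular; last exact: subaddr.
    apply: subadd_absr; apply: (@subs_trans _ _ sub0); last exact: sub0s.
    rewrite -AB0; apply: subI_glb; first exact: capl.
    apply: (@subs_trans _ _ (subI (subadd A L) K)); last by rewrite (dsum_cap d AK).
    by apply: subI_glb; [exact: capr|apply: subs_trans (@capl _ _ _ _) BK].
  by rewrite -e; apply: subI_glb => //; rewrite subaddC.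
have [X _ cX] := ex_coversr flM (@sub0s _ _ L) (nesym L0).
have JX : J <=s X.
  have [XL _ _] := cX; rewrite -(dsum_cap (dsumC d) XL); apply: subI_glb => //.
  exact: (hJ (dsum_cover (dsumC d) cX)).
by have := rkS flM JX; have := rk_covers flM cX; lia.
Qed.

(** [K] is maximal in [Y] because [L] is simple, so [J] lies in [K] and then in every maximal
    submodule of [K]. Two of these meet in length 1, too short for [J]. *)
Lemma dsum_unique_max K L : dsum Y K L -> covers sub0 L -> rk K = 3%N -> (2 <= rk J)%N -> exists X, unique_max K X.
Proof.
move=> d cL rK rJ; apply/unique_max_subm => //; apply: contrapT => nl.
have K0 : K <> sub0 by move=> e; move: rK; rewrite e rk0.
have [A [B [cA cB nAB]]] := nonlocal_two_covers flM K0 nl.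
have JZ Z : covers Z K -> J <=s Z.
  move=> c; have [ZK _ _] := c; have JK : J <=s K.
    by rewrite -(subadd_absl (@sub0s _ _ K)); apply: hJ; apply: (dsum_cover (dsumC d) cL).
  by rewrite -(dsum_cap d ZK); apply: subI_glb => //; apply: hJ; apply: dsum_cover d c.
have nBA : ~ B <=s A.
  by move=> h; apply: nAB; apply/esym/(rk_eq flM) => //; have := rk_covers flM cA; have := rk_covers flM cB; lia.
have [AK _ _] := cA; have [BK _ _] := cB.
have e : subadd A B = K.
  apply: (rk_eq flM); first exact: subadd_lub.
  rewrite (rk_covers flM cA); apply: (rk_lt flM (@subaddl _ _ A B)) => eA.
  by apply: nBA; rewrite eA; apply: subaddr.
have := rkS flM (subI_glb (JZ _ cA) (JZ _ cB)); have := rkD flM A B.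
by rewrite e; have := rk_covers flM cA; have := rk_covers flM cB; lia.
Qed.

End CoversCore.
End DirectSum.

Lemma chain_atom (S : pzRingType) (M : lmodType S) (Z : submodClosed M) : flen M -> covers sub0 Z -> chain_below Z.
Proof.
move=> flM c X Y XZ YZ; have [->|X0] := pselect (X = sub0); first by left; apply: sub0s.
by right; have -> // : X = Z; apply: (rk_eq flM) => //; rewrite (rk_atom flM c) rk_gt0.
Qed.

(** [N] embeds in [P / S1] as its radical, so [local_local_rad] makes [N1] local; having length 2,
    it is a chain. *)
Lemma dsum_local_chain (S : pzRingType) (P : lmodType S) (Y N S1 N1 : submodClosed P) :
  (forall M : lmodType S, flen M -> indecomposable M -> ~ local_module M -> (len M <= 4)%N) ->
  flen P -> unique_max subT Y -> dsum Y N S1 -> unique_max N N1 -> rk N = 3%N -> chain_below N.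
Proof.
move=> nak flP uY d uN rN.
have rN1 : rk N1 = 2%N by have := rk_covers flP uN.1; lia.
pose g : {linear subm N -> quom S1} := proj S1 \o incl N.
have [[N1N _ _] _] := uN.
have gi : linj g.
  move=> x /projP h; apply: (@incl_inj _ _ N); apply/eqP; rewrite -in_sub0 -d.2.
  by rewrite in_subI inclP.
have eQ : limg g subT = limg (proj S1) Y.
  apply: subsub_anti => _ /limgP[x xY <-].
    by apply: mem_limg; apply: (dsum_subl d); exact: inclP.
  have := xY; rewrite -d.1 => /subaddP[y yN h]; have [z ez] := ex_incl yN.
  apply/limgP; exists z => //; apply: etrans (congr1 (proj S1) ez) _; apply/eqP.
  by rewrite eq_sym -subr_eq0 -linearB proj_eq0.
have kY : S1 <=s Y := dsum_subr d.
have uQ : unique_max subT (limg (proj S1) Y) by apply: local_quom.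
have uH : unique_max (limg (proj S1) Y) (limg g (lpre (incl N) N1)).
  rewrite -eQ; apply: unique_max_img; first exact: unique_max_pull.
  by rewrite (lker0 gi); apply: sub0s.
have fQ : flen (quom S1) := flen_quom S1 flP; have fN : flen (subm N) := flen_subm N flP.
have H0 : limg g (lpre (incl N) N1) <> sub0.
  move=> e; have := rk_limg_inj fN fQ (lpre (incl N) N1) gi.
  by rewrite e rk0 // rk_pull // rN1.
have lo := local_local_rad nak fQ uQ uH H0.
have lo1 : local_module (subm N1).
  apply: local_iso lo; first exact: flen_subm.
  apply: mod_iso_trans (subm_pull_iso N1N).
  exact/mod_iso_sym/subm_iso.
have [Z uZ] := (unique_max_subm N1 flP).1 lo1.
apply: (chain_unique_max uN); apply: (chain_unique_max uZ); apply: chain_atom => //.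
by apply: (atom_rk flP); have := rk_covers flP uZ.1; lia.
Qed.

(** * Automorphisms of an indecomposable projective module *)

Section Automorphisms.
Variables (R : comPzRingType) (A : algType R).
Hypothesis (nakA : right_Nakayama A 4).
Variables (P : lmodType A^c) (Y : submodClosed P).
Hypotheses (flP : flen P) (prP : projective P) (uY : unique_max subT Y).
Implicit Types K L X Z : submodClosed P.
Let J := subpush (modrad (subm Y)).
Let JL L : covers L Y -> J <=s L := @radpush_sub _ _ Y L.
Let flW : flen (quom J) := flen_quom J flP.

Lemma quom_rad_inter K L : rk Y = (rk J + 2)%N -> covers K Y -> covers L Y -> K <> L -> subI K L = J.
Proof.
move=> rY cK cL n; apply/esym/(rk_eq flP); first by apply: subI_glb; apply: JL.
have [KY _ _] := cK; have [LY _ _] := cL.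
have e : subadd K L = Y.
  apply: (rk_eq flP); first exact: subadd_lub.
  rewrite (rk_covers flP cK); apply: (rk_lt flP (@subaddl _ _ K L)) => eK.
  by apply: n; apply/esym/(rk_eq flP); [rewrite eK; apply: subaddr|have := rk_covers flP cK; have := rk_covers flP cL; lia].
by have := rkD flP K L; rewrite e; have := rk_covers flP cK; have := rk_covers flP cL; lia.
Qed.

Lemma proj_inter0 K L : J <=s K -> J <=s L -> subI K L = J ->
  subI (limg (proj J) K) (limg (proj J) L) = sub0.
Proof.
move=> JK JL' e; apply: subs0 => z; rewrite in_subI => /andP[/limgP[x xK <-] /limgP[y yL exy]].
rewrite in_sub0 proj_eq0 -e in_subI xK /=.
by apply: (memBr (y := y)) => //; apply: JL'; rewrite -proj_eq0 linearB exy subrr.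
Qed.

(** A lift is onto modulo [J], hence onto, because [J] lies in the radical of [P]. *)
Lemma lift_auto (f : {linear quom J -> quom J}) : linj f -> lsurj f ->
  exists h : {linear P -> P}, [/\ linj h, lsurj h & forall x, proj J (h x) = f (proj J x)].
Proof.
move=> fi fs; have [h hE] := prP (f \o proj J) (@proj_surj _ _ J).
have hs : lsurj h.
  apply: (local_surj uY) => hY; have [[_ n _] _] := uY; apply: n; apply: subTs => x _.
  have [w ew] := fs (proj J x); have [y ey] := proj_surj w.
  apply: (memBr (y := h y)); last exact/hY/mem_limg.
  apply: (radpush_subY); rewrite -/J -proj_eq0 linearB hE; apply/eqP.
  by rewrite -ew -ey subrr.
exists h; split=> //; exact: (lsurj_inj flP flP hs).
Qed.

Lemma auto_inverse (h : {linear P -> P}) K L : linj h -> lsurj h -> limg h K = L ->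
  exists h' : {linear P -> P}, [/\ linj h', lsurj h' & limg h' L = K].
Proof.
move=> hi hs <-; have [g [gh hg]] := lin_inverse hi hs; exists g; split.
- by move=> y ey; rewrite -(hg y) ey linear0.
- by move=> x; exists (h x); rewrite gh.
- apply: subsub_anti => [_ /limgP[_ /limgP[x xK <-] <-]|x xK]; first by rewrite gh.
  by rewrite -(gh x); apply/mem_limg/mem_limg.
Qed.

(* K / J and L / J are isomorphic, both being complements of L' / J. Amalgamating
   P / J with itself along them gives an automorphism of P / J, which lifts to P. *)
Lemma auto_max_glue K L L' : rk Y = (rk J + 2)%N -> covers K Y -> covers L Y -> covers L' Y ->
  K <> L' -> L <> L' -> exists h : {linear P -> P}, [/\ linj h, lsurj h & limg h K = L].
Proof.
move=> rY cK cL cL' nK nL.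
have KY : K <=s Y by case: cK. have LY : L <=s Y by case: cL. have LY' : L' <=s Y by case: cL'.
have rK := rk_covers flP cK; have rL := rk_covers flP cL; have rL' := rk_covers flP cL'.
pose p := proj J; pose X Z := limg p Z.
have eY Z : covers Z Y -> Z <> L' -> subadd (X Z) (X L') = X Y.
  move=> cZ nZ; rewrite -limg_add; congr limg; have [ZY _ _] := cZ.
  apply: (rk_eq flP); first exact: subadd_lub.
  rewrite (rk_covers flP cZ); apply: (rk_lt flP (@subaddl _ _ Z L')) => e.
  apply: nZ; apply/esym/(rk_eq flP); first by rewrite e; apply: subaddr.
  by have := rk_covers flP cZ; lia.
have i0 Z : covers Z Y -> Z <> L' -> subI (X Z) (X L') = sub0.
  by move=> cZ nZ; apply: proj_inter0; [apply: JL|apply: JL|apply: quom_rad_inter].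
have rX Z : covers Z Y -> rk (X Z) = 1%N.
  move=> cZ; have := rk_limg_ker (f := p) flP flW (K := Z); rewrite lker_proj => /(_ (JL cZ)).
  by rewrite -/(X Z); have := rk_covers flP cZ; lia.
have [g [gi gs]] := iso_lin (compl_iso (etrans (eY _ cK nK) (esym (eY _ cL nL))) (i0 _ cK nK) (i0 _ cL nL)).
have cX : covers sub0 (X K) by apply: (atom_rk flW); apply: rX.
have uQ : unique_max subT (X Y) by apply: local_quom => //; apply: radpush_subY.
have loQ : local_module (quom J) by apply/unique_maxP => //; exists (X Y).
have lQ : len (quom J) = 3%N.
  by have := len_quom J flP; have := rk_covers flP uY.1; rewrite -/(len P); lia.
have iv : linj (incl (X L) \o g) by move=> t e; apply: gi; apply: incl_inj; exact: e.
have XY Z : Z <=s Y -> X Z <=s X Y by apply: limgS.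
have fin (f : {linear quom J -> quom J}) Z Z' (T : lmodType A^c) (u v : {linear T -> quom J}) :
    simple_module T -> covers Z Y -> covers Z' Y -> limg u subT = X Z -> limg v subT = X Z' -> linj v ->
    (forall t, f (u t) = v t) -> exists h : {linear P -> P}, [/\ linj h, lsurj h & limg h Z = Z'].
  move=> sT cZ cZ' eu ev vi fE; have [ZY _ _] := cZ.
  have [t0 nt0] : exists t0 : T, t0 <> 0.
    by apply: nonzero_elt; have /simpleP[] := sT.
  have fi : linj f.
    apply: (kill_inj flW uQ (@quom_rad0 _ _ _ Y) (x := u t0)).
    - by apply: (XY _ ZY); rewrite -eu; apply: mem_limg.
    - by rewrite fE => /vi.
  have [h [hi hs hE]] := lift_auto fi (linj_surj flW flW fi (leqnn _)).
  exists h; split=> //; have rZ := rk_covers flP cZ; have rZ' := rk_covers flP cZ'.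
  apply: (rk_eq flP); last by rewrite rk_limg_inj //; lia.
  move=> _ /limgP[x xZ <-].
  have : p x \in X Z by apply: mem_limg.
  rewrite -eu => /limgP[t _ et].
  have : v t \in X Z' by rewrite -ev; apply: mem_limg.
  rewrite -fE et -hE => /limgP[y yZ' ey].
  apply: (memBr (y := y)) => //; apply: (JL cZ'); rewrite -proj_eq0 linearB.
  by rewrite -[proj J y]/(p y) ey subrr.
have e1 : limg (incl (X K)) subT = X K := limg_incl _.
have e2 : limg (incl (X L) \o g) subT = X L.
  apply: subsub_anti => [_ /limgP[t _ <-]|x xL]; first exact: inclP.
  have [y <-] := ex_incl xL; have [t <-] := gs y.
  by apply/limgP; exists t.
have sT : simple_module (subm (X K)) by apply/simple_subm.
have [|[f fE]|[f fE]] := amalgam (nonlocal_len nakA) flW flW sT loQ loQ (@incl_inj _ _ (X K)) iv.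
- by rewrite lQ.
- exact: (fin f K L _ _ _ sT cK cL e1 e2 iv fE).
have [h [hi hs hE]] := fin f L K _ _ _ sT cL cK e2 e1 (@incl_inj _ _ (X K)) fE.
exact: (auto_inverse hi hs hE).
Qed.


Section TwoChains.
Variables N1 N2 S1 S2 : submodClosed P.
Hypotheses (d : dsum Y N1 N2) (r1 : rk N1 = 2%N) (r2 : rk N2 = 2%N).
Hypotheses (o1 : only_atom N1 S1) (o2 : only_atom N2 S2) (rJ : (2 <= rk J)%N).

(** [J] lies in the intersection of the maximal submodules [S1 + N2] and [N1 + S2], which is
    [S1 + S2]; its length gives equality. *)
Lemma two_chains_rad : J = subadd S1 S2 /\ dsum J S1 S2.
Proof.
have [c1 h1 _] := o1; have [c2 h2 _] := o2.
have rS1 := rk_atom flP c1; have rS2 := rk_atom flP c2.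
have d12 := dsum_sub d h1 h2.
have e : J = subadd S1 S2.
  apply: (rk_eq flP); last by rewrite (dsum_rk flP d12) rS1 rS2.
  have k1 : covers S1 N1 by apply: (rkP_covers flP) => //; rewrite r1 rS1.
  have k2 : covers S2 N2 by apply: (rkP_covers flP) => //; rewrite r2 rS2.
  have J1 := JL (dsum_cover flP d k1); have J2 := JL (dsum_cover flP (dsumC d) k2).
  have <- : subI (subadd S1 N2) (subadd N1 S2) = subadd S1 S2.
    rewrite modular; last by apply: subs_trans h1 (@subaddl _ _ _ _).
    by rewrite subIC (subaddC N1) (dsum_cap (dsumC d) h2).
  by apply: subI_glb => //; rewrite subaddC.
by split=> //; rewrite [J]e.
Qed.

(** A nonsurjective [f] maps [P] into [Y] and [Y] into [J], which is semisimple. So the chains [N1]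
    and [N2] of length 2 have their socles killed. *)
Lemma nonsurj_kills_rad (f : {linear P -> P}) : ~ lsurj f -> J <=s lker f.
Proof.
move=> nf; have [eJ dJ] := two_chains_rad.
have fY : limg f subT <=s Y.
  by apply: uY.2 => // /limgT_surj.
have fYJ : limg f Y <=s J.
  apply: sub_radpush; first by apply: subs_trans (limgS (f := f) (@subsT _ _ Y)) fY.
  move=> L cL; have [h|h] := pselect (limg f subT <=s L).
    exact: subs_trans (limgS (f := f) (@subsT _ _ Y)) h.
  have [_ n cov] := covers_lpre_sub cL fY h; have [_ nY _] := uY.1.
  have [//|e|e] := cov Y _ (@subsT _ _ _); first exact: uY.2.
    by move=> _ /limgP[x xY <-]; move: xY; rewrite e in_subI => /andP[].
  by case: nY.
have kill K Z Z' : only_atom K Z -> rk K = 2%N -> K <=s Y -> covers Z' J -> limg f Z <=s Z'.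
  move=> [cZ ZK uZ] rK KY cZ'.
  have fK : limg f K <=s J by apply: subs_trans (limgS (f := f) KY) fYJ.
  have [h|h] := pselect (limg f K <=s Z'); first exact: subs_trans (limgS (f := f) ZK) h.
  have c := covers_lpre_sub cZ' fK h; have := rk_covers flP c; rewrite rK => -[/esym/(atom_rk flP) c'].
  rewrite -(uZ _ c'); last exact: capr.
  by move=> _ /limgP[x + <-]; rewrite in_subI => /andP[].
have [c1 h1 _] := o1; have [c2 h2 _] := o2.
have rS1 := rk_atom flP c1; have rS2 := rk_atom flP c2.
have rJ2 : rk J = 2%N by rewrite (dsum_rk flP dJ) rS1 rS2.
have k1 : covers S1 J by apply: (rkP_covers flP); [apply: dsum_subl dJ|rewrite rJ2 rS1].
have k2 : covers S2 J by apply: (rkP_covers flP); [apply: dsum_subr dJ|rewrite rJ2 rS2].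
have kill0 K Z x : only_atom K Z -> rk K = 2%N -> K <=s Y -> x \in Z -> f x = 0.
  move=> oK rK KY xZ; apply/eqP; rewrite -in_sub0 -dJ.2 in_subI.
  by apply/andP; split; [apply: (kill K Z)|apply: (kill K Z)] => //; apply: mem_limg.
move=> x; rewrite eJ => /subaddP[y y1 y2]; rewrite in_lker -[x](subrK y) linearD.
by rewrite (kill0 N1 S1 y) // ?(kill0 N2 S2 (x - y)) ?addr0 //; [apply: dsum_subr d|apply: dsum_subl d].
Qed.

(** [P], of length 5, is amalgamated with itself. A nonsurjective map would kill [J] and with it the
    glued atom. *)
Lemma auto_atom_glue Z Z' : covers sub0 Z -> covers sub0 Z' -> Z <=s J -> Z' <=s J ->
  mod_iso (subm Z) (subm Z') -> exists h : {linear P -> P}, [/\ linj h, lsurj h & limg h Z = Z'].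
Proof.
move=> cZ cZ' ZJ Z'J /iso_lin[g [gi gs]].
have loP : local_module P by apply/unique_maxP => //; exists Y.
have lP : len P = 5%N.
  by have := rk_covers flP uY.1; rewrite (dsum_rk flP d) r1 r2.
have iv : linj (incl Z' \o g) by move=> t e; apply: gi; apply: incl_inj; exact: e.
have fin (f : {linear P -> P}) X X' (T : lmodType A^c) (u v : {linear T -> P}) :
    simple_module T -> covers sub0 X -> covers sub0 X' -> X <=s J -> limg u subT = X ->
    limg v subT = X' -> linj v ->
    (forall t, f (u t) = v t) -> exists h : {linear P -> P}, [/\ linj h, lsurj h & limg h X = X'].
  move=> sT cX cX' XJ eu ev vi fE.
  have [t0 nt0] : exists t0 : T, t0 <> 0 by apply: nonzero_elt; have /simpleP[] := sT.
  have fs : lsurj f.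
    apply: contrapT => /nonsurj_kills_rad k; apply/nt0/vi; rewrite -fE; apply/lkerP/k/XJ.
    by rewrite -eu; apply: mem_limg.
  have fi := lsurj_inj flP flP fs (leqnn _).
  exists f; split=> //; apply: (rk_eq flP).
    by move=> _ /limgP[x + <-]; rewrite -eu -ev => /limgP[t _ <-]; rewrite fE; apply: mem_limg.
  by rewrite rk_limg_inj // (rk_atom flP cX) (rk_atom flP cX').
have e1 : limg (incl Z) subT = Z := limg_incl _.
have e2 : limg (incl Z' \o g) subT = Z'.
  apply: subsub_anti => [_ /limgP[t _ <-]|x xL]; first exact: inclP.
  have [y <-] := ex_incl xL; have [t <-] := gs y.
  by apply/limgP; exists t.
have sT : simple_module (subm Z) by apply/simple_subm.
have [|[f fE]|[f fE]] := amalgam (nonlocal_len nakA) flP flP sT loP loP (@incl_inj _ _ Z) iv.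
- by rewrite lP.
- exact: (fin f Z Z' _ _ _ sT cZ cZ' ZJ e1 e2 iv fE).
have [h [hi hs hE]] := fin f Z' Z _ _ _ sT cZ' cZ Z'J e2 e1 (@incl_inj _ _ Z) fE.
exact: (auto_inverse hi hs hE).
Qed.

End TwoChains.
End Automorphisms.

(** * Quotients of indecomposable projective modules *)

Section Builders.
Variables (R : comPzRingType) (A : algType R).
Hypotheses (artA : artin_algebra A) (nakA : right_Nakayama A 4).
Variables (P : lmodType A^c) (Y : submodClosed P).
Hypotheses (flP : flen P) (uY : unique_max subT Y).
Implicit Types K L N X Z : submodClosed P.

Lemma proper_cases K : K <> sub0 -> K <> subT ->
  K = Y \/ K <=s Y /\ (0 < rk K < rk Y)%N.
Proof.
move=> K0 KT; have KY := uY.2 _ (@subsT _ _ _) KT.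
have [->|n] := pselect (K = Y); [by left|right].
by split=> //; rewrite rk_gt0 // rk_lt.
Qed.

Lemma len_rad : len P = (rk Y).+1. Proof. by rewrite /len (rk_covers flP uY.1). Qed.

Lemma eq_rad : modrad P = Y. Proof. exact: modrad_unique_max. Qed.

Lemma atom_rad Z : covers sub0 Z -> (2 <= rk Y)%N -> Z <=s Y.
Proof.
move=> cZ r; apply: uY.2 => // e; have := rk_atom flP cZ.
by have := len_rad; rewrite /len -e; lia.
Qed.

Hypothesis nlY : ~ local_module (subm Y).

(** A simple [K] is taken as one of the two summands, so that it is literally on the list. *)
Lemma caseB K : rk Y = 2%N -> K <> sub0 -> K <> subT ->
  factor_serial 2 P /\
  exists S1 S2 : submodClosed P,
    [/\ simple_module (subm S1), simple_module (subm S2),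
        modrad P = modsoc P, is_dsum (modsoc P) S1 S2 &
    exists2 X, X \in [:: modrad P; S1; S2] & mod_iso (quom K) (quom X)].
Proof.
move=> rY K0 KT; split.
  by apply: (factor_serial_local flP _ _ uY nlY); rewrite ?len_rad ?rY.
have Y0 : Y <> sub0 by move=> e; move: rY; rewrite e rk0.
have [L1 [L2 [c1 c2 n12]]] := nonlocal_two_covers flP Y0 nlY.
have at1 L : covers L Y -> covers sub0 L.
  by move=> c; apply: (atom_rk flP); have := rk_covers flP c; rewrite rY => -[].
have dec L L' : covers L Y -> covers L' Y -> L <> L' -> modsoc P = Y /\ is_dsum Y L L'.
  move=> c c' n; have [LY _ _] := c; have [LY' _ _] := c'.
  have i0 : subI L L' = sub0.
    apply: subI_atom (at1 _ c) _ => h; apply: n; apply: (rk_eq flP) => //.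
    by rewrite (rk_atom flP (at1 _ c)) (rk_atom flP (at1 _ c')).
  have [e _] : dsum Y L L'.
    by apply: rk_dsum => //; rewrite rY (rk_atom flP (at1 _ c)) (rk_atom flP (at1 _ c')).
  split; last by apply/is_dsumE; rewrite e.
  rewrite -e; apply: modsocE; [exact: at1|exact: at1|].
  by move=> Z cZ; rewrite e; apply: atom_rad; rewrite ?rY.
have fin L L' X : covers L Y -> covers L' Y -> L <> L' -> X \in [:: Y; L; L'] ->
    mod_iso (quom K) (quom X) -> exists S1 S2 : submodClosed P,
    [/\ simple_module (subm S1), simple_module (subm S2),
        modrad P = modsoc P, is_dsum (modsoc P) S1 S2 &
    exists2 X, X \in [:: modrad P; S1; S2] & mod_iso (quom K) (quom X)].
  move=> c c' n XL i; have [e d] := dec _ _ c c' n.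
  by exists L, L'; rewrite e eq_rad; split; rewrite ?simple_subm //; [exact: at1|exact: at1|exists X].
have [eK|[KY rK]] := proper_cases K0 KT.
  by apply: (fin L1 L2 Y) => //; rewrite ?inE ?eqxx // eK; apply: mod_iso_refl.
have cK : covers K Y by apply: (rkP_covers flP) => //; move: rK; rewrite rY; lia.
have [e|n] := pselect (K = L1).
  by apply: (fin L1 L2 K) => //; rewrite ?inE e ?eqxx ?orbT //; apply: mod_iso_refl.
by apply: (fin K L1 K) => //; rewrite ?inE ?eqxx ?orbT //; apply: mod_iso_refl.
Qed.

(** Submodules of length 2 are conjugate under automorphisms of [Y], which need not extend to [P]; a
    [K] of length 2 is therefore itself listed as [N1]. *)
Lemma caseC K : indecomposable (subm Y) -> rk Y = 3%N -> K <> sub0 -> K <> subT ->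
  [/\ factor_serial 3 P, colocal P, factor_serial 3 (subm (modrad P)),
      has_length (subm (modrad P)) 3 & ~ local_module (subm (modrad P))] /\
  exists N1 N2 : submodClosed P,
    [/\ uniserial (subm N1) /\ has_length (subm N1) 2,
        uniserial (subm N2) /\ has_length (subm N2) 2,
        simple_module (subm (modsoc P)),
        submodules_are [:: modrad P; N1; N2; modsoc P] &
    exists2 X, X \in [:: modrad P; N1; N2; modsoc P] & mod_iso (quom K) (quom X)].
Proof.
move=> iY rY K0 KT; rewrite eq_rad.
have flY := flen_subm Y flP.
have lY : len (subm Y) = 3%N by rewrite len_subm.
have [S' cS'] := len3_colocal flY lY nlY iY.
pose S := limg (incl Y) S'.
have cS : covers sub0 S by have := covers_push cS'.1; rewrite limg0.
have rS := rk_atom flP cS.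
have rp L : L <=s Y -> rk (lpre (incl Y) L) = rk L by apply: rk_pull.
have SK L : L <=s Y -> L <> sub0 -> S <=s L.
  move=> LY L0; rewrite -(limg_incl_lpre LY); apply: limgS; apply: cS'.2 => e; apply: L0.
  by rewrite -(limg_incl_lpre LY) e limg0.
have eS : modsoc P = S.
  apply: modsoc1E => // Z cZ; have [_ n _] := cZ.
  have SZ : S <=s Z by apply: SK (nesym n); apply: atom_rad; rewrite ?rY.
  by rewrite (rk_eq flP SZ) // rS (rk_atom flP cZ).
have sS : simple_module (subm S) by apply/simple_subm.
split.
  split=> //.
  - by apply: (factor_serial_local flP _ _ uY nlY); rewrite ?len_rad ?rY.
  - by rewrite /colocal eS.
  - exact: factor_serial_nonlocal.
  - exact/has_length_subm.
rewrite eS.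
have mp L : L <=s Y -> rk L = 2%N -> maximal_submod (lpre (incl Y) L).
  by move=> LY rL; apply: maximal_pull; apply: (rkP_covers flP) => //; rewrite rY rL.
have conj L L1 L2 : L <=s Y -> L1 <=s Y -> L2 <=s Y -> rk L = 2%N -> rk L1 = 2%N -> rk L2 = 2%N ->
    L1 <> L2 -> L = L2 \/ mod_iso (subm L) (subm L1).
  move=> LY LY1 LY2 r r1 r2 n.
  have [|e|[i _]] := max_conj3 nakA flY lY nlY cS' (mp _ LY r) (mp _ LY1 r1) (mp _ LY2 r2).
  - by move=> e; apply: n; apply: pull_inj e.
  - by left; apply: pull_inj e.
  right; apply: mod_iso_trans (mod_iso_sym (subm_pull_iso LY)) _.
  exact: mod_iso_trans i (subm_pull_iso LY1).
have uni L : L <=s Y -> rk L = 2%N -> uniserial (subm L) /\ has_length (subm L) 2.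
  move=> LY rL; split; last exact/has_length_subm.
  apply/uniserial_subm => //; apply: (chain_rank2 flP (Z := S)); rewrite ?rL // => X cX XL.
  have [_ n _] := cX; apply/esym/(rk_eq flP); last by rewrite rS (rk_atom flP cX).
  by apply: SK (nesym n); apply: subs_trans XL LY.
have fin L1 L2 X : L1 <=s Y -> L2 <=s Y -> rk L1 = 2%N -> rk L2 = 2%N -> L1 <> L2 ->
    X \in [:: Y; L1; L2; S] -> mod_iso (quom K) (quom X) ->
    exists N1 N2 : submodClosed P,
    [/\ uniserial (subm N1) /\ has_length (subm N1) 2,
        uniserial (subm N2) /\ has_length (subm N2) 2,
        simple_module (subm S),
        submodules_are [:: Y; N1; N2; S] &
    exists2 X, X \in [:: Y; N1; N2; S] & mod_iso (quom K) (quom X)].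
  move=> LY1 LY2 r1 r2 n XL i; exists L1, L2; split=> //; [exact: uni|exact: uni| |by exists X].
  split.
  - by uniq_goals => //; try (by apply: nesym); apply: rk_neq; rewrite ?rY ?rS ?r1 ?r2.
  - by move=> L; rewrite !inE => /or4P[]/eqP->; apply: proper_rk => //; rewrite ?rY ?rS ?r1 ?r2 len_rad rY.
  - move=> L L0 LT; have [->|[LY rL]] := proper_cases L0 LT.
      by exists Y; rewrite ?inE ?eqxx //; apply: mod_iso_refl.
    have [e|ne] := pselect (rk L = 1%N).
      exists S; rewrite ?inE ?eqxx ?orbT //.
      by rewrite (rk_eq flP (SK _ LY L0)) ?e ?rS //; apply: mod_iso_refl.
    have {ne}rL2 : rk L = 2%N by move: rL; rewrite rY; lia.
    have [->|j] := conj L L1 L2 LY LY1 LY2 rL2 r1 r2 n.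
      by exists L2; rewrite ?inE ?eqxx ?orbT //; apply: mod_iso_refl.
    by exists L1; rewrite ?inE ?eqxx ?orbT.
have Y0 : Y <> sub0 by move=> e; move: rY; rewrite e rk0.
have [L1 [L2 [c1 c2 n12]]] := nonlocal_two_covers flP Y0 nlY.
have [LY1 _ _] := c1; have [LY2 _ _] := c2.
have r1 : rk L1 = 2%N by have := rk_covers flP c1; rewrite rY => -[].
have r2 : rk L2 = 2%N by have := rk_covers flP c2; rewrite rY => -[].
have [eK|[KY rK]] := proper_cases K0 KT.
  by apply: (fin L1 L2 Y) => //; rewrite ?inE ?eqxx // eK; apply: mod_iso_refl.
have [e|ne] := pselect (rk K = 1%N).
  apply: (fin L1 L2 S) => //; rewrite ?inE ?eqxx ?orbT //.
  by rewrite (rk_eq flP (SK _ KY K0)) ?e ?rS //; apply: mod_iso_refl.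
have {ne}rK2 : rk K = 2%N by move: rK; rewrite rY; lia.
have [e|n] := pselect (K = L1).
  by apply: (fin L1 L2 K) => //; rewrite ?inE e ?eqxx ?orbT //; apply: mod_iso_refl.
by apply: (fin K L1 K) => //; rewrite ?inE ?eqxx ?orbT //; apply: mod_iso_refl.
Qed.

(** The radical has the lattice of case (I), with [N1] the core [D]. A [K] of length 3 other than
    [M2] serves as [M1], and a [K] of length 2 other than [D] serves as [N2]. *)
Lemma caseE K : indecomposable (subm Y) -> rk Y = 4%N -> K <> sub0 -> K <> subT ->
  [/\ colocal P, factor_serial 4 P, factor_serial 4 (subm (modrad P)),
      has_length (subm (modrad P)) 4 & ~ local_module (subm (modrad P))] /\
  exists M1 M2 N1 N2 : submodClosed P,
    [/\ has_length (subm M1) 3 /\ uniserial (subm M1),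
        [/\ has_length (subm M2) 3, ~ local_module (subm M2) &
            factor_serial 3 (subm M2)],
        uniserial (subm N1) /\ has_length (subm N1) 2 &
        uniserial (subm N2) /\ has_length (subm N2) 2] /\
    [/\ {subset N1 <= M1}, {subset N1 <= M2}, {subset N2 <= M2},
        simple_module (subm (modsoc P)) &
        submodules_are [:: modrad P; M1; M2; N1; N2; modsoc P]] /\
    exists2 X, X \in [:: modrad P; M1; M2; N1; N2; modsoc P] &
      mod_iso (quom K) (quom X).
Proof.
move=> iY rY K0 KT; rewrite eq_rad.
have flY := flen_subm Y flP.
have lY : len (subm Y) = 4%N by rewrite len_subm.
have [S' cS'] := rad_colocal artA nakA flP uY iY nlY rY.
have [D' [M2' [/(colocal4_push flP) + _]]] := colocal4P artA nakA flY iY lY nlY cS'.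
move: (limg _ S') (limg _ D') (limg _ M2') => S D M2.
move=> [[cS SY SK] [[rD rM2 DM2 M2Y nl2] [[[L1 [LY1 rL1 nL1]] [L2 [LY2 rL2 nL2]] h3 h2 i3] i2]]].
have rS := rk_atom flP cS; have DY := subs_trans DM2 M2Y.
have eS : modsoc P = S.
  apply: modsoc1E => // Z cZ; have [_ n _] := cZ.
  have SZ : S <=s Z by apply: SK (nesym n); apply: atom_rad; rewrite ?rY.
  by rewrite (rk_eq flP SZ) // rS (rk_atom flP cZ).
have sS : simple_module (subm S) by apply/simple_subm.
split.
  split=> //.
  - by rewrite /colocal eS.
  - by apply: (factor_serial_local flP _ _ uY nlY); rewrite ?len_rad ?rY.
  - exact: factor_serial_nonlocal.
  - exact/has_length_subm.
rewrite eS.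
have uni L : L <=s Y -> rk L = 2%N -> uniserial (subm L) /\ has_length (subm L) 2.
  move=> LY rL; split; last exact/has_length_subm.
  apply/uniserial_subm => //; apply: (chain_rank2 flP (Z := S)); rewrite ?rL // => X cX XL.
  have [_ n _] := cX; apply/esym/(rk_eq flP); last by rewrite rS (rk_atom flP cX).
  by apply: SK (nesym n); apply: subs_trans XL LY.
have fin M1 N2 X : M1 <=s Y -> N2 <=s Y -> rk M1 = 3%N -> rk N2 = 2%N -> M1 <> M2 -> N2 <> D ->
    X \in [:: Y; M1; M2; D; N2; S] -> mod_iso (quom K) (quom X) ->
    exists M1 M2 N1 N2 : submodClosed P,
    [/\ has_length (subm M1) 3 /\ uniserial (subm M1),
        [/\ has_length (subm M2) 3, ~ local_module (subm M2) &
            factor_serial 3 (subm M2)],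
        uniserial (subm N1) /\ has_length (subm N1) 2 &
        uniserial (subm N2) /\ has_length (subm N2) 2] /\
    [/\ {subset N1 <= M1}, {subset N1 <= M2}, {subset N2 <= M2},
        simple_module (subm S) &
        submodules_are [:: Y; M1; M2; N1; N2; S]] /\
    exists2 X, X \in [:: Y; M1; M2; N1; N2; S] & mod_iso (quom K) (quom X).
  move=> MY NY rM1 rN2 n1 n2 XL i; have [//|[DM1 ch1]] := h3 M1 MY rM1.
  exists M1, M2, D, N2; split; last split; last by exists X.
    split; [by split; [exact/has_length_subm|exact/uniserial_subm]| |exact: uni|exact: uni].
    split=> //; first exact/has_length_subm.
    by apply: factor_serial_nonlocal; rewrite ?len_subm //; apply: flen_subm.
  split=> //; first exact: h2.
  split.
  - by uniq_goals => //; try (by apply: nesym); apply: rk_neq; rewrite ?rY ?rS ?rM1 ?rM2 ?rD ?rN2.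
  - move=> L; rewrite !inE => /or4P[/eqP->|/eqP->|/eqP->|/or3P[]/eqP->]; apply: proper_rk => //;
      by rewrite ?rY ?rS ?rM1 ?rM2 ?rD ?rN2 len_rad rY.
  - move=> L L0 LT; have [->|[LY rL]] := proper_cases L0 LT.
      by exists Y; rewrite ?inE ?eqxx //; apply: mod_iso_refl.
    have [e|ne] := pselect (rk L = 1%N).
      exists S; rewrite ?inE ?eqxx ?orbT //.
      by rewrite (rk_eq flP (SK _ LY L0)) ?e ?rS //; apply: mod_iso_refl.
    have [e|ne2] := pselect (rk L = 2%N).
      have [->|j] := i2 L D N2 LY DY NY e rD rN2 (nesym n2).
        by exists N2; rewrite ?inE ?eqxx ?orbT //; apply: mod_iso_refl.
      by exists D; rewrite ?inE ?eqxx ?orbT.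
    have {ne ne2}rL3 : rk L = 3%N by move: rL; rewrite rY; lia.
    have [->|n] := pselect (L = M2).
      by exists M2; rewrite ?inE ?eqxx ?orbT //; apply: mod_iso_refl.
    by exists M1; rewrite ?inE ?eqxx ?orbT //; apply: i3.
have [eK|[KY rK]] := proper_cases K0 KT.
  by apply: (fin L1 L2 Y) => //; rewrite ?inE ?eqxx // eK; apply: mod_iso_refl.
have [e|ne] := pselect (rk K = 1%N).
  apply: (fin L1 L2 S) => //; rewrite ?inE ?eqxx ?orbT //.
  by rewrite (rk_eq flP (SK _ KY K0)) ?e ?rS //; apply: mod_iso_refl.
have [e2|ne2] := pselect (rk K = 2%N).
  have [eD|nD] := pselect (K = D).
    by apply: (fin L1 L2 K) => //; rewrite ?inE eD ?eqxx ?orbT //; apply: mod_iso_refl.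
  by apply: (fin L1 K K) => //; rewrite ?inE ?eqxx ?orbT //; apply: mod_iso_refl.
have {ne ne2}rK3 : rk K = 3%N by move: rK; rewrite rY; lia.
have [e|n] := pselect (K = M2).
  by apply: (fin L1 L2 K) => //; rewrite ?inE e ?eqxx ?orbT //; apply: mod_iso_refl.
by apply: (fin K L2 K) => //; rewrite ?inE ?eqxx ?orbT //; apply: mod_iso_refl.
Qed.

Let J := subpush (modrad (subm Y)).
Let hJ L : covers L Y -> J <=s L := @radpush_sub _ _ Y L.

(** A submodule of [Y] that misses [S1] projects into [N]; one that contains [S1] is [S1], the socle
    or [Y]. The summands are adapted to [K]: a complement of [S0] replaces [N0], and an atom outside
    [N0] replaces [S0]. *)
Lemma caseD N0 S0 K : dsum Y N0 S0 -> rk N0 = 2%N -> rk S0 = 1%N -> (0 < rk J)%N ->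
  K <> sub0 -> K <> subT ->
  factor_serial 3 P /\ ~ colocal P /\
  exists N S1 S2 : submodClosed P,
    [/\ is_dsum (modrad P) N S1,
        uniserial (subm N) /\ has_length (subm N) 2,
        simple_module (subm S1) &
        is_dsum (modsoc P) S1 S2 /\ subpush (modsoc (subm N)) = S2] /\
    submodules_are [:: modrad P; N; S1; modsoc P; S2] /\
    exists2 X, X \in [:: modrad P; N; modsoc P; S1; S2] & mod_iso (quom K) (quom X).
Proof.
move=> d0 r0 s0 rJ K0 KT; rewrite eq_rad.
have rY : rk Y = 3%N by rewrite (dsum_rk flP d0) r0 s0.
have st N S1 : dsum Y N S1 -> rk N = 2%N -> rk S1 = 1%N -> exists S2,
    [/\ only_atom N S2, dsum (subadd S1 S2) S1 S2 & modsoc P = subadd S1 S2].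
  move=> d r s.
  have [S2 o2] : exists S2, only_atom N S2.
    by apply: (dsum_only_atom flP hJ d); rewrite ?s // => e; move: s; rewrite e rk0.
  have [c2 S2N _] := o2; have c1 := atom_rk flP s.
  exists S2; split=> //.
    exact: dsum_sub (dsumC d) (@subs_refl _ _ S1) S2N.
  apply: modsocE => // Z cZ; rewrite subaddC.
  by apply: (dsum_atoms flP d o2 (only_atom_self flP c1) cZ); apply: atom_rad; rewrite ?rY.
have ns N S1 S2 : only_atom N S2 -> rk N = 2%N -> dsum (subadd S1 S2) S1 S2 -> rk S1 = 1%N ->
    rk (subadd S1 S2) = 2%N.
  by move=> [c _ _] r d s; rewrite (dsum_rk flP d) s (rk_atom flP c).
have inC N S1 S2 L : dsum Y N S1 -> rk N = 2%N -> rk S1 = 1%N -> only_atom N S2 ->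
    dsum (subadd S1 S2) S1 S2 -> S1 <=s L -> L <=s Y -> rk L = 2%N -> L = subadd S1 S2.
  move=> d r s o d12 h LY rL; have eL := dsum_in d h LY.
  apply: (rk_eq flP); last by rewrite (ns N) // rL.
  rewrite eL; apply: subaddS => //; apply: (only_atom_small flP o); first exact: capl.
  have := dsum_rk flP (dsum_sub (dsumC d) (@subs_refl _ _ S1) (@capl _ _ N L)).
  by rewrite -eL s rL; lia.
split; first by apply: (factor_serial_local flP _ _ uY nlY); rewrite ?len_rad ?rY.
split.
  have [S2 [o d e]] := st _ _ d0 r0 s0.
  by rewrite /colocal e => /(simple_rk _ flP); rewrite (ns N0).
have fin N S1 S2 X : dsum Y N S1 -> rk N = 2%N -> rk S1 = 1%N -> only_atom N S2 ->
    dsum (subadd S1 S2) S1 S2 -> modsoc P = subadd S1 S2 ->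
    X \in [:: Y; N; modsoc P; S1; S2] -> mod_iso (quom K) (quom X) ->
    exists N S1 S2 : submodClosed P,
    [/\ is_dsum Y N S1,
        uniserial (subm N) /\ has_length (subm N) 2,
        simple_module (subm S1) &
        is_dsum (modsoc P) S1 S2 /\ subpush (modsoc (subm N)) = S2] /\
    submodules_are [:: Y; N; S1; modsoc P; S2] /\
    exists2 X, X \in [:: Y; N; modsoc P; S1; S2] & mod_iso (quom K) (quom X).
  move=> d r s o d12 eC XL i; exists N, S1, S2; have [c2 S2N u2] := o.
  have rC := ns _ _ _ o r d12 s; have s2 := rk_atom flP c2.
  have nCN : N <> subadd S1 S2.
    move=> e; have [_ n _] := atom_rk flP s; apply: n; rewrite -d.2 subI_absr // e.
    exact: subaddl.
  have n12 : S1 <> S2.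
    move=> e; have [_ n _] := c2; apply: n; by rewrite -d12.2 e subI_absl.
  split; last split; last by exists X.
    split; [by apply/is_dsumE; have [-> ->] := d| |exact/simple_rk|].
      split; last exact/has_length_subm.
      apply/uniserial_subm => //; apply: (chain_rank2 flP (Z := S2)); rewrite ?r //.
    split; first by rewrite eC; apply/is_dsumE; split=> //; exact: d12.2.
    by apply: socpush1E => // Z c ZN; rewrite (u2 Z).
  rewrite eC; split.
  - by uniq_goals => //; try (by apply: nesym); apply: rk_neq; rewrite ?rY ?r ?s ?s2 ?rC.
  - move=> L; rewrite !inE => /or4P[/eqP->|/eqP->|/eqP->|/orP[]/eqP->]; apply: proper_rk => //;
      by rewrite ?rY ?r ?s ?s2 ?rC len_rad rY.
  - move=> L L0 LT; have [->|[LY rL]] := proper_cases L0 LT.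
      by exists Y; rewrite ?inE ?eqxx //; apply: mod_iso_refl.
    have [e|ne] := pselect (rk L = 2%N).
      have [h|h] := pselect (S1 <=s L).
        exists (subadd S1 S2); rewrite ?inE ?eqxx ?orbT //.
        by rewrite (inC N S1 S2 L) //; apply: mod_iso_refl.
      have LS0 : subI L S1 = sub0 by rewrite subIC; apply: (subI_atom (atom_rk flP s) h).
      have [L' [LN rL' j _]] := dsum_trace flP d LY LS0.
      exists N; rewrite ?inE ?eqxx ?orbT //.
      by have <- : L' = N by apply: (rk_eq flP) => //; rewrite r rL' e.
    have r1 : rk L = 1%N by move: rL; rewrite rY; lia.
    have [h|h] := pselect (S1 <=s L).
      exists S1; rewrite ?inE ?eqxx ?orbT //.
      by rewrite (rk_eq flP h) ?r1 ?s //; apply: mod_iso_refl.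
    have LS0 : subI L S1 = sub0 by rewrite subIC; apply: (subI_atom (atom_rk flP s) h).
    have [L' [LN rL' j _]] := dsum_trace flP d LY LS0.
    exists S2; rewrite ?inE ?eqxx ?orbT //.
    by have <- : L' = S2 by apply: u2 => //; apply: (atom_rk flP); rewrite rL' r1.
have [S2 [o d12 e12]] := st _ _ d0 r0 s0; have [c2 S2N u2] := o.
have [eK|[KY rK]] := proper_cases K0 KT.
  by apply: (fin N0 S0 S2 Y) => //; rewrite ?inE ?eqxx // eK; apply: mod_iso_refl.
have [e|ne] := pselect (rk K = 2%N).
  have [h|h] := pselect (S0 <=s K).
    apply: (fin N0 S0 S2 K) => //; last exact: mod_iso_refl.
    by rewrite e12 (inC N0 S0 S2 K) // !inE ?eqxx ?orbT.
  have KS0 : subI K S0 = sub0 by rewrite subIC; apply: (subI_atom (atom_rk flP s0) h).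
  have dK : dsum Y K S0 by apply: rk_dsum => //; [apply: dsum_subr d0|rewrite rY e s0].
  have [S2' [o' d' e']] := st _ _ dK e s0.
  by apply: (fin K S0 S2' K) => //; rewrite ?inE ?eqxx ?orbT //; apply: mod_iso_refl.
have r1 : rk K = 1%N by move: rK; rewrite rY; lia.
have cK := atom_rk flP r1.
have [h|h] := pselect (K <=s N0).
  by apply: (fin N0 S0 S2 K) => //; [rewrite (u2 K) // !inE ?eqxx ?orbT|apply: mod_iso_refl].
have dK : dsum Y N0 K.
  apply: rk_dsum => //; [apply: dsum_subl d0| |by rewrite rY r0 r1].
  by rewrite subIC; apply: subI_atom.
have [S2' [o' d' e']] := st _ _ dK r0 r1.
by apply: (fin N0 K S2' K) => //; rewrite ?inE ?eqxx ?orbT //; apply: mod_iso_refl.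
Qed.


(** The bound on [J] makes [N] a chain. Submodules above [S1] then correspond to terms of this
    chain, and those that miss [S1] project isomorphically onto such terms. *)
Lemma caseF N0 S0 K : dsum Y N0 S0 -> rk N0 = 3%N -> rk S0 = 1%N -> (2 <= rk J)%N ->
  K <> sub0 -> K <> subT ->
  ~ colocal P /\ factor_serial 4 P /\
  exists N S1 N1 S2 : submodClosed P,
    [/\ is_dsum (modrad P) N S1,
        uniserial (subm N) /\ has_length (subm N) 3,
        simple_module (subm S1),
        [/\ indecomposable (subm N1), uniserial (subm N1) &
            has_length (subm N1) 2] &
        is_dsum (modsoc P) S1 S2 /\ subpush (modsoc (subm N)) = S2] /\
    is_dsum (subadd N1 S1) N1 S1 /\
    submodules_are [:: modrad P; N; S1; N1; subadd N1 S1; modsoc P; S2] /\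
    exists2 X, X \in [:: modrad P; N; N1; subadd N1 S1; modsoc P; S1; S2] &
      mod_iso (quom K) (quom X).
Proof.
move=> d0 r0 s0 rJ K0 KT; rewrite eq_rad.
have rY : rk Y = 4%N by rewrite (dsum_rk flP d0) r0 s0.
pose good N S1 N1 S2 := [/\ [/\ dsum Y N S1, rk N = 3%N, rk S1 = 1%N & chain_below N],
  [/\ N1 <=s N & rk N1 = 2%N], only_atom N S2, dsum (subadd S1 S2) S1 S2 & modsoc P = subadd S1 S2].
have st N S1 : dsum Y N S1 -> rk N = 3%N -> rk S1 = 1%N -> exists N1 S2, good N S1 N1 S2.
  move=> d r s; have c1 := atom_rk flP s.
  have [N1 uN] := dsum_unique_max flP hJ d c1 r rJ.
  have ch := dsum_local_chain (nonlocal_len nakA) flP uY d uN r.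
  have rN1 : rk N1 = 2%N by have := rk_covers flP uN.1; rewrite r => -[].
  have [N1N _ _] := uN.1.
  have [|S2 S2N c2] := ex_atom flP (K := N); first by move=> e; move: r; rewrite e rk0.
  have o2 : only_atom N S2.
    split=> // Z c ZN; have [h|h] := ch _ _ ZN S2N; [|apply/esym]; apply: (rk_eq flP) => //;
      by rewrite (rk_atom flP c) (rk_atom flP c2).
  exists N1, S2; split=> //.
    exact: dsum_sub (dsumC d) (@subs_refl _ _ S1) S2N.
  apply: modsocE => // Z cZ; rewrite subaddC.
  by apply: (dsum_atoms flP d o2 (only_atom_self flP c1) cZ); apply: atom_rad; rewrite ?rY.
have ns N S1 N1 S2 : good N S1 N1 S2 -> rk S2 = 1%N /\ rk (subadd S1 S2) = 2%N.
  by move=> [[_ _ s _] _ [c _ _] d _]; rewrite (dsum_rk flP d) s (rk_atom flP c).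
have uniq_rk N X X' : chain_below N -> X <=s N -> X' <=s N -> rk X = rk X' -> X = X'.
  move=> ch h h' e; have [k|k] := ch _ _ h h'; [|apply/esym];
    by apply: (rk_eq flP) => //; rewrite e.
have inS N S1 N1 S2 L : good N S1 N1 S2 -> S1 <=s L -> L <=s Y -> rk L <> 4%N ->
    [\/ L = S1, L = subadd S1 S2 | L = subadd N1 S1].
  move=> g h LY r4; have [[d r s ch] [N1N rN1] [c2 S2N u2] d12 _] := g; have [s2 rC] := ns _ _ _ _ g.
  have eL := dsum_in d h LY.
  have rL := dsum_rk flP (dsum_sub (dsumC d) (@subs_refl _ _ S1) (@capl _ _ N L)).
  move: rL; rewrite -eL s => rL; have := rkS flP LY; rewrite rY => le.
  have [e|n2] := pselect (rk L = 2%N).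
    apply: Or32; rewrite eL; congr subadd; apply: (uniq_rk N) => //; rewrite s2; lia.
  have [e|n3] := pselect (rk L = 3%N).
    apply: Or33; rewrite eL subaddC; congr subadd; apply: (uniq_rk N) => //; rewrite rN1; lia.
  by apply: Or31; apply/esym/(rk_eq flP) => //; rewrite s; lia.
split.
  have [N1 [S2 g]] := st _ _ d0 r0 s0; have [_ rC] := ns _ _ _ _ g; have [_ _ _ _ e] := g.
  by rewrite /colocal e => /(simple_rk _ flP); rewrite rC.
split; first by apply: (factor_serial_local flP _ _ uY nlY); rewrite ?len_rad ?rY.
(* [N1] may be any submodule of length 2 that misses [S1], not only the term [N0'] of the chain [N];
   so [K] itself can be [N1]. *)
have fin N S1 N0' N1 S2 X : good N S1 N0' S2 -> N1 <=s Y -> rk N1 = 2%N -> subI N1 S1 = sub0 ->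
    X \in [:: Y; N; N1; subadd N1 S1; modsoc P; S1; S2] -> mod_iso (quom K) (quom X) ->
    exists N S1 N1 S2 : submodClosed P,
    [/\ is_dsum Y N S1,
        uniserial (subm N) /\ has_length (subm N) 3,
        simple_module (subm S1),
        [/\ indecomposable (subm N1), uniserial (subm N1) &
            has_length (subm N1) 2] &
        is_dsum (modsoc P) S1 S2 /\ subpush (modsoc (subm N)) = S2] /\
    is_dsum (subadd N1 S1) N1 S1 /\
    submodules_are [:: Y; N; S1; N1; subadd N1 S1; modsoc P; S2] /\
    exists2 X, X \in [:: Y; N; N1; subadd N1 S1; modsoc P; S1; S2] &
      mod_iso (quom K) (quom X).
  move=> g NY rN1 i0 XL i; exists N, S1, N1, S2.
  have [[d r s ch] [N0N rN0] o d12 eC] := g; have [s2 rC] := ns _ _ _ _ g; have [c2 S2N u2] := o.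
  have c1 := atom_rk flP s; have [_ n1 _] := c1; have [_ n2 _] := c2.
  have [N1' [h' rN1' iN1 eN1]] := dsum_trace flP d NY i0.
  have e0 : N1' = N0' by apply: (uniq_rk N) => //; rewrite rN1' rN1.
  rewrite {}e0 in h' rN1' iN1 eN1.
  have rT : rk (subadd N1 S1) = 3%N.
    by have dT : dsum (subadd N1 S1) N1 S1 by []; rewrite (dsum_rk flP dT) rN1 s.
  have nS X' : S1 <=s X' -> X' <> N /\ X' <> N1.
    by move=> h; split=> e; apply: n1; [rewrite -d.2|rewrite -i0]; rewrite subI_absr // -e.
  have [nT1 _] := nS _ (@subaddr _ _ N1 S1); have [_ nC1] := nS _ (@subaddl _ _ S1 S2).
  have n12 : S1 <> S2 by move=> e; apply: n2; rewrite -d12.2 e subI_absl.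
  have ch1 : chain_below N1.
    apply: (chain_rank2 flP (Z := subI N1 (modsoc P))); rewrite ?rN1 // => Z c ZN.
    apply: (rk_eq flP); first by apply: subI_glb => //; apply: atom_modsoc.
    rewrite (rk_atom flP c); have := rk_lt flP (@capl _ _ N1 (modsoc P)); rewrite rN1.
    have : subI N1 (modsoc P) <> N1; last by move=> n /(_ n); lia.
    move=> e; apply: nC1; rewrite -eC; apply/esym/(rk_eq flP); last by rewrite eC rC rN1.
    by rewrite -e; apply: capr.
  split; last split; last split; last by exists X.
    split; [by apply/is_dsumE; have [-> ->] := d| |exact/simple_rk| |].
    - by split; [apply/uniserial_subm|apply/has_length_subm].
    - split; [|exact/uniserial_subm|exact/has_length_subm].
      apply/indecomposable_subm; split; first by move=> e; move: rN1; rewrite e rk0.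
      move=> Z Z' e z0; have ZN : Z <=s N1 by rewrite -e; apply: subaddl.
      have ZN' : Z' <=s N1 by rewrite -e; apply: subaddr.
      have [h|h] := ch1 _ _ ZN ZN'; [left|right]; by rewrite -z0 ?(subI_absl h) ?(subI_absr h).
    split; first by rewrite eC; apply/is_dsumE; split=> //; exact: d12.2.
    by apply: socpush1E => // Z c ZN; rewrite (u2 Z).
    by apply/is_dsumE.
  rewrite eC; split.
  - uniq_goals => //; try (by apply: nesym); try exact: nT1;
      by apply: rk_neq; rewrite ?rY ?r ?s ?s2 ?rC ?rN1 ?rT.
  - move=> L; rewrite !inE => /or4P[/eqP->|/eqP->|/eqP->|/or4P[]/eqP->]; apply: proper_rk => //;
      by rewrite ?rY ?r ?s ?s2 ?rC ?rN1 ?rT len_rad rY.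
  move=> L L0 LT; have [->|[LY rL]] := proper_cases L0 LT.
    by exists Y; rewrite ?inE ?eqxx //; apply: mod_iso_refl.
  have [h|h] := pselect (S1 <=s L).
    have [|->|->|->] := inS _ _ _ _ _ g h LY.
    - by move=> e; move: rL; rewrite rY e ltnn andbF.
    - by exists S1; rewrite ?inE ?eqxx ?orbT //; apply: mod_iso_refl.
    - by exists (subadd S1 S2); rewrite ?inE ?eqxx ?orbT //; apply: mod_iso_refl.
    - by exists (subadd N1 S1); rewrite ?inE ?eqxx ?orbT // -eN1; apply: mod_iso_refl.
  have LS0 : subI L S1 = sub0 by rewrite subIC; apply: subI_atom h.
  have [L' [LN rL' j _]] := dsum_trace flP d LY LS0.
  have [e|n3] := pselect (rk L = 3%N).
    exists N; rewrite ?inE ?eqxx ?orbT //.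
    by have <- : L' = N by apply: (uniq_rk N) => //; rewrite rL' e.
  have [e|n22] := pselect (rk L = 2%N).
    exists N1; rewrite ?inE ?eqxx ?orbT //; apply: mod_iso_trans (mod_iso_sym iN1).
    by have <- : L' = N0' by apply: (uniq_rk N) => //; rewrite rL' e.
  exists S2; rewrite ?inE ?eqxx ?orbT //.
  have <- // : L' = S2 by apply: (uniq_rk N) => //; rewrite rL' s2; move: rL; rewrite rY; lia.
have good0 N S1 N1 S2 : good N S1 N1 S2 -> [/\ N1 <=s Y, rk N1 = 2%N & subI N1 S1 = sub0].
  move=> [[d _ _ _] [h r] _ _ _]; split=> //; first exact: subs_trans h (dsum_subl d).
  by apply: subI0S h (@subs_refl _ _ S1) d.2.
have [N1 [S2 g]] := st _ _ d0 r0 s0; have [[_ _ _ ch] _ [c2 S2N u2] d12 e12] := g.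
have [NY rN1 i0] := good0 _ _ _ _ g.
have c1 := atom_rk flP s0.
have [eK|[KY rK]] := proper_cases K0 KT.
  by apply: (fin N0 S0 N1 N1 S2 Y) => //; rewrite ?inE ?eqxx // eK; apply: mod_iso_refl.
have [h|h] := pselect (S0 <=s K).
  apply: (fin N0 S0 N1 N1 S2 K) => //; last exact: mod_iso_refl.
  have [|->|->|->] := inS _ _ _ _ _ g h KY; rewrite ?e12 ?inE ?eqxx ?orbT //.
  by move=> e; move: rK; rewrite rY e ltnn andbF.
have KS0 : subI K S0 = sub0 by rewrite subIC; apply: subI_atom h.
have [e|n3] := pselect (rk K = 3%N).
  have dK : dsum Y K S0 by apply: rk_dsum => //; [apply: dsum_subr d0|rewrite rY e s0].
  have [N1' [S2' g']] := st _ _ dK e s0; have [NY' rN1' i0'] := good0 _ _ _ _ g'.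
  by apply: (fin K S0 N1' N1' S2' K) => //; rewrite ?inE ?eqxx ?orbT //; apply: mod_iso_refl.
have [e|n2] := pselect (rk K = 2%N).
  by apply: (fin N0 S0 N1 K S2 K) => //; rewrite ?inE ?eqxx ?orbT //; apply: mod_iso_refl.
have r1 : rk K = 1%N by move: rK; rewrite rY; lia.
have cK := atom_rk flP r1.
have [k|k] := pselect (K <=s N0).
  by apply: (fin N0 S0 N1 N1 S2 K) => //; [rewrite (u2 K) // !inE ?eqxx ?orbT|apply: mod_iso_refl].
have dK : dsum Y N0 K.
  apply: rk_dsum => //; [apply: dsum_subl d0| |by rewrite rY r0 r1].
  by rewrite subIC; apply: subI_atom.
have [N1' [S2' g']] := st _ _ dK r0 r1; have [NY' rN1' i0'] := good0 _ _ _ _ g'.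
by apply: (fin N0 K N1' N1' S2' K) => //; rewrite ?inE ?eqxx ?orbT //; apply: mod_iso_refl.
Qed.

End Builders.

(** * The radical as a sum of two chains of length 2: case (G) *)

Section CaseG.
Variables (R : comPzRingType) (A : algType R).
Hypotheses (artA : artin_algebra A) (nakA : right_Nakayama A 4).
Variables (P : lmodType A^c) (Y : submodClosed P).
Hypotheses (flP : flen P) (prP : projective P) (uY : unique_max subT Y).
Implicit Types K L N X Z : submodClosed P.
Let J := subpush (modrad (subm Y)).
Let hJ L : covers L Y -> J <=s L := @radpush_sub _ _ Y L.
Hypothesis rJ : (2 <= rk J)%N.

Definition two_chains N1 N2 S1 S2 :=
  [/\ dsum Y N1 N2, rk N1 = 2%N, rk N2 = 2%N, only_atom N1 S1 & only_atom N2 S2].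

Lemma two_chainsC N1 N2 S1 S2 : two_chains N1 N2 S1 S2 -> two_chains N2 N1 S2 S1.
Proof. by move=> [/dsumC d r1 r2 o1 o2]. Qed.

Lemma ex_two_chains N1 N2 : dsum Y N1 N2 -> rk N1 = 2%N -> rk N2 = 2%N ->
  exists S1 S2, two_chains N1 N2 S1 S2.
Proof.
move=> d r1 r2.
have nz N : rk N = 2%N -> N <> sub0 by move=> r e; move: r; rewrite e rk0.
have [||S1 o1] := dsum_only_atom flP hJ d r1; [exact: nz|by rewrite r2|].
have [||S2 o2] := dsum_only_atom flP hJ (dsumC d) r2; [exact: nz|by rewrite r1|].
by exists S1, S2.
Qed.

Lemma two_chains_J N1 N2 S1 S2 : two_chains N1 N2 S1 S2 ->
  [/\ J = subadd S1 S2, dsum J S1 S2, rk J = 2%N, rk Y = 4%N & modsoc P = J].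
Proof.
move=> [d r1 r2 o1 o2]; have [e dJ] := two_chains_rad flP d r1 r2 o1 o2 rJ.
have [c1 _ _] := o1; have [c2 _ _] := o2.
have rY : rk Y = 4%N by rewrite (dsum_rk flP d) r1 r2.
split=> //; first by rewrite [LHS](dsum_rk flP dJ) (rk_atom flP c1) (rk_atom flP c2).
rewrite /J e; apply: modsocE => // Z cZ; apply: (dsum_atoms flP d o1 o2 cZ).
by apply: atom_rad; rewrite ?rY.
Qed.

Lemma two_chains_max N1 N2 S1 S2 : two_chains N1 N2 S1 S2 ->
  [/\ covers (subadd N1 S2) Y, dsum (subadd N1 S2) N1 S2, rk (subadd N1 S2) = 3%N &
      ~ N2 <=s subadd N1 S2].
Proof.
move=> [d r1 r2 o1 o2]; have [c2 S2N _] := o2.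
have dd := dsum_sub d (@subs_refl _ _ N1) S2N.
have r : rk (subadd N1 S2) = 3%N by rewrite (dsum_rk flP dd) r1 (rk_atom flP c2).
split=> //.
  apply: (rkP_covers flP); last by rewrite r (dsum_rk flP d) r1 r2.
  by have [<- _] := d; apply: subaddS.
move=> h; have : subadd N1 N2 <=s subadd N1 S2 by apply: subadd_lub => //; apply: subaddl.
by move/(rkS flP); rewrite d.1 (dsum_rk flP d) r r1 r2.
Qed.

Lemma rank2_in_max N1 N2 S1 S2 L : two_chains N1 N2 S1 S2 -> L <=s subadd N1 S2 ->
  rk L = 2%N -> L <> J -> mod_iso (subm L) (subm N1) /\ dsum Y L N2.
Proof.
move=> g LM rL nJ; have [d r1 r2 o1 o2] := g; have [eJ _ rJ2 rY _] := two_chains_J g.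
have [cM dM rM _] := two_chains_max g; have [c2 S2N _] := o2; have [MY _ _] := cM.
have LS : subI L S2 = sub0.
  rewrite subIC; apply: subI_atom => // h; apply: nJ; rewrite eJ.
  have eL := dsum_in dM h LM; apply: (rk_eq flP); last by rewrite -eJ rJ2 rL.
  rewrite eL subaddC; apply: subaddS => //; apply: (only_atom_small flP o1); first exact: capl.
  have := dsum_rk flP (dsum_sub (dsumC dM) (@subs_refl _ _ S2) (@capl _ _ N1 L)).
  by rewrite -eL rL (rk_atom flP c2); lia.
have dL : dsum (subadd N1 S2) L S2.
  by apply: (rk_dsum flP) => //; rewrite rM rL (rk_atom flP c2).
split.
  by apply: (compl_iso (Z := S2)) => //; [rewrite dL.1|exact: dM.2].
have e : subadd L N2 = Y.
  apply: subsub_anti.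
    by apply: subadd_lub; [apply: subs_trans LM MY|apply: dsum_subr d].
  rewrite -d.1; apply: subadd_lub; last exact: subaddr.
  apply: subs_trans (dsum_subl dM) _; rewrite -dL.1.
  by apply: subaddS.
split=> //; apply: (rk_eq0 flP); have := rkD flP L N2.
by rewrite e rY rL r2; lia.
Qed.

Lemma auto_dsum (h : {linear P -> P}) K L : linj h -> lsurj h -> dsum Y K L ->
  dsum Y (limg h K) (limg h L).
Proof.
move=> hi hs [e i]; split; last by rewrite -limgI_inj // i limg0.
rewrite -limg_add e; apply: (rk_eq flP); first exact: local_endo_rad.
by rewrite rk_limg_inj.
Qed.

Lemma max_cases N1 N2 S1 S2 L : two_chains N1 N2 S1 S2 -> covers L Y ->
  L = subadd N2 S1 \/ exists h : {linear P -> P}, [/\ linj h, lsurj h & limg h L = subadd N1 S2].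
Proof.
move=> g cL; have [e|n] := pselect (L = subadd N2 S1); [by left|right].
have [_ _ rJ2 rY _] := two_chains_J g; have [c1 _ _ n1] := two_chains_max g.
have [c2 _ _ _] := two_chains_max (two_chainsC g).
apply: (auto_max_glue nakA flP prP uY _ cL c1 c2) => //; first by rewrite -/J rJ2 rY.
by move=> e; apply: n1; rewrite e; apply: subaddl.
Qed.

(** [L + J] is a maximal submodule of [Y]: it is [N2 + S1], or an automorphism of [P] carries it to
    [N1 + S2]. In the second case the complement of [L] is obtained from [N2] by the inverse
    automorphism. *)
Lemma rank2_cases N1 N2 S1 S2 L : two_chains N1 N2 S1 S2 -> L <=s Y -> rk L = 2%N -> L <> J ->
  mod_iso (subm L) (subm N2) /\ dsum Y L N1 \/
  mod_iso (subm L) (subm N1) /\ exists N, dsum Y L N /\ rk N = 2%N.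
Proof.
move=> g LY rL nJ; have [d r1 r2 o1 o2] := g; have [eJ _ rJ2 rY _] := two_chains_J g.
(* A maximal submodule of [Y] above [L] contains [J] as well. *)
have nY : subadd L J <> Y.
  move=> e; have nLY : L <> Y by move=> k; move: rL; rewrite k rY.
  have [L' LL' c] := ex_coversr flP LY nLY; have [_ + _] := coversP c; apply.
  by rewrite -e; apply: subadd_lub => //; apply: hJ.
have JY : J <=s Y := @radpush_subY _ _ Y.
have cLJ : covers (subadd L J) Y.
  have lY : subadd L J <=s Y by apply: subadd_lub.
  apply: (rkP_covers flP) => //.
  have := rk_lt flP lY nY; have := rk_lt flP (@subaddl _ _ L J); rewrite rL rY.
  have : L <> subadd L J; last by move=> n /(_ n); lia.
  by move=> e; apply: nJ; apply/esym/(rk_eq flP); [rewrite e; apply: subaddr|rewrite rL rJ2].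
have [e|[h [hi hs hE]]] := max_cases g cLJ.
  left; apply: (rank2_in_max (two_chainsC g)) => //; rewrite -e; exact: subaddl.
right; have LM : limg h L <=s subadd N1 S2 by rewrite -hE; apply/limgS/subaddl.
have nhJ : limg h L <> J.
  move=> k; apply: nJ; apply: (limg_inj hi); rewrite k; apply/esym/(rk_eq flP).
    exact: radpush_endo.
  by rewrite rk_limg_inj.
have rhL : rk (limg h L) = 2%N by rewrite rk_limg_inj.
have [i dL] := rank2_in_max g LM rhL nhJ; split.
  exact: mod_iso_trans (subm_iso _ hi) i.
have [h' [hi' hs' hE']] := auto_inverse hi hs (erefl (limg h L)).
exists (limg h' N2); split; last by rewrite rk_limg_inj.
by rewrite -hE'; apply: auto_dsum.
Qed.

Lemma rank1_cases N1 N2 S1 S2 Z : two_chains N1 N2 S1 S2 -> covers sub0 Z ->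
  Z = S2 \/ mod_iso (subm Z) (subm S1) /\ mod_iso (quom Z) (quom S1).
Proof.
move=> g cZ; have [e|n] := pselect (Z = S2); [by left|right].
have [d r1 r2 o1 o2] := g; have [eJ dJ rJ2 rY eC] := two_chains_J g.
have [c1 _ _] := o1; have [c2 _ _] := o2.
have ZJ : Z <=s J by rewrite -eC; apply: atom_modsoc.
have i0 : subI Z S2 = sub0.
  apply: (subI_atom cZ) => h; apply: n; apply: (rk_eq flP) => //.
  by rewrite (rk_atom flP cZ) (rk_atom flP c2).
have dZ : dsum J Z S2.
  by apply: rk_dsum => //; [apply: dsum_subr dJ|rewrite rJ2 (rk_atom flP cZ) (rk_atom flP c2)].
have i : mod_iso (subm Z) (subm S1).
  by apply: (compl_iso (Z := S2)) => //; [rewrite dZ.1 dJ.1|exact: dJ.2].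
have [h [hi hs hE]] := auto_atom_glue nakA flP uY d r1 r2 o1 o2 rJ cZ c1 ZJ (dsum_subl dJ) i.
by split=> //; rewrite -hE; apply: quom_iso_img.
Qed.

(* Up to automorphisms of P there are two maximal submodules of rad P and two atoms;
   a submodule K of length 2 other than the socle can itself serve as N1. *)
Lemma caseG N1 N2 K : ~ local_module (subm Y) -> dsum Y N1 N2 -> rk N1 = 2%N -> rk N2 = 2%N ->
  K <> sub0 -> K <> subT ->
  ~ colocal P /\ factor_serial 4 P /\
  exists N1 N2 S1 S2 : submodClosed P,
    [/\ is_dsum (modrad P) N1 N2,
        uniserial (subm N1) /\ has_length (subm N1) 2,
        uniserial (subm N2) /\ has_length (subm N2) 2,
        is_dsum (modsoc P) S1 S2 &
        subpush (modsoc (subm N1)) = S1 /\ subpush (modsoc (subm N2)) = S2] /\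
    is_dsum (subadd N1 S2) N1 S2 /\ is_dsum (subadd N2 S1) N2 S1 /\
    submodules_are
      [:: modrad P; N1; N2; subadd N1 S2; subadd N2 S1; modsoc P; S1; S2] /\
    exists2 X, X \in [:: modrad P; N1; N2; subadd N1 S2; subadd N2 S1;
                         modsoc P; S1; S2] &
      mod_iso (quom K) (quom X).
Proof.
move=> nlY d0 rN1 rN2 K0 KT; rewrite (eq_rad uY).
have [S1 [S2 g0]] := ex_two_chains d0 rN1 rN2.
have [_ dJ rJ2 rY eC] := two_chains_J g0; rewrite eC.
split; first by rewrite /colocal eC => /(simple_rk _ flP); rewrite rJ2.
split; first by apply: (factor_serial_local flP _ _ uY nlY); rewrite ?(len_rad flP uY) ?rY.
have fin M1 M2 T1 T2 X : two_chains M1 M2 T1 T2 ->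
    X \in [:: Y; M1; M2; subadd M1 T2; subadd M2 T1; J; T1; T2] -> mod_iso (quom K) (quom X) ->
    exists N1 N2 S1 S2 : submodClosed P,
    [/\ is_dsum Y N1 N2,
        uniserial (subm N1) /\ has_length (subm N1) 2,
        uniserial (subm N2) /\ has_length (subm N2) 2,
        is_dsum J S1 S2 &
        subpush (modsoc (subm N1)) = S1 /\ subpush (modsoc (subm N2)) = S2] /\
    is_dsum (subadd N1 S2) N1 S2 /\ is_dsum (subadd N2 S1) N2 S1 /\
    submodules_are [:: Y; N1; N2; subadd N1 S2; subadd N2 S1; J; S1; S2] /\
    exists2 X, X \in [:: Y; N1; N2; subadd N1 S2; subadd N2 S1; J; S1; S2] &
      mod_iso (quom K) (quom X).
  move=> g XL i; exists M1, M2, T1, T2.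
  have [d r1 r2 o1 o2] := g; have [eJ d12 _ _ _] := two_chains_J g.
  have [cM1 dM1 r3 nM1] := two_chains_max g.
  have [cM2 dM2 r4 nM2] := two_chains_max (two_chainsC g).
  have [c1 h1 u1] := o1; have [c2 h2 u2] := o2.
  have s1 := rk_atom flP c1; have s2 := rk_atom flP c2.
  have uni N S : only_atom N S -> rk N = 2%N -> uniserial (subm N) /\ has_length (subm N) 2.
    move=> [_ _ u] r; split; last exact/has_length_subm.
    by apply/uniserial_subm => //; apply: (chain_rank2 flP (Z := S)); rewrite ?r.
  split; [|split; [|split; [|split]]].
  - split; [|exact: uni o1 r1|exact: uni o2 r2| |].
    + by apply/is_dsumE; have [-> ->] := d.
    + by apply/is_dsumE; have [-> ->] := d12.
    + by split; apply: socpush1E => // Z c ZN; [rewrite (u1 Z)|rewrite (u2 Z)].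
  - by apply/is_dsumE; have [_ ->] := dM1.
  - by apply/is_dsumE; have [_ ->] := dM2.
  - have n34 : subadd M1 T2 <> subadd M2 T1.
      by move=> e; apply: nM1; rewrite e; apply: subaddl.
    have n12 : M1 <> M2 by move=> e; apply: nM1; rewrite -e; apply: subaddl.
    have nJ1 : M1 <> J.
      move=> e; have [_ n _] := c2; apply: n; rewrite -dM1.2 subI_absr // e.
      exact: dsum_subr d12.
    have nJ2 : M2 <> J.
      move=> e; have [_ n _] := c1; apply: n; rewrite -dM2.2 subI_absr // e.
      exact: dsum_subl d12.
    have nT : T1 <> T2.
      by move=> e; have [_ n _] := c1; apply: n; rewrite -d12.2 -e subI_absl.
    split.
    + by uniq_goals => //; try (by apply: nesym); apply: rk_neq;
        rewrite ?rY ?r1 ?r2 ?r3 ?r4 ?rJ2 ?s1 ?s2.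
    + move=> L; rewrite !inE => /or4P[/eqP->|/eqP->|/eqP->|/or4P[/eqP->|/eqP->|/eqP->|/orP[]/eqP->]];
        apply: proper_rk => //; by rewrite ?rY ?r1 ?r2 ?r3 ?r4 ?rJ2 ?s1 ?s2 (len_rad flP uY) rY.
    + move=> L L0 LT; have [->|[LY rL]] := proper_cases flP uY L0 LT.
        by exists Y; rewrite ?inE ?eqxx //; apply: mod_iso_refl.
      have [e|n3] := pselect (rk L = 3%N).
        have cL : covers L Y by apply: (rkP_covers flP) => //; rewrite rY e.
        have [->|[h [hi hs <-]]] := max_cases g cL.
          by exists (subadd M2 T1); rewrite ?inE ?eqxx ?orbT //; apply: mod_iso_refl.
        by exists (limg h L); rewrite ?inE ?eqxx ?orbT //; apply: subm_iso.
      have [e|n2] := pselect (rk L = 2%N).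
        have [->|n] := pselect (L = J).
          by exists J; rewrite ?inE ?eqxx ?orbT //; apply: mod_iso_refl.
        have [[j _]|[j _]] := rank2_cases g LY e n; first by exists M2; rewrite ?inE ?eqxx ?orbT.
        by exists M1; rewrite ?inE ?eqxx ?orbT.
      have cL : covers sub0 L by apply: (atom_rk flP); move: rL; rewrite rY; lia.
      have [->|[j _]] := rank1_cases g cL.
        by exists T2; rewrite ?inE ?eqxx ?orbT //; apply: mod_iso_refl.
      by exists T1; rewrite ?inE ?eqxx ?orbT.
  - by exists X.
have [eK|[KY rK]] := proper_cases flP uY K0 KT.
  by apply: (fin N1 N2 S1 S2 Y) => //; rewrite ?inE ?eqxx // eK; apply: mod_iso_refl.
have [e|n3] := pselect (rk K = 3%N).
  have cK : covers K Y by apply: (rkP_covers flP) => //; rewrite rY e.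
  have [eK|[h [hi hs hE]]] := max_cases g0 cK.
    apply: (fin N1 N2 S1 S2 (subadd N2 S1)); rewrite ?inE ?eqxx ?orbT //.
    by rewrite -eK; apply: mod_iso_refl.
  apply: (fin N1 N2 S1 S2 (subadd N1 S2)); rewrite ?inE ?eqxx ?orbT //.
  by rewrite -hE; apply: quom_iso_img.
have [e|n2] := pselect (rk K = 2%N).
  have [eKJ|n] := pselect (K = J).
    apply: (fin N1 N2 S1 S2 J); rewrite ?inE ?eqxx ?orbT //.
    by rewrite eKJ; apply: mod_iso_refl.
  have [N [dN rN]] : exists N, dsum Y K N /\ rk N = 2%N.
    by have [[_ h]|[_ //]] := rank2_cases g0 KY e n; exists N1.
  have [T1 [T2 g]] := ex_two_chains dN e rN.
  by apply: (fin K N T1 T2 K) => //; rewrite ?inE ?eqxx ?orbT //; apply: mod_iso_refl.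
have cK : covers sub0 K by apply: (atom_rk flP); move: rK; rewrite rY; lia.
have [eK|[_ j]] := rank1_cases g0 cK.
  apply: (fin N1 N2 S1 S2 S2); rewrite ?inE ?eqxx ?orbT //.
  by rewrite eK; apply: mod_iso_refl.
by apply: (fin N1 N2 S1 S2 S1) => //; rewrite ?inE ?eqxx ?orbT.
Qed.

End CaseG.

(** * The uniserial case (A), small lengths, and nonprojective quotients *)

Section Lengths.
Variable S : pzRingType.
Implicit Types M N P : lmodType S.

(** In a chain a nonzero term has a single maximal submodule, so each radical step drops the length
    by 1; truncated subtraction covers the steps after zero is reached. *)
Lemma rk_modradn P t : flen P -> chain_below (subT : submodClosed P) ->
  rk (modradn P t) = (len P - t)%N.
Proof.
move=> flP ch; elim: t => [|t IH]; first by rewrite subn0.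
have [e0|n0] := pselect (modradn P t = sub0).
  have h : modradn P t.+1 = sub0 by apply: subs0; rewrite -e0; apply: modradnS.
  by move: IH; rewrite h e0 (rk0 flP); lia.
have [L _ cL] := ex_coversr flP (@sub0s _ _ (modradn P t)) (nesym n0).
have -> : modradn P t.+1 = L.
  apply: subsub_anti; first exact: radpush_sub.
  have [Lt _ _] := cL; apply: sub_radpush => // L' cL'.
  have [h|h] := ch L L' (@subsT _ _ _) (@subsT _ _ _) => //.
  have -> : L = L'; last by [].
  apply/esym/(rk_eq flP) => //.
  by rewrite -ltnS -(rk_covers flP cL) -(rk_covers flP cL').
by have := rk_covers flP cL; rewrite IH; lia.
Qed.

Lemma caseA P (K : submodClosed P) : flen P -> uniserial P -> K <> sub0 -> K <> subT ->
  exists l t, [/\ has_length P l, (1 <= t < l)%N & K = modradn P t].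
Proof.
move=> flP /uniserialP[_ ch] K0 KT; have r0 := rk_gt0 flP K0; have rT := rk_subT flP KT.
rewrite -/(len P) in rT.
exists (len P), (len P - rk K)%N; split; first exact/has_lengthP; first by lia.
have e : rk (modradn P (len P - rk K)) = rk K by rewrite rk_modradn //; lia.
have [h|h] := ch K (modradn P (len P - rk K)) (@subsT _ _ _) (@subsT _ _ _); [|apply/esym];
  by apply: (rk_eq flP) => //; rewrite e.
Qed.

Lemma indecomposable_iso M N : mod_iso M N -> indecomposable M -> indecomposable N.
Proof.
move=> /mod_iso_sym/iso_lin[f [fi fs]] /indecomposableP[nz ind]; apply/indecomposableP; split.
  by move=> e; apply: nz; rewrite -(limgT fs) e limg0.
move=> X Z eXZ i0; have [||h|h] := ind (limg f X) (limg f Z).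
- by rewrite -limg_add eXZ limgT.
- by rewrite -limgI_inj // i0 limg0.
- by left; apply: (limg_inj fi); rewrite h limg0.
- by right; apply: (limg_inj fi); rewrite h limg0.
Qed.

Lemma quom_nonprojective M P (K : submodClosed P) : indecomposable M -> indecomposable P ->
  mod_iso M (quom K) -> K <> sub0 -> ~ projective M.
Proof.
move=> iM iP i n pM; apply: n; apply: projective_quom => //.
  exact: indecomposable_iso iM.
exact: projective_iso pM.
Qed.

Lemma decompose M (Y : submodClosed M) : Y <> sub0 -> ~ indecomposable (subm Y) ->
  exists K L, [/\ dsum Y K L, K <> sub0 & L <> sub0].
Proof.
move=> Y0 nd; apply: contrapT => h; apply: nd; apply/indecomposable_subm; split=> // K L e i.
by apply: contrapT => /not_orP[nK nL]; apply: h; exists K, L.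
Qed.

Lemma nonlocal_ge2 M (Y : submodClosed M) : flen M -> Y <> sub0 -> ~ local_module (subm Y) ->
  (2 <= rk Y)%N.
Proof.
move=> flM Y0 nl; have [L1 [L2 [c1 c2 n]]] := nonlocal_two_covers flM Y0 nl.
have := rk_covers flM c1; have := rk_covers flM c2.
have [//|le] := leqP 2 (rk Y) => r2 r1; case: n.
have -> : L1 = sub0 by apply: (rk_eq0 flM); lia.
by apply/esym/(rk_eq0 flM); lia.
Qed.

(** In length 2, two different maximal submodules are simple and complementary. *)
Lemma nonlocal_indec_ge3 M : flen M -> indecomposable M -> ~ local_module M -> (3 <= len M)%N.
Proof.
move=> flM /indecomposableP[nz ind] nl.
have [L1 [L2 [c1 c2 n]]] := nonlocal_two_max flM (nesym nz) nl.
have r1 := rk_covers flM c1; have r2 := rk_covers flM c2.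
rewrite -/(len M) in r1 r2.
have [//|le] := leqP 3 (len M); case: n.
have [e|ne] := pselect (rk L1 = 0%N).
  have -> : L1 = sub0 by apply: (rk_eq0 flM); lia.
by apply/esym/(rk_eq0 flM); lia.
have cL : covers sub0 L1 by apply: (atom_rk flM); lia.
apply: contrapT => n.
have i0 : subI L1 L2 = sub0.
  by apply: (subI_atom cL) => h; apply: n; apply: (rk_eq flM) => //; lia.
have eT : subadd L1 L2 = subT.
  by apply: (rk_eq flM) => //; have := rkD flM L1 L2; rewrite i0 (rk0 flM) -/(len M); lia.
have [h|h] := ind L1 L2 eT i0.
- by move: ne; rewrite h rk0.
- by move: r2; rewrite h (rk0 flM); lia.
Qed.

End Lengths.

(** Cases (D) and (F) place [S1] differently in the list of submodules and in the list of
    kernels. *)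
Lemma subset_move (T : eqType) (x : T) u s1 s2 :
  {subset u ++ s1 ++ x :: s2 <= u ++ x :: s1 ++ s2}.
Proof. by move=> y; rewrite !mem_cat !inE mem_cat (orbCA (y \in s1)). Qed.

Lemma submodules_are_nonprojective (S : pzRingType) (M P : lmodType S) (s t : seq (submodClosed P)) :
  indecomposable M -> indecomposable P -> submodules_are s -> {subset t <= s} ->
  (exists2 X, X \in t & mod_iso M (quom X)) -> ~ projective M.
Proof.
move=> iM iP [_ h _] ts [X Xt i]; have [X0 _] := h X (ts _ Xt).
exact: quom_nonprojective i X0.
Qed.

Theorem theorem3p4 (R : comPzRingType) (A : algType R)
  (artinA : artin_algebra A) (nakA : right_Nakayama A 4)
  (M : lmodType A^c) (fgM : fin_gen M) (indM : indecomposable M) :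
  ~ projective M <->
  (* (A) *)
  (exists P : lmodType A^c,
     [/\ fin_gen P, indecomposable P, projective P, uniserial P &
     exists l t, [/\ has_length P l, (1 <= t < l)%N &
       mod_iso M (quom (modradn P t))]])
  \/
  (* (B) *)
  (exists P : lmodType A^c,
     [/\ fin_gen P, indecomposable P, projective P, factor_serial 2 P &
     exists S1 S2 : submodClosed P,
       [/\ simple_module (subm S1), simple_module (subm S2),
           modrad P = modsoc P, is_dsum (modsoc P) S1 S2 &
       exists2 X, X \in [:: modrad P; S1; S2] & mod_iso M (quom X)]])
  \/
  (* (C) *)
  (exists P : lmodType A^c,
     [/\ fin_gen P, indecomposable P & projective P] /\
     [/\ factor_serial 3 P, colocal P, factor_serial 3 (subm (modrad P)),
         has_length (subm (modrad P)) 3 & ~ local_module (subm (modrad P))] /\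
     exists N1 N2 : submodClosed P,
       [/\ uniserial (subm N1) /\ has_length (subm N1) 2,
           uniserial (subm N2) /\ has_length (subm N2) 2,
           simple_module (subm (modsoc P)),
           submodules_are [:: modrad P; N1; N2; modsoc P] &
       exists2 X, X \in [:: modrad P; N1; N2; modsoc P] & mod_iso M (quom X)])
  \/
  (* (D) *)
  (exists P : lmodType A^c,
     [/\ fin_gen P, indecomposable P & projective P] /\
     factor_serial 3 P /\ ~ colocal P /\
     exists N S1 S2 : submodClosed P,
       [/\ is_dsum (modrad P) N S1,
           uniserial (subm N) /\ has_length (subm N) 2,
           simple_module (subm S1) &
           is_dsum (modsoc P) S1 S2 /\ subpush (modsoc (subm N)) = S2] /\
       submodules_are [:: modrad P; N; S1; modsoc P; S2] /\
       exists2 X, X \in [:: modrad P; N; modsoc P; S1; S2] & mod_iso M (quom X))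
  \/
  (* (E) *)
  (exists P : lmodType A^c,
     [/\ fin_gen P, indecomposable P & projective P] /\
     [/\ colocal P, factor_serial 4 P, factor_serial 4 (subm (modrad P)),
         has_length (subm (modrad P)) 4 & ~ local_module (subm (modrad P))] /\
     exists M1 M2 N1 N2 : submodClosed P,
       [/\ has_length (subm M1) 3 /\ uniserial (subm M1),
           [/\ has_length (subm M2) 3, ~ local_module (subm M2) &
               factor_serial 3 (subm M2)],
           uniserial (subm N1) /\ has_length (subm N1) 2 &
           uniserial (subm N2) /\ has_length (subm N2) 2] /\
       [/\ {subset N1 <= M1}, {subset N1 <= M2}, {subset N2 <= M2},
           simple_module (subm (modsoc P)) &
           submodules_are [:: modrad P; M1; M2; N1; N2; modsoc P]] /\
       exists2 X, X \in [:: modrad P; M1; M2; N1; N2; modsoc P] &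
         mod_iso M (quom X))
  \/
  (* (F) *)
  (exists P : lmodType A^c,
     [/\ fin_gen P, indecomposable P & projective P] /\
     ~ colocal P /\ factor_serial 4 P /\
     exists N S1 N1 S2 : submodClosed P,
       [/\ is_dsum (modrad P) N S1,
           uniserial (subm N) /\ has_length (subm N) 3,
           simple_module (subm S1),
           [/\ indecomposable (subm N1), uniserial (subm N1) &
               has_length (subm N1) 2] &
           is_dsum (modsoc P) S1 S2 /\ subpush (modsoc (subm N)) = S2] /\
       is_dsum (subadd N1 S1) N1 S1 /\
       submodules_are [:: modrad P; N; S1; N1; subadd N1 S1; modsoc P; S2] /\
       exists2 X, X \in [:: modrad P; N; N1; subadd N1 S1; modsoc P; S1; S2] &
         mod_iso M (quom X))
  \/
  (* (G) *)
  (exists P : lmodType A^c,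
     [/\ fin_gen P, indecomposable P & projective P] /\
     ~ colocal P /\ factor_serial 4 P /\
     exists N1 N2 S1 S2 : submodClosed P,
       [/\ is_dsum (modrad P) N1 N2,
           uniserial (subm N1) /\ has_length (subm N1) 2,
           uniserial (subm N2) /\ has_length (subm N2) 2,
           is_dsum (modsoc P) S1 S2 &
           subpush (modsoc (subm N1)) = S1 /\ subpush (modsoc (subm N2)) = S2] /\
       is_dsum (subadd N1 S2) N1 S2 /\ is_dsum (subadd N2 S1) N2 S1 /\
       submodules_are
         [:: modrad P; N1; N2; subadd N1 S2; subadd N2 S1; modsoc P; S1; S2] /\
       exists2 X, X \in [:: modrad P; N1; N2; subadd N1 S2; subadd N2 S1;
                            modsoc P; S1; S2] &
         mod_iso M (quom X))
  \/
  (* (H) *)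
  (~ local_module M /\ factor_serial 3 M /\
   exists M1 M2 : submodClosed M,
     [/\ uniserial (subm M1), uniserial (subm M2),
         simple_module (subm (modsoc M)),
         submodules_are [:: M1; M2; modsoc M] &
         indec_quotients_are [:: M1; M2]])
  \/
  (* (I) *)
  (~ local_module M /\ factor_serial 4 M /\ simple_module (subm (modsoc M)) /\
   exists M1 M2 N1 N2 : submodClosed M,
     [/\ [/\ maximal_submod M1, has_length (subm M1) 3 & uniserial (subm M1)],
         [/\ maximal_submod M2, has_length (subm M2) 3,
             ~ local_module (subm M2) & factor_serial 3 (subm M2)],
         uniserial (subm N1) /\ has_length (subm N1) 2 &
         uniserial (subm N2) /\ has_length (subm N2) 2] /\
     [/\ {subset N1 <= M1}, {subset N1 <= M2}, {subset N2 <= M2},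
         submodules_are [:: M1; M2; N1; N2; modsoc M] &
         indec_quotients_are [:: M1; M2; N2]])
  \/
  (* (J) *)
  (~ local_module M /\ factor_serial 4 M /\ ~ simple_module (subm (modsoc M)) /\
   exists N1 N2 S1 S2 : submodClosed M,
     [/\ [/\ indecomposable (subm N1), has_length (subm N1) 3 &
             factor_serial 2 (subm N1)],
         uniserial (subm N2) /\ has_length (subm N2) 2,
         simple_module (subm S1) /\ simple_module (subm S2),
         is_dsum (modsoc M) S1 S2 &
         subpush (modsoc (subm N2)) = S2] /\
     is_dsum (subadd N2 S1) N2 S1 /\
     submodules_are [:: N1; N2; subadd N2 S1; modsoc M; S1; S2] /\
     indec_quotients_are [:: N1; N2; subadd N2 S1; S1]).
Proof.
have flM := fin_gen_flen artinA nakA fgM.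
split.
  move=> npM; have [loM|nlM] := pselect (local_module M); last first.
    have ge3 := nonlocal_indec_ge3 flM indM nlM.
    have le4 := nonlocal_len nakA flM indM nlM.
    have [l3|n3] := pselect (len M = 3%N).
      do 7!right; left; exact: (nonlocal_case3 nakA flM indM l3 nlM).
    have l4 : len M = 4%N by lia.
    have [[S cS]|nS] := pselect (exists S : submodClosed M, colocal_at S).
      do 8!right; left; exact: (nonlocal_case4_colocal artinA nakA flM indM l4 nlM cS).
    do 9!right; exact: (nonlocal_case4_noncolocal artinA nakA flM indM l4 nlM nS).
  have [P [p [fgP iP pP sp]]] := ex_projective_cover (artinian_regular artinA) flM loM.
  have flP := fin_gen_flen artinA nakA fgP.
  pose K := lker p; have iK : mod_iso M (quom K) by apply/mod_iso_sym/quom_iso.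
  have K0 : K <> sub0.
    move=> e; apply: npM; apply: projective_iso pP; apply: lin_iso sp.
    exact: lker_inj.
  have KT : K <> subT.
    move=> e; have /indecomposableP[nz _] := indM; apply: nz.
    rewrite -(limgT sp); apply: subs0 => _ /limgP[x _ <-].
    by rewrite in_sub0; apply/eqP/lkerP; rewrite -/K e.
  have [uP|[Y [uY Y0 nlY]]] := local_cases (nonlocal_len nakA) flP (projective_local flP iP pP).
    left; exists P; split=> //; have [l [t [hl ht e]]] := caseA flP uP K0 KT.
    by exists l, t; split=> //; rewrite -e.
  have le4 : (rk Y <= 4)%N.
    by have := local_len nakA flP iP uY Y0 nlY; rewrite (len_rad flP uY).
  have ge2 := nonlocal_ge2 flP Y0 nlY.
  (* For a decomposable radical of length 3 this makes [rad^2 P] nonzero, and for one of length 4 it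
     gives [rad^2 P] length at least 2, as the cases (D), (F) and (G) require. *)
  have rad2 := rad_top_le2 artinA nakA flP pP uY.
  have tr X : mod_iso (quom K) (quom X) -> mod_iso M (quom X) := mod_iso_trans iK.
  right.
  have [r2|n2] := pselect (rk Y = 2%N).
    left; exists P; have [fs [S1 [S2 [h1 h2 h3 h4 [X XL i]]]]] := caseB flP uY nlY r2 K0 KT.
    split=> //; exists S1, S2; split=> //; exists X => //; exact: tr.
  right; have [iY|nY] := pselect (indecomposable (subm Y)).
    have [r3|n3] := pselect (rk Y = 3%N).
      left; exists P; split=> //.
      have [h [N1 [N2 [h1 h2 h3 h4 [X XL i]]]]] := caseC nakA flP uY nlY iY r3 K0 KT.
      split=> //; exists N1, N2; split=> //; exists X => //; exact: tr.
    right; right; left; exists P; split=> //.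
    have r4 : rk Y = 4%N by lia.
    have [h [M1 [M2 [N1 [N2 [h1 [h2 [X XL i]]]]]]]] := caseE artinA nakA flP uY nlY iY r4 K0 KT.
    split=> //; exists M1, M2, N1, N2; split=> //; split=> //; exists X => //; exact: tr.
  right.
  have [U [V [d U0 V0]]] := decompose Y0 nY.
  have := dsum_rk flP d; have := rk_gt0 flP U0; have := rk_gt0 flP V0 => v0 u0 rY.
  have [r3|n3] := pselect (rk Y = 3%N).
    left; exists P; split=> //.
    have [N [S0 [d' rN rS]]] : exists N S0, [/\ dsum Y N S0, rk N = 2%N & rk S0 = 1%N].
      have [e|n] := pselect (rk U = 2%N); first by exists U, V; split=> //; lia.
      by exists V, U; split; [exact: dsumC|lia|lia].
    have rJ : (0 < rk (subpush (modrad (subm Y))))%N by lia.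
    have [h1 [h2 [N' [S1 [S2 [h3 [h4 [X XL i]]]]]]]] := caseD flP uY nlY d' rN rS rJ K0 KT.
    split=> //; split=> //; exists N', S1, S2; split=> //; split=> //; exists X => //; exact: tr.
  have rY4 : rk Y = 4%N by lia.
  have rJ : (2 <= rk (subpush (modrad (subm Y))))%N by lia.
  right; right.
  have [e|n22] := pselect (rk U = 2%N).
    right; left; exists P; split=> //; have rV : rk V = 2%N by lia.
    have [h1 [h2 [N1 [N2 [S1 [S2 [h3 [h4 [h5 [h6 [X XL i]]]]]]]]]]] := caseG nakA flP pP uY rJ nlY d e rV K0 KT.
    split=> //; split=> //; exists N1, N2, S1, S2; do 4!split=> //; exists X => //; exact: tr.
  left; exists P; split=> //.
  have [N [S0 [d' rN rS]]] : exists N S0, [/\ dsum Y N S0, rk N = 3%N & rk S0 = 1%N].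
    have [e|n] := pselect (rk U = 3%N); first by exists U, V; split=> //; lia.
    by exists V, U; split; [exact: dsumC|lia|lia].
  have [h1 [h2 [N' [S1 [N1 [S2 [h3 [h4 [h5 [X XL i]]]]]]]]]] := caseF nakA flP uY nlY d' rN rS rJ K0 KT.
  split=> //; split=> //; exists N', S1, N1, S2; do 3!split=> //; exists X => //; exact: tr.
(* Converse: in (A) to (G) [M] is a proper quotient of an indecomposable projective module, and in
   (H) to (J) it is not local. *)
have tac (P : lmodType A^c) (s t : seq (submodClosed P)) := @submodules_are_nonprojective _ M P s t indM.
move=> [|[|[|[|[|[|[|[|[|]]]]]]]]].
- move=> [P [fgP iP _ /uniserialP[flP ch] [l [t [/(has_lengthP _ flP) hl ht i]]]]].
  apply: (quom_nonprojective indM iP i) => e.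
  by have := rk_modradn t flP ch; rewrite e (rk0 flP) /len hl; lia.
- move=> [P [fgP iP pP _ [S1 [S2 [/simple_subm[_ n1 _] /simple_subm[_ n2 _] e [eS _] [X XL i]]]]]].
  apply: (quom_nonprojective indM iP i); move: XL; rewrite !inE e => /or3P[]/eqP-> h.
  + have h1 : S1 <=s sub0 by rewrite -h eS; apply: subaddl.
    by apply: n1; rewrite (subs0 h1).
  + exact: n1.
  + exact: n2.
- move=> [P [[_ iP _] [_ [N1 [N2 [_ _ _ sm ex]]]]]].
  exact: (tac _ _ _ iP sm _ ex).
- move=> [P [[_ iP _] [_ [_ [N [S1 [S2 [_ [sm ex]]]]]]]]].
  exact: (tac _ _ _ iP sm (@subset_move _ S1 [:: modrad P; N] [:: modsoc P] [:: S2]) ex).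
- move=> [P [[_ iP _] [_ [M1 [M2 [N1 [N2 [_ [[_ _ _ _ sm] ex]]]]]]]]].
  exact: (tac _ _ _ iP sm _ ex).
- move=> [P [[_ iP _] [_ [_ [N [S1 [N1 [S2 [_ [_ [sm ex]]]]]]]]]]].
  exact: (tac _ _ _ iP sm
    (@subset_move _ S1 [:: modrad P; N] [:: N1; subadd N1 S1; modsoc P] [:: S2]) ex).
- move=> [P [[_ iP _] [_ [_ [N1 [N2 [S1 [S2 [_ [_ [_ [sm ex]]]]]]]]]]]].
  exact: (tac _ _ _ iP sm _ ex).
- by move=> [nl _] /(projective_local flM indM).
- by move=> [nl _] /(projective_local flM indM).
- by move=> [nl _] /(projective_local flM indM).
Qed.
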